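(* Let $\tau\in i\mathbb{R}_{>0}$. For each $\ell\in\{1,2,3\}$ we have $$\sigma_1^{(\ell)}\cap\sigma_2^{(\ell)}=\{0\}\cup\{T\in V_\ell\mid Q_\ell(T)=0\}.$$ Furthermore, $\mathcal{L}(T)$ with $T\in AP$ is unitarizable if and only if $T=0$.
   Context: Let $\Lambda_\tau=\mathbb{Z}+\mathbb{Z}\tau$; $\wp,\zeta$ are the Weierstrass functions of $\Lambda_\tau$ ($\zeta'=-\wp$, $\zeta$ odd). Put $\omega_0=0,\omega_1=1,\omega_2=\tau,\omega_3=1+\tau$, $\eta_0=0$, $\eta_i=\zeta(z+\omega_i)-\zeta(z)$ for $i=1,2,3$. For $\ell\in\{1,2,3\}$ let $\varepsilon^{(\ell)}_0=\varepsilon^{(\ell)}_\ell=1$ and $\varepsilon^{(\ell)}_j=-1$ for $j\in\{1,2,3\}\setminus\{\ell\}$. For $(T_0,T_1,T_2,T_3,B)\in\mathbb{C}^5$ with $\sum T_k=0$ consider $y''=qy$ with $q(z)=\tfrac34\sum_{k=0}^3\wp(z-\tfrac{\omega_k}{2})+\sum_{k=0}^3T_k\zeta(z-\tfrac{\omega_k}{2})+B$. $AP$ is the set of parameters for which all solutions are free of logarithmic singularities at every $\omega_k/2$. One has $AP=V_1\cup V_2\cup V_3$ with $$V_\ell=\{(\varepsilon_0^{(\ell)}T,\varepsilon_1^{(\ell)}T,\varepsilon_2^{(\ell)}T,\varepsilon_3^{(\ell)}T,\,T^2-\eta_{3-\ell}T)\mid T\in\mathbb{C}\},$$ each identified with $\mathbb{C}$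 via $T$; the equation is written $\mathcal{L}(T)$, or $\mathcal{L}_\ell(T)$ with potential $q_\ell(z;T)$ when $T\in V_\ell$; $T=0$ means the zero parameter. Spectral polynomial: with $F^{(\ell)}(z;T)=-\sum_{k=0}^3\varepsilon_k^{(\ell)}\zeta(z-\tfrac{\omega_k}{2})+2T+\eta_{3-\ell}$, $Q_\ell(T)=\big((F^{(\ell)})'\big)^2-2(F^{(\ell)})''F^{(\ell)}+4q_\ell(z;T)(F^{(\ell)})^2$ ($'=d/dz$), independent of $z$ and polynomial in $T$. Monodromy matrices: fix $z_0\in\mathbb{C}$ such that $z_0+\mathbb{R}$ and $z_0+\tau\mathbb{R}$ contain no singularities of $q$, and let $y_1,y_2$ be linearly independent solutions near $z_0$; $M_1,M_2$ are defined by $(y_1,y_2)^t(z+1)=M_1(y_1,y_2)^t(z)$ near $z_0+\mathbb{R}$ and $(y_1,y_2)^t(z+\tau)=M_2(y_1,y_2)^t(z)$ near $z_0+\tau\mathbb{R}$. The equation is unitarizable if $M_1,M_2$ become unitary after a common conjugation. The Hill's discriminants on $V_\ell$ are $\Delta_k^{(\ell)}(T)=\tfrac12\mathrm{tr}\,M_k$, $k=1,2$, and the conditional stability sets are $\sigma_k^{(\ell)}=(\Delta_k^{(\ell)})^{-1}([-1,1])\subseteq V_\ell\cong\mathbb{C}$. *)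

(* Defs.v *)
From Stdlib Require Import Reals.
From Coquelicot Require Import Coquelicot.
Open Scope C_scope.

Definition csum (f : nat -> C) (n : nat) : C := sum_n (G := C_AbelianMonoid) f n.

(** The object of type [C] singled out by a property that holds of exactly one
    complex number (see [iota_correct]). *)
Definition the (P : C -> Prop) : C := iota (T := C_CompleteNormedModule) P.

Definition lattice (tau z : C) : Prop :=
  exists m n : Z, z = RtoC (IZR m) + RtoC (IZR n) * tau.

(** The sums below converge absolutely, so summing over the growing squares
    [|m|, |n| <= N] is only a choice of enumeration of the lattice. *)
Definition lattice_partial_sum (tau : C) (a : C -> C) (N : nat) : C :=
  csum (fun j => csum (fun k =>
    if (Nat.eqb j N && Nat.eqb k N)%bool then 0
    else a (RtoC (INR j - INR N) + RtoC (INR k - INR N) * tau))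
    (2 * N)) (2 * N).

(** Sum of [a w] over the nonzero lattice points [w]. *)
Definition lattice_sum (tau : C) (a : C -> C) : C :=
  the (fun v => filterlim (lattice_partial_sum tau a) eventually (locally v)).

Definition wp (tau z : C) : C :=
  1 / (z * z) + lattice_sum tau (fun w => 1 / ((z - w) * (z - w)) - 1 / (w * w)).

Definition wzeta (tau z : C) : C :=
  1 / z + lattice_sum tau (fun w => 1 / (z - w) + 1 / w + z / (w * w)).

(** Meaningful for [k <= 3]. *)
Definition omega (tau : C) (k : nat) : C :=
  match k with
  | 1%nat => 1
  | 2%nat => tau
  | 3%nat => 1 + tau
  | _ => 0
  end.

(** [eta tau 0 = 0] because [omega tau 0 = 0]. *)
Definition eta (tau : C) (k : nat) : C :=
  the (fun c => forall z : C, ~ lattice tau z ->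
                  wzeta tau (z + omega tau k) - wzeta tau z = c).

Definition eps (l k : nat) : C :=
  if (Nat.eqb k 0 || Nat.eqb k l)%bool then 1 else - (1).

(** The potential with parameters [(T 0, T 1, T 2, T 3, B)]; the values of [T]
    beyond index 3 are never used. *)
Definition potential (tau : C) (T : nat -> C) (B z : C) : C :=
  3 / 4 * csum (fun k => wp tau (z - omega tau k / 2)) 3
  + csum (fun k => T k * wzeta tau (z - omega tau k / 2)) 3 + B.

(** All the points [omega_k / 2 + lattice] are double poles of the potential. *)
Definition singular (tau z : C) : Prop :=
  exists k : nat, (k <= 3)%nat /\ lattice tau (z - omega tau k / 2).

(** [y] is holomorphic on the open set [U] and satisfies [y'' = q y] there. *)
Definition solution (q : C -> C) (U : C -> Prop) (y : C -> C) : Prop :=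
  exists y' : C -> C, forall z : C, U z ->
    is_derive (K := C_AbsRing) (V := C_NormedModule) y z (y' z) /\
    is_derive (K := C_AbsRing) (V := C_NormedModule) y' z (q z * y z).

Definition slit_disc (p : C) (r : R) (z : C) : Prop :=
  (Cmod (z - p) < r)%R /\ ~ (Im (z - p) = 0%R /\ (Re (z - p) <= 0)%R).

(** The local exponents at a double pole [p] with leading coefficient 3/4 are
    -1/2 and 3/2.  By Frobenius' method a logarithm-free solution is thus
    [(z - p)^(-1/2)] times a function [h] holomorphic at [p] (the exponent 3/2
    corresponds to [h] vanishing to order 2).  Below [s] is a branch of the
    square root of [z - p] on the slit disc, on which solutions are
    single-valued. *)
Definition log_free (q : C -> C) (p : C) : Prop :=
  forall (r : R) (y : C -> C), (0 < r)%R -> solution q (slit_disc p r) y ->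
  exists (rho : R) (s h : C -> C), (0 < rho <= r)%R /\
    (forall z : C, slit_disc p rho z -> continuous s z /\ s z * s z = z - p) /\
    (forall z : C, (Cmod (z - p) < rho)%R ->
       ex_derive (K := C_AbsRing) (V := C_NormedModule) h z) /\
    (forall z : C, slit_disc p rho z -> s z * y z = h z).

Definition AP (tau : C) (T : nat -> C) (B : C) : Prop :=
  csum T 3 = 0 /\
  forall k : nat, (k <= 3)%nat ->
    log_free (potential tau T B) (omega tau k / 2).

(** The point of [V_l] with coordinate [T]. *)
Definition V_res (l : nat) (T : C) (k : nat) : C := eps l k * T.
Definition V_acc (tau : C) (l : nat) (T : C) : C := T * T - eta tau (3 - l) * T.

Definition q_ (tau : C) (l : nat) (T : C) : C -> C :=
  potential tau (V_res l T) (V_acc tau l T).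

Definition F_ (tau : C) (l : nat) (T z : C) : C :=
  - csum (fun k => eps l k * wzeta tau (z - omega tau k / 2)) 3
  + 2 * T + eta tau (3 - l).

Definition Q_ (tau : C) (l : nat) (T : C) : C :=
  let F := F_ tau l T in
  let F' := C_derive F in
  let F'' := C_derive F' in
  the (fun v => forall z : C, ~ singular tau z ->
         F' z * F' z - 2 * F'' z * F z + 4 * q_ tau l T z * (F z * F z) = v).

(** Neither [z0 + R] nor [z0 + tau R] meets a singularity. *)
Definition admissible_base (tau z0 : C) : Prop :=
  forall s : R, ~ singular tau (z0 + RtoC s) /\ ~ singular tau (z0 + tau * RtoC s).

(** Strips around [z0 + R] and [z0 + tau R]; their union is a simply connected
    cross on which solutions near [z0] continue single-valuedly. *)
Definition strip1 (tau z0 : C) (e : R) (z : C) : Prop :=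
  exists s t : R, z = z0 + RtoC s + RtoC t * tau /\ (Rabs t < e)%R.
Definition strip2 (tau z0 : C) (e : R) (z : C) : Prop :=
  exists s t : R, z = z0 + RtoC s + RtoC t * tau /\ (Rabs s < e)%R.

Definition CM2 : Type := @matrix C 2 2.

Definition column (y1 y2 : C -> C) (z : C) : @matrix C 2 1 :=
  mk_matrix 2 1 (fun i _ => match i with O => y1 z | _ => y2 z end).

Definition monodromy (tau z0 : C) (q : C -> C) (M1 M2 : CM2) : Prop :=
  exists (e : R) (y1 y2 : C -> C),
    let U z := strip1 tau z0 e z \/ strip2 tau z0 e z in
    (0 < e)%R /\
    (forall z : C, U z -> ~ singular tau z) /\
    solution q U y1 /\ solution q U y2 /\
    (forall a b : C,
       locally z0 (fun z : C => a * y1 z + b * y2 z = 0) -> a = 0 /\ b = 0) /\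
    (forall z : C, strip1 tau z0 e z ->
       column y1 y2 (z + 1) = Mmult (T := C_Ring) M1 (column y1 y2 z)) /\
    (forall z : C, strip2 tau z0 e z ->
       column y1 y2 (z + tau) = Mmult (T := C_Ring) M2 (column y1 y2 z)).

Definition trace (M : CM2) : C :=
  coeff_mat (0 : C) M 0 0 + coeff_mat (0 : C) M 1 1.

Definition adjoint (M : CM2) : CM2 :=
  mk_matrix 2 2 (fun i j => Cconj (coeff_mat (0 : C) M j i)).

Definition unitary (M : CM2) : Prop :=
  Mmult (T := C_Ring) M (adjoint M) = Mone (T := C_Ring).

(** Another choice of basis of solutions conjugates [(M1, M2)] simultaneously,
    so it does not matter which monodromy pair is taken here and in [Delta]. *)
Definition unitarizable (tau z0 : C) (q : C -> C) : Prop :=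
  exists M1 M2 P P' : CM2,
    monodromy tau z0 q M1 M2 /\
    Mmult (T := C_Ring) P P' = Mone (T := C_Ring) /\
    Mmult (T := C_Ring) P' P = Mone (T := C_Ring) /\
    unitary (Mmult (T := C_Ring) (Mmult (T := C_Ring) P M1) P') /\
    unitary (Mmult (T := C_Ring) (Mmult (T := C_Ring) P M2) P').

(** Hill's discriminants, for [k] = 1, 2. *)
Definition Delta (tau z0 : C) (l k : nat) (T : C) : C :=
  the (fun d => exists M1 M2 : CM2, monodromy tau z0 (q_ tau l T) M1 M2 /\
         d = trace (match k with 1%nat => M1 | _ => M2 end) / 2).

(** Membership of [T] in the conditional stability set [sigma_k] of [V_l]. *)
Definition stability (tau z0 : C) (l k : nat) (T : C) : Prop :=
  exists x : R, (-1 <= x <= 1)%R /\ Delta tau z0 l k T = RtoC x.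

(* Main.v *)
From Stdlib Require Import Reals Lra Lia Classical ClassicalEpsilon Factorial.
From Coquelicot Require Import Coquelicot.
Require Import Defs.
Open Scope C_scope.

(** Let [G_l(z) = sum_k eps_k zeta(z - omega_k / 2) - eta_(3-l)].  The spectral
    polynomial is built from [F = 2 T - G_l], and [q_l], [Q_l] become polynomials
    in [T] and [G_l] once the differential equation of [G_l] is known.  That
    equation comes from Liouville's theorem: the half periods multiply [G_l] by
    signs, so [G_l' = - G_m G_n] ([dG_product]) and [G_l^2] is the sum of the four
    [wp]'s up to a constant ([Gf_square]), whence
    [G_l'^2 = (G_l^2 - A) (G_l^2 - B)] with [A], [B], [0] distinct ([Gf_equation]).
    If [G_l(a) = 2 T] ([Gf_surjective]), then [Q_l(T) = G_l'(a)^2] ([Q_value]).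

    The operator [y -> F y' - F' y / 2] maps solutions to solutions, commutes with
    both monodromy matrices and has square [Q_l / 4].  If [Q_l] is not 0, its
    eigenvectors [f] are common eigenvectors of [M_1] and [M_2].  Here [f^2 / F]
    is the exponential of a primitive of [X = - G_l'(a) / F], and the partial
    fractions of [X] ([X_product]) give for the multiplier over a period [om] with
    quasi-period [et] the modulus [|lam|^2 = exp (Re (om S(a) - 4 et a))], where
    [S(z) = 2 zeta(2 z)] is the zeta function of the half lattice
    ([generic_multiplier]).

    As [tau] is imaginary, [Re (om S(a) - 4 et a)] as a function of [a / om] has
    period [1/2] and is odd under reflection in the imaginary axis.  Between its
    zero lines [Re (a / om) = 0] and [1/4] it is positive: a minimum principle
    compares it with [2 pi cot (2 pi z)] ([strip_positivity]).  So both exponents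
    vanish only if [4 a] is in [Lambda] ([drift_both_zero]), and then [T = 0] or
    [G_l'(a) = 0] ([hlat_double]).  Hence traces between -2 and 2 for both
    matrices, as well as unitarizability, force [T = 0] or [Q_l(T) = 0].

    Conversely, at [T = 0] both matrices are [-1]: for [l = 3] the translation by
    half a period changes the sign of the operator above ([trivial_multiplier]).
    If [Q_l(T) = 0], the reciprocal of [F] is elementary ([Y_product]); both
    matrices then have a double eigenvalue [1] or [-1], and they are both scalar
    only if [eta_2 = tau eta_1], which [legendre_neq] excludes.  A unitary matrix
    with such a double eigenvalue is scalar, so this case is not unitarizable.

    Finally by Frobenius' method freedom from logarithms at [omega_k / 2] makes
    [T_k^2] equal to the constant term of the potential there ([frobenius]).
    This constant is the same at the four poles ([log_free_square]); with
    [sum T_k = 0] it leaves the three families ([AP_family]).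

    Complex analysis is developed from complex differentiability: Goursat's
    lemma, Cauchy's formula, Weierstrass' theorem, removable singularities,
    Liouville's theorem and linear equations of the second order on star domains. *)

Local Notation VN := C_R_NormedModule.
Local Notation VC := C_R_CompleteNormedModule.
Implicit Types (z w c p om et lam kappa a b u v : C) (f g h q : C -> C).

(** * Complex differentiability *)

Definition cdiff f (z l : C) : Prop :=
  is_derive (K := C_AbsRing) (V := C_NormedModule) f z l.

Definition rdiff (f : R -> C) (t : R) (l : C) : Prop :=
  is_derive (K := R_AbsRing) (V := VN) f t l.

(** Continuity by distances rather than filters, in the form that estimates use. *)
Definition ccont f z : Prop :=
  forall e : R, 0 < e -> exists d : R, 0 < d /\
    forall z' : C, Cmod (z' - z) < d -> Cmod (f z' - f z) < e.

Definition rcont (f : R -> C) (t : R) : Prop :=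
  continuous (T := R_UniformSpace) (U := C_UniformSpace) f t.

Ltac tri := eapply Rle_trans; [apply Cmod_triangle|].

Lemma Cmod_self c : Cmod (c - c) = 0%R.
Proof. replace (c - c) with (0:C) by ring. apply Cmod_0. Qed.

Lemma cdiff_eps f (z l : C) :
  cdiff f z l <->
  forall e : R, 0 < e -> exists d : R, 0 < d /\
    forall z' : C, Cmod (z' - z) < d ->
      Cmod (f z' - f z - l * (z' - z)) <= e * Cmod (z' - z).
Proof.
  split.
  - intros [_ H] e He.
    destruct (H z (fun P HP => HP) (mkposreal e He)) as [d Hd].
    exists d; split; [apply cond_pos|].
    intros z' Hz'. specialize (Hd z' Hz').
    simpl in Hd. unfold norm in Hd; simpl in Hd.
    replace (f z' - f z - l * (z' - z)) with
      (minus (G := C_AbelianGroup) (minus (G:=C_AbelianGroup) (f z') (f z)) (mult (K := C_Ring) (minus (G:=C_AbelianGroup) z' z) l)).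
    exact Hd.
    unfold minus, plus, opp, mult; simpl. ring.
  - intros H. split.
    + apply is_linear_scal_l.
    + intros x Hx.
      assert (x = z).
      { symmetry. exact (is_filter_lim_locally_unique (K:=C_AbsRing) (V:=AbsRing_NormedModule C_AbsRing) _ _ Hx). }
      subst x.
      intros [e He]. destruct (H e He) as [d [Hd H1]].
      exists (mkposreal d Hd). intros z' Hz'.
      specialize (H1 z' Hz').
      unfold norm; simpl.
      replace (f z' - f z - l * (z' - z)) with
        (minus (G := C_AbelianGroup) (minus (G:=C_AbelianGroup) (f z') (f z)) (mult (K := C_Ring) (minus (G:=C_AbelianGroup) z' z) l)) in H1.
      exact H1.
      unfold minus, plus, opp, mult; simpl. ring.
Qed.

Lemma rdiff_eps (f : R -> C) (t : R) (l : C) :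
  rdiff f t l <->
  forall e : R, 0 < e -> exists d : R, 0 < d /\
    forall s : R, Rabs (s - t) < d ->
      Cmod (f s - f t - l * RtoC (s - t)) <= e * Rabs (s - t).
Proof.
  split.
  - intros [_ H] e He.
    destruct (H t (fun P HP => HP) (mkposreal e He)) as [d Hd].
    exists d; split; [apply cond_pos|].
    intros s Hs. specialize (Hd s Hs).
    rewrite Cmod_norm.
    replace (f s - f t - l * RtoC (s - t)) with
      (minus (G := C_R_NormedModule) (minus (G:=C_R_NormedModule) (f s) (f t)) (scal (V := VN) (minus (G:=R_AbelianGroup) s t) l)).
    exact Hd.
    rewrite scal_R_Cmult.
    unfold minus, plus, opp, scal; simpl.
    change (f s - f t - (s-t)%R * l = f s - f t - l * (s - t)%R). ring.
  - intros H. split.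
    + apply is_linear_scal_l.
    + intros x Hx.
      assert (x = t).
      { symmetry. exact (is_filter_lim_locally_unique (K:=R_AbsRing) (V:=R_NormedModule) _ _ Hx). }
      subst x.
      intros [e He]. destruct (H e He) as [d [Hd H1]].
      exists (mkposreal d Hd). intros s Hs.
      specialize (H1 s Hs).
      rewrite Cmod_norm in H1.
      replace (f s - f t - l * RtoC (s - t)) with
        (minus (G := C_R_NormedModule) (minus (G:=C_R_NormedModule) (f s) (f t)) (scal (V := VN) (minus (G:=R_AbelianGroup) s t) l)) in H1.
      exact H1.
      rewrite scal_R_Cmult.
      unfold minus, plus, opp, scal; simpl.
      change (f s - f t - (s-t)%R * l = f s - f t - l * (s - t)%R). ring.
Qed.

Lemma rcont_eps (f : R -> C) (t : R) :
  rcont f t <->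
  forall e : R, 0 < e -> exists d : R, 0 < d /\
    forall s : R, Rabs (s - t) < d -> Cmod (f s - f t) < e.
Proof.
  split.
  - intros H e He.
    assert (H1 := proj1 (filterlim_locally_ball_norm (K := R_AbsRing) (U := C_R_NormedModule) (F := locally t) f (f t)) H (mkposreal e He)).
    destruct H1 as [d Hd]. exists d; split; [apply cond_pos|].
    intros s Hs. specialize (Hd s Hs). rewrite Cmod_norm. exact Hd.
  - intros H.
    apply (proj2 (filterlim_locally_ball_norm (K := R_AbsRing) (U := C_R_NormedModule) (F := locally t) f (f t))).
    intros [e He]. destruct (H e He) as [d [Hd H1]].
    exists (mkposreal d Hd). intros s Hs. specialize (H1 s Hs).
    rewrite Cmod_norm in H1. exact H1.
Qed.

Lemma cdiff_val f (z l l' : C) : cdiff f z l -> l = l' -> cdiff f z l'.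
Proof. intros H <-; exact H. Qed.

Lemma cdiff_loc f g (z l : C) (d : R) :
  0 < d -> (forall z', Cmod (z' - z) < d -> f z' = g z') ->
  cdiff f z l -> cdiff g z l.
Proof.
  intros Hd H Hf. apply cdiff_eps. intros e He.
  destruct (proj1 (cdiff_eps f z l) Hf e He) as [d1 [Hd1 H1]].
  exists (Rmin d d1). split; [apply Rmin_pos; assumption|].
  intros z' Hz'. rewrite <- !H.
  - apply H1. apply (Rmin_Rgt_l _ _ _ Hz').
  - replace (z - z) with (0 : C) by ring. rewrite Cmod_0; assumption.
  - apply (Rmin_Rgt_l _ _ _ Hz').
Qed.

Lemma cdiff_ext f g (z l : C) :
  (forall z', f z' = g z') -> cdiff f z l -> cdiff g z l.
Proof. intros H; apply (cdiff_loc f g z l 1); [lra|auto]. Qed.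

Lemma cdiff_ring f (z l : C) :
  cdiff f z l <->
  is_derive (K := C_AbsRing) (V := AbsRing_NormedModule C_AbsRing) f z l.
Proof. split; intros [_ H]; split; try apply is_linear_scal_l; exact H. Qed.

Lemma cdiff_const c z : cdiff (fun _ => c) z 0.
Proof. apply cdiff_ring. exact (is_derive_const (K := C_AbsRing) (V := AbsRing_NormedModule C_AbsRing) c z). Qed.

Lemma cdiff_id z : cdiff (fun z => z) z 1.
Proof. apply cdiff_ring. exact (is_derive_id (K := C_AbsRing) z). Qed.

Lemma cdiff_plus f g (z l m : C) :
  cdiff f z l -> cdiff g z m -> cdiff (fun z => f z + g z) z (l + m).
Proof.
  rewrite !cdiff_ring.
  exact (is_derive_plus (K := C_AbsRing) (V := AbsRing_NormedModule C_AbsRing) f g z l m).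
Qed.

Lemma cdiff_mult f g (z l m : C) :
  cdiff f z l -> cdiff g z m -> cdiff (fun z => f z * g z) z (l * g z + f z * m).
Proof.
  rewrite !cdiff_ring. intros Hf Hg.
  exact (is_derive_mult (K := C_AbsRing) f g z l m Hf Hg Cmult_comm).
Qed.

Lemma cdiff_opp f (z l : C) :
  cdiff f z l -> cdiff (fun z => - f z) z (- l).
Proof.
  rewrite !cdiff_ring.
  exact (is_derive_opp (K := C_AbsRing) (V := AbsRing_NormedModule C_AbsRing) f z l).
Qed.

Lemma cdiff_minus f g (z l m : C) :
  cdiff f z l -> cdiff g z m -> cdiff (fun z => f z - g z) z (l - m).
Proof. intros Hf Hg. apply cdiff_plus; [exact Hf|apply cdiff_opp; exact Hg]. Qed.

Lemma cdiff_comp f g (z l m : C) :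
  cdiff f (g z) l -> cdiff g z m -> cdiff (fun z => f (g z)) z (l * m).
Proof.
  rewrite !cdiff_ring. intros Hf Hg. rewrite Cmult_comm.
  exact (is_derive_comp (K := C_AbsRing) (V := AbsRing_NormedModule C_AbsRing) f g z l m Hf Hg).
Qed.

Lemma Cmod_sym a b : Cmod (a - b) = Cmod (b - a).
Proof. rewrite <- Cmod_opp. f_equal. ring. Qed.

Lemma Cmod_tri_minus a b c : Cmod (a - c) <= Cmod (a - b) + Cmod (b - c).
Proof. replace (a - c) with ((a - b) + (b - c)) by ring. apply Cmod_triangle. Qed.

Lemma Cmod_minus_le a b : Cmod (a - b) <= Cmod a + Cmod b.
Proof. rewrite <- (Cmod_opp b). apply Cmod_triangle. Qed.

Lemma Cmod_minus_ge a b : Cmod a - Cmod b <= Cmod (a - b).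
Proof. generalize (Cmod_triangle (a - b) b). replace (a - b + b) with a by ring. lra. Qed.

Lemma cdiff_cinv z : z <> 0 -> cdiff Cinv z (- (/ z * / z)).
Proof.
  intros Hz. apply cdiff_eps. intros e He.
  assert (Hm := proj1 (Cmod_gt_0 z) Hz).
  set (m := Cmod z) in *.
  exists (Rmin (m / 2) (e * (m * m * m) / 2)).
  assert (Hm3 : 0 < m * m * m) by (repeat apply Rmult_lt_0_compat; lra).
  assert (Hem : 0 < e * (m*m*m)) by (apply Rmult_lt_0_compat; lra).
  split. { apply Rmin_pos; lra. }
  intros z' H.
  destruct (Rmin_Rgt_l _ _ _ H) as [H1 H2].
  clear H.
  assert (Hz' : m / 2 < Cmod z').
  { generalize (Cmod_minus_ge z z'). rewrite Cmod_sym. fold m. lra. }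
  assert (z' <> 0). { apply Cmod_gt_0. lra. }
  replace (/ z' - / z - - (/ z * / z) * (z' - z)) with
    ((z' - z) * ((z' - z) * (/ z * / z * / z'))) by (field; split; assumption).
  rewrite Cmod_mult, Rmult_comm.
  apply Rmult_le_compat_r; [apply Cmod_ge_0|].
  rewrite !Cmod_mult, !Cmod_inv by assumption. fold m.
  replace e with ((e * (m*m*m) / 2) * (/ m * / m * / (m / 2)))%R by (field; lra).
  apply Rmult_le_compat; [apply Cmod_ge_0| |lra|].
  - assert (0 < Cmod z') by lra.
    repeat apply Rmult_le_pos; left; apply Rinv_0_lt_compat; lra.
  - apply Rmult_le_compat_l.
    + left; apply Rmult_lt_0_compat; apply Rinv_0_lt_compat; lra.
    + apply Rinv_le_contravar; lra.
Qed.

Lemma cdiff_inv f (z l : C) :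
  cdiff f z l -> f z <> 0 -> cdiff (fun z => / f z) z (- (l / (f z * f z))).
Proof.
  intros Hf Hz. eapply cdiff_val.
  - apply (cdiff_comp Cinv f); [apply cdiff_cinv; exact Hz|exact Hf].
  - field. exact Hz.
Qed.

Lemma cdiff_div f g (z l m : C) :
  cdiff f z l -> cdiff g z m -> g z <> 0 ->
  cdiff (fun z => f z / g z) z ((l * g z - f z * m) / (g z * g z)).
Proof.
  intros Hf Hg Hz. eapply cdiff_val.
  - apply cdiff_mult; [exact Hf|apply cdiff_inv; [exact Hg|exact Hz]].
  - cbv beta. field. exact Hz.
Qed.

Lemma RtoC_neq_0 (x : R) : x <> 0%R -> RtoC x <> 0.
Proof. intros H E. apply H. apply RtoC_inj. exact E. Qed.

Lemma Cmult_integral z w : z * w = 0 -> z = 0 \/ w = 0.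
Proof.
  intros H. destruct (classic (z = 0)) as [Hz|Hz]; [auto|right]. apply NNPP. intros Hw. exact (Cmult_neq_0 z w Hz Hw H).
Qed.

Lemma square_eq z w : z * z = w * w -> z = w \/ z = - w.
Proof.
  intros H. destruct (Cmult_integral (z - w) (z + w)) as [E|E].
  - transitivity (z * z - w * w); [ring|]. rewrite H. ring.
  - left. apply Ceq_minus, E.
  - right. apply Ceq_minus. rewrite <- E. ring.
Qed.

Ltac cd_step :=
  lazymatch goal with
  | |- cdiff (fun _ => ?c) _ _ => apply cdiff_const
  | |- cdiff (fun z => z) _ _ => apply cdiff_id
  | |- cdiff (fun z => @?f z + @?g z) _ _ => eapply (cdiff_plus f g)
  | |- cdiff (fun z => @?f z - @?g z) _ _ => eapply (cdiff_minus f g)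
  | |- cdiff (fun z => @?f z * @?g z) _ _ => eapply (cdiff_mult f g)
  | |- cdiff (fun z => @?f z / @?g z) _ _ => eapply (cdiff_div f g)
  | |- cdiff (fun z => / @?f z) _ _ => eapply (cdiff_inv f)
  | |- cdiff (fun z => - @?f z) _ _ => eapply (cdiff_opp f)
  | |- cdiff _ _ _ => eassumption
  | |- RtoC _ <> RtoC _ => apply RtoC_neq_0; lra
  end.
Ltac cd := eapply cdiff_val; [repeat cd_step|cbv beta].

Lemma cdiff_unique f (z l m : C) : cdiff f z l -> cdiff f z m -> l = m.
Proof.
  intros H1 H2.
  rewrite <- (is_C_derive_unique f z l H1). apply is_C_derive_unique. exact H2.
Qed.

Lemma cdiff_shift f (a z l : C) :
  cdiff f (z + a) l -> cdiff (fun z => f (z + a)) z l.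
Proof.
  intros H. eapply cdiff_val.
  - apply (cdiff_comp f (fun z => z + a)); [exact H|].
    apply cdiff_plus; [apply cdiff_id|apply cdiff_const].
  - ring.
Qed.

Lemma cdiff_shift_minus f (a z l : C) :
  cdiff f (z - a) l -> cdiff (fun z => f (z - a)) z l.
Proof. exact (cdiff_shift f (- a) z l). Qed.

Lemma cdiff_scale f (a z l : C) :
  cdiff f (a * z) l -> cdiff (fun z => f (a * z)) z (l * a).
Proof.
  intros H. eapply cdiff_val.
  - apply (cdiff_comp f (fun z => a * z)); [exact H|].
    apply cdiff_mult; [apply cdiff_const|apply cdiff_id].
  - cbv beta; ring.
Qed.

Lemma cdiff_ccont f (z l : C) : cdiff f z l -> ccont f z.
Proof.
  intros H e He.
  destruct (proj1 (cdiff_eps f z l) H 1%R Rlt_0_1) as [d [Hd H1]].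
  assert (Hp : 0 < Cmod l + 1) by (generalize (Cmod_ge_0 l); lra).
  exists (Rmin d (e / (Cmod l + 1) )). split.
  { apply Rmin_pos; [exact Hd|]. apply Rdiv_lt_0_compat; lra. }
  intros z' Hz'.
  destruct (Rmin_Rgt_l _ _ _ Hz') as [H2 H3].
  specialize (H1 z' H2).
  replace (f z' - f z) with ((f z' - f z - l * (z' - z)) + l * (z' - z)) by ring.
  eapply Rle_lt_trans; [apply Cmod_triangle|]. rewrite Cmod_mult.
  apply Rle_lt_trans with ((Cmod l + 1) * Cmod (z' - z))%R; [lra|].
  apply Rlt_le_trans with ((Cmod l + 1) * (e / (Cmod l + 1)))%R.
  - apply Rmult_lt_compat_l; assumption.
  - right; field; lra.
Qed.

Lemma rdiff_comp (F : C -> C) (g : R -> C) (t : R) (l m : C) :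
  cdiff F (g t) l -> rdiff g t m -> rdiff (fun s => F (g s)) t (l * m).
Proof.
  intros HF Hg. apply rdiff_eps. intros e He.
  set (M := (Cmod m + 1)%R). set (L := (Cmod l + 1)%R).
  assert (HM : 0 < M) by (unfold M; generalize (Cmod_ge_0 m); lra).
  assert (HL : 0 < L) by (unfold L; generalize (Cmod_ge_0 l); lra).
  destruct (proj1 (cdiff_eps _ _ _) HF (e / 2 / M)%R) as [d1 [Hd1 H1]].
  { apply Rdiv_lt_0_compat; lra. }
  destruct (proj1 (rdiff_eps _ _ _) Hg (Rmin 1 (e / 2 / L))) as [d2 [Hd2 H2]].
  { apply Rmin_pos; [lra|]. apply Rdiv_lt_0_compat; lra. }
  exists (Rmin d2 (d1 / M)). split.
  { apply Rmin_pos; [lra|]. apply Rdiv_lt_0_compat; lra. }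
  intros s Hs.
  destruct (Rmin_Rgt_l _ _ _ Hs) as [Hs1 Hs2].
  specialize (H2 s Hs1).
  assert (H3 : Cmod (g s - g t - m * RtoC (s - t)) <= e / 2 / L * Rabs (s - t)).
  { eapply Rle_trans; [apply H2|]. apply Rmult_le_compat_r; [apply Rabs_pos|apply Rmin_r]. }
  assert (H4 : Cmod (g s - g t) <= M * Rabs (s - t)).
  { replace (g s - g t) with ((g s - g t - m * RtoC (s - t)) + m * RtoC (s - t)) by ring.
    tri. rewrite Cmod_mult, Cmod_R.
    assert (Cmod (g s - g t - m * RtoC (s - t)) <= 1 * Rabs (s - t)).
    { eapply Rle_trans; [apply H2|]. apply Rmult_le_compat_r; [apply Rabs_pos|apply Rmin_l]. }
    unfold M. lra. }
  assert (H5 : Cmod (g s - g t) < d1).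
  { eapply Rle_lt_trans; [apply H4|]. apply Rlt_le_trans with (M * (d1 / M))%R.
    - apply Rmult_lt_compat_l; assumption.
    - right; field; lra. }
  specialize (H1 _ H5).
  replace (F (g s) - F (g t) - l * m * RtoC (s - t)) with
    ((F (g s) - F (g t) - l * (g s - g t)) + l * (g s - g t - m * RtoC (s - t))) by ring.
  tri. rewrite Cmod_mult.
  assert (H6 : e / 2 / M * Cmod (g s - g t) <= e / 2 * Rabs (s - t)).
  { apply Rle_trans with (e / 2 / M * (M * Rabs (s - t)))%R.
    - apply Rmult_le_compat_l; [|exact H4]. left; apply Rdiv_lt_0_compat; lra.
    - right; field; lra. }
  assert (H7 : Cmod l * Cmod (g s - g t - m * RtoC (s - t)) <= e / 2 * Rabs (s - t)).
  { apply Rle_trans with (L * (e / 2 / L * Rabs (s - t)))%R.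
    - apply Rmult_le_compat; [apply Cmod_ge_0|apply Cmod_ge_0|unfold L; lra|exact H3].
    - right; field; lra. }
  lra.
Qed.

Lemma rdiff_line a b (t : R) : rdiff (fun t => a + RtoC t * b) t b.
Proof.
  apply rdiff_eps. intros e He. exists 1%R. split; [lra|]. intros s _.
  replace (a + RtoC s * b - (a + RtoC t * b) - b * RtoC (s - t)) with (0:C)
    by (rewrite RtoC_minus; ring).
  rewrite Cmod_0. apply Rmult_le_pos; [lra|apply Rabs_pos].
Qed.

Lemma rdiff_rcont (f : R -> C) (t : R) (l : C) : rdiff f t l -> rcont f t.
Proof.
  intros H. apply (ex_derive_continuous (K := R_AbsRing) (V := VN)).
  exists l. exact H.
Qed.

(** * Continuity along curves and integrals over the unit interval *)

Lemma rcont_comp (F : C -> C) (g : R -> C) (t : R) :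
  ccont F (g t) -> rcont g t -> rcont (fun s => F (g s)) t.
Proof.
  intros HF Hg. apply rcont_eps. intros e He.
  destruct (HF e He) as [d [Hd H1]].
  destruct (proj1 (rcont_eps g t) Hg d Hd) as [d2 [Hd2 H2]].
  exists d2; split; [exact Hd2|]. intros s Hs. apply H1, H2, Hs.
Qed.

Lemma rcont_plus (f g : R -> C) (t : R) :
  rcont f t -> rcont g t -> rcont (fun s => f s + g s) t.
Proof. exact (continuous_plus (V := VN) f g t). Qed.

Lemma rcont_opp (f : R -> C) (t : R) : rcont f t -> rcont (fun s => - f s) t.
Proof. exact (continuous_opp (V := VN) f t). Qed.

Lemma rcont_minus (f g : R -> C) (t : R) :
  rcont f t -> rcont g t -> rcont (fun s => f s - g s) t.
Proof. intros Hf Hg. apply rcont_plus; [exact Hf|apply rcont_opp, Hg]. Qed.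

Lemma rcont_mult (f g : R -> C) (t : R) :
  rcont f t -> rcont g t -> rcont (fun s => f s * g s) t.
Proof.
  intros Hf Hg.
  assert (Hsq : forall h : R -> C, rcont h t -> rcont (fun s => / 4 * (h s * h s)) t).
  { intros h Hh. apply (rcont_comp (fun z => / 4 * (z * z)) h); [|exact Hh]. eapply cdiff_ccont. repeat cd_step. }
  assert (E : forall s, / 4 * ((f s + g s) * (f s + g s)) - / 4 * ((f s - g s) * (f s - g s)) = f s * g s) by (intros s; field).
  apply (continuous_ext _ _ t E). apply rcont_minus; apply Hsq; [apply rcont_plus|apply rcont_minus]; assumption.
Qed.

Lemma rcont_const c (t : R) : rcont (fun _ => c) t.
Proof. apply continuous_const. Qed.

Lemma rcont_line a b (t : R) : rcont (fun t => a + RtoC t * b) t.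
Proof. exact (rdiff_rcont _ _ _ (rdiff_line a b t)). Qed.

Lemma rcont_RtoC (t : R) : rcont RtoC t.
Proof.
  apply rcont_eps. intros e He. exists e; split; [exact He|]. intros s Hs.
  rewrite <- RtoC_minus, Cmod_R. exact Hs.
Qed.

Global Opaque cdiff rdiff rcont.

(** A local property that survives shrinking of [d] holds with one [d] on a
    compact interval. *)
Lemma compact_interval (P : R -> R -> Prop) (a b : R) :
  (forall s d d' : R, 0 < d' <= d -> P s d -> P s d') ->
  (forall t : R, a <= t <= b -> exists d : R, 0 < d /\
     forall s : R, Rabs (s - t) < d -> a <= s <= b -> P s d) ->
  exists d : R, 0 < d /\ forall s : R, a <= s <= b -> P s d.
Proof.
  intros Hanti Hloc.
  assert (H : forall t : R, exists d : R, 0 < d /\ (a <= t <= b ->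
     forall s : R, Rabs (s - t) < d -> a <= s <= b -> P s d)).
  { intros t. destruct (classic (a <= t <= b)) as [Ht|Ht].
    - destruct (Hloc t Ht) as [d [Hd H]]. exists d; auto.
    - exists 1%R. split; [lra|]. intros Ht'; contradiction. }
  apply (choice (fun t d => 0 < d /\ (a <= t <= b ->
     forall s : R, Rabs (s - t) < d -> a <= s <= b -> P s d))) in H.
  destruct H as [delta Hdelta].
  destruct (compactness_value_1d a b (fun t => mkposreal (delta t) (proj1 (Hdelta t)))) as [d Hd].
  exists d. split; [apply cond_pos|]. intros s Hs.
  apply NNPP. intros HP. apply (Hd s Hs). intros [t [Ht [H1 H2]]].
  apply HP. simpl in H1, H2. apply Hanti with (delta t).
  - split; [apply cond_pos|exact H2].
  - apply (proj2 (Hdelta t)); assumption.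
Qed.

Lemma unif_cont_arc g (gam : R -> C) (a b : R) :
  (forall t : R, a <= t <= b -> rcont gam t) ->
  (forall t : R, a <= t <= b -> ccont g (gam t)) ->
  forall e : R, 0 < e -> exists d : R, 0 < d /\
    forall t : R, a <= t <= b -> forall v : C,
      Cmod (v - gam t) < d -> Cmod (g v - g (gam t)) < e.
Proof.
  intros Hgam Hg e He.
  apply (compact_interval (fun t d => forall v : C,
      Cmod (v - gam t) < d -> Cmod (g v - g (gam t)) < e)).
  - intros s d d' Hd H v Hv. apply H. lra.
  - intros t Ht.
    destruct (Hg t Ht (e / 2)%R) as [rho [Hrho H1]]; [lra|].
    destruct (proj1 (rcont_eps gam t) (Hgam t Ht) (rho / 2)%R) as [d [Hd H2]]; [lra|].
    exists (Rmin d (rho / 2)). split; [apply Rmin_pos; lra|].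
    intros s Hs Hs' v Hv.
    assert (Hs1 : Rabs (s - t) < d) by (apply (Rmin_Rgt_l _ _ _ Hs)).
    assert (Hv1 : Cmod (v - gam s) < rho / 2) by (apply (Rmin_Rgt_l _ _ _ Hv)).
    specialize (H2 s Hs1).
    assert (H3 : Cmod (g v - g (gam t)) < e / 2).
    { apply H1. generalize (Cmod_tri_minus v (gam s) (gam t)). lra. }
    assert (H4 : Cmod (g (gam s) - g (gam t)) < e / 2).
    { apply H1. lra. }
    generalize (Cmod_tri_minus (g v) (g (gam t)) (g (gam s))).
    rewrite (Cmod_sym (g (gam t))). lra.
Qed.

Lemma rdiff_scal c (f : R -> C) (t : R) (l : C) :
  rdiff f t l -> rdiff (fun s => c * f s) t (c * l).
Proof.
  intros H. replace (c * l) with (c * 1 * l) by ring.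
  apply (rdiff_comp (fun z => c * z) f); [|exact H].
  eapply cdiff_val; [apply cdiff_mult; [apply cdiff_const|apply cdiff_id]|].
  cbv beta; ring.
Qed.

Lemma re_le z : Rabs (Re z) <= Cmod z.
Proof. apply re_le_Cmod. Qed.

Lemma im_le z : Rabs (Im z) <= Cmod z.
Proof. eapply Rle_trans; [apply (Rmax_r (Rabs (fst z)))|apply Rmax_Cmod]. Qed.

Lemma re_minus a b : Re (a - b) = (Re a - Re b)%R.
Proof. unfold Cminus. rewrite re_plus, re_opp. reflexivity. Qed.

Lemma im_minus a b : Im (a - b) = (Im a - Im b)%R.
Proof. unfold Cminus. rewrite im_plus, im_opp. reflexivity. Qed.

Lemma rdiff_re (f : R -> C) (t : R) (l : C) :
  rdiff f t l -> is_derive (fun s => Re (f s)) t (Re l).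
Proof.
  intros H. apply is_derive_Reals. intros e He.
  destruct (proj1 (rdiff_eps f t l) H (e / 2)%R) as [d [Hd H1]]; [lra|].
  exists (mkposreal d Hd). intros h Hh Hhd. simpl in Hhd.
  specialize (H1 (t + h)%R). replace (t + h - t)%R with h in H1 by ring.
  specialize (H1 Hhd).
  assert (Hp : 0 < Rabs h) by (apply Rabs_pos_lt; exact Hh).
  replace ((Re (f (t + h)%R) - Re (f t)) / h - Re l)%R with
    (Re (f (t + h)%R - f t - l * RtoC h) / h)%R.
  - unfold Rdiv. rewrite Rabs_mult, Rabs_inv.
    apply Rmult_lt_reg_r with (Rabs h); [exact Hp|].
    rewrite Rmult_assoc, Rinv_l, Rmult_1_r by lra.
    generalize (re_le (f (t + h)%R - f t - l * RtoC h)).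
    assert (0 < e * Rabs h) by (apply Rmult_lt_0_compat; lra). lra.
  - rewrite !re_minus, re_scal_r. field. exact Hh.
Qed.

(** The mean value inequality for a curve reduces to the real mean value theorem
    for the component of the curve in the direction of its total displacement. *)
Lemma curve_mean_value (h h' : R -> C) (a b D : R) :
  a <= b ->
  (forall t : R, a <= t <= b -> rdiff h t (h' t) /\ Cmod (h' t) <= D) ->
  Cmod (h b - h a) <= D * (b - a).
Proof.
  intros Hab H. set (w := h b - h a).
  destruct (Req_dec (Cmod w) 0) as [Hw|Hw].
  { rewrite Hw. apply Rmult_le_pos; [|lra].
    destruct (H a) as [_ H1]; [lra|]. generalize (Cmod_ge_0 (h' a)); lra. }
  assert (Hw' : 0 < Cmod w) by (generalize (Cmod_ge_0 w); lra).
  destruct (MVT_gen (fun t => Re (Cconj w * h t)) a b (fun t => Re (Cconj w * h' t))) as [c [Hc H1]].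
  - intros t Ht. rewrite Rmin_left, Rmax_right in Ht by assumption.
    apply (rdiff_re (fun t => Cconj w * h t)). apply rdiff_scal. apply H; lra.
  - intros t Ht. rewrite Rmin_left, Rmax_right in Ht by assumption.
    apply continuity_pt_filterlim.
    apply (ex_derive_continuous (K := R_AbsRing) (V := R_NormedModule)).
    exists (Re (Cconj w * h' t)).
    apply (rdiff_re (fun t => Cconj w * h t)). apply rdiff_scal. apply H; lra.
  - rewrite Rmin_left, Rmax_right in Hc by assumption.
    rewrite <- re_minus in H1.
    replace (Cconj w * h b - Cconj w * h a) with (w * Cconj w) in H1 by (unfold w; ring).
    rewrite <- Cmod2_conj, re_RtoC in H1.
    assert (H2 : Re (Cconj w * h' c) <= Cmod w * D).
    { eapply Rle_trans; [apply Rle_abs|]. eapply Rle_trans; [apply re_le|].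
      rewrite Cmod_mult, Cmod_conj. apply Rmult_le_compat_l; [lra|]. apply H; lra. }
    apply Rmult_le_reg_l with (Cmod w); [exact Hw'|].
    simpl in H1. rewrite Rmult_1_r in H1. rewrite H1.
    rewrite <- Rmult_assoc. apply Rmult_le_compat_r; [lra|exact H2].
Qed.

Definition segt a b (t : R) : C := a + RtoC t * (b - a).

Lemma segt_0 a b : segt a b 0 = a.
Proof. unfold segt. ring. Qed.

Lemma segt_1 a b : segt a b 1 = b.
Proof. unfold segt. ring. Qed.

Lemma mean_value_bound g g' (z0 z l : C) (e : R) :
  (forall t : R, 0 <= t <= 1 ->
     cdiff g (segt z0 z t) (g' (segt z0 z t)) /\
     Cmod (g' (segt z0 z t) - l) <= e) ->
  Cmod (g z - g z0 - l * (z - z0)) <= e * Cmod (z - z0).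
Proof.
  intros H.
  set (h := fun t : R => g (segt z0 z t) - l * segt z0 z t).
  replace (g z - g z0 - l * (z - z0)) with (h 1%R - h 0%R).
  - replace (e * Cmod (z - z0))%R with (e * Cmod (z - z0) * (1 - 0))%R by ring.
    apply curve_mean_value with (fun t => (g' (segt z0 z t) - l) * (z - z0)); [lra|].
    intros t Ht. destruct (H t Ht) as [H1 H2]. split.
    + apply (rdiff_comp (fun z => g z - l * z) (segt z0 z)).
      * cd. ring.
      * apply rdiff_line.
    + rewrite Cmod_mult. apply Rmult_le_compat_r; [apply Cmod_ge_0|exact H2].
  - unfold h. rewrite segt_0, segt_1. ring.
Qed.

Definition I01 (f : R -> C) : C := RInt (V := VC) f 0 1.
Definition isI01 (f : R -> C) (l : C) : Prop :=
  is_RInt (V := VN) f 0 1 l.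
Definition cont01 (f : R -> C) : Prop := forall t : R, 0 <= t <= 1 -> rcont f t.

Lemma I01_correct (f : R -> C) : cont01 f -> isI01 f (I01 f).
Proof.
  intros H. apply (RInt_correct (V := VC)).
  apply (ex_RInt_continuous (V := VC)).
  intros t Ht. rewrite Rmin_left, Rmax_right in Ht by lra. apply H, Ht.
Qed.

Lemma I01_unique (f : R -> C) (l : C) : isI01 f l -> I01 f = l.
Proof. exact (is_RInt_unique (V := VC) f 0 1 l). Qed.

Lemma I01_ext (f g : R -> C) : (forall t : R, 0 <= t <= 1 -> f t = g t) -> I01 f = I01 g.
Proof.
  intros H. apply (RInt_ext (V := VC)).
  intros t Ht. rewrite Rmin_left, Rmax_right in Ht by lra. apply H; lra.
Qed.

Lemma I01_FTC (g g' : R -> C) :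
  (forall t : R, 0 <= t <= 1 -> rdiff g t (g' t)) -> cont01 g' ->
  I01 g' = g 1%R - g 0%R.
Proof.
  intros H1 H2. apply I01_unique.
  apply (is_RInt_derive (V := VC) g g').
  - intros t Ht. rewrite Rmin_left, Rmax_right in Ht by lra. apply H1, Ht.
  - intros t Ht. rewrite Rmin_left, Rmax_right in Ht by lra. apply H2, Ht.
Qed.

Lemma I01_plus (f g : R -> C) : cont01 f -> cont01 g ->
  I01 (fun t => f t + g t) = I01 f + I01 g.
Proof.
  intros Hf Hg. apply I01_unique.
  exact (is_RInt_plus (V := VN) f g 0 1 _ _ (I01_correct f Hf) (I01_correct g Hg)).
Qed.

Lemma I01_scal c (f : R -> C) : cont01 f -> I01 (fun t => c * f t) = c * I01 f.
Proof.
  intros Hf. apply I01_unique. assert (H := I01_correct f Hf).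
  assert (H1 := is_RInt_fct_extend_fst f 0 1 _ H).
  assert (H2 := is_RInt_fct_extend_snd f 0 1 _ H).
  apply (is_RInt_fct_extend_pair (U := R_NormedModule) (V := R_NormedModule)).
  - exact (is_RInt_minus _ _ _ _ _ _ (is_RInt_scal _ _ _ (fst c) _ H1) (is_RInt_scal _ _ _ (snd c) _ H2)).
  - exact (is_RInt_plus _ _ _ _ _ _ (is_RInt_scal _ _ _ (fst c) _ H2) (is_RInt_scal _ _ _ (snd c) _ H1)).
Qed.

Lemma I01_opp (f : R -> C) : cont01 f -> I01 (fun t => - f t) = - I01 f.
Proof.
  intros Hf. rewrite (I01_ext _ (fun t => - (1) * f t)) by (intros; ring).
  rewrite I01_scal by exact Hf. ring.
Qed.

Lemma cont01_mult (f g : R -> C) : cont01 f -> cont01 g -> cont01 (fun t => f t * g t).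
Proof. intros Hf Hg t Ht. apply rcont_mult; auto. Qed.
Lemma cont01_plus (f g : R -> C) : cont01 f -> cont01 g -> cont01 (fun t => f t + g t).
Proof. intros Hf Hg t Ht. apply rcont_plus; auto. Qed.
Lemma cont01_opp (f : R -> C) : cont01 f -> cont01 (fun t => - f t).
Proof. intros Hf t Ht. apply rcont_opp; auto. Qed.
Lemma cont01_const c : cont01 (fun _ => c).
Proof. intros t Ht. apply rcont_const. Qed.

Lemma I01_minus (f g : R -> C) : cont01 f -> cont01 g ->
  I01 (fun t => f t - g t) = I01 f - I01 g.
Proof. intros Hf Hg. unfold Cminus. rewrite I01_plus, I01_opp; auto using cont01_opp. Qed.

Lemma I01_bound (f : R -> C) (M : R) : cont01 f ->
  (forall t : R, 0 <= t <= 1 -> Cmod (f t) <= M) -> Cmod (I01 f) <= M.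
Proof.
  intros Hf HM. rewrite Cmod_norm. replace M with ((1 - 0) * M)%R by ring.
  apply (norm_RInt_le_const (V := VN) f 0 1 (I01 f) M); [lra| |apply I01_correct, Hf].
  intros t Ht. rewrite <- Cmod_norm. apply HM, Ht.
Qed.

Lemma I01_const c : I01 (fun _ => c) = c.
Proof.
  rewrite (I01_FTC (fun t => 0 + RtoC t * c) (fun _ => c)).
  - ring.
  - intros t _. apply rdiff_line.
  - apply cont01_const.
Qed.

Lemma I01_rev (f : R -> C) : cont01 f -> I01 (fun t => f (1 - t)%R) = I01 f.
Proof.
  intros Hf. apply I01_unique. assert (H := I01_correct f Hf).
  assert (H1 := is_RInt_swap (V := VN) f 1 0 _ H).
  assert (H2 : is_RInt (V := VN) f (-1 * 0 + 1) (-1 * 1 + 1) (opp (G := C_R_NormedModule) (I01 f))).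
  { replace (-1 * 0 + 1)%R with 1%R by ring. replace (-1 * 1 + 1)%R with 0%R by ring. exact H1. }
  assert (H3 := is_RInt_opp (V := VN) _ _ _ _ (is_RInt_comp_lin (V := VN) f (-1) 1 0 1 _ H2)).
  rewrite opp_opp in H3.
  eapply is_RInt_ext; [|exact H3].
  intros t _. cbv beta. rewrite scal_R_Cmult.
  change (- (RtoC (-1) * f (-1 * t + 1)%R) = f (1 - t)%R).
  replace (-1 * t + 1)%R with (1 - t)%R by ring. ring.
Qed.

(** For the subdivision of triangles below. *)
Lemma I01_half (f : R -> C) : cont01 f ->
  I01 f = / 2 * (I01 (fun t => f (/ 2 * t + 0)%R) + I01 (fun t => f (/ 2 * t + / 2)%R)).
Proof.
  intros Hf.
  assert (HC : forall a b : R, 0 <= a <= b -> b <= 1 ->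
     is_RInt (V := VN) f a b (RInt (V := VC) f a b)).
  { intros a b Ha Hb. apply (RInt_correct (V := VC)).
    apply (ex_RInt_continuous (V := VC)).
    intros t Ht. rewrite Rmin_left, Rmax_right in Ht by lra. apply Hf; lra. }
  assert (Hs : forall v : R, (v = 0 \/ v = / 2)%R ->
     / 2 * I01 (fun t => f (/ 2 * t + v)%R) = RInt (V := VC) f (/ 2 * 0 + v) (/ 2 * 1 + v)).
  { intros v Hv. rewrite <- I01_scal.
    - apply I01_unique.
      eapply is_RInt_ext; [|apply (is_RInt_comp_lin (V := VN) f (/2) v 0 1), HC; lra].
      intros t _. cbv beta. rewrite scal_R_Cmult, RtoC_inv by lra. reflexivity.
    - intros t Ht.
      apply (continuous_comp (U := R_UniformSpace) (V := R_UniformSpace) (W := C_UniformSpace) (fun t => (/ 2 * t + v)%R) f).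
      + apply (ex_derive_continuous (K := R_AbsRing) (V := R_NormedModule)). auto_derive. exact I.
      + apply Hf. lra. }
  rewrite Cmult_plus_distr_l, !Hs by auto.
  replace (/ 2 * 0 + 0)%R with 0%R by ring. replace (/ 2 * 0 + / 2)%R with (/ 2)%R by ring.
  replace (/ 2 * 1 + 0)%R with (/ 2)%R by ring. replace (/ 2 * 1 + / 2)%R with 1%R by field.
  apply I01_unique.
  apply (is_RInt_Chasles (V := VN) f 0 (/2) 1); apply HC; lra.
Qed.

(** Differentiation under the integral sign in a complex parameter. *)
Lemma I01_cdiff (Phi Phi' : C -> R -> C) z0 (r : R) :
  0 < r ->
  (forall z t, Cmod (z - z0) < r -> 0 <= t <= 1 ->
     cdiff (fun z => Phi z t) z (Phi' z t)) ->
  (forall z, Cmod (z - z0) < r -> cont01 (Phi z)) ->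
  cont01 (Phi' z0) ->
  (forall e : R, 0 < e -> exists d : R, 0 < d /\
     forall z t, Cmod (z - z0) < d -> 0 <= t <= 1 ->
       Cmod (Phi' z t - Phi' z0 t) <= e) ->
  cdiff (fun z => I01 (Phi z)) z0 (I01 (Phi' z0)).
Proof.
  intros Hr Hd Hc Hc' Hu. apply cdiff_eps. intros e He.
  destruct (Hu e He) as [d [Hd0 H1]].
  exists (Rmin d r). split; [apply Rmin_pos; assumption|]. intros z Hz.
  destruct (Rmin_Rgt_l _ _ _ Hz) as [Hz1 Hz2].
  assert (Hz0 : Cmod (z0 - z0) < r) by (rewrite Cmod_self; exact Hr).
  assert (Hseg : forall s : R, 0 <= s <= 1 -> Cmod (segt z0 z s - z0) <= Cmod (z - z0)).
  { intros s Hs. unfold segt. replace (z0 + RtoC s * (z - z0) - z0) with (RtoC s * (z - z0)) by ring.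
    rewrite Cmod_mult, Cmod_R, Rabs_pos_eq by lra.
    rewrite <- (Rmult_1_l (Cmod (z - z0))) at 2. apply Rmult_le_compat_r; [apply Cmod_ge_0|lra]. }
  replace (I01 (Phi z) - I01 (Phi z0) - I01 (Phi' z0) * (z - z0)) with
    (I01 (fun t => Phi z t - Phi z0 t - (z - z0) * Phi' z0 t)).
  - apply I01_bound.
    + intros t Ht. apply rcont_minus; [apply rcont_minus|apply rcont_mult; [apply rcont_const|]].
      * apply (Hc z Hz2 t Ht).
      * apply (Hc z0 Hz0 t Ht).
      * apply (Hc' t Ht).
    + intros t Ht. rewrite (Cmult_comm (z - z0)).
      apply (mean_value_bound (fun z => Phi z t) (fun z => Phi' z t)).
      intros s Hs. specialize (Hseg s Hs). split.
      * apply Hd; [lra|assumption].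
      * apply H1; [lra|assumption].
  - assert (A1 := Hc z Hz2). assert (A2 := Hc z0 Hz0).
    rewrite (I01_minus (fun t => Phi z t - Phi z0 t) (fun t => (z - z0) * Phi' z0 t)).
    + rewrite I01_minus, I01_scal by assumption. ring.
    + intros t Ht. apply rcont_minus; [apply A1|apply A2]; assumption.
    + apply cont01_mult; [apply cont01_const|exact Hc'].
Qed.

Definition holo (U : C -> Prop) f : Prop :=
  forall z : C, U z -> exists l : C, cdiff f z l.

Definition disc c (r : R) z : Prop := (Cmod (z - c) < r).

Definition clim (u : nat -> C) (l : C) : Prop :=
  forall e : R, 0 < e -> exists N : nat, forall n : nat, (N <= n)%nat ->
    Cmod (u n - l) < e.

Lemma Cmod_le_re_im z : Cmod z <= Rabs (Re z) + Rabs (Im z).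
Proof.
  destruct z as [x y]. unfold Re, Im; simpl.
  assert (E : (x, y) = RtoC x + Ci * RtoC y) by (apply injective_projections; simpl; ring).
  rewrite E. tri.
  rewrite Cmod_mult, Cmod_Ci, !Cmod_R. lra.
Qed.

Lemma clim_cauchy (u : nat -> C) :
  (forall e : R, 0 < e -> exists N : nat, forall n m : nat, (N <= n)%nat -> (N <= m)%nat ->
    Cmod (u n - u m) < e) -> exists l : C, clim u l.
Proof.
  intros H.
  assert (H1 : ex_finite_lim_seq (fun n => Re (u n))).
  { apply ex_lim_seq_cauchy_corr. intros e. destruct (H e (cond_pos e)) as [N HN].
    exists N. intros n m Hn Hm. rewrite <- re_minus.
    eapply Rle_lt_trans; [apply re_le|]. apply HN; assumption. }
  assert (H2 : ex_finite_lim_seq (fun n => Im (u n))).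
  { apply ex_lim_seq_cauchy_corr. intros e. destruct (H e (cond_pos e)) as [N HN].
    exists N. intros n m Hn Hm. rewrite <- im_minus.
    eapply Rle_lt_trans; [apply im_le|]. apply HN; assumption. }
  destruct H1 as [x Hx]. destruct H2 as [y Hy]. exists (x, y). intros e He.
  apply is_lim_seq_spec in Hx. apply is_lim_seq_spec in Hy.
  assert (He2 : 0 < e / 2) by lra.
  destruct (Hx (mkposreal _ He2)) as [N1 H1]. destruct (Hy (mkposreal _ He2)) as [N2 H2].
  exists (max N1 N2). intros n Hn.
  eapply Rle_lt_trans; [apply Cmod_le_re_im|].
  rewrite re_minus, im_minus. simpl in H1, H2.
  specialize (H1 n). specialize (H2 n).
  assert (Rabs (Re (u n) - x) < e / 2) by (apply H1; lia).
  assert (Rabs (Im (u n) - y) < e / 2) by (apply H2; lia).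
  unfold Re, Im in *. simpl fst in *. simpl snd in *. lra.
Qed.

Lemma clim_unique (u : nat -> C) (l m : C) : clim u l -> clim u m -> l = m.
Proof.
  intros Hl Hm. apply Ceq_minus. apply Cmod_eq_0.
  destruct (Req_dec (Cmod (l - m)) 0) as [H|H]; [exact H|exfalso].
  assert (Hp : 0 < Cmod (l - m) / 2) by (generalize (Cmod_ge_0 (l - m)); lra).
  destruct (Hl _ Hp) as [N1 H1]. destruct (Hm _ Hp) as [N2 H2].
  specialize (H1 (max N1 N2)). specialize (H2 (max N1 N2)).
  assert (A := H1 ltac:(lia)). assert (B := H2 ltac:(lia)).
  rewrite Cmod_sym in A. generalize (Cmod_tri_minus l (u (max N1 N2)) m). lra.
Qed.

Lemma clim_bound (u : nat -> C) (l c : C) (M : R) (N : nat) :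
  clim u l -> (forall n, (N <= n)%nat -> Cmod (u n - c) <= M) -> Cmod (l - c) <= M.
Proof.
  intros Hl H. apply Rnot_lt_le. intros Hlt.
  destruct (Hl (Cmod (l - c) - M)%R) as [N1 H1]; [lra|].
  specialize (H1 (max N1 N) ltac:(lia)). specialize (H (max N1 N) ltac:(lia)).
  rewrite Cmod_sym in H1. generalize (Cmod_tri_minus l (u (max N1 N)) c). lra.
Qed.

(** * Segments, triangles and Goursat's lemma *)

Definition segint f a b : C := (b - a) * I01 (fun t => f (segt a b t)).

Lemma segt_ball c a b (r t : R) :
  Cmod (a - c) <= r -> Cmod (b - c) <= r -> 0 <= t <= 1 ->
  Cmod (segt a b t - c) <= r.
Proof.
  intros Ha Hb Ht. unfold segt.
  replace (a + RtoC t * (b - a) - c) with (RtoC (1 - t) * (a - c) + RtoC t * (b - c))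
    by (rewrite RtoC_minus; ring).
  tri. rewrite !Cmod_mult, !Cmod_R, !Rabs_pos_eq by lra.
  replace r with ((1 - t) * r + t * r)%R by ring.
  apply Rplus_le_compat; apply Rmult_le_compat_l; lra.
Qed.

Lemma rcont_segt a b (t : R) : rcont (segt a b) t.
Proof. apply rcont_line. Qed.

Definition contseg f a b : Prop :=
  forall t : R, 0 <= t <= 1 -> ccont f (segt a b t).

Lemma cont01_seg f a b : contseg f a b -> cont01 (fun t => f (segt a b t)).
Proof. intros H t Ht. apply rcont_comp; [apply H, Ht|apply rcont_segt]. Qed.

Lemma segint_rev f a b : contseg f a b -> segint f b a = - segint f a b.
Proof.
  intros H. unfold segint. rewrite <- (I01_rev (fun t => f (segt a b t))) by (apply cont01_seg, H).
  rewrite (I01_ext (fun t => f (segt a b (1 - t))) (fun t => f (segt b a t))).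
  - ring.
  - intros t _. f_equal. unfold segt. rewrite RtoC_minus. ring.
Qed.

Lemma segint_half f (a b m : C) : contseg f a b -> m = (a + b) / 2 ->
  segint f a b = segint f a m + segint f m b.
Proof.
  intros H Hm. unfold segint. rewrite I01_half by (apply cont01_seg, H).
  rewrite (I01_ext (fun t => f (segt a b (/ 2 * t + 0))) (fun t => f (segt a m t))).
  rewrite (I01_ext (fun t => f (segt a b (/ 2 * t + / 2))) (fun t => f (segt m b t))).
  - rewrite Hm. field.
  - intros t _. f_equal. rewrite Hm. unfold segt. rewrite RtoC_plus, RtoC_mult, !RtoC_inv by lra. field.
  - intros t _. f_equal. rewrite Hm. unfold segt. rewrite RtoC_plus, RtoC_mult, !RtoC_inv by lra. field.
Qed.

Lemma segint_bound f a b (M : R) : contseg f a b ->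
  (forall t : R, 0 <= t <= 1 -> Cmod (f (segt a b t)) <= M) ->
  Cmod (segint f a b) <= Cmod (b - a) * M.
Proof.
  intros H HM. unfold segint. rewrite Cmod_mult.
  apply Rmult_le_compat_l; [apply Cmod_ge_0|].
  apply I01_bound; [apply cont01_seg, H|exact HM].
Qed.

Lemma segint_FTC (F f : C -> C) a b :
  (forall t : R, 0 <= t <= 1 -> cdiff F (segt a b t) (f (segt a b t))) ->
  contseg f a b -> segint f a b = F b - F a.
Proof.
  intros HF Hc. unfold segint.
  rewrite <- I01_scal by (apply cont01_seg, Hc).
  rewrite (I01_FTC (fun t => F (segt a b t))).
  - rewrite segt_0, segt_1. reflexivity.
  - intros t Ht. rewrite Cmult_comm. apply (rdiff_comp F (segt a b)); [apply HF, Ht|apply rdiff_line].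
  - apply cont01_mult; [apply cont01_const|apply cont01_seg, Hc].
Qed.

Lemma segint_plus f g a b : contseg f a b -> contseg g a b ->
  segint (fun z => f z + g z) a b = segint f a b + segint g a b.
Proof. intros Hf Hg. unfold segint. rewrite I01_plus by (apply cont01_seg; assumption). ring. Qed.

Definition triint f (a b d : C) : C := segint f a b + segint f b d + segint f d a.

(** All vertices in a ball, on which the integrand is continuous, and sides at
    most [D], a quantity that subdivision halves. *)
Definition tri_ok c (r D : R) (a b d : C) : Prop :=
  (Cmod (a - c) <= r) /\ Cmod (b - c) <= r /\ Cmod (d - c) <= r /\
  Cmod (b - a) <= D /\ Cmod (d - b) <= D /\ Cmod (a - d) <= D.

Definition contball f c (r : R) : Prop :=
  forall z : C, Cmod (z - c) <= r -> ccont f z.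

Lemma contball_seg f c a b (r : R) : contball f c r ->
  Cmod (a - c) <= r -> Cmod (b - c) <= r -> contseg f a b.
Proof. intros H Ha Hb t Ht. apply H. apply segt_ball; assumption. Qed.

Lemma mid_ball c a b (r : R) :
  Cmod (a - c) <= r -> Cmod (b - c) <= r -> Cmod ((a + b) / 2 - c) <= r.
Proof.
  intros Ha Hb. replace ((a + b) / 2) with (segt a b (/ 2)).
  - apply segt_ball; auto; lra.
  - unfold segt. rewrite RtoC_inv by lra. field.
Qed.

Lemma Cmod_half z w (D : R) : z = w / 2 -> Cmod w <= D -> Cmod z <= D / 2.
Proof.
  intros -> H. unfold Cdiv. rewrite Cmod_mult, Cmod_inv, Cmod_R, Rabs_pos_eq by (try lra; intros E; apply RtoC_inj in E; lra).
  lra.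
Qed.

Ltac half v := apply (Cmod_half _ v); [repeat match goal with x := _ |- _ => subst x end; field|assumption].

Lemma tri_split f c (r D M : R) (a b d : C) :
  contball f c r -> tri_ok c r D a b d -> M <= Cmod (triint f a b d) ->
  exists a' b' d' : C, tri_ok c r (D / 2) a' b' d' /\ M / 4 <= Cmod (triint f a' b' d') /\
    Cmod (a' - a) <= D.
Proof.
  intros Hf (Ha & Hb & Hd & H1 & H2 & H3) HM.
  set (m1 := (a + b) / 2). set (m2 := (b + d) / 2). set (m3 := (d + a) / 2).
  assert (Hm1 : Cmod (m1 - c) <= r) by (apply mid_ball; assumption).
  assert (Hm2 : Cmod (m2 - c) <= r) by (apply mid_ball; assumption).
  assert (Hm3 : Cmod (m3 - c) <= r) by (apply mid_ball; assumption).
  assert (Hseg : forall x y, Cmod (x - c) <= r -> Cmod (y - c) <= r -> contseg f x y)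
    by (intros x y; apply (contball_seg f c); assumption).
  assert (E : triint f a b d = triint f a m1 m3 + triint f m1 b m2 + triint f m3 m2 d + triint f m1 m2 m3).
  { unfold triint.
    rewrite (segint_half f a b m1), (segint_half f b d m2), (segint_half f d a m3) by auto.
    rewrite (segint_rev f m1 m2), (segint_rev f m2 m3), (segint_rev f m3 m1) by auto.
    ring. }
  assert (D0 : 0 <= D) by (generalize (Cmod_ge_0 (b - a)); lra).
  assert (K : M / 4 <= Cmod (triint f a m1 m3) \/ M / 4 <= Cmod (triint f m1 b m2) \/
     M / 4 <= Cmod (triint f m3 m2 d) \/ M / 4 <= Cmod (triint f m1 m2 m3)).
  { apply NNPP. intros HN.
    assert (T1 := Cmod_triangle (triint f a m1 m3 + triint f m1 b m2 + triint f m3 m2 d) (triint f m1 m2 m3)).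
    assert (T2 := Cmod_triangle (triint f a m1 m3 + triint f m1 b m2) (triint f m3 m2 d)).
    assert (T3 := Cmod_triangle (triint f a m1 m3) (triint f m1 b m2)). rewrite <- E in T1.
    apply HN. destruct (Rle_or_lt (M / 4) (Cmod (triint f a m1 m3))) as [|?]; [left; assumption|right].
    destruct (Rle_or_lt (M / 4) (Cmod (triint f m1 b m2))) as [|?]; [left; assumption|right].
    destruct (Rle_or_lt (M / 4) (Cmod (triint f m3 m2 d))) as [|?]; [left; assumption|right].
    lra. }
  assert (S1 : Cmod (m1 - a) <= D / 2) by half (b - a).
  assert (S2 : Cmod (b - m1) <= D / 2) by half (b - a).
  assert (S3 : Cmod (m2 - b) <= D / 2) by half (d - b).
  assert (S4 : Cmod (d - m2) <= D / 2) by half (d - b).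
  assert (S5 : Cmod (m3 - d) <= D / 2) by half (a - d).
  assert (S6 : Cmod (a - m3) <= D / 2) by half (a - d).
  assert (S7 : Cmod (m3 - m1) <= D / 2) by half (d - b).
  assert (S8 : Cmod (m1 - m2) <= D / 2) by half (a - d).
  assert (S9 : Cmod (m2 - m3) <= D / 2) by half (b - a).
  assert (S7' := S7). assert (S8' := S8). assert (S9' := S9).
  rewrite Cmod_sym in S7', S8', S9'.
  assert (Ha1 : Cmod (m1 - a) <= D) by lra.
  assert (Ha3 : Cmod (m3 - a) <= D) by (rewrite Cmod_sym; lra).
  destruct K as [K|[K|[K|K]]].
  - exists a, m1, m3. unfold tri_ok. rewrite Cmod_self. auto 10.
  - exists m1, b, m2. unfold tri_ok. auto 10.
  - exists m3, m2, d. unfold tri_ok. auto 10.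
  - exists m1, m2, m3. unfold tri_ok. auto 10.
Qed.

Lemma ccont_minus f g z : ccont f z -> ccont g z -> ccont (fun z => f z - g z) z.
Proof.
  intros Hf Hg e He.
  destruct (Hf (e / 2)%R) as [d1 [Hd1 H1]]; [lra|].
  destruct (Hg (e / 2)%R) as [d2 [Hd2 H2]]; [lra|].
  exists (Rmin d1 d2). split; [apply Rmin_pos; assumption|]. intros z' Hz.
  assert (A := H1 z' ltac:(apply (Rmin_Rgt_l _ _ _ Hz))).
  assert (B := H2 z' ltac:(apply (Rmin_Rgt_l _ _ _ Hz))).
  replace (f z' - g z' - (f z - g z)) with ((f z' - f z) + - (g z' - g z)) by ring.
  eapply Rle_lt_trans; [apply Cmod_triangle|]. rewrite Cmod_opp. lra.
Qed.

Lemma pow2_inv_small (D d : R) : 0 < d -> exists n : nat, D / 2 ^ n < d.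
Proof.
  intros Hd. destruct (Rle_dec D 0) as [HD|HD].
  { exists 0%nat. simpl. lra. }
  destruct (Pow_x_infinity 2 ltac:(rewrite Rabs_pos_eq; lra) (D / d + 1)%R) as [N HN].
  exists N. specialize (HN N ltac:(lia)).
  assert (Hp : 0 < 2 ^ N) by (apply pow_lt; lra).
  rewrite Rabs_pos_eq in HN by lra.
  apply Rmult_lt_reg_r with (2 ^ N)%R; [exact Hp|].
  unfold Rdiv. rewrite Rmult_assoc, Rinv_l, Rmult_1_r by lra.
  apply Rlt_le_trans with (d * (D / d + 1))%R.
  - replace (d * (D / d + 1))%R with (D + d)%R by (field; lra). lra.
  - apply Rmult_le_compat_l; lra.
Qed.

(** Of the four parts of a triangle one carries a quarter of the integral.
    Iterating, the parts shrink to a point, where the function is affine up to a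
    remainder too small for such an integral. *)
Theorem goursat_triangle f c (r D : R) (a b d : C) :
  (forall z : C, Cmod (z - c) <= r -> exists l : C, cdiff f z l) ->
  tri_ok c r D a b d -> triint f a b d = 0.
Proof.
  intros Hf Ht.
  assert (Hc : contball f c r).
  { intros z Hz. destruct (Hf z Hz) as [l Hl]. exact (cdiff_ccont f z l Hl). }
  assert (D0 : 0 <= D).
  { destruct Ht as (_ & _ & _ & H & _). generalize (Cmod_ge_0 (b - a)); lra. }
  set (eta := Cmod (triint f a b d)).
  destruct (Req_dec eta 0) as [He|He]; [apply Cmod_eq_0, He|exfalso].
  assert (Heta : 0 < eta) by (generalize (Cmod_ge_0 (triint f a b d)); fold eta; lra).
  set (P := fun (n : nat) (T : C * C * C) =>
     tri_ok c r (D / 2 ^ n) (fst (fst T)) (snd (fst T)) (snd T) /\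
     eta / 4 ^ n <= Cmod (triint f (fst (fst T)) (snd (fst T)) (snd T))).
  assert (Hstep : forall p : nat * (C * C * C), exists T' : C * C * C, P (fst p) (snd p) ->
     P (S (fst p)) T' /\ Cmod (fst (fst T') - fst (fst (snd p))) <= D / 2 ^ (fst p)).
  { intros [n T]. simpl fst; simpl snd. destruct (classic (P n T)) as [HP|HP].
    - destruct HP as [HP1 HP2].
      destruct (tri_split f c r _ _ _ _ _ Hc HP1 HP2) as (a' & b' & d' & Q1 & Q2 & Q3).
      exists (a', b', d'). intros _. split; [|exact Q3]. split; simpl fst; simpl snd.
      + replace (D / 2 ^ S n)%R with (D / 2 ^ n / 2)%R; [exact Q1|].
        simpl. field. apply pow_nonzero; lra.
      + replace (eta / 4 ^ S n)%R with (eta / 4 ^ n / 4)%R; [exact Q2|].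
        simpl. field. apply pow_nonzero; lra.
    - exists T. intros HP'; contradiction. }
  apply (choice (fun (p : nat * (C * C * C)) T' => P (fst p) (snd p) ->
     P (S (fst p)) T' /\ Cmod (fst (fst T') - fst (fst (snd p))) <= D / 2 ^ (fst p))) in Hstep.
  destruct Hstep as [step Hstep].
  set (T := fix T n := match n with O => (a, b, d) | S n => step (n, T n) end).
  assert (HT : forall n, P n (T n)).
  { induction n as [|n IH].
    - split; simpl fst; simpl snd; simpl pow; rewrite Rdiv_1_r.
      + exact Ht.
      + apply Rle_refl.
    - apply (Hstep (n, T n) IH). }
  set (u := fun n => fst (fst (T n))).
  assert (Hu : forall n k, Cmod (u (n + k)%nat - u n) <= 2 * D / 2 ^ n - 2 * D / 2 ^ (n + k)).
  { intros n k. induction k as [|k IH].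
    - rewrite Nat.add_0_r. rewrite Cmod_self. lra.
    - rewrite Nat.add_succ_r.
      eapply Rle_trans; [apply (Cmod_tri_minus _ (u (n + k)%nat))|].
      assert (H := proj2 (Hstep ((n + k)%nat, T (n + k)%nat) (HT _))). simpl fst in H; simpl snd in H.
      change (Cmod (u (S (n + k)) - u (n + k)%nat) <= D / 2 ^ (n + k)) in H.
      assert (E : (2 * D / 2 ^ S (n + k) = D / 2 ^ (n + k))%R).
      { simpl. field. apply pow_nonzero; lra. }
      assert (E2 : (2 * D / 2 ^ (n + k) = 2 * (D / 2 ^ (n + k)))%R) by (unfold Rdiv; ring).
      rewrite E. rewrite E2 in IH. lra. }
  assert (Hp2 : forall n, 0 <= D / 2 ^ n).
  { intros n. apply Rmult_le_pos; [exact D0|]. left; apply Rinv_0_lt_compat, pow_lt; lra. }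
  assert (Hu' : forall n k, Cmod (u (n + k)%nat - u n) <= 2 * (D / 2 ^ n)).
  { intros n k. eapply Rle_trans; [apply Hu|]. generalize (Hp2 (n + k)%nat). unfold Rdiv. lra. }
  destruct (clim_cauchy u) as [xi Hxi].
  { intros e He0. destruct (pow2_inv_small (4 * D) e He0) as [N HN]. exists N.
    intros n m Hn Hm. generalize (Hu' N (n - N)%nat), (Hu' N (m - N)%nat).
    replace (N + (n - N))%nat with n by lia. replace (N + (m - N))%nat with m by lia.
    intros A B. eapply Rle_lt_trans; [apply (Cmod_tri_minus _ (u N))|].
    rewrite (Cmod_sym (u N)). unfold Rdiv in *. lra. }
  assert (Hxi1 : forall n, Cmod (xi - u n) <= 2 * (D / 2 ^ n)).
  { intros n. apply (clim_bound u xi (u n) _ n Hxi). intros m Hm.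
    replace m with (n + (m - n))%nat by lia. apply Hu'. }
  assert (Hxi2 : Cmod (xi - c) <= r).
  { apply (clim_bound u xi c r 0 Hxi). intros n _. apply (HT n). }
  destruct (Hf xi Hxi2) as [l Hl].
  (* three sides, each of length [D_n] and within [3 D_n] of the limit point *)
  set (e := (eta / (9 * D * D + 1))%R).
  assert (HD : 0 < 9 * D * D + 1) by nra.
  assert (He0 : 0 < e) by (apply Rdiv_lt_0_compat; assumption).
  destruct (proj1 (cdiff_eps f xi l) Hl e He0) as [de [Hde H1]].
  destruct (pow2_inv_small (3 * D) de Hde) as [n Hn].
  destruct (HT n) as [(Ha & Hb & Hd & Sab & Sbd & Sda) HM].
  fold (u n) in *. set (an := u n) in *. set (bn := snd (fst (T n))) in *. set (dn := snd (T n)) in *.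
  set (Dn := (D / 2 ^ n)%R) in *.
  assert (HDn : 0 <= Dn) by apply Hp2.
  assert (Hn' : 3 * Dn < de) by (unfold Dn; unfold Rdiv in *; lra).
  set (A := fun z => f xi + l * (z - xi)).
  set (PA := fun z => f xi * z + l * ((z - xi) * (z - xi) / 2)).
  assert (HPA : forall z, cdiff PA z (A z)).
  { intros z. unfold PA, A. cd. field.
  }
  assert (HA : forall z, ccont A z).
  { intros z. unfold A. eapply cdiff_ccont. repeat cd_step. }
  set (E := fun z => f z + - A z).
  assert (HE : contball E c r).
  { intros z Hz. apply (ccont_minus f A); [apply Hc, Hz|].
    unfold A. eapply cdiff_ccont. repeat cd_step. }
  assert (Hnear : forall x y, Cmod (x - an) <= Dn -> Cmod (y - an) <= Dn ->
     Cmod (x - c) <= r -> Cmod (y - c) <= r -> Cmod (y - x) <= Dn ->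
     Cmod (segint f x y - (PA y - PA x)) <= Dn * (e * (3 * Dn))).
  { intros x y Hx Hy Hxc Hyc Hxy.
    assert (Hs : contseg f x y) by (apply (contball_seg f c x y r); assumption).
    assert (HsE : contseg E x y) by (apply (contball_seg E c x y r); assumption).
    replace (segint f x y) with (segint (fun z => A z + E z) x y).
    2:{ unfold segint. f_equal. apply I01_ext. intros t _. unfold E. ring. }
    rewrite segint_plus by (auto; intros t _; apply HA).
    rewrite (segint_FTC PA A) by (intros t _; auto).
    replace (PA y - PA x + segint E x y - (PA y - PA x)) with (segint E x y) by ring.
    eapply Rle_trans; [apply (segint_bound _ _ _ (e * (3 * Dn))); [exact HsE|]|].
    - intros t Ht'.
      assert (Hz : Cmod (segt x y t - xi) <= 3 * Dn).
      { eapply Rle_trans; [apply (Cmod_tri_minus _ an)|].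
        generalize (segt_ball an x y Dn t Hx Hy Ht'). specialize (Hxi1 n). fold an in Hxi1. fold Dn in Hxi1.
        rewrite Cmod_sym in Hxi1. lra. }
      unfold E, A. replace (f (segt x y t) + - (f xi + l * (segt x y t - xi))) with
        (f (segt x y t) - f xi - l * (segt x y t - xi)) by ring.
      eapply Rle_trans; [apply H1; lra|]. apply Rmult_le_compat_l; lra.
    - apply Rmult_le_compat_r; [|exact Hxy]. apply Rmult_le_pos; lra. }
  assert (Haa : Cmod (an - an) <= Dn) by (rewrite Cmod_self; exact HDn).
  assert (Hda : Cmod (dn - an) <= Dn) by (rewrite Cmod_sym; exact Sda).
  assert (K1 := Hnear an bn Haa Sab Ha Hb Sab).
  assert (K2 := Hnear bn dn Sab Hda Hb Hd Sbd).
  assert (K3 := Hnear dn an Hda Haa Hd Ha Sda).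
  assert (K : Cmod (triint f an bn dn) <= 9 * e * (Dn * Dn)).
  { unfold triint. replace (segint f an bn + segint f bn dn + segint f dn an) with
      ((segint f an bn - (PA bn - PA an)) + (segint f bn dn - (PA dn - PA bn)) + (segint f dn an - (PA an - PA dn))) by ring.
    tri.
    eapply Rle_trans; [apply Rplus_le_compat_r, Cmod_triangle|]. lra. }
  assert (K' : eta / 4 ^ n <= 9 * e * (Dn * Dn)) by lra.
  assert (E4 : (Dn * Dn = D * D / 4 ^ n)%R).
  { unfold Dn. replace (4 ^ n)%R with (2 ^ n * 2 ^ n)%R.
    - field. apply pow_nonzero; lra.
    - rewrite <- Rpow_mult_distr. f_equal; ring. }
  rewrite E4 in K'.
  assert (H4 : 0 < 4 ^ n) by (apply pow_lt; lra).
  assert (K'' : eta <= 9 * e * (D * D)).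
  { apply Rmult_le_reg_r with (/ 4 ^ n)%R; [apply Rinv_0_lt_compat, H4|].
    unfold Rdiv in K'. rewrite Rmult_assoc. exact K'. }
  assert (E5 : (e * (9 * D * D + 1) = eta)%R) by (unfold e; field; lra).
  nra.
Qed.

(** Morera: the difference quotient of [segint f c] at [z] is an average of [f]
    over a segment at [z]. *)
Lemma triangle_primitive f c (r : R) : (forall z, disc c r z -> ccont f z) ->
  (forall z z', disc c r z -> disc c r z' -> triint f c z z' = 0) ->
  forall z, disc c r z -> cdiff (segint f c) z (f z).
Proof.
  intros Hc HT z Hz. unfold disc in Hz.
  apply cdiff_eps. intros e He.
  destruct (Hc z Hz (e / 2)%R) as [d [Hd H1]]; [lra|].
  exists (Rmin d ((r - Cmod (z - c)) / 2)). split; [apply Rmin_pos; lra|].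
  intros z' Hz'.
  destruct (Rmin_Rgt_l _ _ _ Hz') as [Hz1 Hz2].
  set (r' := ((r + Cmod (z - c)) / 2)%R).
  assert (Hr' : r' < r) by (unfold r'; lra).
  assert (A0 : Cmod (c - c) <= r').
  { rewrite Cmod_self. unfold r'. generalize (Cmod_ge_0 (z - c)); lra. }
  assert (A1 : Cmod (z - c) <= r') by (unfold r'; lra).
  assert (A2 : Cmod (z' - c) <= r') by (generalize (Cmod_tri_minus z' z c); unfold r'; lra).
  assert (Hcb : contball f c r') by (intros w Hw; apply Hc; unfold disc; lra).
  assert (Hseg : forall x y, Cmod (x - c) <= r' -> Cmod (y - c) <= r' -> contseg f x y)
    by (intros x y; apply (contball_seg f c); assumption).
  assert (T : triint f c z z' = 0) by (apply HT; unfold disc; lra).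
  unfold triint in T. rewrite (segint_rev f c z') in T by auto.
  replace (segint f c z' - segint f c z) with (segint f z z').
  2:{ replace (segint f c z') with (segint f c z' + (segint f c z + segint f z z' + - segint f c z')) by (rewrite T; ring). ring. }
  replace (segint f z z' - f z * (z' - z)) with (segint (fun w => f w + - f z) z z').
  - rewrite Rmult_comm.
    apply segint_bound.
    + intros t Ht. apply (ccont_minus f (fun _ => f z)); [apply Hseg; assumption|]. apply (cdiff_ccont _ _ 0), cdiff_const.
    + intros t Ht. left. apply Rlt_trans with (e / 2)%R; [|lra].
      apply H1. unfold segt. replace (z + RtoC t * (z' - z) - z) with (RtoC t * (z' - z)) by ring.
      rewrite Cmod_mult, Cmod_R, Rabs_pos_eq by lra.
      generalize (Cmod_ge_0 (z' - z)). nra.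
  - rewrite segint_plus by (auto; intros t Ht; apply (cdiff_ccont _ _ 0), cdiff_const).
    unfold segint at 2. rewrite I01_const. ring.
Qed.

Lemma disc_triangle f c z z' (r : R) :
  holo (disc c r) f -> disc c r z -> disc c r z' -> triint f c z z' = 0.
Proof.
  intros Hf Hz Hz'. unfold disc in *. assert (M := Rmax_lub_lt _ _ _ Hz Hz').
  assert (M1 := Rmax_l (Cmod (z - c)) (Cmod (z' - c))). assert (M2 := Rmax_r (Cmod (z - c)) (Cmod (z' - c))).
  set (r0 := Rmax _ _) in *.
  generalize (Cmod_ge_0 (z - c)), (Cmod_ge_0 (z' - z)), (Cmod_ge_0 (c - z')). intros B1 B2 B3.
  apply (goursat_triangle f c r0 (Cmod (z - c) + Cmod (z' - z) + Cmod (c - z'))).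
  - intros w Hw. apply Hf, (Rle_lt_trans _ _ _ Hw M).
  - unfold tri_ok. rewrite Cmod_self. repeat split; lra.
Qed.

Lemma holo_disc_primitive f c (r : R) :
  holo (disc c r) f -> forall z, disc c r z -> cdiff (segint f c) z (f z).
Proof.
  intros Hf. apply triangle_primitive; [|intros z z'; apply disc_triangle, Hf].
  intros w Hw. destruct (Hf w Hw) as [l Hl]. exact (cdiff_ccont f w l Hl).
Qed.

Definition copen (U : C -> Prop) : Prop :=
  forall z : C, U z -> exists d : R, 0 < d /\ forall z' : C, Cmod (z' - z) < d -> U z'.

Lemma copen_disc c (r : R) : copen (disc c r).
Proof.
  intros z Hz. unfold disc in *. exists (r - Cmod (z - c))%R. split; [lra|].
  intros z' Hz'. generalize (Cmod_tri_minus z' z c). lra.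
Qed.

Lemma disc_center c (r : R) : 0 < r -> disc c r c.
Proof. intros H. unfold disc. rewrite Cmod_self. exact H. Qed.

Lemma bounded01 (f : R -> C) : cont01 f ->
  exists M : R, 0 < M /\ forall t : R, 0 <= t <= 1 -> Cmod (f t) <= M.
Proof.
  intros Hf.
  destruct (compact_interval (fun t d => Cmod (f t) <= / d) 0 1) as [d [Hd H]].
  - intros s d d' Hd H. eapply Rle_trans; [exact H|]. apply Rinv_le_contravar; lra.
  - intros t Ht. destruct (proj1 (rcont_eps f t) (Hf t Ht) 1%R Rlt_0_1) as [d [Hd H]].
    assert (Hp : 0 < Cmod (f t) + 1) by (generalize (Cmod_ge_0 (f t)); lra).
    exists (Rmin d (/ (Cmod (f t) + 1))). split.
    { apply Rmin_pos; [exact Hd|]. apply Rinv_0_lt_compat, Hp. }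
    intros s Hs _. specialize (H s ltac:(apply (Rmin_Rgt_l _ _ _ Hs))).
    apply Rle_trans with (Cmod (f t) + 1)%R.
    + generalize (Cmod_minus_ge (f s) (f t)). lra.
    + rewrite <- (Rinv_inv (Cmod (f t) + 1)) at 1. apply Rinv_le_contravar; [|apply Rmin_r].
      apply Rmin_pos; [exact Hd|]. apply Rinv_0_lt_compat, Hp.
  - exists (/ d)%R. split; [apply Rinv_0_lt_compat, Hd|exact H].
Qed.

(** * The exponential and Cauchy's formula *)

(** All the contour integrals below depend on their complex parameter through a
    composition with an affine function of it. *)
Lemma I01_cdiff_affine (V : C -> Prop) g g' (psi alpha beta : R -> C) z0 :
  copen V -> (forall w, V w -> cdiff g w (g' w) /\ ccont g' w) ->
  cont01 psi -> cont01 alpha -> cont01 beta ->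
  (forall t : R, 0 <= t <= 1 -> V (alpha t + beta t * z0)) ->
  cdiff (fun z => I01 (fun t => psi t * g (alpha t + beta t * z))) z0
    (I01 (fun t => psi t * (g' (alpha t + beta t * z0) * beta t))).
Proof.
  intros HV Hg Hpsi Ha Hb Harc.
  destruct (bounded01 psi Hpsi) as [A [HA HpsiA]].
  destruct (bounded01 beta Hb) as [B [HB HbB]].
  assert (Hca : cont01 (fun t => alpha t + beta t * z0)).
  { apply cont01_plus; [exact Ha|]. apply cont01_mult; [exact Hb|apply cont01_const]. }
  destruct (compact_interval (fun t d => forall v, Cmod (v - (alpha t + beta t * z0)) < d -> V v) 0 1)
    as [rho [Hrho Htube]].
  { intros s d d' Hd H v Hv. apply H. lra. }
  { intros t Ht. destruct (HV _ (Harc t Ht)) as [d [Hd H]].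
    destruct (proj1 (rcont_eps _ t) (Hca t Ht) (d / 2)%R) as [d2 [Hd2 H2]]; [lra|].
    exists (Rmin (d / 2) d2). split; [apply Rmin_pos; lra|].
    intros s Hs _ v Hv. apply H.
    specialize (H2 s ltac:(apply (Rmin_Rgt_l _ _ _ Hs))). cbv beta in H2.
    assert (Hv' : Cmod (v - (alpha s + beta s * z0)) < d / 2) by (apply (Rmin_Rgt_l _ _ _ Hv)).
    generalize (Cmod_tri_minus v (alpha s + beta s * z0) (alpha t + beta t * z0)). lra. }
  assert (Hdist : forall z t, 0 <= t <= 1 ->
    Cmod (alpha t + beta t * z - (alpha t + beta t * z0)) <= B * Cmod (z - z0)).
  { intros z t Ht. replace (alpha t + beta t * z - (alpha t + beta t * z0)) with (beta t * (z - z0)) by ring.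
    rewrite Cmod_mult. apply Rmult_le_compat_r; [apply Cmod_ge_0|apply HbB, Ht]. }
  assert (Hsmall : forall z d, 0 < d -> Cmod (z - z0) < d / B -> B * Cmod (z - z0) < d).
  { intros z d Hd Hz. apply Rlt_le_trans with (B * (d / B))%R.
    - apply Rmult_lt_compat_l; assumption.
    - right; field; lra. }
  assert (HVz : forall z t, Cmod (z - z0) < rho / B -> 0 <= t <= 1 -> V (alpha t + beta t * z)).
  { intros z t Hz Ht. apply (Htube t Ht). eapply Rle_lt_trans; [apply Hdist, Ht|]. apply Hsmall; assumption. }
  assert (Haff : forall z, cont01 (fun t => alpha t + beta t * z)).
  { intros z. apply cont01_plus; [exact Ha|]. apply cont01_mult; [exact Hb|apply cont01_const]. }
  apply (I01_cdiff (fun z t => psi t * g (alpha t + beta t * z))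
    (fun z t => psi t * (g' (alpha t + beta t * z) * beta t)) z0 (rho / B)).
  - apply Rdiv_lt_0_compat; assumption.
  - intros z t Hz Ht. destruct (Hg _ (HVz z t Hz Ht)) as [Hg1 _].
    eapply cdiff_val.
    + apply cdiff_mult; [apply cdiff_const|].
      apply (cdiff_comp g (fun z => alpha t + beta t * z)); [exact Hg1|].
      repeat cd_step.
    + cbv beta. ring.
  - intros z Hz t Ht. apply rcont_mult; [apply Hpsi, Ht|].
    apply (rcont_comp g (fun t => alpha t + beta t * z)); [|apply Haff, Ht].
    destruct (Hg _ (HVz z t Hz Ht)) as [Hg1 _]. exact (cdiff_ccont _ _ _ Hg1).
  - intros t Ht. apply rcont_mult; [apply Hpsi, Ht|]. apply rcont_mult; [|apply Hb, Ht].
    apply (rcont_comp g' (fun t => alpha t + beta t * z0)); [|apply Haff, Ht].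
    apply Hg, Harc, Ht.
  - intros e He.
    destruct (unif_cont_arc g' (fun t => alpha t + beta t * z0) 0 1) with (e := (e / (A * B))%R) as [d [Hd H]].
    + intros t Ht. apply Haff, Ht.
    + intros t Ht. apply Hg, Harc, Ht.
    + apply Rdiv_lt_0_compat; [exact He|]. apply Rmult_lt_0_compat; assumption.
    + exists (d / B)%R. split; [apply Rdiv_lt_0_compat; assumption|].
      intros z t Hz Ht.
      specialize (H t Ht (alpha t + beta t * z)).
      assert (H1 : Cmod (g' (alpha t + beta t * z)%C - g' (alpha t + beta t * z0)%C) < e / (A * B)).
      { apply H. eapply Rle_lt_trans; [apply Hdist, Ht|]. apply Hsmall; assumption. }
      replace (psi t * (g' (alpha t + beta t * z) * beta t) - psi t * (g' (alpha t + beta t * z0) * beta t))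
        with (psi t * ((g' (alpha t + beta t * z) - g' (alpha t + beta t * z0)) * beta t)) by ring.
      rewrite !Cmod_mult.
      apply Rle_trans with (A * (e / (A * B) * B))%R; [|right; field; lra].
      apply Rmult_le_compat; [apply Cmod_ge_0| |apply HpsiA, Ht|].
      * apply Rmult_le_pos; apply Cmod_ge_0.
      * apply Rmult_le_compat; [apply Cmod_ge_0|apply Cmod_ge_0|lra|apply HbB, Ht].
Qed.

Definition cexp z : C := (exp (Re z) * cos (Im z), exp (Re z) * sin (Im z))%R.

Lemma cexp_plus z w : cexp (z + w) = cexp z * cexp w.
Proof.
  unfold cexp. rewrite re_plus, im_plus, exp_plus, cos_plus, sin_plus.
  apply injective_projections; simpl; ring.
Qed.

Lemma cexp_0 : cexp 0 = 1.
Proof.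
  unfold cexp. rewrite re_RtoC, im_RtoC, exp_0, cos_0, sin_0.
  apply injective_projections; simpl; ring.
Qed.

Lemma Cmod_cexp z : Cmod (cexp z) = exp (Re z).
Proof.
  unfold Cmod, cexp; simpl.
  replace (_ + _)%R with ((exp (Re z))² * ((sin (Im z))² + (cos (Im z))²))%R by (unfold Rsqr; ring).
  rewrite sin2_cos2, Rmult_1_r. apply sqrt_Rsqr. left; apply exp_pos.
Qed.

Lemma cexp_neq_0 z : cexp z <> 0.
Proof. apply Cmod_gt_0. rewrite Cmod_cexp. apply exp_pos. Qed.

Lemma derivable_eps (f : R -> R) (x l : R) : derivable_pt_lim f x l ->
  forall e, 0 < e -> exists d, 0 < d /\ forall h : R, Rabs h < d ->
    Rabs (f (x + h)%R - f x - l * h) <= e * Rabs h.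
Proof.
  intros H e He. destruct (H e He) as [d Hd]. exists d. split; [apply cond_pos|].
  intros h Hh. destruct (Req_dec h 0) as [->|Hh0].
  - rewrite Rplus_0_r. replace (f x - f x - l * 0)%R with 0%R by ring. rewrite Rabs_R0. lra.
  - specialize (Hd h Hh0 Hh).
    replace (f (x + h) - f x - l * h)%R with (((f (x + h) - f x) / h - l) * h)%R by (field; exact Hh0).
    rewrite Rabs_mult. apply Rmult_le_compat_r; [apply Rabs_pos|lra].
Qed.

Lemma cdiff_cexp_0 : cdiff cexp 0 1.
Proof.
  apply cdiff_eps. intros e He.
  set (k := (Rmin 1 (e / 8))%R).
  assert (Hk : 0 < k) by (apply Rmin_pos; lra).
  assert (Hk1 : k <= 1) by apply Rmin_l.
  assert (Hk8 : k <= e / 8) by apply Rmin_r.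
  destruct (derivable_eps exp 0 _ (derivable_pt_lim_exp 0) k Hk) as [d1 [Hd1 H1]].
  destruct (derivable_eps sin 0 _ (derivable_pt_lim_sin 0) k Hk) as [d2 [Hd2 H2]].
  destruct (derivable_eps cos 0 _ (derivable_pt_lim_cos 0) k Hk) as [d3 [Hd3 H3]].
  exists (Rmin (Rmin d1 (e / 16)) (Rmin d2 (Rmin d3 1))).
  split; [repeat apply Rmin_pos; lra|].
  intros z Hz. replace (z - 0) with z in * by ring.
  destruct (Rmin_Rgt_l _ _ _ Hz) as [Z12 Z345]. destruct (Rmin_Rgt_l _ _ _ Z12) as [Z1 Z2].
  destruct (Rmin_Rgt_l _ _ _ Z345) as [Z3 Z45]. destruct (Rmin_Rgt_l _ _ _ Z45) as [Z4 Z5].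
  set (x := Re z) in *. set (y := Im z) in *.
  assert (Hx : Rabs x <= Cmod z) by apply re_le.
  assert (Hy : Rabs y <= Cmod z) by apply im_le.
  specialize (H1 x ltac:(lra)). specialize (H2 y ltac:(lra)). specialize (H3 y ltac:(lra)).
  rewrite exp_0, Rplus_0_l in H1. rewrite sin_0, cos_0, Rplus_0_l in H2. rewrite sin_0, cos_0, Rplus_0_l in H3.
  set (X := (exp x - 1 - 1 * x)%R) in *. set (S := (sin y - 0 - 1 * y)%R) in *. set (K := (cos y - 1 - - 0 * y)%R) in *.
  rewrite cexp_0.
  assert (Ez : z = RtoC x + Ci * RtoC y).
  { unfold x, y. destruct z as [a b]. apply injective_projections; simpl; ring. }
  replace (cexp z - 1 - 1 * z) with
    (RtoC X * (RtoC (cos y) + Ci * RtoC (sin y)) + RtoC x * (RtoC K + Ci * RtoC (sin y)) + (RtoC K + Ci * RtoC S)).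
  2:{ rewrite Ez at 2. unfold cexp. fold x y. unfold X, S, K. apply injective_projections; simpl; ring. }
  assert (B : forall a b : R, Cmod (RtoC a + Ci * RtoC b) <= Rabs a + Rabs b).
  { intros a b. tri. rewrite Cmod_mult, Cmod_Ci, !Cmod_R. lra. }
  assert (Hsin : Rabs (sin y) <= 2 * Cmod z).
  { replace (sin y) with (S + y)%R by (unfold S; ring). eapply Rle_trans; [apply Rabs_triang|].
    assert (k * Rabs y <= 1 * Cmod z) by (apply Rmult_le_compat; try apply Rabs_pos; lra). lra. }
  assert (HK : Rabs K <= e / 8 * Cmod z).
  { eapply Rle_trans; [apply H3|]. apply Rmult_le_compat; try apply Rabs_pos; lra. }
  assert (HS : Rabs S <= e / 8 * Cmod z).
  { eapply Rle_trans; [apply H2|]. apply Rmult_le_compat; try apply Rabs_pos; lra. }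
  assert (HX : Rabs X <= e / 8 * Cmod z).
  { eapply Rle_trans; [apply H1|]. apply Rmult_le_compat; try apply Rabs_pos; lra. }
  assert (Hc : Cmod (RtoC (cos y) + Ci * RtoC (sin y)) <= 2).
  { eapply Rle_trans; [apply B|]. generalize (COS_bound y), (SIN_bound y). intros [C1 C2] [D1 D2].
    assert (Rabs (cos y) <= 1) by (apply Rabs_le; lra). assert (Rabs (sin y) <= 1) by (apply Rabs_le; lra). lra. }
  assert (Hz0 := Cmod_ge_0 z).
  assert (T1 : Cmod (RtoC X * (RtoC (cos y) + Ci * RtoC (sin y))) <= e / 8 * Cmod z * 2).
  { rewrite Cmod_mult, Cmod_R. apply Rmult_le_compat; try apply Rabs_pos; try apply Cmod_ge_0; lra. }
  assert (T2 : Cmod (RtoC x * (RtoC K + Ci * RtoC (sin y))) <= Cmod z * (e / 8 + e / 8)).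
  { rewrite Cmod_mult, Cmod_R. apply Rmult_le_compat; try apply Rabs_pos; try apply Cmod_ge_0; [lra|].
    eapply Rle_trans; [apply B|]. apply Rplus_le_compat; [|lra].
    assert (e / 8 * Cmod z <= e / 8 * 1) by (apply Rmult_le_compat_l; lra). lra. }
  assert (T3 : Cmod (RtoC K + Ci * RtoC S) <= e / 8 * Cmod z + e / 8 * Cmod z).
  { eapply Rle_trans; [apply B|]. lra. }
  assert (Hez : 0 <= e * Cmod z) by (apply Rmult_le_pos; lra).
  tri.
  eapply Rle_trans; [apply Rplus_le_compat_r, Cmod_triangle|]. lra.
Qed.

Lemma cdiff_cexp z : cdiff cexp z (cexp z).
Proof.
  apply (cdiff_ext (fun w => cexp z * cexp (w - z))).
  - intros w. rewrite <- cexp_plus. f_equal. ring.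
  - eapply cdiff_val.
    + apply cdiff_mult; [apply cdiff_const|]. apply cdiff_shift_minus.
      replace (z - z) with (0:C) by ring. apply cdiff_cexp_0.
    + cbv beta. replace (z - z) with (0:C) by ring. rewrite cexp_0. ring.
Qed.

(** The summand [0] makes the exponent an instance of [rdiff_line]. *)
Definition circ c (r : R) (t : R) : C := c + RtoC r * cexp (0 + RtoC t * (2 * PI * Ci)).
Definition dcirc (r : R) (t : R) : C := RtoC r * (cexp (0 + RtoC t * (2 * PI * Ci)) * (2 * PI * Ci)).

Lemma rdiff_circ c (r t : R) : rdiff (circ c r) t (dcirc r t).
Proof.
  unfold circ, dcirc.
  replace (RtoC r * (cexp (0 + RtoC t * (2 * PI * Ci)) * (2 * PI * Ci))) with
    (RtoC r * cexp (0 + RtoC t * (2 * PI * Ci)) * (2 * PI * Ci)) by ring.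
  apply (rdiff_comp (fun w => c + RtoC r * cexp w)); [|apply rdiff_line].
  eapply cdiff_val.
  - apply cdiff_plus; [apply cdiff_const|]. apply cdiff_mult; [apply cdiff_const|apply cdiff_cexp].
  - cbv beta. ring.
Qed.

Lemma circ_closed c (r : R) : circ c r 1 = circ c r 0.
Proof.
  unfold circ. do 2 f_equal. unfold cexp.
  rewrite !re_plus, !im_plus, !re_scal_l, !im_scal_l, re_RtoC, im_RtoC.
  replace (Re (2 * PI * Ci)) with 0%R by (unfold Re; simpl; ring).
  replace (Im (2 * PI * Ci)) with (2 * PI)%R by (unfold Im; simpl; ring).
  rewrite !Rmult_0_r, !Rmult_1_l, !Rmult_0_l, !Rplus_0_l, cos_2PI, sin_2PI, cos_0, sin_0. reflexivity.
Qed.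

Lemma circ_dist c (r t : R) : 0 < r -> Cmod (circ c r t - c) = r.
Proof.
  intros Hr. unfold circ. replace (c + RtoC r * cexp (0 + RtoC t * (2 * PI * Ci)) - c) with
    (RtoC r * cexp (0 + RtoC t * (2 * PI * Ci))) by ring.
  rewrite Cmod_mult, Cmod_cexp, Cmod_R, re_plus, re_RtoC, re_scal_l.
  replace (Re (2 * PI * Ci)) with 0%R by (unfold Re; simpl; ring).
  rewrite Rmult_0_r, Rplus_0_l, exp_0, Rabs_pos_eq; lra.
Qed.

Lemma cont01_circ c (r : R) : cont01 (circ c r).
Proof. intros t _. exact (rdiff_rcont _ _ _ (rdiff_circ c r t)). Qed.

Lemma cont01_dcirc (r : R) : cont01 (dcirc r).
Proof.
  intros t _. unfold dcirc.
  apply rcont_mult; [apply rcont_const|]. apply rcont_mult; [|apply rcont_const].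
  apply rcont_comp; [exact (cdiff_ccont _ _ _ (cdiff_cexp _))|apply rcont_line].
Qed.

Lemma dcirc_circ c (r t : R) : dcirc r t = (circ c r t - c) * (2 * PI * Ci).
Proof. unfold dcirc, circ. ring. Qed.

Lemma circ_neq c z (r t : R) : 0 < r -> Cmod (z - c) < r -> circ c r t - z <> 0.
Proof.
  intros Hr Hz. apply Cmod_gt_0.
  generalize (Cmod_tri_minus (circ c r t) z c). rewrite circ_dist by exact Hr. lra.
Qed.

Lemma cont01_inv (f : R -> C) : cont01 f -> (forall t, 0 <= t <= 1 -> f t <> 0) -> cont01 (fun t => / f t).
Proof.
  intros Hf Hn t Ht. apply (rcont_comp Cinv f); [|apply Hf, Ht].
  exact (cdiff_ccont _ _ _ (cdiff_cinv _ (Hn t Ht))).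
Qed.

Lemma cont01_minus (f g : R -> C) : cont01 f -> cont01 g -> cont01 (fun t => f t - g t).
Proof. intros Hf Hg. apply cont01_plus; [exact Hf|apply cont01_opp, Hg]. Qed.

Lemma copen_neq0 : copen (fun w : C => w <> 0).
Proof.
  intros w Hw. exists (Cmod w). split; [apply Cmod_gt_0, Hw|].
  intros w' Hw'. apply Cmod_gt_0. generalize (Cmod_minus_ge w w'). rewrite Cmod_sym. lra.
Qed.

(** Applied to [1/w], [-1/w^2], [2/w^3], each the derivative of the one before,
    this differentiates a Cauchy integral again and again. *)
Lemma cauchy_kernel (psi : R -> C) c (r : R) g g' z :
  0 < r -> cont01 psi -> Cmod (z - c) < r ->
  (forall w : C, w <> 0 -> cdiff g w (g' w) /\ ccont g' w) ->
  cdiff (fun z => I01 (fun t => psi t * g (circ c r t - z))) z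
    (- I01 (fun t => psi t * g' (circ c r t - z))).
Proof.
  intros Hr Hpsi Hz Hg.
  assert (H := I01_cdiff_affine (fun w : C => w <> 0) g g' psi (circ c r) (fun _ => - (1)) z
    copen_neq0 Hg Hpsi (cont01_circ c r) (cont01_const _)).
  assert (Hne : forall t, 0 <= t <= 1 -> circ c r t + - (1) * z <> 0).
  { intros t _. replace (circ c r t + - (1) * z) with (circ c r t - z) by ring. apply circ_neq; assumption. }
  specialize (H Hne).
  eapply cdiff_val.
  - eapply cdiff_ext; [|exact H]. intros z'. cbv beta. apply I01_ext. intros t _. do 2 f_equal. ring.
  - rewrite <- I01_opp.
    + apply I01_ext. intros t _. cbv beta. replace (circ c r t + - (1) * z) with (circ c r t - z) by ring. ring.
    + apply cont01_mult; [exact Hpsi|]. intros t Ht.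
      apply (rcont_comp g' (fun t => circ c r t - z)).
      * apply Hg. apply circ_neq; assumption.
      * apply cont01_minus; [apply cont01_circ|apply cont01_const|exact Ht].
Qed.

Lemma ker1 w : w <> 0 -> cdiff (fun w => / w) w (- / (w * w)) /\ ccont (fun w => - / (w * w)) w.
Proof.
  intros Hw. split.
  - cd; [exact Hw|]. field. exact Hw.
  - eapply cdiff_ccont. repeat cd_step. apply Cmult_neq_0; exact Hw.
Qed.

Lemma segment_constant g z0 z :
  (forall t : R, 0 <= t <= 1 -> cdiff g (segt z0 z t) 0) -> g z = g z0.
Proof.
  intros H. apply Ceq_minus, Cmod_eq_0.
  assert (K := mean_value_bound g (fun _ => 0) z0 z 0 0).
  replace (g z - g z0 - 0 * (z - z0)) with (g z - g z0) in K by ring.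
  assert (Cmod (g z - g z0) <= 0 * Cmod (z - z0)).
  { apply K. intros t Ht. split; [apply H, Ht|]. rewrite Cmod_self. lra. }
  generalize (Cmod_ge_0 (g z - g z0)). lra.
Qed.

Lemma two_pi_i_neq_0 : 2 * PI * Ci <> 0.
Proof.
  repeat apply Cmult_neq_0.
  - apply RtoC_neq_0. lra.
  - apply RtoC_neq_0. generalize PI_RGT_0. lra.
  - apply Ci_nz.
Qed.

(** The integral does not change when [z] moves to the centre. *)
Lemma winding_number c z (r : R) : 0 < r -> Cmod (z - c) < r ->
  I01 (fun t => dcirc r t * / (circ c r t - z)) = 2 * PI * Ci.
Proof.
  intros Hr Hz.
  rewrite (segment_constant (fun z => I01 (fun t => dcirc r t * / (circ c r t - z))) c z).
  - rewrite (I01_ext _ (fun _ => 2 * PI * Ci)); [apply I01_const|].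
    intros t _. rewrite (dcirc_circ c). field. apply circ_neq; [exact Hr|]. rewrite Cmod_self. exact Hr.
  - intros s Hs.
    assert (Hz' : Cmod (segt c z s - c) < r).
    { apply Rle_lt_trans with (Cmod (z - c)); [|exact Hz].
      apply segt_ball; [rewrite Cmod_self; apply Cmod_ge_0|lra|exact Hs]. }
    eapply cdiff_val.
    + apply (cauchy_kernel (dcirc r) c r (fun w => / w) (fun w => - / (w * w))); [exact Hr|apply cont01_dcirc|exact Hz'|apply ker1].
    + set (z' := segt c z s) in *.
      rewrite (I01_FTC (fun t => / (circ c r t - z'))).
      * rewrite circ_closed. ring.
      * intros t _. rewrite Cmult_comm.
        apply (rdiff_comp (fun w => / (w - z')) (circ c r)); [|apply rdiff_circ].
        assert (circ c r t - z' <> 0) by (apply circ_neq; assumption).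
        cd; [assumption|]. field. assumption.
      * apply cont01_mult; [apply cont01_dcirc|]. apply cont01_opp, cont01_inv.
        -- apply cont01_mult; (apply cont01_minus; [apply cont01_circ|apply cont01_const]).
        -- intros t _. apply Cmult_neq_0; apply circ_neq; assumption.
Qed.

(** Cauchy's integral formula, by shrinking the circle to the point [z]: the
    derivative of the integral in the scaling factor is the integral of a derivative. *)
Lemma cauchy_formula_C1 (F f : C -> C) c z (r r' : R) :
  0 < r < r' -> (forall w, disc c r' w -> cdiff F w (f w) /\ ccont f w) ->
  Cmod (z - c) < r ->
  I01 (fun t => F (circ c r t) * dcirc r t * / (circ c r t - z)) = F z * (2 * PI * Ci).
Proof.
  intros Hr HF Hz.
  set (psi := fun t => dcirc r t * / (circ c r t - z)).
  set (phi := fun lam => I01 (fun t => psi t * F (z + (circ c r t - z) * lam))).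
  assert (Hne : forall t, circ c r t - z <> 0) by (intros t; apply circ_neq; lra).
  assert (Hcz : cont01 (fun t => circ c r t - z)) by (apply cont01_minus; [apply cont01_circ|apply cont01_const]).
  assert (Hpsi : cont01 psi).
  { apply cont01_mult; [apply cont01_dcirc|]. apply cont01_inv; [exact Hcz|intros t _; apply Hne]. }
  assert (Hin : forall s t, 0 <= s <= 1 -> disc c r' (z + (circ c r t - z) * RtoC s)).
  { intros s t Hs. unfold disc. replace (z + (circ c r t - z) * RtoC s) with (segt z (circ c r t) s) by (unfold segt; ring).
    apply Rle_lt_trans with r; [|lra]. apply segt_ball; [lra|rewrite circ_dist; lra|exact Hs]. }
  assert (Hconst : phi 1 = phi 0).
  { apply segment_constant. intros s Hs.
    replace (segt 0 1 s) with (RtoC s) by (unfold segt; ring).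
    eapply cdiff_val.
    - apply (I01_cdiff_affine (disc c r') F f psi (fun _ => z) (fun t => circ c r t - z)).
      + apply copen_disc.
      + exact HF.
      + exact Hpsi.
      + apply cont01_const.
      + exact Hcz.
      + intros t _. apply Hin, Hs.
    - rewrite (I01_ext _ (fun t => f (z + (circ c r t - z) * RtoC s) * dcirc r t)).
      2:{ intros t _. unfold psi. field. apply Hne. }
      destruct (Req_dec s 0) as [->|Hs0].
      + rewrite (I01_ext _ (fun t => f z * dcirc r t)).
        2:{ intros t _. f_equal. f_equal. ring. }
        rewrite I01_scal by apply cont01_dcirc.
        rewrite (I01_FTC (circ c r)); [|intros t _; apply rdiff_circ|apply cont01_dcirc].
        rewrite circ_closed. ring.
      + assert (Hs' : RtoC s <> 0) by (apply RtoC_neq_0, Hs0).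
        rewrite (I01_FTC (fun t => F (z + (circ c r t - z) * RtoC s) / RtoC s)).
        * rewrite circ_closed. ring.
        * intros t _.
          apply (rdiff_comp (fun w => F (z + (w - z) * RtoC s) / RtoC s) (circ c r)); [|apply rdiff_circ].
          eapply cdiff_val.
          -- apply cdiff_div; [|apply cdiff_const|exact Hs'].
             apply (cdiff_comp F (fun w => z + (w - z) * RtoC s)).
             ++ apply HF. apply Hin, Hs.
             ++ repeat cd_step.
          -- cbv beta. field. exact Hs'.
        * apply cont01_mult; [|apply cont01_dcirc]. intros t Ht.
          apply (rcont_comp f (fun t => z + (circ c r t - z) * RtoC s)).
          -- apply HF. apply Hin, Hs.
          -- apply rcont_plus; [apply rcont_const|]. apply rcont_mult; [apply Hcz, Ht|apply rcont_const]. }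
  transitivity (phi 1).
  - unfold phi. apply I01_ext. intros t _. unfold psi.
    replace (z + (circ c r t - z) * 1) with (circ c r t) by ring. ring.
  - rewrite Hconst. unfold phi.
    rewrite (I01_ext _ (fun t => F z * psi t)).
    2:{ intros t _. replace (z + (circ c r t - z) * 0) with z by ring. ring. }
    rewrite I01_scal by exact Hpsi. unfold psi. rewrite winding_number by lra. reflexivity.
Qed.

Lemma cont01_on_circ f c (r r' : R) : 0 < r < r' ->
  (forall w, disc c r' w -> ccont f w) -> cont01 (fun t => f (circ c r t)).
Proof.
  intros Hr Hf t Ht. apply rcont_comp; [|apply cont01_circ, Ht].
  apply Hf. unfold disc. rewrite circ_dist; lra.
Qed.

(** The primitive [F] of [f] is continuously differentiable, so Cauchy's formula
    applies to it and shows that its second derivative is again differentiable. *)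
Lemma holo_disc_derive f c (r : R) :
  0 < r -> holo (disc c r) f ->
  exists f' : C -> C, forall z, Cmod (z - c) < r / 2 -> cdiff f z (f' z) /\ exists l, cdiff f' z l.
Proof.
  intros Hr Hf. set (F := segint f c).
  assert (HF : forall w, disc c r w -> cdiff F w (f w) /\ ccont f w).
  { intros w Hw. split; [apply holo_disc_primitive with r; assumption|].
    destruct (Hf w Hw) as [l Hl]. exact (cdiff_ccont _ _ _ Hl). }
  set (k := / (2 * PI * Ci)).
  set (psi := fun t => F (circ c (r / 2) t) * dcirc (r / 2) t).
  assert (Hpsi : cont01 psi).
  { apply cont01_mult; [|apply cont01_dcirc]. apply (cont01_on_circ F c (r / 2) r); [lra|].
    intros w Hw. exact (cdiff_ccont _ _ _ (proj1 (HF w Hw))). }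
  set (K1 := fun z => I01 (fun t => psi t * / (circ c (r / 2) t - z))).
  set (K2 := fun z => I01 (fun t => psi t * - / ((circ c (r / 2) t - z) * (circ c (r / 2) t - z)))).
  set (g3 := fun w : C => 2 / (w * w * w)).
  set (K3 := fun z => I01 (fun t => psi t * g3 (circ c (r / 2) t - z))).
  assert (D1 : forall z, Cmod (z - c) < r / 2 -> cdiff K1 z (- K2 z)).
  { intros z Hz. apply (cauchy_kernel psi c (r / 2) (fun w => / w) (fun w => - / (w * w))); [lra|exact Hpsi|exact Hz|apply ker1]. }
  assert (Hg3 : forall w : C, w <> 0 -> cdiff (fun w => - / (w * w)) w (g3 w) /\ ccont g3 w).
  { intros w Hw. split.
    - unfold g3. cd; [apply Cmult_neq_0; exact Hw|]. field. exact Hw.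
    - unfold g3. eapply cdiff_ccont. repeat cd_step. repeat apply Cmult_neq_0; exact Hw. }
  assert (D2 : forall z, Cmod (z - c) < r / 2 -> cdiff K2 z (- K3 z)).
  { intros z Hz. apply (cauchy_kernel psi c (r / 2) (fun w => - / (w * w)) g3); [lra|exact Hpsi|exact Hz|exact Hg3]. }
  assert (D3 : forall z, Cmod (z - c) < r / 2 -> exists l, cdiff K3 z l).
  { intros z Hz. eexists.
    apply (cauchy_kernel psi c (r / 2) g3 (fun w => - (6 / (w * w * w * w)))); [lra|exact Hpsi|exact Hz|].
    intros w Hw. split.
    - unfold g3. cd; [repeat apply Cmult_neq_0; exact Hw|]. field. exact Hw.
    - eapply cdiff_ccont. repeat cd_step. repeat apply Cmult_neq_0; exact Hw. }
  assert (EF : forall z, Cmod (z - c) < r / 2 -> K1 z * k = F z).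
  { intros z Hz. unfold K1, psi.
    rewrite (cauchy_formula_C1 F f c z (r / 2) r); [|lra|exact HF|exact Hz].
    unfold k. field. split; [apply Ci_nz|]. apply RtoC_neq_0. generalize PI_RGT_0; lra. }
  assert (Hnear : forall z, Cmod (z - c) < r / 2 -> exists d, 0 < d /\
     forall z', Cmod (z' - z) < d -> Cmod (z' - c) < r / 2).
  { intros z Hz. exact (copen_disc c (r / 2) z Hz). }
  assert (Ef : forall z, Cmod (z - c) < r / 2 -> - K2 z * k = f z).
  { intros z Hz. apply (cdiff_unique F z).
    - destruct (Hnear z Hz) as [d [Hd H]].
      apply (cdiff_loc (fun z => K1 z * k) F z _ d Hd).
      + intros z' Hz'. apply EF, H, Hz'.
      + eapply cdiff_val; [apply cdiff_mult; [apply D1, Hz|apply cdiff_const]|]. cbv beta. ring.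
    - apply HF. unfold disc. lra. }
  exists (fun z => K3 z * k). intros z Hz. split.
  - destruct (Hnear z Hz) as [d [Hd H]].
    apply (cdiff_loc (fun z => - K2 z * k) f z _ d Hd).
    + intros z' Hz'. apply Ef, H, Hz'.
    + eapply cdiff_val; [apply cdiff_mult; [apply cdiff_opp, D2, Hz|apply cdiff_const]|]. cbv beta. ring.
  - destruct (D3 z Hz) as [l Hl]. eexists. eapply cdiff_mult; [exact Hl|apply cdiff_const].
Qed.

Lemma cdiff_C_derive f (z l : C) : cdiff f z l -> cdiff f z (C_derive f z).
Proof.
  intros H. replace (C_derive f z) with l; [exact H|].
  symmetry. apply is_C_derive_unique. exact H.
Qed.

Lemma C_derive_eq f (z l : C) : cdiff f z l -> C_derive f z = l.
Proof. intros H. apply is_C_derive_unique. exact H. Qed.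

Theorem holo_derive (U : C -> Prop) f : copen U -> holo U f ->
  (forall z, U z -> cdiff f z (C_derive f z)) /\ holo U (C_derive f).
Proof.
  intros HU Hf. split.
  - intros z Hz. destruct (Hf z Hz) as [l Hl]. exact (cdiff_C_derive f z l Hl).
  - intros z Hz. destruct (HU z Hz) as [d [Hd H]].
    destruct (holo_disc_derive f z d Hd) as [f' Hf'].
    { intros w Hw. apply Hf, H, Hw. }
    destruct (Hf' z) as [_ [l Hl]]; [rewrite Cmod_self; lra|].
    exists l. apply (cdiff_loc f' (C_derive f) z l (d / 2)); [lra| |exact Hl].
    intros z' Hz'. symmetry. apply C_derive_eq. apply Hf', Hz'.
Qed.

Lemma holo_ccont (U : C -> Prop) f z : holo U f -> U z -> ccont f z.
Proof. intros Hf Hz. destruct (Hf z Hz) as [l Hl]. exact (cdiff_ccont _ _ _ Hl). Qed.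

Lemma cdiff_at (U : C -> Prop) f z :
  copen U -> holo U f -> U z -> cdiff f z (C_derive f z).
Proof. intros HU Hf Hz. exact (proj1 (holo_derive U f HU Hf) z Hz). Qed.

Lemma cauchy_formula f c z (r r' : R) :
  0 < r < r' -> holo (disc c r') f -> Cmod (z - c) < r ->
  I01 (fun t => f (circ c r t) * dcirc r t * / (circ c r t - z)) = f z * (2 * PI * Ci).
Proof.
  intros Hr Hf Hz. apply cauchy_formula_C1 with (f := C_derive f) (r' := r'); [exact Hr| |exact Hz].
  destruct (holo_derive _ f (copen_disc c r') Hf) as [H1 H2].
  intros w Hw. split; [apply H1, Hw|apply (holo_ccont _ _ _ H2 Hw)].
Qed.

Lemma cauchy_derive f c (r r' : R) :
  0 < r < r' -> holo (disc c r') f ->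
  C_derive f c = I01 (fun t => f (circ c r t) * / (circ c r t - c)).
Proof.
  intros Hr Hf.
  assert (Hcf : cont01 (fun t => f (circ c r t))).
  { apply (cont01_on_circ f c r r' Hr). intros w Hw. apply (holo_ccont _ _ _ Hf Hw). }
  set (psi := fun t => f (circ c r t) * dcirc r t).
  assert (Hpsi : cont01 psi) by (apply cont01_mult; [exact Hcf|apply cont01_dcirc]).
  assert (Hc0 : Cmod (c - c) < r) by (rewrite Cmod_self; lra).
  assert (Hne : forall t, circ c r t - c <> 0) by (intros t; apply circ_neq; [lra|exact Hc0]).
  assert (HD := cauchy_kernel psi c r (fun w => / w) (fun w => - / (w * w)) c ltac:(lra) Hpsi Hc0 ker1).
  assert (HD2 : cdiff (fun z => f z * (2 * PI * Ci)) c (C_derive f c * (2 * PI * Ci))).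
  { eapply cdiff_val.
    - apply cdiff_mult; [|apply cdiff_const].
      apply (cdiff_at (disc c r')); [apply copen_disc|exact Hf|apply disc_center; lra].
    - cbv beta. ring. }
  assert (E : C_derive f c * (2 * PI * Ci) = - I01 (fun t => psi t * - / ((circ c r t - c) * (circ c r t - c)))).
  { apply (cdiff_unique (fun z => f z * (2 * PI * Ci)) c); [exact HD2|].
    eapply (cdiff_loc _ _ c _ r); [lra| |exact HD].
    intros z Hz. apply cauchy_formula with r'; assumption. }
  assert (E2 : - I01 (fun t => psi t * - / ((circ c r t - c) * (circ c r t - c))) =
    (2 * PI * Ci) * I01 (fun t => f (circ c r t) * / (circ c r t - c))).
  { rewrite <- I01_scal, <- I01_opp.
    - apply I01_ext. intros t _. unfold psi. rewrite (dcirc_circ c). field. apply Hne.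
    - apply cont01_mult; [exact Hpsi|]. apply cont01_opp, cont01_inv.
      + apply cont01_mult; (apply cont01_minus; [apply cont01_circ|apply cont01_const]).
      + intros t _. apply Cmult_neq_0; apply Hne.
    - apply cont01_mult; [exact Hcf|]. apply cont01_inv.
      + apply cont01_minus; [apply cont01_circ|apply cont01_const].
      + intros t _. apply Hne. }
  rewrite E2, Cmult_comm in E.
  assert (K := two_pi_i_neq_0).
  replace (C_derive f c) with (/ (2 * PI * Ci) * (2 * PI * Ci * C_derive f c)).
  - rewrite E. field. repeat split; try apply Ci_nz; apply RtoC_neq_0; generalize PI_RGT_0; lra.
  - field. repeat split; try apply Ci_nz; apply RtoC_neq_0; generalize PI_RGT_0; lra.
Qed.

Lemma cauchy_estimate f c (r r' M : R) :
  0 < r < r' -> holo (disc c r') f ->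
  (forall z, Cmod (z - c) = r -> Cmod (f z) <= M) ->
  Cmod (C_derive f c) <= M / r.
Proof.
  intros Hr Hf HM. rewrite (cauchy_derive f c r r' Hr Hf).
  assert (Hne : forall t, circ c r t - c <> 0) by (intros t; apply circ_neq; [lra|rewrite Cmod_self; lra]).
  apply I01_bound.
  - apply cont01_mult.
    + apply (cont01_on_circ f c r r' Hr). intros w Hw. apply (holo_ccont _ _ _ Hf Hw).
    + apply cont01_inv; [apply cont01_minus; [apply cont01_circ|apply cont01_const]|intros t _; apply Hne].
  - intros t _. rewrite Cmod_mult, Cmod_inv by apply Hne. rewrite circ_dist by lra.
    apply Rmult_le_compat_r; [left; apply Rinv_0_lt_compat; lra|]. apply HM, circ_dist. lra.
Qed.

(** Cauchy's estimate on large circles kills the derivative. *)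
Theorem liouville f (M : R) :
  holo (fun _ => True) f -> (forall z, Cmod (f z) <= M) -> forall z w, f z = f w.
Proof.
  intros Hf HM z w.
  assert (HT : copen (fun _ => True)) by (intros v _; exists 1%R; split; [lra|auto]).
  apply segment_constant. intros t _. set (v := segt w z t).
  replace (RtoC 0) with (C_derive f v); [apply (cdiff_at (fun _ => True)); auto|].
  apply Cmod_eq_0. apply Rle_antisym; [|apply Cmod_ge_0].
  apply Rnot_lt_le. intros Hlt.
  assert (M0 : 0 <= M) by (generalize (Cmod_ge_0 (f z)), (HM z); lra).
  set (r := ((M + 1) / Cmod (C_derive f v))%R).
  assert (Hr : 0 < r) by (apply Rdiv_lt_0_compat; lra).
  assert (H := cauchy_estimate f v r (r + 1) M ltac:(lra)).
  assert (H' : Cmod (C_derive f v) <= M / r).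
  { apply H; [intros u _; apply Hf; exact I|intros u _; apply HM]. }
  apply (Rmult_le_compat_r r) in H'; [|lra].
  unfold Rdiv at 1 in H'. rewrite Rmult_assoc, Rinv_l, Rmult_1_r in H' by lra.
  unfold r in H'. replace (Cmod (C_derive f v) * ((M + 1) / Cmod (C_derive f v)))%R with (M + 1)%R in H' by (field; lra).
  lra.
Qed.

(** * Uniform limits, primitives and removable singularities *)

Definition uconv (D : C -> Prop) (fn : nat -> C -> C) f : Prop :=
  forall e : R, 0 < e -> exists N : nat, forall n : nat, (N <= n)%nat ->
    forall z, D z -> Cmod (fn n z - f z) <= e.

Lemma uconv_of_cauchy (D : C -> Prop) (fn : nat -> C -> C) f :
  (forall e : R, 0 < e -> exists N : nat, forall n m : nat, (N <= n)%nat -> (N <= m)%nat ->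
    forall z, D z -> Cmod (fn n z - fn m z) <= e) ->
  (forall z, D z -> clim (fun n => fn n z) (f z)) -> uconv D fn f.
Proof.
  intros Hc Hl e He. destruct (Hc e He) as [N HN]. exists N. intros n Hn z Hz.
  rewrite Cmod_sym. apply (clim_bound (fun n => fn n z) (f z) (fn n z) e N (Hl z Hz)).
  intros m Hm. apply HN; assumption.
Qed.

Lemma holo_minus (U : C -> Prop) f g : holo U f -> holo U g -> holo U (fun z => f z - g z).
Proof.
  intros Hf Hg z Hz. destruct (Hf z Hz) as [l Hl]. destruct (Hg z Hz) as [m Hm].
  eexists. eapply cdiff_minus; eassumption.
Qed.

Lemma holo_sub (U V : C -> Prop) f : (forall z, V z -> U z) -> holo U f -> holo V f.
Proof. intros H Hf z Hz. apply Hf, H, Hz. Qed.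

(** Integrals over triangles pass to the limit, so [f] has a primitive and is
    holomorphic; the derivatives converge by Cauchy's estimate for [fn n - f]. *)
Theorem weierstrass (fn : nat -> C -> C) f c (r : R) :
  0 < r -> (forall n, holo (disc c r) (fn n)) -> uconv (disc c r) fn f ->
  holo (disc c r) f /\ uconv (disc c (r / 2)) (fun n => C_derive (fn n)) (C_derive f).
Proof.
  intros Hr Hfn Hu.
  assert (Hcont : forall w, disc c r w -> ccont f w).
  { intros w Hw e He. destruct (Hu (e / 4)%R) as [N HN]; [lra|].
    destruct (holo_ccont _ _ _ (Hfn N) Hw (e / 4)%R) as [d [Hd H]]; [lra|].
    destruct (copen_disc c r w Hw) as [d2 [Hd2 H2]].
    exists (Rmin d d2). split; [apply Rmin_pos; assumption|]. intros w' Hw'.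
    specialize (H w' ltac:(apply (Rmin_Rgt_l _ _ _ Hw'))).
    specialize (H2 w' ltac:(apply (Rmin_Rgt_l _ _ _ Hw'))).
    assert (A := HN N (le_n N) w Hw). assert (B := HN N (le_n N) w' H2).
    rewrite Cmod_sym in B.
    generalize (Cmod_tri_minus (f w') (fn N w') (f w)), (Cmod_tri_minus (fn N w') (fn N w) (f w)). lra. }
  assert (Hf : holo (disc c r) f).
  { assert (HP : forall z, disc c r z -> cdiff (segint f c) z (f z)).
    { apply triangle_primitive; [exact Hcont|]. intros z z' Hz Hz'. unfold disc in Hz, Hz'.
      set (r0 := Rmax (Cmod (z - c)) (Cmod (z' - c))). assert (Hr0 : r0 < r) by (apply Rmax_lub_lt; assumption).
      assert (A1 : Cmod (z - c) <= r0) by apply Rmax_l. assert (A2 : Cmod (z' - c) <= r0) by apply Rmax_r.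
      assert (A0 : Cmod (c - c) <= r0) by (rewrite Cmod_self; generalize (Cmod_ge_0 (z - c)); lra).
      set (S := (Cmod (z - c) + Cmod (z' - z) + Cmod (c - z'))%R).
      assert (HS : 0 <= S) by (unfold S; generalize (Cmod_ge_0 (z - c)), (Cmod_ge_0 (z' - z)), (Cmod_ge_0 (c - z')); lra).
      apply Cmod_eq_0. apply Rle_antisym; [|apply Cmod_ge_0]. apply Rnot_lt_le. intros HX.
      set (X := Cmod (triint f c z z')) in *. destruct (Hu (X / (2 * (S + 1)))%R) as [N HN]; [apply Rdiv_lt_0_compat; lra|].
      set (e := (X / (2 * (S + 1)))%R) in *. assert (Ee : (e * (2 * (S + 1)) = X)%R) by (unfold e; field; lra).
      set (g := fun w => fn N w - f w).
      assert (Hg : forall x y, Cmod (x - c) <= r0 -> Cmod (y - c) <= r0 ->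
        segint f x y = segint (fn N) x y - segint g x y /\ Cmod (segint g x y) <= e * Cmod (y - x)).
      { intros x y Hx Hy. assert (Hsf : contseg f x y).
        { apply (contball_seg f c x y r0); [|exact Hx|exact Hy]. intros w Hw. apply Hcont. unfold disc. lra. }
        assert (Hsg : contseg g x y).
        { apply (contball_seg g c x y r0); [|exact Hx|exact Hy]. intros w Hw. assert (Hd : disc c r w) by (unfold disc; lra).
          apply (ccont_minus (fn N) f); [apply (holo_ccont _ _ _ (Hfn N) Hd)|apply Hcont, Hd]. }
        split.
        - replace (segint (fn N) x y) with (segint (fun w => f w + g w) x y).
          2:{ unfold segint. f_equal. apply I01_ext. intros t _. unfold g. ring. }
          rewrite segint_plus by assumption. ring.
        - rewrite Rmult_comm. apply segint_bound; [exact Hsg|]. intros t Ht. apply (HN N (le_n N)). unfold disc.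
          eapply Rle_lt_trans; [apply (segt_ball c x y r0 t); assumption|exact Hr0]. }
      destruct (Hg c z A0 A1) as [E1 B1]. destruct (Hg z z' A1 A2) as [E2 B2]. destruct (Hg z' c A2 A0) as [E3 B3].
      assert (T := disc_triangle (fn N) c z z' r (Hfn N) Hz Hz').
      assert (E : triint f c z z' = - (segint g c z + segint g z z' + segint g z' c)).
      { transitivity (triint (fn N) c z z' - (segint g c z + segint g z z' + segint g z' c)); [|rewrite T; ring].
        unfold triint. rewrite E1, E2, E3. ring. }
      apply (f_equal Cmod) in E. fold X in E. rewrite Cmod_opp in E.
      generalize (Cmod_triangle (segint g c z + segint g z z') (segint g z' c)), (Cmod_triangle (segint g c z) (segint g z z')).
      unfold S in *. nra. }
    assert (HF : holo (disc c r) (segint f c)) by (intros z Hz; eexists; apply HP, Hz).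
    intros z Hz. destruct (proj2 (holo_derive _ _ (copen_disc c r) HF) z Hz) as [l Hl]. exists l.
    destruct (copen_disc c r z Hz) as [d [Hd H]]. apply (cdiff_loc (C_derive (segint f c)) f z l d Hd); [|exact Hl].
    intros w Hw. apply C_derive_eq, HP, H, Hw. }
  split; [exact Hf|].
  intros e He. destruct (Hu (e * (r / 4))%R) as [N HN].
  { apply Rmult_lt_0_compat; lra. }
  exists N. intros n Hn z Hz. unfold disc in Hz.
  assert (Hin : forall w, disc z (r / 2) w -> disc c r w).
  { intros w Hw. unfold disc in *. generalize (Cmod_tri_minus w z c). lra. }
  assert (Hsub : holo (disc z (r / 2)) (fun w => fn n w - f w)).
  { apply holo_minus; apply (holo_sub (disc c r)); auto. }
  assert (Hz0 : disc c r z) by (unfold disc; lra).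
  replace (C_derive (fn n) z - C_derive f z) with (C_derive (fun w => fn n w - f w) z).
  - replace e with (e * (r / 4) / (r / 4))%R by (field; lra).
    apply (cauchy_estimate _ z (r / 4) (r / 2)); [lra|exact Hsub|].
    intros w Hw. apply HN; [exact Hn|]. apply Hin. unfold disc. lra.
  - apply C_derive_eq. apply cdiff_minus; (apply (cdiff_at (disc c r)); [apply copen_disc|auto|exact Hz0]).
Qed.

Definition star (U : C -> Prop) z0 : Prop :=
  forall z t, U z -> 0 <= t <= 1 -> U (segt z0 z t).

Lemma star_disc c (r : R) : star (disc c r) c.
Proof.
  intros z t Hz Ht. unfold disc in *. apply Rle_lt_trans with (Cmod (z - c)); [|exact Hz].
  apply segt_ball; [rewrite Cmod_self; apply Cmod_ge_0|lra|exact Ht].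
Qed.

Lemma cont01_t : cont01 RtoC.
Proof. intros t _. apply rcont_RtoC. Qed.

Lemma I01_segt_cdiff (U : C -> Prop) z0 z f :
  copen U -> star U z0 -> holo U f -> U z ->
  cdiff (fun z => I01 (fun t => f (segt z0 z t))) z (I01 (fun t => C_derive f (segt z0 z t) * RtoC t)).
Proof.
  intros HU Hs Hf Hz. destruct (holo_derive U f HU Hf) as [H1 H2].
  assert (E : forall z t, z0 * (1 - RtoC t) + RtoC t * z = segt z0 z t) by (intros; unfold segt; ring).
  eapply cdiff_ext; [|eapply cdiff_val].
  2:{ apply (I01_cdiff_affine U f (C_derive f) (fun _ => 1) (fun t => z0 * (1 - RtoC t)) RtoC z HU).
      - intros w Hw. split; [apply H1, Hw|apply (holo_ccont _ _ _ H2 Hw)].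
      - apply cont01_const.
      - apply cont01_mult; [apply cont01_const|]. apply cont01_minus; [apply cont01_const|apply cont01_t].
      - apply cont01_t.
      - intros t Ht. rewrite E. apply Hs; assumption. }
  - intros z'. cbv beta. apply I01_ext. intros t _. rewrite E. ring.
  - apply I01_ext. intros t _. rewrite E. ring.
Qed.

Lemma contseg_star (U : C -> Prop) z0 z f :
  star U z0 -> (forall w, U w -> ccont f w) -> U z -> contseg f z0 z.
Proof. intros Hs Hf Hz t Ht. apply Hf, Hs; assumption. Qed.

(** [t f(z0 + t (z - z0))] is a primitive, in [t], of the derivative of the
    integrand in [z]. *)
Theorem star_primitive (U : C -> Prop) z0 z f :
  copen U -> star U z0 -> holo U f -> U z -> cdiff (segint f z0) z (f z).
Proof.
  intros HU Hs Hf Hz. destruct (holo_derive U f HU Hf) as [H1 H2].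
  eapply cdiff_val.
  - apply cdiff_mult.
    + apply cdiff_minus; [apply cdiff_id|apply cdiff_const].
    + apply (I01_segt_cdiff U); assumption.
  - cbv beta.
    assert (Hcf : contseg f z0 z) by (apply (contseg_star U); auto; intros w Hw; apply (holo_ccont _ _ _ Hf Hw)).
    assert (Hcd : contseg (C_derive f) z0 z) by (apply (contseg_star U); auto; intros w Hw; apply (holo_ccont _ _ _ H2 Hw)).
    destruct (classic (z = z0)) as [->|Hne].
    + rewrite (I01_ext _ (fun _ => f z0)); [rewrite I01_const; ring|].
      intros t _. f_equal. unfold segt. ring.
    + assert (Hd : z - z0 <> 0) by (intros E; apply Hne; apply Ceq_minus; exact E).
      rewrite <- (I01_scal (z - z0)).
      2:{ apply cont01_mult; [apply cont01_seg, Hcd|apply cont01_t]. }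
      replace ((1 - 0) * I01 (fun t => f (segt z0 z t))) with (I01 (fun t => f (segt z0 z t))) by ring.
      rewrite <- I01_plus.
      2:{ apply cont01_seg, Hcf. }
      2:{ apply cont01_mult; [apply cont01_const|]. apply cont01_mult; [apply cont01_seg, Hcd|apply cont01_t]. }
      rewrite (I01_FTC (fun t => (segt z0 z t - z0) / (z - z0) * f (segt z0 z t))).
      * rewrite segt_1, segt_0. field. exact Hd.
      * intros t Ht.
        replace (f (segt z0 z t) + (z - z0) * (C_derive f (segt z0 z t) * RtoC t)) with
          ((f (segt z0 z t) / (z - z0) + RtoC t * C_derive f (segt z0 z t)) * (z - z0)) by (field; exact Hd).
        apply (rdiff_comp (fun w => (w - z0) / (z - z0) * f w) (segt z0 z)); [|apply rdiff_line].
        eapply cdiff_val.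
        -- apply cdiff_mult; [repeat cd_step; exact Hd|]. apply H1. apply Hs; assumption.
        -- cbv beta. unfold segt. field. exact Hd.
      * apply cont01_plus; [apply cont01_seg, Hcf|].
        apply cont01_mult; [apply cont01_const|]. apply cont01_mult; [apply cont01_seg, Hcd|apply cont01_t].
Qed.

Theorem holo_division (U : C -> Prop) p g :
  copen U -> star U p -> U p -> holo U g ->
  exists k : C -> C, holo U k /\ k p = C_derive g p /\ forall z, U z -> g z = g p + (z - p) * k z.
Proof.
  intros HU Hs Hp Hg. destruct (holo_derive U g HU Hg) as [H1 H2].
  exists (fun z => I01 (fun t => C_derive g (segt p z t))). repeat split.
  - intros z Hz. eexists. apply (I01_segt_cdiff U); assumption.
  - rewrite (I01_ext _ (fun _ => C_derive g p)); [apply I01_const|].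
    intros t _. f_equal. unfold segt. ring.
  - intros z Hz. change (g z = g p + segint (C_derive g) p z).
    rewrite (segint_FTC g (C_derive g)).
    + ring.
    + intros t Ht. apply H1, Hs; assumption.
    + apply (contseg_star U); auto. intros w Hw. apply (holo_ccont _ _ _ H2 Hw).
Qed.

(** A limit that ignores the value at [p], where the total functions below
    have arbitrary values. *)
Definition tends f (p l : C) : Prop :=
  forall e : R, 0 < e -> exists d : R, 0 < d /\
    forall z : C, z <> p -> Cmod (z - p) < d -> Cmod (f z - l) < e.

Definition punctured p (r : R) z : Prop := z <> p /\ Cmod (z - p) < r.

(** Riemann's theorem: [(z-p)^2 h] is differentiable at [p] too, and can be divided
    by [z-p] twice. *)
Theorem removable h p (r : R) :
  0 < r -> holo (punctured p r) h -> tends (fun z => (z - p) * h z) p 0 ->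
  exists k : C -> C, holo (disc p r) k /\ forall z, punctured p r z -> h z = k z.
Proof.
  intros Hr Hh Hl.
  set (G := fun z => if excluded_middle_informative (z = p) then RtoC 0 else (z - p) * (z - p) * h z).
  assert (Gne : forall z, z <> p -> G z = (z - p) * (z - p) * h z).
  { intros z Hz. unfold G. destruct (excluded_middle_informative (z = p)); [contradiction|reflexivity]. }
  assert (Gp : G p = 0).
  { unfold G. destruct (excluded_middle_informative (p = p)); [reflexivity|contradiction]. }
  assert (DGp : cdiff G p 0).
  { apply cdiff_eps. intros e He. destruct (Hl e He) as [d [Hd H]].
    exists d. split; [exact Hd|]. intros z Hz.
    destruct (classic (z = p)) as [->|Hne].
    - rewrite Gp, Cmod_self. replace (0 - 0 - 0 * (p - p)) with (0:C) by ring. rewrite Cmod_0. lra.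
    - rewrite Gp, Gne by exact Hne. specialize (H z Hne Hz).
      replace ((z - p) * (z - p) * h z - 0 - 0 * (z - p)) with (((z - p) * h z - 0) * (z - p)) by ring.
      rewrite Cmod_mult. apply Rmult_le_compat_r; [apply Cmod_ge_0|lra]. }
  assert (HG : holo (disc p r) G).
  { intros z Hz. destruct (classic (z = p)) as [->|Hne]; [exists 0; exact DGp|].
    destruct (Hh z (conj Hne Hz)) as [l Hlz].
    eexists. apply (cdiff_loc (fun z => (z - p) * (z - p) * h z) G z _ (Cmod (z - p))).
    - apply Cmod_gt_0. intros E. apply Hne, Ceq_minus, E.
    - intros z' Hz'. symmetry. apply Gne. intros ->. rewrite Cmod_sym in Hz'. lra.
    - repeat cd_step. }
  destruct (holo_division (disc p r) p G (copen_disc p r) (star_disc p r) (disc_center p r Hr) HG)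
    as [k1 [Hk1 [K1p E1]]].
  destruct (holo_division (disc p r) p k1 (copen_disc p r) (star_disc p r) (disc_center p r Hr) Hk1)
    as [k2 [Hk2 [_ E2]]].
  exists k2. split; [exact Hk2|]. intros z [Hne Hz].
  specialize (E1 z Hz). specialize (E2 z Hz).
  rewrite K1p, (C_derive_eq G p 0 DGp) in E2. rewrite Gp, Gne in E1 by exact Hne. rewrite E2 in E1.
  assert (Hd : z - p <> 0) by (intros E; apply Hne, Ceq_minus, E).
  assert (E3 : (z - p) * (z - p) * (h z - k2 z) = 0) by (rewrite Cmult_comm; replace ((h z - k2 z) * ((z - p) * (z - p))) with ((z - p) * (z - p) * h z - (z - p) * ((z - p) * k2 z)) by ring; rewrite E1; ring).
  apply Ceq_minus. apply NNPP. intros Hn.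
  apply (Cmult_neq_0 _ _ (Cmult_neq_0 _ _ Hd Hd) Hn), E3.
Qed.

Lemma csum_O (f : nat -> C) : csum f 0 = f 0%nat.
Proof. exact (sum_O (G := C_AbelianMonoid) f). Qed.

Lemma csum_S (f : nat -> C) (n : nat) : csum f (S n) = csum f n + f (S n).
Proof. exact (sum_Sn (G := C_AbelianMonoid) f n). Qed.

Lemma csum_ext (f g : nat -> C) (n : nat) :
  (forall k, (k <= n)%nat -> f k = g k) -> csum f n = csum g n.
Proof. intros H. exact (sum_n_ext_loc (G := C_AbelianMonoid) f g n H). Qed.

Lemma m_test (D : C -> Prop) (u : nat -> C -> C) (M : nat -> R) :
  ex_series M -> (forall n z, D z -> Cmod (u n z) <= M n) ->
  forall e : R, 0 < e -> exists N : nat, forall n m : nat, (N <= n)%nat -> (N <= m)%nat ->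
    forall z, D z -> Cmod (csum (fun k => u k z) n - csum (fun k => u k z) m) <= e.
Proof.
  intros [l Hl] HM e He.
  assert (Hd : forall z n k, D z ->
    Cmod (csum (fun k => u k z) (n + k) - csum (fun k => u k z) n) <= sum_n M (n + k) - sum_n M n).
  { intros z n k Hz. induction k as [|k IH].
    - rewrite Nat.add_0_r, Cmod_self. lra.
    - rewrite Nat.add_succ_r, csum_S, sum_Sn. unfold plus; simpl.
      replace (csum (fun k => u k z) (n + k) + u (S (n + k)) z - csum (fun k => u k z) n) with
        (csum (fun k => u k z) (n + k) - csum (fun k => u k z) n + u (S (n + k)) z) by ring.
      tri. specialize (HM (S (n + k)) z Hz). lra. }
  assert (He2 : 0 < e / 4) by lra.
  destruct (proj1 (filterlim_locally (F := eventually) (sum_n M) l) Hl (mkposreal _ He2)) as [N HN].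
  assert (HN' : forall n, (N <= n)%nat -> Rabs (sum_n M n - l) < e / 4).
  { intros n Hn. exact (HN n Hn). }
  exists N. intros n m Hn Hm z Hz.
  assert (A : forall n, (N <= n)%nat -> Cmod (csum (fun k => u k z) n - csum (fun k => u k z) N) <= e / 2).
  { intros i Hi. replace i with (N + (i - N))%nat by lia.
    eapply Rle_trans; [apply Hd, Hz|]. replace (N + (i - N))%nat with i by lia.
    generalize (HN' i Hi), (HN' N (le_n N)). intros B1 B2.
    apply Rabs_def2 in B1. apply Rabs_def2 in B2. lra. }
  eapply Rle_trans; [apply (Cmod_tri_minus _ (csum (fun k => u k z) N))|].
  rewrite (Cmod_sym (csum (fun k => u k z) N)).
  generalize (A n Hn), (A m Hm). lra.
Qed.

Lemma I01_bound_pow (f : R -> C) (A : R) (m : nat) : cont01 f ->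
  (forall t : R, 0 <= t <= 1 -> Cmod (f t) <= A * t ^ m) ->
  Cmod (I01 f) <= A / INR (S m).
Proof.
  intros Hf HA. rewrite Cmod_norm.
  assert (Hm : INR (S m) <> 0%R) by (apply not_0_INR; lia).
  apply (norm_RInt_le (V := VN) f (fun t => A * t ^ m)%R 0 1); [lra| |apply I01_correct, Hf|].
  - intros t Ht. rewrite <- Cmod_norm. apply HA, Ht.
  - replace (A / INR (S m))%R with (minus (G := R_AbelianGroup) (A * 1 ^ S m / INR (S m)) (A * 0 ^ S m / INR (S m)))%R.
    + apply (is_RInt_derive (V := R_CompleteNormedModule) (fun t => A * t ^ S m / INR (S m))%R).
      * intros t _. auto_derive; [exact I|]. rewrite S_INR in *. simpl pred.
        destruct m as [|m]; [simpl in *; field|]. rewrite <- !S_INR in *.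
        change (match (S m) with 0%nat => 1%R | S _ => (INR (S m) + 1)%R end) with (INR (S (S m))).
        field. exact Hm.
      * intros t _. apply (ex_derive_continuous (K := R_AbsRing) (V := R_NormedModule)). auto_derive. exact I.
    + unfold minus, plus, opp; simpl. rewrite pow1. field. exact Hm.
Qed.

(** * Linear equations of the second order *)

(** Picard iteration for [y'' = q y]: each term is the twofold primitive of [q]
    times the previous one. *)
Fixpoint picard q z0 a b (n : nat) : C -> C :=
  match n with
  | O => fun z => a + b * (z - z0)
  | S n => segint (segint (fun z => q z * picard q z0 a b n z) z0) z0
  end.

Definition picard' q z0 a b (n : nat) : C -> C :=
  match n with
  | O => fun _ => b
  | S n => segint (fun z => q z * picard q z0 a b n z) z0
  end.

Lemma holo_mult (U : C -> Prop) f g : holo U f -> holo U g -> holo U (fun z => f z * g z).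
Proof.
  intros Hf Hg z Hz. destruct (Hf z Hz) as [l Hl]. destruct (Hg z Hz) as [m Hm].
  eexists. eapply cdiff_mult; eassumption.
Qed.

Section PicardIteration.
Variables (U : C -> Prop) (q : C -> C) (z0 a b : C).
Hypotheses (HU : copen U) (HS : star U z0) (H0 : U z0) (Hq : holo U q).

Lemma holo_segint f : holo U f -> holo U (segint f z0).
Proof. intros Hf z Hz. eexists. apply (star_primitive U); assumption. Qed.

Lemma holo_picard (n : nat) : holo U (picard q z0 a b n).
Proof.
  induction n as [|n IH].
  - intros z _. eexists. simpl. repeat cd_step.
  - simpl. apply holo_segint, holo_segint, holo_mult; assumption.
Qed.

Lemma holo_q_picard (n : nat) : holo U (fun z => q z * picard q z0 a b n z).
Proof. apply holo_mult; [exact Hq|apply holo_picard]. Qed.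

Lemma picard_diff (n : nat) z : U z -> cdiff (picard q z0 a b n) z (picard' q z0 a b n z).
Proof.
  intros Hz. destruct n as [|n].
  - simpl. cd. ring.
  - simpl. apply (star_primitive U); auto. apply holo_segint, holo_q_picard.
Qed.

Lemma picard'_diff_O z : cdiff (picard' q z0 a b 0) z 0.
Proof. simpl. cd. ring. Qed.

Lemma picard'_diff_S (n : nat) z : U z -> cdiff (picard' q z0 a b (S n)) z (q z * picard q z0 a b n z).
Proof.
  intros Hz. apply (star_primitive U z0 z (fun z => q z * picard q z0 a b n z)); auto.
  apply holo_q_picard.
Qed.

(** The domains of uniform convergence of the Picard series; they have to be
    unions of segments from [z0], along which the iterates are integrated. *)
Definition good (S : C -> Prop) (K rho : R) : Prop :=
  (forall w, S w -> U w /\ Cmod (q w) <= K /\ Cmod (w - z0) <= rho) /\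
  (forall w t, S w -> 0 <= t <= 1 -> S (segt z0 w t)).

Lemma Cmod_segt w (t : R) : 0 <= t <= 1 -> Cmod (segt z0 w t - z0) = (t * Cmod (w - z0))%R.
Proof.
  intros Ht. unfold segt. replace (z0 + RtoC t * (w - z0) - z0) with (RtoC t * (w - z0)) by ring.
  rewrite Cmod_mult, Cmod_R, Rabs_pos_eq; lra.
Qed.

Lemma segint_bound_pow (S : C -> Prop) (K rho A : R) (m : nat) f :
  good S K rho -> holo U f -> 0 <= A ->
  (forall w, S w -> Cmod (f w) <= A * Cmod (w - z0) ^ m) ->
  forall w, S w -> Cmod (segint f z0 w) <= A / INR (Datatypes.S m) * Cmod (w - z0) ^ Datatypes.S m.
Proof.
  intros [G1 G2] Hf HA H w Hw. unfold segint. rewrite Cmod_mult.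
  replace (A / INR (Datatypes.S m) * Cmod (w - z0) ^ Datatypes.S m)%R with
    (Cmod (w - z0) * (A * Cmod (w - z0) ^ m / INR (Datatypes.S m)))%R.
  2:{ change (Cmod (w - z0) ^ Datatypes.S m)%R with (Cmod (w - z0) * Cmod (w - z0) ^ m)%R. unfold Rdiv. ring. }
  apply Rmult_le_compat_l; [apply Cmod_ge_0|].
  apply I01_bound_pow.
  - apply cont01_seg. apply (contseg_star U); auto.
    + intros v Hv. apply (holo_ccont _ _ _ Hf Hv).
    + apply G1, Hw.
  - intros t Ht. eapply Rle_trans; [apply H, G2; assumption|].
    rewrite Cmod_segt by exact Ht. rewrite Rpow_mult_distr. right. ring.
Qed.

Lemma picard_bound (S : C -> Prop) (K rho : R) (n : nat) : good S K rho -> 0 <= K -> 0 <= rho ->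
  forall w, S w ->
    Cmod (picard q z0 a b n w) <= (Cmod a + Cmod b * rho) * K ^ n / INR (fact n) * Cmod (w - z0) ^ (2 * n).
Proof.
  intros HG HK Hrho. assert (HA : 0 <= Cmod a + Cmod b * rho).
  { generalize (Cmod_ge_0 a), (Rmult_le_pos _ _ (Cmod_ge_0 b) Hrho). lra. }
  set (A := (Cmod a + Cmod b * rho)%R) in *.
  induction n as [|n IH]; intros w Hw.
  - simpl. replace (A * 1 / 1 * 1)%R with A by field. unfold A.
    tri. rewrite Cmod_mult.
    apply Rplus_le_compat_l, Rmult_le_compat_l; [apply Cmod_ge_0|]. apply HG, Hw.
  - assert (Hfn : 0 < INR (fact n)) by apply INR_fact_lt_0.
    assert (HKn : 0 <= K ^ n) by (apply pow_le, HK).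
    set (B := (A * K ^ Datatypes.S n / INR (fact n))%R).
    assert (HB : 0 <= B).
    { unfold B. apply Rmult_le_pos; [apply Rmult_le_pos; [exact HA|apply pow_le, HK]|].
      left; apply Rinv_0_lt_compat, Hfn. }
    assert (B1 : forall w, S w -> Cmod (q w * picard q z0 a b n w) <= B * Cmod (w - z0) ^ (2 * n)).
    { intros v Hv. rewrite Cmod_mult.
      apply Rle_trans with (K * (A * K ^ n / INR (fact n) * Cmod (v - z0) ^ (2 * n)))%R.
      - apply Rmult_le_compat; try apply Cmod_ge_0; [apply HG, Hv|apply IH, Hv].
      - right. unfold B. simpl. field. lra. }
    assert (B2 := segint_bound_pow S K rho B (2 * n) _ HG (holo_q_picard n) HB B1).
    assert (Hi : 1 <= INR (Datatypes.S (2 * n))) by (rewrite S_INR; generalize (pos_INR (2 * n)); lra).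
    assert (B2' : forall w, S w -> Cmod (segint (fun z => q z * picard q z0 a b n z)%C z0 w) <= B * Cmod (w - z0) ^ Datatypes.S (2 * n)).
    { intros v Hv. eapply Rle_trans; [apply B2, Hv|].
      apply Rmult_le_compat_r; [apply pow_le, Cmod_ge_0|].
      rewrite <- (Rmult_1_r B) at 2. apply Rmult_le_compat_l; [exact HB|].
      rewrite <- Rinv_1. apply Rinv_le_contravar; lra. }
    assert (B3 := segint_bound_pow S K rho B _ _ HG (holo_segint _ (holo_q_picard n)) HB B2' w Hw).
    change (picard q z0 a b (Datatypes.S n)) with (segint (segint (fun z => q z * picard q z0 a b n z) z0) z0).
    eapply Rle_trans; [apply B3|].
    replace (2 * Datatypes.S n)%nat with (Datatypes.S (Datatypes.S (2 * n))) by lia.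
    apply Rmult_le_compat_r; [apply pow_le, Cmod_ge_0|].
    unfold B. rewrite fact_simpl, mult_INR.
    assert (Hn1 : 0 < INR (Datatypes.S n)) by (apply lt_0_INR; lia).
    replace (A * K ^ Datatypes.S n / (INR (Datatypes.S n) * INR (fact n)))%R with (B / INR (Datatypes.S n))%R
      by (unfold B; field; lra).
    fold B. apply Rmult_le_compat_l; [exact HB|]. apply Rinv_le_contravar; [exact Hn1|].
    apply le_INR. lia.
Qed.

Lemma good_nbhd (zs : C) : U zs -> exists (d : R) (S : C -> Prop) (K rho : R),
  0 < d /\ 0 <= K /\ 0 <= rho /\ good S K rho /\ forall z, disc zs d z -> S z /\ U z.
Proof.
  intros Hz. destruct (HU zs Hz) as [d0 [Hd0 H1]].
  destruct (compact_interval (fun t d => forall z, Cmod (z - zs) < d -> Cmod (z - zs) < d0 ->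
     Cmod (q (segt z0 z t)) <= / d) 0 1) as [d [Hd H]].
  - intros s d d' Hd H z Hz1 Hz2. eapply Rle_trans; [apply H; lra|]. apply Rinv_le_contravar; lra.
  - intros t Ht.
    assert (Hqc : ccont q (segt z0 zs t)) by (apply (holo_ccont U); [exact Hq|apply HS; assumption]).
    destruct (Hqc 1%R Rlt_0_1) as [d [Hd H]].
    set (B := (Cmod (q (segt z0 zs t)) + 1)%R).
    assert (HB : 0 < B) by (unfold B; generalize (Cmod_ge_0 (q (segt z0 zs t))); lra).
    set (L := (Cmod (zs - z0) + 1)%R).
    assert (HL : 0 < L) by (unfold L; generalize (Cmod_ge_0 (zs - z0)); lra).
    exists (Rmin (/ B) (Rmin (d / 2) (d / 2 / L))). split.
    { repeat apply Rmin_pos; [apply Rinv_0_lt_compat, HB|lra|apply Rdiv_lt_0_compat; lra]. }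
    intros s Hs Hs' z Hz1 Hz2.
    assert (Hs1 : Rabs (s - t) < d / 2 / L).
    { eapply Rlt_le_trans; [apply Hs|]. eapply Rle_trans; [apply Rmin_r|apply Rmin_r]. }
    assert (Hz3 : Cmod (z - zs) < d / 2).
    { eapply Rlt_le_trans; [apply Hz1|]. eapply Rle_trans; [apply Rmin_r|apply Rmin_l]. }
    assert (K1 : Cmod (q (segt z0 z s) - q (segt z0 zs t)) < 1).
    { apply H. replace (segt z0 z s - segt z0 zs t) with (RtoC s * (z - zs) + RtoC (s - t) * (zs - z0))
        by (unfold segt; rewrite RtoC_minus; ring).
      eapply Rle_lt_trans; [apply Cmod_triangle|]. rewrite !Cmod_mult, !Cmod_R.
      rewrite (Rabs_pos_eq s) by lra.
      assert (s * Cmod (z - zs) <= 1 * Cmod (z - zs)) by (apply Rmult_le_compat_r; [apply Cmod_ge_0|lra]).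
      assert (HR2 : Rabs (s - t) * Cmod (zs - z0) <= d / 2 / L * L).
      { apply Rmult_le_compat; [apply Rabs_pos|apply Cmod_ge_0|lra|unfold L; lra]. }
      replace (d / 2 / L * L)%R with (d / 2)%R in HR2 by (field; lra). lra. }
    apply Rle_trans with B.
    + generalize (Cmod_minus_ge (q (segt z0 z s)) (q (segt z0 zs t))). unfold B. lra.
    + rewrite <- (Rinv_inv B) at 1. apply Rinv_le_contravar; [|apply Rmin_l].
      repeat apply Rmin_pos; [apply Rinv_0_lt_compat, HB|lra|apply Rdiv_lt_0_compat; lra].
  - set (dd := Rmin d d0). assert (Hdd : 0 < dd) by (apply Rmin_pos; assumption).
    exists dd, (fun w => exists z t, Cmod (z - zs) < dd /\ 0 <= t <= 1 /\ w = segt z0 z t), (/ d)%R,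
      (Cmod (zs - z0) + dd)%R.
    assert (Hin : forall z, Cmod (z - zs) < dd -> (Cmod (z - zs) < d /\ Cmod (z - zs) < d0)%R).
    { intros z Hz1. split; (eapply Rlt_le_trans; [apply Hz1|]); [apply Rmin_l|apply Rmin_r]. }
    split; [exact Hdd|]. split; [left; apply Rinv_0_lt_compat, Hd|].
    split; [generalize (Cmod_ge_0 (zs - z0)); lra|]. split.
    + split.
      * intros w (z & t & Hz1 & Ht & ->). destruct (Hin z Hz1) as [Hz2 Hz3]. repeat split.
        -- apply HS; [apply H1, Hz3|exact Ht].
        -- apply H; assumption.
        -- rewrite Cmod_segt by exact Ht.
           assert (t * Cmod (z - z0) <= 1 * Cmod (z - z0)) by (apply Rmult_le_compat_r; [apply Cmod_ge_0|lra]).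
           generalize (Cmod_tri_minus z zs z0). lra.
      * intros w s (z & t & Hz1 & Ht & ->) Hs. exists z, (s * t)%R. repeat split; [exact Hz1|nra|nra|].
        unfold segt. rewrite RtoC_mult. ring.
    + intros z Hz1. split; [|apply H1, Hin, Hz1]. exists z, 1%R. repeat split; [exact Hz1|lra|lra|].
      symmetry. apply segt_1.
Qed.

Lemma ex_series_exp (A x : R) : ex_series (fun n => A * x ^ n / INR (fact n))%R.
Proof.
  assert (H : ex_series (fun n => / INR (fact n) * x ^ n)%R).
  { exists (exp x). generalize (is_exp_Reals x). intros H. unfold is_pseries in H.
    eapply is_series_ext; [|exact H]. intros n. cbv beta. rewrite pow_n_pow. unfold scal; simpl. unfold mult; simpl. ring. }
  apply (ex_series_scal_l A) in H. eapply ex_series_ext; [|exact H].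
  intros n. cbv beta. unfold scal; simpl. unfold mult; simpl. unfold Rdiv. ring.
Qed.

Definition psum (n : nat) z : C := csum (fun k => picard q z0 a b k z) n.
Definition psum' (n : nat) z : C := csum (fun k => picard' q z0 a b k z) n.

Lemma psum_diff (n : nat) z : U z -> cdiff (psum n) z (psum' n z).
Proof.
  intros Hz. induction n as [|n IH].
  - apply (cdiff_ext (picard q z0 a b 0)); [intros w; symmetry; apply csum_O|].
    unfold psum'. rewrite csum_O. apply picard_diff, Hz.
  - apply (cdiff_ext (fun z => psum n z + picard q z0 a b (S n) z)); [intros w; symmetry; apply csum_S|].
    unfold psum'. rewrite csum_S. apply cdiff_plus; [exact IH|apply picard_diff, Hz].
Qed.

Lemma psum'_diff (n : nat) z : U z ->
  cdiff (psum' n) z (match n with O => 0 | S n => q z * psum n z end).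
Proof.
  intros Hz. induction n as [|n IH].
  - apply (cdiff_ext (picard' q z0 a b 0)); [intros w; symmetry; apply csum_O|]. apply picard'_diff_O.
  - apply (cdiff_ext (fun z => psum' n z + picard' q z0 a b (S n) z)); [intros w; symmetry; apply csum_S|].
    eapply cdiff_val; [apply cdiff_plus; [exact IH|apply picard'_diff_S, Hz]|].
    destruct n as [|n].
    + unfold psum. rewrite csum_O. ring.
    + unfold psum at 2. rewrite csum_S. fold (psum n z). ring.
Qed.

Lemma psum_cauchy (S : C -> Prop) (K rho : R) : good S K rho -> 0 <= K -> 0 <= rho ->
  forall e : R, 0 < e -> exists N : nat, forall n m : nat, (N <= n)%nat -> (N <= m)%nat ->
  forall z, S z -> Cmod (psum n z - psum m z) <= e.
Proof.
  intros HG HK Hrho. apply (m_test S (fun n => picard q z0 a b n)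
    (fun n => (Cmod a + Cmod b * rho) * (K * (rho * rho)) ^ n / INR (fact n))%R).
  - apply ex_series_exp.
  - intros n z Hz. eapply Rle_trans; [apply (picard_bound S K rho); assumption|].
    rewrite Rpow_mult_distr, pow_mult. rewrite Rpow_mult_distr.
    assert (Hf : 0 < / INR (fact n)) by (apply Rinv_0_lt_compat, INR_fact_lt_0).
    assert (HA : 0 <= (Cmod a + Cmod b * rho) * K ^ n).
    { apply Rmult_le_pos; [|apply pow_le, HK].
      generalize (Cmod_ge_0 a), (Rmult_le_pos _ _ (Cmod_ge_0 b) Hrho). lra. }
    assert (Hp : (Cmod (z - z0) ^ 2) ^ n <= rho ^ n * rho ^ n).
    { rewrite <- Rpow_mult_distr. apply pow_incr. split; [apply pow_le, Cmod_ge_0|].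
      simpl. rewrite Rmult_1_r. destruct HG as [G1 _]. destruct (G1 z Hz) as (_ & _ & Hr).
      apply Rmult_le_compat; try apply Cmod_ge_0; exact Hr. }
    unfold Rdiv.
    apply Rle_trans with ((Cmod a + Cmod b * rho) * K ^ n * / INR (fact n) * (rho ^ n * rho ^ n))%R.
    + apply Rmult_le_compat_l; [|exact Hp]. apply Rmult_le_pos; lra.
    + right. ring.
Qed.

Lemma picard_limit : exists y : C -> C, forall z, U z -> clim (fun n => psum n z) (y z).
Proof.
  assert (H : forall z, exists l, U z -> clim (fun n => psum n z) l).
  { intros z. destruct (classic (U z)) as [Hz|Hz]; [|exists 0; contradiction].
    destruct (good_nbhd z Hz) as (d & S & K & rho & Hd & HK & Hrho & HG & HS').
    destruct (clim_cauchy (fun n => psum n z)) as [l Hl].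
    - intros e He. destruct (psum_cauchy S K rho HG HK Hrho (e / 2)%R) as [N HN]; [lra|].
      exists N. intros n m Hn Hm. apply Rle_lt_trans with (e / 2)%R; [|lra].
      apply HN; auto. apply HS', disc_center, Hd.
    - exists l. auto. }
  apply (choice (fun z l => U z -> clim (fun n => psum n z) l)) in H.
  exact H.
Qed.

Theorem ode_existence : exists y y' : C -> C,
  (forall z, U z -> cdiff y z (y' z) /\ cdiff y' z (q z * y z)) /\ y z0 = a /\ y' z0 = b.
Proof.
  destruct picard_limit as [y Hy].
  assert (Hun : forall z, U z -> exists d, 0 < d /\ (forall w, disc z d w -> U w) /\
     uconv (disc z d) psum y).
  { intros z Hz. destruct (good_nbhd z Hz) as (d & S & K & rho & Hd & HK & Hrho & HG & HS').
    exists d. split; [exact Hd|]. split; [intros w Hw; apply HS', Hw|].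
    apply uconv_of_cauchy.
    - intros e He. destruct (psum_cauchy S K rho HG HK Hrho e He) as [N HN].
      exists N. intros n m Hn Hm w Hw. apply HN; auto. apply HS', Hw.
    - intros w Hw. apply Hy, HS', Hw. }
  assert (Hps : forall n, holo U (psum n)) by (intros n z Hz; eexists; apply psum_diff, Hz).
  assert (Hps' : forall n, holo U (psum' n)) by (intros n z Hz; eexists; apply psum'_diff, Hz).
  assert (Hyh : holo U y).
  { intros z Hz. destruct (Hun z Hz) as (d & Hd & HdU & Hu).
    apply (weierstrass psum y z d Hd); [intros n; apply (holo_sub U); auto|exact Hu|apply disc_center, Hd]. }
  assert (Hy'h := proj2 (holo_derive U y HU Hyh)).
  assert (Hlim' : forall z, U z -> exists d, 0 < d /\ (forall w, disc z d w -> U w) /\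
     uconv (disc z d) psum' (C_derive y)).
  { intros z Hz. destruct (Hun z Hz) as (d & Hd & HdU & Hu).
    destruct (weierstrass psum y z d Hd) as [_ W]; [intros n; apply (holo_sub U); auto|exact Hu|].
    assert (Hin : forall w, disc z (d / 2) w -> U w) by (intros w Hw; apply HdU; unfold disc in *; lra).
    exists (d / 2)%R. split; [lra|]. split; [exact Hin|].
    intros e He. destruct (W e He) as [N HN]. exists N. intros n Hn w Hw.
    rewrite <- (C_derive_eq (psum n) w (psum' n w)) by (apply psum_diff, Hin, Hw). apply HN; assumption. }
  exists y, (C_derive y). split; [|split].
  - intros z Hz. split; [apply (cdiff_at U); assumption|].
    replace (q z * y z) with (C_derive (C_derive y) z); [apply (cdiff_at U); assumption|].
    destruct (Hlim' z Hz) as (d & Hd & HdU & Hu).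
    destruct (weierstrass psum' (C_derive y) z d Hd) as [_ W]; [intros n; apply (holo_sub U); auto|exact Hu|].
    apply (clim_unique (fun n => q z * psum n z)).
    + intros e He. destruct (W (e / 2)%R) as [N HN]; [lra|]. exists N. intros n Hn.
      specialize (HN (S n) ltac:(lia) z (disc_center z (d / 2) ltac:(lra))).
      rewrite (C_derive_eq (psum' (S n)) z _ (psum'_diff (S n) z Hz)) in HN. lra.
    + intros e He. set (B := (Cmod (q z) + 1)%R).
      assert (HB : 0 < B) by (unfold B; generalize (Cmod_ge_0 (q z)); lra).
      destruct (Hy z Hz (e / B)%R) as [N HN]; [apply Rdiv_lt_0_compat; lra|].
      exists N. intros n Hn. specialize (HN n Hn).
      replace (q z * psum n z - q z * y z) with (q z * (psum n z - y z)) by ring.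
      rewrite Cmod_mult. apply Rle_lt_trans with (B * Cmod (psum n z - y z))%R.
      * apply Rmult_le_compat_r; [apply Cmod_ge_0|unfold B; lra].
      * apply Rlt_le_trans with (B * (e / B))%R; [apply Rmult_lt_compat_l; assumption|right; field; lra].
  - apply (clim_unique (fun n => psum n z0)); [apply Hy, H0|].
    assert (E : forall n, psum n z0 = a).
    { induction n as [|n IH]; unfold psum in *.
      - rewrite csum_O. simpl. ring.
      - rewrite csum_S, IH. simpl. unfold segint at 1. ring. }
    intros e He. exists 0%nat. intros n _. rewrite E, Cmod_self. exact He.
  - destruct (Hlim' z0 H0) as (d & Hd & HdU & Hu).
    apply (clim_unique (fun n => psum' n z0)).
    + intros e He. destruct (Hu (e / 2)%R) as [N HN]; [lra|]. exists N. intros n Hn.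
      specialize (HN n Hn z0 (disc_center z0 d Hd)). lra.
    + assert (E : forall n, psum' n z0 = b).
      { induction n as [|n IH]; unfold psum' in *.
        - rewrite csum_O. reflexivity.
        - rewrite csum_S, IH. simpl. unfold segint at 1. ring. }
      intros e He. exists 0%nat. intros n _. rewrite E, Cmod_self. exact He.
Qed.
End PicardIteration.

Definition ptc (x y : R) : C := RtoC x + RtoC y * Ci.

Lemma re_ptc (x y : R) : Re (ptc x y) = x.
Proof. unfold ptc, Re; simpl; ring. Qed.
Lemma im_ptc (x y : R) : Im (ptc x y) = y.
Proof. unfold ptc, Im; simpl; ring. Qed.
Lemma ptc_eta z : z = ptc (Re z) (Im z).
Proof. destruct z as [x y]. apply injective_projections; unfold ptc, Re, Im; simpl; ring. Qed.

Lemma Cmod_ptc_minus (x y x' y' : R) : Cmod (ptc x y - ptc x' y') <= Rabs (x - x') + Rabs (y - y').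
Proof. eapply Rle_trans; [apply Cmod_le_re_im|]. rewrite re_minus, im_minus, !re_ptc, !im_ptc. lra. Qed.

Lemma compact_box (P : C -> R -> Prop) (a b c d : R) :
  (forall z r r', 0 < r' <= r -> P z r -> P z r') ->
  (forall x y, a <= x <= b -> c <= y <= d -> exists r, 0 < r /\
     forall z, Cmod (z - ptc x y) < r -> P z r) ->
  exists r, 0 < r /\ forall x y, a <= x <= b -> c <= y <= d -> P (ptc x y) r.
Proof.
  intros Hanti Hloc.
  destruct (compact_interval (fun x r => forall y, c <= y <= d -> P (ptc x y) r) a b) as [r [Hr H]].
  - intros s r r' Hr H y Hy. apply (Hanti _ r); auto.
  - intros x0 Hx0.
    destruct (compact_interval (fun y r => forall x, Rabs (x - x0) < r -> P (ptc x y) r) c d) as [r [Hr H]].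
    + intros s r r' Hr H x Hx. apply (Hanti _ r); auto. apply H. lra.
    + intros y0 Hy0. destruct (Hloc x0 y0 Hx0 Hy0) as [r [Hr H]].
      exists (r / 2)%R. split; [lra|]. intros y Hy _ x Hx. apply (Hanti _ r); [lra|]. apply H.
      eapply Rle_lt_trans; [apply Cmod_ptc_minus|]. lra.
    + exists r. split; [exact Hr|]. intros x Hx _ y Hy. apply H; assumption.
  - exists r. split; [exact Hr|]. intros x y Hx Hy. apply H; assumption.
Qed.

Definition recont (V : C -> R) z : Prop :=
  forall e, 0 < e -> exists r, 0 < r /\ forall w, Cmod (w - z) < r -> Rabs (V w - V z) < e.

(** Positivity of [V + m] on a compact box, with [m] the supremum of [- V],
    would bound [1 / (V + m)] and contradict the choice of [m]. *)
Lemma box_min (V : C -> R) (a b c d : R) : a <= b -> c <= d ->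
  (forall x y, a <= x <= b -> c <= y <= d -> recont V (ptc x y)) ->
  exists x0 y0, a <= x0 <= b /\ c <= y0 <= d /\
    forall x y, a <= x <= b -> c <= y <= d -> V (ptc x0 y0) <= V (ptc x y).
Proof.
  intros Hab Hcd HV.
  destruct (compact_box (fun z r => - / r <= V z) a b c d) as [B [HB HBV]].
  - intros z r r' Hr H. assert (/ r <= / r') by (apply Rinv_le_contravar; lra). lra.
  - intros x y Hx Hy. destruct (HV x y Hx Hy 1%R Rlt_0_1) as [r [Hr H]].
    set (M := (Rabs (V (ptc x y)) + 1)%R).
    assert (HM : 0 < M) by (unfold M; generalize (Rabs_pos (V (ptc x y))); lra).
    exists (Rmin r (/ M)). assert (Hm : 0 < Rmin r (/ M)) by (apply Rmin_pos; [exact Hr|apply Rinv_0_lt_compat, HM]).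
    split; [exact Hm|]. intros z Hz. specialize (H z ltac:(apply (Rmin_Rgt_l _ _ _ Hz))).
    apply Rabs_def2 in H. generalize (Rle_abs (- V (ptc x y))). rewrite Rabs_Ropp. intros K.
    assert (M <= / Rmin r (/ M)) by (rewrite <- (Rinv_inv M) at 1; apply Rinv_le_contravar; [exact Hm|apply Rmin_r]).
    unfold M in *. lra.
  - set (E := fun v : R => exists x y, a <= x <= b /\ c <= y <= d /\ v = (- V (ptc x y))%R).
    destruct (completeness E) as [m [Hm1 Hm2]].
    + exists (/ B)%R. intros v (x & y & Hx & Hy & ->). specialize (HBV x y Hx Hy). lra.
    + exists (- V (ptc a c))%R, a, c. repeat split; lra.
    + apply NNPP. intros Hno.
      assert (Hpos : forall x y, a <= x <= b -> c <= y <= d -> 0 < V (ptc x y) + m).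
      { intros x y Hx Hy. assert (- V (ptc x y) <= m) by (apply Hm1; exists x, y; auto).
        destruct (Req_dec (V (ptc x y) + m) 0) as [E0|E0]; [|lra]. exfalso. apply Hno.
        exists x, y. repeat split; try lra. intros x' y' Hx' Hy'.
        assert (- V (ptc x' y') <= m) by (apply Hm1; exists x', y'; auto). lra. }
      destruct (compact_box (fun z r => r <= V z + m) a b c d) as [r [Hr Hrr]].
      * intros z r r' Hr H. lra.
      * intros x y Hx Hy. specialize (Hpos x y Hx Hy).
        destruct (HV x y Hx Hy ((V (ptc x y) + m) / 2)%R) as [r [Hr H]]; [lra|].
        exists (Rmin r ((V (ptc x y) + m) / 2)). split; [apply Rmin_pos; lra|].
        intros z Hz. specialize (H z ltac:(apply (Rmin_Rgt_l _ _ _ Hz))).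
        apply Rabs_def2 in H. generalize (Rmin_r r ((V (ptc x y) + m) / 2)). lra.
      * assert (m <= m - r); [|lra]. apply Hm2. intros v (x & y & Hx & Hy & ->).
        specialize (Hrr x y Hx Hy). lra.
Qed.

Section Tau.
Variable tau : C.
Hypothesis tau_re : Re tau = 0%R.
Hypothesis tau_im : 0 < Im tau.

(** * Lattice sums and the zeta function *)

Lemma csum_shift (f : nat -> C) (n : nat) : csum f (S n) = f 0%nat + csum (fun k => f (S k)) n.
Proof.
  induction n as [|n IH].
  - rewrite csum_S, !csum_O. reflexivity.
  - rewrite csum_S, IH, csum_S. ring.
Qed.

Lemma csum_opp (f : nat -> C) (n : nat) : csum (fun k => - f k) n = - csum f n.
Proof. induction n as [|n IH]; [rewrite !csum_O; reflexivity|rewrite !csum_S, IH; ring]. Qed.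

Lemma csum_plus (f g : nat -> C) (n : nat) : csum (fun k => f k + g k) n = csum f n + csum g n.
Proof. induction n as [|n IH]; [rewrite !csum_O; reflexivity|rewrite !csum_S, IH; ring]. Qed.

Lemma csum_scal c (f : nat -> C) (n : nat) : csum (fun k => c * f k) n = c * csum f n.
Proof. induction n as [|n IH]; [rewrite !csum_O; reflexivity|rewrite !csum_S, IH; ring]. Qed.

Lemma csum_minus (f g : nat -> C) (n : nat) : csum (fun k => f k - g k) n = csum f n - csum g n.
Proof. unfold Cminus. rewrite csum_plus, csum_opp. reflexivity. Qed.

Lemma csum_rev (f : nat -> C) (n : nat) : csum (fun k => f (n - k)%nat) n = csum f n.
Proof.
  revert f. induction n as [|n IH]; intros f.
  - rewrite !csum_O. reflexivity.
  - rewrite csum_S, (csum_shift f n), Nat.sub_diag, Cplus_comm. f_equal.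
    rewrite <- (IH (fun k => f (S k))). apply csum_ext. intros k Hk. f_equal. lia.
Qed.

Lemma csum_swap (f : nat -> nat -> C) (n m : nat) :
  csum (fun j => csum (fun k => f j k) m) n = csum (fun k => csum (fun j => f j k) n) m.
Proof.
  induction n as [|n IH].
  - rewrite csum_O. apply csum_ext. intros k _. rewrite csum_O. reflexivity.
  - rewrite csum_S, IH, <- csum_plus. apply csum_ext. intros k _. rewrite csum_S. reflexivity.
Qed.

Lemma csum_bound (f : nat -> C) (n : nat) (B : R) :
  (forall k, (k <= n)%nat -> Cmod (f k) <= B) -> Cmod (csum f n) <= INR (S n) * B.
Proof.
  induction n as [|n IH]; intros H.
  - rewrite csum_O. simpl. rewrite Rmult_1_l. apply H. lia.
  - rewrite csum_S, S_INR. tri.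
    assert (A := IH (fun k Hk => H k (Nat.le_trans _ _ _ Hk (Nat.le_succ_diag_r n)))).
    specialize (H (S n) (le_n _)). lra.
Qed.

Lemma csum_delta c (N n : nat) : (N <= n)%nat ->
  csum (fun j => if Nat.eqb j N then c else RtoC 0) n = c.
Proof.
  induction n as [|n IH]; intros H.
  - rewrite csum_O. replace N with 0%nat by lia. reflexivity.
  - rewrite csum_S. destruct (Nat.eq_dec N (S n)) as [->|Hne].
    + rewrite Nat.eqb_refl.
      assert (E : csum (fun j => if Nat.eqb j (S n) then c else RtoC 0) n = 0).
      { rewrite (csum_ext _ (fun _ => 0 * 0)).
        - rewrite csum_scal. ring.
        - intros k Hk. destruct (Nat.eqb_spec k (S n)); [lia|ring]. }
      rewrite E. ring.
    + rewrite IH by lia. destruct (Nat.eqb_spec (S n) N); [lia|ring].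
Qed.

Lemma cdiff_csum (f : nat -> C -> C) (l : nat -> C) z (n : nat) :
  (forall k, (k <= n)%nat -> cdiff (f k) z (l k)) ->
  cdiff (fun z => csum (fun k => f k z) n) z (csum l n).
Proof.
  induction n as [|n IH]; intros H.
  - rewrite csum_O. apply (cdiff_ext (f 0%nat)); [intros w; rewrite csum_O; reflexivity|]. apply H. lia.
  - rewrite csum_S. apply (cdiff_ext (fun z => csum (fun k => f k z) n + f (S n) z)).
    + intros w. rewrite csum_S. reflexivity.
    + apply cdiff_plus; [apply IH; intros k Hk; apply H; lia|apply H; lia].
Qed.

Definition lpt (N j k : nat) : C := RtoC (INR j - INR N) + RtoC (INR k - INR N) * tau.
Definition center (N j k : nat) : bool := (Nat.eqb j N && Nat.eqb k N)%bool.

Lemma lps_unfold (a : C -> C) (N : nat) :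
  lattice_partial_sum tau a N =
  csum (fun j => csum (fun k => if center N j k then RtoC 0 else a (lpt N j k)) (2 * N)) (2 * N).
Proof. reflexivity. Qed.

Lemma lpt_S (N j k : nat) : lpt (S N) (S j) (S k) = lpt N j k.
Proof. unfold lpt. rewrite !S_INR. f_equal; [|f_equal]; f_equal; ring. Qed.

Lemma csum_ends (f : nat -> C) (n : nat) :
  csum f (S (S n)) = f 0%nat + csum (fun k => f (S k)) n + f (S (S n)).
Proof. rewrite csum_S, csum_shift. reflexivity. Qed.

(** The edge of the square: the indices are shifted by [N], so these are the
    lattice points with [max (|m|, |n|) = N]. *)
Definition shell (N j k : nat) : Prop :=
  (j <= 2 * N)%nat /\ (k <= 2 * N)%nat /\ (j = 0 \/ j = 2 * N \/ k = 0 \/ k = 2 * N)%nat.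

(** The square grows by an edge of [8 (N + 1)] points. *)
Lemma lps_step (a : C -> C) (N : nat) (B : R) :
  (forall j k, shell (S N) j k -> Cmod (a (lpt (S N) j k)) <= B) ->
  Cmod (lattice_partial_sum tau a (S N) - lattice_partial_sum tau a N) <= 8 * INR (S N) * B.
Proof.
  intros HB. rewrite !lps_unfold.
  replace (2 * S N)%nat with (S (S (2 * N))) by lia.
  set (g := fun j k => if center (S N) j k then RtoC 0 else a (lpt (S N) j k)).
  assert (Eg : forall j k, g (S j) (S k) = (if center N j k then RtoC 0 else a (lpt N j k))).
  { intros j k. unfold g, center. rewrite lpt_S. reflexivity. }
  assert (Hg : forall j k, shell (S N) j k -> Cmod (g j k) <= B).
  { intros j k Hs. specialize (HB j k Hs). unfold g, center.
    destruct (Nat.eqb_spec j (S N)) as [E1|E1]; destruct (Nat.eqb_spec k (S N)) as [E2|E2]; simpl; try exact HB.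
    exfalso. unfold shell in Hs. lia. }
  change (csum (fun j => csum (fun k => if center (S N) j k then RtoC 0 else a (lpt (S N) j k)) (S (S (2 * N)))) (S (S (2 * N))))
    with (csum (fun j => csum (fun k => g j k) (S (S (2 * N)))) (S (S (2 * N)))).
  rewrite csum_ends.
  rewrite (csum_ext (fun j => csum (fun k => g (S j) k) (S (S (2 * N))))
    (fun j => csum (fun k => if center N j k then RtoC 0 else a (lpt N j k)) (2 * N) + (g (S j) 0%nat + g (S j) (S (S (2 * N)))))).
  2:{ intros j _. rewrite csum_ends. rewrite (csum_ext (fun k => g (S j) (S k)) (fun k => if center N j k then RtoC 0 else a (lpt N j k))) by (intros k _; apply Eg). ring. }
  rewrite csum_plus.
  match goal with |- (Cmod ?X <= _) => replace X with
    (csum (fun k => g 0%nat k) (S (S (2 * N))) + csum (fun k => g (S (S (2 * N))) k) (S (S (2 * N))) +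
      csum (fun j => g (S j) 0%nat + g (S j) (S (S (2 * N)))) (2 * N)) by ring end.
  assert (B1 : Cmod (csum (fun k => g 0%nat k) (S (S (2 * N)))) <= INR (S (S (S (2 * N)))) * B).
  { apply csum_bound. intros k Hk. apply Hg. unfold shell. lia. }
  assert (B2 : Cmod (csum (fun k => g (S (S (2 * N))) k) (S (S (2 * N)))) <= INR (S (S (S (2 * N)))) * B).
  { apply csum_bound. intros k Hk. apply Hg. unfold shell. lia. }
  assert (B3 : Cmod (csum (fun j => g (S j) 0%nat + g (S j) (S (S (2 * N))))%C (2 * N)) <= INR (S (2 * N)) * (B + B)).
  { apply csum_bound. intros k Hk. tri.
    apply Rplus_le_compat; apply Hg; unfold shell; lia. }
  tri. eapply Rle_trans; [apply Rplus_le_compat_r, Cmod_triangle|].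
  rewrite !S_INR, mult_INR in *. simpl (INR 2) in *. lra.
Qed.

(** A lattice point with [max (|m|, |n|) = N] has modulus at least [kap N]. *)
Definition kap : R := Rmin 1 (Im tau).

Lemma kap_pos : 0 < kap.
Proof. apply Rmin_pos; [lra|exact tau_im]. Qed.

Lemma re_lin (a b : R) : Re (RtoC a + RtoC b * tau) = a.
Proof. rewrite re_plus, re_RtoC, re_scal_l, tau_re. ring. Qed.

Lemma im_lin (a b : R) : Im (RtoC a + RtoC b * tau) = (b * Im tau)%R.
Proof. rewrite im_plus, im_RtoC, im_scal_l. ring. Qed.

Lemma C_eq z w : Re z = Re w -> Im z = Im w -> z = w.
Proof. intros H1 H2. apply injective_projections; assumption. Qed.

Lemma tau_eq : tau = RtoC (Im tau) * Ci.
Proof. apply C_eq; [rewrite tau_re|]; unfold Re, Im; simpl; ring. Qed.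

Lemma tau_conj : Cconj tau = - tau.
Proof. apply C_eq; [rewrite re_conj, re_opp, tau_re; ring|rewrite im_conj, im_opp; reflexivity]. Qed.

Lemma tau_neq_0 : tau <> 0.
Proof. intros E. assert (K := tau_im). rewrite E, im_RtoC in K. lra. Qed.

Lemma Cmod_lin (a b : R) (M : R) : 0 <= M -> (M <= Rabs a \/ M <= Rabs b)%R ->
  kap * M <= Cmod (RtoC a + RtoC b * tau).
Proof.
  intros HM H. assert (K1 : kap <= 1) by apply Rmin_l. assert (K2 : kap <= Im tau) by apply Rmin_r.
  assert (K0 := kap_pos).
  destruct H as [H|H].
  - eapply Rle_trans; [|apply re_le]. rewrite re_lin.
    apply Rle_trans with (1 * M)%R; [apply Rmult_le_compat_r; lra|lra].
  - eapply Rle_trans; [|apply im_le]. rewrite im_lin, Rabs_mult, (Rabs_pos_eq (Im tau)) by lra.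
    rewrite Rmult_comm. apply Rmult_le_compat; lra.
Qed.

Lemma lattice_small w : lattice tau w -> Cmod w < kap -> w = 0.
Proof.
  intros (m & n & ->) H.
  assert (Hz : forall x : Z, x <> 0%Z -> 1 <= Rabs (IZR x)).
  { intros x Hx. rewrite <- abs_IZR. apply IZR_le. lia. }
  destruct (Z.eq_dec m 0) as [Hm|Hm].
  - destruct (Z.eq_dec n 0) as [Hn|Hn].
    + subst. ring.
    + assert (K := Cmod_lin (IZR m) (IZR n) 1 ltac:(lra) (or_intror (Hz n Hn))). lra.
  - assert (K := Cmod_lin (IZR m) (IZR n) 1 ltac:(lra) (or_introl (Hz m Hm))). lra.
Qed.

Lemma lattice_plus z w : lattice tau z -> lattice tau w -> lattice tau (z + w).
Proof.
  intros (m & n & ->) (m' & n' & ->). exists (m + m')%Z, (n + n')%Z.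
  rewrite !plus_IZR, !RtoC_plus. ring.
Qed.

Lemma lattice_opp z : lattice tau z -> lattice tau (- z).
Proof. intros (m & n & ->). exists (- m)%Z, (- n)%Z. rewrite !opp_IZR, !RtoC_opp. ring. Qed.

Lemma lattice_minus z w : lattice tau z -> lattice tau w -> lattice tau (z - w).
Proof. intros Hz Hw. apply lattice_plus; [exact Hz|apply lattice_opp, Hw]. Qed.

Lemma lattice_0 : lattice tau 0.
Proof. exists 0%Z, 0%Z. ring. Qed.
Lemma lattice_1 : lattice tau 1.
Proof. exists 1%Z, 0%Z. ring. Qed.
Lemma lattice_tau : lattice tau tau.
Proof. exists 0%Z, 1%Z. ring. Qed.

Lemma lattice_discrete z : exists d : R, 0 < d /\
  forall w, lattice tau w -> Cmod (w - z) < d -> w = z.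
Proof.
  assert (K := kap_pos).
  destruct (classic (exists w, lattice tau w /\ w <> z /\ Cmod (w - z) < kap / 2)) as [(w0 & L0 & N0 & D0)|Hn].
  - exists (Cmod (w0 - z)). split.
    + apply Cmod_gt_0. intros E. apply N0, Ceq_minus, E.
    + intros w Hw Hd. exfalso.
      assert (E : w - w0 = 0).
      { apply lattice_small; [apply lattice_minus; assumption|].
        generalize (Cmod_tri_minus w z w0). rewrite (Cmod_sym z w0). lra. }
      assert (w = w0) by (apply Ceq_minus, E). subst w. lra.
  - exists (kap / 2)%R. split; [lra|]. intros w Hw Hd. apply NNPP. intros Hne. apply Hn. eauto.
Qed.

Lemma shell_far (N j k : nat) : shell N j k -> kap * INR N <= Cmod (lpt N j k).
Proof.
  intros (H1 & H2 & H3). apply Cmod_lin; [apply pos_INR|].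
  assert (A : forall i, (i = 0 \/ i = 2 * N)%nat -> Rabs (INR i - INR N) = INR N).
  { intros i [->| ->].
    - simpl. rewrite Rminus_0_l, Rabs_Ropp. apply Rabs_pos_eq, pos_INR.
    - rewrite mult_INR. simpl (INR 2). replace ((1 + 1) * INR N - INR N)%R with (INR N) by ring.
      apply Rabs_pos_eq, pos_INR. }
  destruct H3 as [H3|[H3|[H3|H3]]]; [left|left|right|right]; rewrite A by auto; lra.
Qed.

Definition tz z w : C := 1 / (z - w) + 1 / w + z / (w * w).
Definition tp z w : C := 1 / ((z - w) * (z - w)) - 1 / (w * w).

Lemma tz_bound z w (rho : R) : 0 < rho -> Cmod z <= rho -> 2 * rho <= Cmod w ->
  Cmod (tz z w) <= 2 * (rho * rho) / (Cmod w * Cmod w * Cmod w).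
Proof.
  intros Hr Hz Hw.
  assert (Hw0 : 0 < Cmod w) by lra.
  assert (Hd : Cmod w / 2 <= Cmod (z - w)) by (rewrite Cmod_sym; generalize (Cmod_minus_ge w z); lra).
  assert (w <> 0) by (apply Cmod_gt_0; lra).
  assert (z - w <> 0) by (apply Cmod_gt_0; lra).
  replace (tz z w) with (z * z * / (w * w * (z - w))).
  2:{ unfold tz. field. split; assumption. }
  rewrite !Cmod_mult, Cmod_inv by (repeat apply Cmult_neq_0; assumption). rewrite !Cmod_mult.
  apply Rle_trans with (rho * rho * / (Cmod w * Cmod w * (Cmod w / 2)))%R.
  - apply Rmult_le_compat.
    + apply Rmult_le_pos; apply Cmod_ge_0.
    + left. apply Rinv_0_lt_compat. repeat apply Rmult_lt_0_compat; lra.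
    + apply Rmult_le_compat; try apply Cmod_ge_0; assumption.
    + apply Rinv_le_contravar; [repeat apply Rmult_lt_0_compat; lra|].
      apply Rmult_le_compat_l; [|exact Hd]. apply Rmult_le_pos; lra.
  - right. field. lra.
Qed.

Definition zsum (N : nat) z : C := lattice_partial_sum tau (tz z) N.

Lemma zsum_cauchy (rho : R) : 0 < rho -> forall e : R, 0 < e ->
  exists N : nat, forall n m : nat, (N <= n)%nat -> (N <= m)%nat ->
    forall z, Cmod z <= rho -> Cmod (zsum n z - zsum m z) <= e.
Proof.
  intros Hr e He. assert (K := kap_pos).
  set (A := (16 * (rho * rho) / (kap * kap * kap))%R).
  assert (HA : 0 < A).
  { apply Rdiv_lt_0_compat; repeat apply Rmult_lt_0_compat; lra. }
  destruct (INR_unbounded (2 * rho / kap + 2 * A / e + 1)) as [N HN].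
  assert (P1 : 0 < 2 * rho / kap) by (apply Rdiv_lt_0_compat; lra).
  assert (P2 : 0 < 2 * A / e) by (apply Rdiv_lt_0_compat; lra).
  assert (HNp : 0 < INR N) by lra.
  assert (Hstep : forall n, (N <= n)%nat -> forall z, Cmod z <= rho ->
     Cmod (zsum (S n) z - zsum n z) <= A / INR n - A / INR (S n)).
  { intros n Hn z Hz. apply le_INR in Hn.
    assert (Hn0 : 0 < INR n) by lra.
    assert (Hsn : INR (S n) = (INR n + 1)%R) by apply S_INR.
    assert (KN : 2 * rho <= kap * INR (S n)).
    { rewrite Hsn. apply (Rmult_le_reg_l (/ kap)); [apply Rinv_0_lt_compat, K|].
      replace (/ kap * (2 * rho))%R with (2 * rho / kap)%R by (unfold Rdiv; ring).
      rewrite <- Rmult_assoc, Rinv_l, Rmult_1_l by lra. lra. }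
    set (x := (kap * INR (S n))%R) in *.
    eapply Rle_trans; [apply (lps_step (tz z) n (2 * (rho * rho) / (x * x * x)))|].
    - intros j k Hs. assert (Hf := shell_far _ _ _ Hs). fold x in Hf.
      eapply Rle_trans; [apply (tz_bound z _ rho); lra|].
      unfold Rdiv. apply Rmult_le_compat_l; [apply Rmult_le_pos; [lra|apply Rmult_le_pos; lra]|].
      assert (Hx : 0 < x) by lra.
      apply Rinv_le_contravar; [apply Rmult_lt_0_compat; [apply Rmult_lt_0_compat|]; exact Hx|].
      assert (Hxx : x * x <= Cmod (lpt (S n) j k) * Cmod (lpt (S n) j k)) by (apply Rmult_le_compat; lra).
      apply Rmult_le_compat; try lra. apply Rmult_le_pos; lra.
    - replace (8 * INR (S n) * (2 * (rho * rho) / (x * x * x)))%R with (A * / (INR (S n) * INR (S n)))%R.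
      2:{ unfold A, x. field. lra. }
      replace (A / INR n - A / INR (S n))%R with (A * / (INR n * INR (S n)))%R.
      2:{ rewrite Hsn. field. lra. }
      apply Rmult_le_compat_l; [lra|]. apply Rinv_le_contravar.
      + apply Rmult_lt_0_compat; lra.
      + apply Rmult_le_compat_r; lra. }
  assert (Htel : forall k z, Cmod z <= rho -> Cmod (zsum (N + k) z - zsum N z) <= A / INR N - A / INR (N + k)).
  { intros k z Hz. induction k as [|k IH].
    - rewrite Nat.add_0_r, Cmod_self. lra.
    - rewrite Nat.add_succ_r.
      assert (H := Hstep (N + k)%nat ltac:(lia) z Hz).
      generalize (Cmod_tri_minus (zsum (S (N + k)) z) (zsum (N + k) z) (zsum N z)). lra. }
  assert (HAN : A / INR N <= e / 2).
  { apply (Rmult_le_reg_r (INR N)); [exact HNp|]. unfold Rdiv at 1. rewrite Rmult_assoc, Rinv_l, Rmult_1_r by lra.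
    apply Rle_trans with (e / 2 * (2 * A / e))%R; [right; field; lra|]. apply Rmult_le_compat_l; lra. }
  exists N. intros n m Hn Hm z Hz.
  assert (B : forall i, (N <= i)%nat -> Cmod (zsum i z - zsum N z) <= e / 2).
  { intros i Hi. replace i with (N + (i - N))%nat by lia. eapply Rle_trans; [apply Htel, Hz|].
    assert (0 < A / INR (N + (i - N))).
    { apply Rdiv_lt_0_compat; [exact HA|]. apply lt_0_INR. assert (N <> 0)%nat by (intros ->; simpl in HNp; lra). lia. }
    lra. }
  eapply Rle_trans; [apply (Cmod_tri_minus _ (zsum N z))|]. rewrite (Cmod_sym (zsum N z)).
  generalize (B n Hn), (B m Hm). lra.
Qed.

Lemma filterlim_clim (u : nat -> C) (l : C) :
  filterlim u eventually (locally (T := C_UniformSpace) l) <-> clim u l.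
Proof.
  split.
  - intros H e He.
    destruct (proj1 (filterlim_locally_ball_norm (K := R_AbsRing) (U := C_R_NormedModule) (F := eventually) u l) H (mkposreal e He)) as [N HN].
    exists N. intros n Hn. specialize (HN n Hn). rewrite Cmod_norm. exact HN.
  - intros H. apply (proj2 (filterlim_locally_ball_norm (K := R_AbsRing) (U := C_R_NormedModule) (F := eventually) u l)).
    intros [e He]. destruct (H e He) as [N HN]. exists N. intros n Hn. specialize (HN n Hn).
    rewrite Cmod_norm in HN. exact HN.
Qed.

Lemma the_unique (P : C -> Prop) v : P v -> (forall w, P w -> w = v) -> the P = v.
Proof.
  intros Hv Hu. apply Hu. unfold the.
  apply (iota_correct (V := C_CompleteNormedModule) P).
  exists v. split; [exact Hv|]. intros w Hw. symmetry. apply Hu, Hw.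
Qed.

Lemma lattice_sum_clim (a : C -> C) v : clim (lattice_partial_sum tau a) v -> lattice_sum tau a = v.
Proof.
  intros H. apply the_unique.
  - apply filterlim_clim, H.
  - intros w Hw. apply (clim_unique (lattice_partial_sum tau a)); [apply filterlim_clim, Hw|exact H].
Qed.

(** The part of [wzeta] that is regular at 0. *)
Definition Z0 z : C := lattice_sum tau (tz z).

Lemma Z0_clim z : clim (fun N => zsum N z) (Z0 z).
Proof.
  destruct (clim_cauchy (fun N => zsum N z)) as [l Hl].
  - intros e He. destruct (zsum_cauchy (Cmod z + 1) ltac:(generalize (Cmod_ge_0 z); lra) (e / 2)%R) as [N HN]; [lra|].
    exists N. intros n m Hn Hm. apply Rle_lt_trans with (e / 2)%R; [|lra]. apply HN; auto. lra.
  - unfold Z0. rewrite (lattice_sum_clim (tz z) l); exact Hl.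
Qed.

Lemma wzeta_Z0 z : wzeta tau z = 1 / z + Z0 z.
Proof. reflexivity. Qed.

Definition reg0 z : Prop := forall w, lattice tau w -> w <> 0 -> z <> w.

Lemma copen_reg0 : copen reg0.
Proof.
  intros z Hz. destruct (lattice_discrete z) as [d [Hd H]].
  exists d. split; [exact Hd|]. intros z' Hz' w Hw Hw0 ->.
  assert (w = z) by (apply H; assumption). subst w. exact (Hz z Hw Hw0 eq_refl).
Qed.

Lemma lpt_lattice (N j k : nat) : lattice tau (lpt N j k).
Proof.
  exists (Z.of_nat j - Z.of_nat N)%Z, (Z.of_nat k - Z.of_nat N)%Z.
  rewrite !minus_IZR, <- !INR_IZR_INZ. reflexivity.
Qed.

Lemma lpt_neq_0 (N j k : nat) : center N j k = false -> lpt N j k <> 0.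
Proof.
  intros H E. unfold lpt in E.
  assert (E1 := f_equal Re E). assert (E2 := f_equal Im E).
  rewrite re_lin, re_RtoC in E1. rewrite im_lin, im_RtoC in E2.
  assert (A : INR j = INR N) by lra. assert (B : INR k = INR N) by nra.
  apply INR_eq in A. apply INR_eq in B. subst. unfold center in H. rewrite !Nat.eqb_refl in H. discriminate.
Qed.

Lemma zsum_diff (N : nat) z : reg0 z -> cdiff (zsum N) z (- lattice_partial_sum tau (tp z) N).
Proof.
  intros Hz. rewrite lps_unfold, <- csum_opp.
  apply (cdiff_csum (fun j z => csum (fun k => if center N j k then RtoC 0 else tz z (lpt N j k)) (2 * N))).
  intros j _. rewrite <- csum_opp.
  apply (cdiff_csum (fun k z => if center N j k then RtoC 0 else tz z (lpt N j k))).
  intros k _. destruct (center N j k) eqn:E.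
  - eapply cdiff_val; [apply cdiff_const|ring].
  - assert (Hw := lpt_neq_0 N j k E).
    assert (Hzw : z - lpt N j k <> 0).
    { intros E'. apply (Hz _ (lpt_lattice N j k) Hw). apply Ceq_minus, E'. }
    unfold tz, tp. set (w := lpt N j k) in *.
    cd; try assumption; [apply Cmult_neq_0; assumption|]. field. split; assumption.
Qed.

Lemma zsum_uconv c (r : R) : 0 < r -> uconv (disc c r) zsum Z0.
Proof.
  intros Hr. apply uconv_of_cauchy; [|intros z _; apply Z0_clim].
  intros e He. destruct (zsum_cauchy (Cmod c + r) ltac:(generalize (Cmod_ge_0 c); lra) e He) as [N HN].
  exists N. intros n m Hn Hm z Hz. apply HN; auto.
  unfold disc in Hz. generalize (Cmod_minus_ge z c). lra.
Qed.

Lemma Z0_holo : holo reg0 Z0.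
Proof.
  intros z Hz. destruct (copen_reg0 z Hz) as [d [Hd H]].
  apply (weierstrass zsum Z0 z d Hd).
  - intros n w Hw. eexists. apply zsum_diff, H, Hw.
  - apply zsum_uconv, Hd.
  - apply disc_center, Hd.
Qed.

Lemma wp_Z0 z : reg0 z -> wp tau z = 1 / (z * z) - C_derive Z0 z.
Proof.
  intros Hz. change (wp tau z) with (1 / (z * z) + lattice_sum tau (tp z)).
  rewrite (lattice_sum_clim (tp z) (- C_derive Z0 z)); [reflexivity|].
  destruct (copen_reg0 z Hz) as [d [Hd H]].
  destruct (weierstrass zsum Z0 z d Hd) as [_ W].
  - intros n w Hw. eexists. apply zsum_diff, H, Hw.
  - apply zsum_uconv, Hd.
  - intros e He. destruct (W (e / 2)%R) as [N HN]; [lra|]. exists N. intros n Hn.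
    specialize (HN n Hn z (disc_center z (d / 2) ltac:(lra))).
    rewrite (C_derive_eq (zsum n) z _ (zsum_diff n z Hz)) in HN.
    rewrite <- Cmod_opp. replace (- (lattice_partial_sum tau (tp z) n - - C_derive Z0 z)) with
      (- lattice_partial_sum tau (tp z) n - C_derive Z0 z) by ring. lra.
Qed.

Lemma wzeta_diff z : ~ lattice tau z -> cdiff (wzeta tau) z (- wp tau z).
Proof.
  intros Hz.
  assert (Hr : reg0 z) by (intros w Hw _ ->; exact (Hz Hw)).
  assert (Hz0 : z <> 0) by (intros ->; exact (Hz lattice_0)).
  rewrite wp_Z0 by exact Hr.
  assert (HZ := cdiff_at reg0 Z0 z copen_reg0 Z0_holo Hr).
  apply (cdiff_ext (fun z => 1 / z + Z0 z)); [reflexivity|].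
  cd; [exact Hz0|]. field. exact Hz0.
Qed.

Lemma reg0_small z : Cmod z < kap -> reg0 z.
Proof. intros Hz w Hw Hw0 ->. exact (Hw0 (lattice_small w Hw Hz)). Qed.

Lemma Z0_derive_0 : C_derive Z0 0 = 0.
Proof.
  assert (H : wp tau 0 = 1 / (0 * 0) - C_derive Z0 0) by (apply wp_Z0, reg0_small; rewrite Cmod_0; apply kap_pos).
  assert (H2 : lattice_sum tau (tp 0) = 0).
  { apply lattice_sum_clim. intros e He. exists 0%nat. intros n _.
    rewrite lps_unfold. rewrite (csum_ext _ (fun _ => 0 * 0)).
    - rewrite csum_scal. replace (0 * csum (fun _ => 0) (2 * n) - 0) with (0:C) by ring. rewrite Cmod_0. exact He.
    - intros j _. rewrite (csum_ext _ (fun _ => 0 * 0)); [rewrite csum_scal; ring|].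
      intros k _. destruct (center n j k); [ring|]. unfold tp.
      replace ((0 - lpt n j k) * (0 - lpt n j k)) with (lpt n j k * lpt n j k) by ring. ring. }
  unfold wp in H. change (lattice_sum tau (fun w => 1 / ((0 - w) * (0 - w)) - 1 / (w * w))) with (lattice_sum tau (tp 0)) in H.
  rewrite H2 in H.
  replace (C_derive Z0 0) with (1 / (0 * 0) - (1 / (0 * 0) - C_derive Z0 0)) by ring. rewrite <- H. ring.
Qed.

Lemma Cinv_0 : / (0 : C) = 0.
Proof. apply injective_projections; simpl; unfold Rdiv; ring. Qed.

Lemma Cinv_opp z : / (- z) = - / z.
Proof.
  destruct (classic (z = 0)) as [->|Hz].
  - replace (- (0:C)) with (0:C) by ring. rewrite Cinv_0. ring.
  - field. exact Hz.
Qed.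

Lemma Cinv_conj' z : Cconj (/ z) = / Cconj z.
Proof.
  destruct (classic (z = 0)) as [->|Hz]; [|apply Cinv_conj, Hz].
  replace (Cconj 0) with (0:C) by (apply injective_projections; simpl; ring). rewrite Cinv_0.
  apply injective_projections; simpl; ring.
Qed.

Lemma Cconj_R (x : R) : Cconj (RtoC x) = RtoC x.
Proof. apply injective_projections; simpl; ring. Qed.

Lemma clim_minus (u v : nat -> C) (l m : C) : clim u l -> clim v m -> clim (fun n => u n - v n) (l - m).
Proof.
  intros Hu Hv e He. destruct (Hu (e / 2)%R) as [N1 H1]; [lra|]. destruct (Hv (e / 2)%R) as [N2 H2]; [lra|].
  exists (max N1 N2). intros n Hn. specialize (H1 n ltac:(lia)). specialize (H2 n ltac:(lia)).
  replace (u n - v n - (l - m)) with ((u n - l) - (v n - m)) by ring.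
  eapply Rle_lt_trans; [apply Cmod_minus_le|]. lra.
Qed.

Lemma clim_const_plus c (u : nat -> C) (l : C) : clim u l -> clim (fun n => c + u n) (c + l).
Proof.
  intros H e He. destruct (H e He) as [N HN]. exists N. intros n Hn.
  replace (c + u n - (c + l)) with (u n - l) by ring. auto.
Qed.

Lemma csum_telescope (F G : nat -> C) (n : nat) :
  (forall j, G (S j) = F j) -> csum G n - csum F n = G 0%nat - F n.
Proof.
  intros H. induction n as [|n IH]; [rewrite !csum_O; reflexivity|].
  rewrite !csum_S, H. replace (csum G n + F n - (csum F n + F (S n))) with (csum G n - csum F n + F n - F (S n)) by ring.
  rewrite IH. ring.
Qed.

Lemma center_rev (N j k : nat) : (j <= 2 * N)%nat -> (k <= 2 * N)%nat ->
  center N (2 * N - j) (2 * N - k) = center N j k.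
Proof.
  intros Hj Hk. unfold center.
  destruct (Nat.eqb_spec (2 * N - j) N), (Nat.eqb_spec j N), (Nat.eqb_spec (2 * N - k) N), (Nat.eqb_spec k N);
    simpl; try reflexivity; exfalso; lia.
Qed.

Lemma center_rev_r (N j k : nat) : (k <= 2 * N)%nat -> center N j (2 * N - k) = center N j k.
Proof.
  intros Hk. unfold center. f_equal.
  destruct (Nat.eqb_spec (2 * N - k) N), (Nat.eqb_spec k N); try reflexivity; exfalso; lia.
Qed.

Lemma lpt_rev (N j k : nat) : (j <= 2 * N)%nat -> (k <= 2 * N)%nat ->
  lpt N (2 * N - j) (2 * N - k) = - lpt N j k.
Proof.
  intros Hj Hk. unfold lpt. rewrite !minus_INR, mult_INR by assumption. simpl (INR 2).
  replace ((1 + 1) * INR N - INR j - INR N)%R with (- (INR j - INR N))%R by ring.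
  replace ((1 + 1) * INR N - INR k - INR N)%R with (- (INR k - INR N))%R by ring.
  rewrite !RtoC_opp. ring.
Qed.

Lemma lps_opp (a : C -> C) (N : nat) :
  lattice_partial_sum tau (fun w => a (- w)) N = lattice_partial_sum tau a N.
Proof.
  rewrite !lps_unfold.
  rewrite <- (csum_rev (fun j => csum (fun k => if center N j k then RtoC 0 else a (lpt N j k)) (2 * N))).
  apply csum_ext. intros j Hj.
  rewrite <- (csum_rev (fun k => if center N (2 * N - j) k then RtoC 0 else a (lpt N (2 * N - j) k))).
  apply csum_ext. intros k Hk.
  rewrite center_rev, lpt_rev by assumption. reflexivity.
Qed.

Lemma lps_conj (a : C -> C) (N : nat) :
  lattice_partial_sum tau (fun w => a (Cconj w)) N = lattice_partial_sum tau a N.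
Proof.
  rewrite !lps_unfold. apply csum_ext. intros j Hj.
  rewrite <- (csum_rev (fun k => if center N j k then RtoC 0 else a (lpt N j k))).
  apply csum_ext. intros k Hk. rewrite center_rev_r by assumption.
  replace (lpt N j (2 * N - k)) with (Cconj (lpt N j k)); [reflexivity|].
  unfold lpt. rewrite Cplus_conj, Cmult_conj, !Cconj_R, tau_conj, minus_INR, mult_INR by assumption.
  simpl (INR 2). replace ((1 + 1) * INR N - INR k - INR N)%R with (- (INR k - INR N))%R by ring.
  rewrite RtoC_opp. ring.
Qed.

Lemma tz_opp z w : tz (- z) w = - tz z (- w).
Proof.
  unfold tz, Cdiv. replace (- z - w) with (- (z - - w)) by ring. replace (- w * - w) with (w * w) by ring.
  rewrite !Cinv_opp. ring.
Qed.

Lemma tz_conj z w : tz (Cconj z) (Cconj w) = Cconj (tz z w).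
Proof.
  unfold tz, Cdiv. rewrite <- Cminus_conj, <- Cmult_conj, <- !Cinv_conj', !Cplus_conj, !Cmult_conj, !Cconj_R. reflexivity.
Qed.

(** The enumeration of the lattice by squares is symmetric, so the symmetries of
    the terms pass to the sum. *)
Lemma Z0_equivariant (phi : C -> C) z : (forall a b, phi (a - b) = phi a - phi b) -> (forall a, Cmod (phi a) = Cmod a) ->
  (forall (a : C -> C) N, lattice_partial_sum tau (fun w => a (phi w)) N = lattice_partial_sum tau a N) ->
  (forall w, tz (phi z) (phi w) = phi (tz z w)) -> Z0 (phi z) = phi (Z0 z).
Proof.
  intros Hm Hn Hp Ht. assert (H0 : phi 0 = 0).
  { replace (RtoC 0) with (0 - 0) at 1 by ring. rewrite Hm. ring. }
  assert (Hs : forall (f : nat -> C) n, csum (fun k => phi (f k)) n = phi (csum f n)).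
  { intros f n. induction n as [|n IH]; [rewrite !csum_O; reflexivity|]. rewrite !csum_S, IH.
    replace (csum f n + f (S n)) with (csum f n - (0 - f (S n))) by ring. rewrite !Hm, H0. ring. }
  apply (clim_unique (fun N => zsum N (phi z))); [apply Z0_clim|].
  intros e He. destruct (Z0_clim z e He) as [N HN]. exists N. intros n Hl.
  replace (zsum n (phi z)) with (phi (zsum n z)); [rewrite <- Hm, Hn; apply HN, Hl|].
  unfold zsum. rewrite <- (Hp (tz (phi z))), !lps_unfold, <- Hs. apply csum_ext. intros j _.
  rewrite <- Hs. apply csum_ext. intros k _. destruct (center n j k); [exact H0|symmetry; apply Ht].
Qed.

Lemma Z0_odd z : Z0 (- z) = - Z0 z.
Proof.
  apply (Z0_equivariant Copp); [intros; ring|apply Cmod_opp|apply lps_opp|].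
  intros w. rewrite tz_opp. do 2 f_equal. ring.
Qed.

Lemma Z0_conj z : Z0 (Cconj z) = Cconj (Z0 z).
Proof. apply Z0_equivariant; [apply Cminus_conj|apply Cmod_conj|apply lps_conj|apply tz_conj]. Qed.

Lemma wzeta_odd z : wzeta tau (- z) = - wzeta tau z.
Proof. rewrite !wzeta_Z0, Z0_odd. unfold Cdiv. rewrite Cinv_opp. ring. Qed.

Lemma wzeta_conj z : wzeta tau (Cconj z) = Cconj (wzeta tau z).
Proof.
  rewrite !wzeta_Z0, Z0_conj, Cplus_conj. f_equal. unfold Cdiv. rewrite Cmult_conj, Cconj_R, Cinv_conj'. reflexivity.
Qed.

Definition fullsum (N : nat) z : C :=
  csum (fun j => csum (fun k => / (z - lpt N j k)) (2 * N)) (2 * N).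

Lemma csum_center c (N : nat) :
  csum (fun j => csum (fun k => if center N j k then c else RtoC 0) (2 * N)) (2 * N) = c.
Proof.
  transitivity (csum (fun j => if Nat.eqb j N then c else RtoC 0) (2 * N)); [|apply csum_delta; lia].
  apply csum_ext. intros j _.
  unfold center. destruct (Nat.eqb j N); simpl.
  - apply csum_delta. lia.
  - rewrite (csum_ext _ (fun _ => 0 * 0)); [rewrite csum_scal; ring|intros; ring].
Qed.

Lemma lpt_center (N j k : nat) : center N j k = true -> lpt N j k = 0.
Proof.
  unfold center. intros H. apply andb_prop in H. destruct H as [H1 H2].
  apply Nat.eqb_eq in H1. apply Nat.eqb_eq in H2. subst. unfold lpt.
  rewrite Rminus_diag. ring.
Qed.

Lemma zsum_full (N : nat) z :
  1 / z + zsum N z = fullsum N z + lattice_partial_sum tau (fun w => 1 / w) N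
    + z * lattice_partial_sum tau (fun w => 1 / (w * w)) N.
Proof.
  unfold zsum, fullsum. rewrite !lps_unfold. rewrite <- (csum_center (1 / z) N) at 1.
  rewrite <- csum_scal, <- !csum_plus. apply csum_ext. intros j _.
  rewrite <- csum_scal, <- !csum_plus. apply csum_ext. intros k _.
  destruct (center N j k) eqn:E.
  - rewrite (lpt_center _ _ _ E). replace (z - 0) with z by ring. unfold Cdiv. ring.
  - unfold tz, Cdiv. ring.
Qed.

Definition wincr (N : nat) om z : C := (1 / (z + om) + zsum N (z + om)) - (1 / z + zsum N z).

Lemma wincr_clim om z : clim (fun N => wincr N om z) (wzeta tau (z + om) - wzeta tau z).
Proof. apply clim_minus; apply clim_const_plus, Z0_clim; assumption. Qed.

Lemma edge_bound (u u' w : C) (rho M : R) : 0 < rho ->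
  Cmod u <= rho -> Cmod u' <= rho -> 2 * rho <= M -> M <= Cmod w ->
  Cmod (/ (u - w) - / (u' - w)) <= 8 * rho / (M * M).
Proof.
  intros Hr Hu Hu' HM Hw.
  assert (H1 : M / 2 <= Cmod (u - w)) by (rewrite Cmod_sym; generalize (Cmod_minus_ge w u); lra).
  assert (H2 : M / 2 <= Cmod (u' - w)) by (rewrite Cmod_sym; generalize (Cmod_minus_ge w u'); lra).
  assert (N1 : u - w <> 0) by (apply Cmod_gt_0; lra).
  assert (N2 : u' - w <> 0) by (apply Cmod_gt_0; lra).
  replace (/ (u - w) - / (u' - w)) with ((u' - u) * / ((u - w) * (u' - w))) by (field; split; assumption).
  rewrite Cmod_mult, Cmod_inv, Cmod_mult by (apply Cmult_neq_0; assumption).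
  apply Rle_trans with (2 * rho * / (M / 2 * (M / 2)))%R; [|right; field; lra].
  apply Rmult_le_compat; [apply Cmod_ge_0| | |].
  - left. apply Rinv_0_lt_compat, Rmult_lt_0_compat; lra.
  - eapply Rle_trans; [apply Cmod_minus_le|]. lra.
  - apply Rinv_le_contravar; [apply Rmult_lt_0_compat; lra|]. apply Rmult_le_compat; lra.
Qed.

(** After the shift by a period the square sums of [1/(z-w)] differ only by two edges
    of the square. *)
Lemma fullsum_shift_1 (N : nat) z :
  fullsum N (z + 1) - fullsum N z =
  csum (fun k => / (z + 1 - lpt N 0 k)) (2 * N) - csum (fun k => / (z - lpt N (2 * N) k)) (2 * N).
Proof.
  unfold fullsum.
  apply (csum_telescope (fun j => csum (fun k => / (z - lpt N j k)) (2 * N))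
    (fun j => csum (fun k => / (z + 1 - lpt N j k)) (2 * N))).
  intros j. apply csum_ext. intros k _. f_equal. unfold lpt. rewrite S_INR.
  replace (INR j + 1 - INR N)%R with ((INR j - INR N) + 1)%R by ring. rewrite RtoC_plus. ring.
Qed.

Lemma fullsum_shift_tau (N : nat) z :
  fullsum N (z + tau) - fullsum N z =
  csum (fun j => / (z + tau - lpt N j 0)) (2 * N) - csum (fun j => / (z - lpt N j (2 * N))) (2 * N).
Proof.
  unfold fullsum.
  rewrite (csum_swap (fun j k => / (z + tau - lpt N j k))), (csum_swap (fun j k => / (z - lpt N j k))).
  apply (csum_telescope (fun k => csum (fun j => / (z - lpt N j k)) (2 * N))
    (fun k => csum (fun j => / (z + tau - lpt N j k)) (2 * N))).
  intros k. apply csum_ext. intros j _. f_equal. unfold lpt. rewrite S_INR.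
  replace (INR k + 1 - INR N)%R with ((INR k - INR N) + 1)%R by ring. rewrite RtoC_plus. ring.
Qed.

(** The increment over a period tends to a sum over two edges, which contribute
    [O(N)] terms; their dependence on [z] is [O(1/N^2)]. *)
Lemma wincr_const om z z' (e1 e2 : nat -> nat -> C) :
  (forall N z, fullsum N (z + om) - fullsum N z =
     csum (fun k => / (z + om - e1 N k)) (2 * N) - csum (fun k => / (z - e2 N k)) (2 * N)) ->
  (forall N k, (k <= 2 * N)%nat -> kap * INR N <= Cmod (e1 N k) /\ kap * INR N <= Cmod (e2 N k)) ->
  wzeta tau (z + om) - wzeta tau z = wzeta tau (z' + om) - wzeta tau z'.
Proof.
  intros Hshift Hfar. assert (K := kap_pos).
  apply Ceq_minus.
  apply (clim_unique (fun N => wincr N om z - wincr N om z')).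
  { apply clim_minus; apply wincr_clim. }
  set (rho := (Cmod z + Cmod z' + Cmod om + 1)%R).
  assert (G1 := Cmod_ge_0 z). assert (G2 := Cmod_ge_0 z'). assert (G3 := Cmod_ge_0 om).
  assert (Hrho : 0 < rho) by (unfold rho; lra).
  assert (R1 : Cmod (z + om) <= rho) by (eapply Rle_trans; [apply Cmod_triangle|unfold rho; lra]).
  assert (R2 : Cmod (z' + om) <= rho) by (eapply Rle_trans; [apply Cmod_triangle|unfold rho; lra]).
  assert (R3 : Cmod z <= rho) by (unfold rho; lra).
  assert (R4 : Cmod z' <= rho) by (unfold rho; lra).
  intros e He.
  assert (P1 : 0 < 2 * rho / kap) by (apply Rdiv_lt_0_compat; lra).
  assert (P2 : 0 < 48 * rho / (kap * kap) / e).
  { repeat apply Rdiv_lt_0_compat; try lra. apply Rmult_lt_0_compat; lra. }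
  destruct (INR_unbounded (2 * rho / kap + 48 * rho / (kap * kap) / e + 1)) as [N0 HN0].
  exists N0. intros N HN. apply le_INR in HN.
  assert (HN1 : 2 * rho / kap < INR N) by lra.
  assert (HN2 : 48 * rho / (kap * kap) / e < INR N) by lra.
  assert (HN3 : 1 < INR N) by lra.
  set (M := (kap * INR N)%R).
  assert (HM : 2 * rho <= M).
  { unfold M. apply Rle_trans with (kap * (2 * rho / kap))%R; [right; field; lra|].
    apply Rmult_le_compat_l; lra. }
  set (B := (8 * rho / (M * M))%R).
  replace (wincr N om z - wincr N om z' - 0) with
    (csum (fun k => / (z + om - e1 N k) - / (z' + om - e1 N k)) (2 * N) -
     csum (fun k => / (z - e2 N k) - / (z' - e2 N k)) (2 * N)).
  2:{ unfold wincr. rewrite !zsum_full, !csum_minus.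
      generalize (Hshift N z), (Hshift N z'). intros E1 E2.
      match goal with |- ?X - ?Y - (?V - ?W) = _ => replace (X - Y - (V - W)) with ((X - V) - (Y - W)) by ring end.
      rewrite <- E1, <- E2. ring. }
  assert (B1 : Cmod (csum (fun k => / (z + om - e1 N k) - / (z' + om - e1 N k))%C (2 * N)) <= INR (S (2 * N)) * B).
  { apply csum_bound. intros k Hk. apply edge_bound; auto. apply (Hfar N k Hk). }
  assert (B2 : Cmod (csum (fun k => / (z - e2 N k) - / (z' - e2 N k))%C (2 * N)) <= INR (S (2 * N)) * B).
  { apply csum_bound. intros k Hk. apply edge_bound; auto. apply (Hfar N k Hk). }
  eapply Rle_lt_trans; [apply Cmod_minus_le|].
  rewrite S_INR, mult_INR in B1, B2. simpl (INR 2) in B1, B2.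
  assert (HB : 0 < B).
  { unfold B. apply Rdiv_lt_0_compat; [lra|]. apply Rmult_lt_0_compat; lra. }
  apply Rle_lt_trans with (6 * INR N * B)%R.
  { assert (B <= INR N * B) by (rewrite <- (Rmult_1_l B) at 1; apply Rmult_le_compat_r; lra). lra. }
  replace (6 * INR N * B)%R with (48 * rho / (kap * kap) / INR N)%R.
  2:{ unfold B, M. field. lra. }
  apply (Rmult_lt_reg_r (INR N)); [lra|]. unfold Rdiv at 1. rewrite Rmult_assoc, Rinv_l, Rmult_1_r by lra.
  apply Rle_lt_trans with (e * (48 * rho / (kap * kap) / e))%R; [right; field; lra|].
  apply Rmult_lt_compat_l; lra.
Qed.

Lemma wincr_1 z z' : wzeta tau (z + 1) - wzeta tau z = wzeta tau (z' + 1) - wzeta tau z'.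
Proof.
  apply (wincr_const 1 z z' (fun N k => lpt N 0 k) (fun N k => lpt N (2 * N) k)).
  - intros N w. apply fullsum_shift_1.
  - intros N k Hk. split; apply shell_far; auto; unfold shell; lia.
Qed.

Lemma wincr_tau z z' : wzeta tau (z + tau) - wzeta tau z = wzeta tau (z' + tau) - wzeta tau z'.
Proof.
  apply (wincr_const tau z z' (fun N j => lpt N j 0) (fun N j => lpt N j (2 * N))).
  - intros N w. apply fullsum_shift_tau.
  - intros N k Hk. split; apply shell_far; auto; unfold shell; lia.
Qed.

Lemma half_not_lattice : ~ lattice tau (/ 2).
Proof.
  intros (m & n & E). assert (E1 := f_equal Re E). rewrite re_lin in E1.
  rewrite <- RtoC_inv, re_RtoC in E1 by lra.
  assert (E2 : (2 * m)%Z = 1%Z) by (apply eq_IZR; rewrite mult_IZR; lra). lia.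
Qed.

Lemma eta_eq (k : nat) c : (forall z, wzeta tau (z + omega tau k) - wzeta tau z = c) -> eta tau k = c.
Proof.
  intros H. apply the_unique.
  - intros z _. apply H.
  - intros w Hw. rewrite <- (Hw _ half_not_lattice). apply H.
Qed.

Lemma wzeta_plus_1 z : wzeta tau (z + 1) = wzeta tau z + eta tau 1.
Proof. rewrite (eta_eq 1 (wzeta tau (z + 1) - wzeta tau z)); [ring|]. intros z'. apply wincr_1. Qed.

Lemma wzeta_plus_tau z : wzeta tau (z + tau) = wzeta tau z + eta tau 2.
Proof. rewrite (eta_eq 2 (wzeta tau (z + tau) - wzeta tau z)); [ring|]. intros z'. apply wincr_tau. Qed.

Lemma eta_0 : eta tau 0 = 0.
Proof. apply eta_eq. intros z. simpl. replace (z + 0) with z by ring. ring. Qed.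

Lemma eta_1_real : Im (eta tau 1) = 0%R.
Proof.
  rewrite (eta_eq 1 (wzeta tau (0 + 1) - wzeta tau 0)) by (intros; apply wincr_1).
  assert (E : forall x : R, Im (wzeta tau (RtoC x)) = 0%R).
  { intros x. assert (E := f_equal Im (wzeta_conj (RtoC x))). rewrite Cconj_R, im_conj in E. lra. }
  rewrite im_minus, <- RtoC_plus, !E. ring.
Qed.

Lemma eta_2_imag : Re (eta tau 2) = 0%R.
Proof.
  rewrite (eta_eq 2 (wzeta tau (0 + tau) - wzeta tau 0)) by (intros; apply wincr_tau).
  assert (E : forall z : C, Cconj z = - z -> Re (wzeta tau z) = 0%R).
  { intros z Hz. assert (E := f_equal Re (wzeta_conj z)). rewrite Hz, wzeta_odd, re_conj, re_opp in E. lra. }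
  rewrite re_minus, !E; [ring| |].
  - rewrite Cconj_R. ring.
  - replace (0 + tau) with tau by ring. apply tau_conj.
Qed.

Lemma tends_cont (f k : C -> C) p (d : R) : 0 < d -> ccont k p ->
  (forall z, punctured p d z -> f z = k z) -> tends f p (k p).
Proof.
  intros Hd Hk E e He. destruct (Hk e He) as [d' [Hd' H]].
  exists (Rmin d d'). split; [apply Rmin_pos; assumption|]. intros z Hne Hz.
  rewrite E; [apply H; apply (Rmin_Rgt_l _ _ _ Hz)|].
  split; [exact Hne|]. apply (Rmin_Rgt_l _ _ _ Hz).
Qed.

Lemma cont_unique f g p (d : R) : 0 < d -> ccont f p -> ccont g p ->
  (forall z, punctured p d z -> f z = g z) -> f p = g p.
Proof.
  intros Hd Hf Hg E. apply Ceq_minus, Cmod_eq_0. apply Rle_antisym; [|apply Cmod_ge_0].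
  apply Rnot_lt_le. intros Hlt. set (X := Cmod (f p - g p)) in *.
  destruct (Hf (X / 2)%R) as [d1 [Hd1 H1]]; [lra|]. destruct (Hg (X / 2)%R) as [d2 [Hd2 H2]]; [lra|].
  set (m := Rmin d (Rmin d1 d2)). assert (Hm : 0 < m) by (repeat apply Rmin_pos; assumption).
  set (z := p + RtoC (m / 2)).
  assert (Ez : Cmod (z - p) = (m / 2)%R).
  { unfold z. replace (p + RtoC (m / 2) - p) with (RtoC (m / 2)) by ring. rewrite Cmod_R, Rabs_pos_eq; lra. }
  assert (M1 : m <= d) by apply Rmin_l.
  assert (M2 : m <= d1) by (eapply Rle_trans; [apply Rmin_r|apply Rmin_l]).
  assert (M3 : m <= d2) by (eapply Rle_trans; [apply Rmin_r|apply Rmin_r]).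
  specialize (H1 z ltac:(lra)). specialize (H2 z ltac:(lra)).
  rewrite (E z) in H1.
  - rewrite Cmod_sym in H1. generalize (Cmod_tri_minus (f p) (g z) (g p)). fold X. lra.
  - split; [|lra]. intros ->. rewrite Cmod_self in Ez. lra.
Qed.

Lemma ccont_shift f a p : ccont f (p + a) -> ccont (fun z => f (z + a)) p.
Proof.
  intros H e He. destruct (H e He) as [d [Hd H1]]. exists d. split; [exact Hd|].
  intros z Hz. apply H1. replace (z + a - (p + a)) with (z - p) by ring. exact Hz.
Qed.

Lemma lattice_ind (P : C -> Prop) : P 0 ->
  (forall v, P v -> P (v + 1)) -> (forall v, P v -> P (v - 1)) ->
  (forall v, P v -> P (v + tau)) -> (forall v, P v -> P (v - tau)) ->
  forall v, lattice tau v -> P v.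
Proof.
  intros H0 H1 H2 H3 H4 v (m & n & ->).
  assert (A : forall m : Z, P (RtoC (IZR m))).
  { intros k. induction k using Z.peano_ind.
    - exact H0.
    - rewrite succ_IZR, RtoC_plus. apply H1, IHk.
    - replace (RtoC (IZR (Z.pred k))) with (RtoC (IZR k) - 1); [apply H2, IHk|].
      rewrite <- Z.sub_1_r, minus_IZR, RtoC_minus. reflexivity. }
  induction n using Z.peano_ind.
  - replace (RtoC (IZR m) + RtoC 0 * tau) with (RtoC (IZR m)) by ring. apply A.
  - rewrite succ_IZR, RtoC_plus.
    replace (RtoC (IZR m) + (RtoC (IZR n) + 1) * tau) with (RtoC (IZR m) + RtoC (IZR n) * tau + tau) by ring.
    apply H3, IHn.
  - replace (RtoC (IZR m) + RtoC (IZR (Z.pred n)) * tau) with (RtoC (IZR m) + RtoC (IZR n) * tau - tau); [apply H4, IHn|].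
    rewrite <- Z.sub_1_r, minus_IZR, RtoC_minus. ring.
Qed.

Lemma lattice_reduce z : exists v x y, lattice tau v /\ 0 <= x <= 1 /\ 0 <= y <= 1 /\
  z = RtoC x + RtoC y * tau + v.
Proof.
  set (y := (Im z / Im tau)%R). set (x := Re z).
  exists (RtoC (IZR (Int_part x)) + RtoC (IZR (Int_part y)) * tau), (frac_part x), (frac_part y).
  split; [exists (Int_part x), (Int_part y); reflexivity|].
  destruct (base_fp x) as [X1 X2]. destruct (base_fp y) as [Y1 Y2].
  split; [lra|]. split; [lra|].
  apply C_eq.
  - rewrite re_plus, !re_lin. unfold frac_part, x. ring.
  - rewrite im_plus, !im_lin. unfold frac_part. fold y.
    replace (Im z) with (y * Im tau)%R; [ring|]. unfold y. field. lra.
Qed.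

Lemma periodic_bounded h : (forall z, ccont h z) ->
  (forall z, h (z + 1) = h z) -> (forall z, h (z + tau) = h z) ->
  exists M : R, forall z, Cmod (h z) <= M.
Proof.
  intros Hc H1 Ht.
  assert (Hper : forall v, lattice tau v -> forall z, h (z + v) = h z).
  { apply (lattice_ind (fun v => forall z, h (z + v) = h z)).
    - intros z. f_equal. ring.
    - intros v IH z. replace (z + (v + 1)) with (z + v + 1) by ring. rewrite H1. apply IH.
    - intros v IH z. rewrite <- (IH z), <- H1. f_equal. ring.
    - intros v IH z. replace (z + (v + tau)) with (z + v + tau) by ring. rewrite Ht. apply IH.
    - intros v IH z. rewrite <- (IH z), <- Ht. f_equal. ring. }
  destruct (box_min (fun z => - Cmod (h z))%R 0 1 0 (Im tau)) as (x0 & y0 & _ & _ & H); [lra|lra| |].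
  - intros x y _ _ e He. destruct (Hc (ptc x y) e He) as [r [Hr H]]. exists r. split; [exact Hr|]. intros w Hw.
    specialize (H w Hw). generalize (Cmod_minus_ge (h w) (h (ptc x y))), (Cmod_minus_ge (h (ptc x y)) (h w)).
    rewrite (Cmod_sym (h (ptc x y))). intros K1 K2. apply Rabs_def1; lra.
  - exists (Cmod (h (ptc x0 y0))). intros z. destruct (lattice_reduce z) as (v & x & y & Hv & Hx & Hy & ->).
    rewrite Hper by exact Hv. replace (RtoC x + RtoC y * tau) with (ptc x (y * Im tau)).
    + specialize (H x (y * Im tau)%R Hx ltac:(split; nra)). lra.
    + symmetry. transitivity (RtoC x + RtoC y * (RtoC (Im tau) * Ci)); [rewrite <- tau_eq; reflexivity|]. unfold ptc. rewrite RtoC_mult. ring.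
Qed.

(** * Elliptic functions for the half lattice *)

Definition discrete (sing : C -> Prop) : Prop :=
  forall z, exists d : R, 0 < d /\ forall w, sing w -> Cmod (w - z) < d -> w = z.

(** Removing the singularities leaves an entire doubly periodic function. *)
Theorem elliptic_constant (sing : C -> Prop) h :
  discrete sing -> (forall z, sing (z + 1) <-> sing z) -> (forall z, sing (z + tau) <-> sing z) ->
  holo (fun z => ~ sing z) h ->
  (forall z, ~ sing z -> h (z + 1) = h z) -> (forall z, ~ sing z -> h (z + tau) = h z) ->
  (forall p, sing p -> tends (fun z => (z - p) * h z) p 0) ->
  exists c, forall z, ~ sing z -> h z = c.
Proof.
  intros Hd Hs1 Hst Hh H1 Ht Hrem.
  assert (Hloc : forall p, exists dk : R * (C -> C), 0 < fst dk /\ holo (disc p (fst dk)) (snd dk) /\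
     (forall z, punctured p (fst dk) z -> ~ sing z /\ h z = snd dk z) /\ (~ sing p -> h p = snd dk p)).
  { intros p. destruct (Hd p) as [d [Hd0 Hdp]].
    destruct (classic (sing p)) as [Hp|Hp].
    - destruct (removable h p d Hd0) as [k [Hk Ek]].
      + intros z [Hne Hz]. apply Hh. intros Hz'. apply Hne. apply Hdp; assumption.
      + apply Hrem, Hp.
      + exists (d, k). simpl. repeat split; auto.
        * intros Hz'. destruct H as [Hne Hz]. apply Hne, Hdp; assumption.
        * contradiction.
    - exists (d, h). simpl. repeat split; auto.
      + intros z Hz. apply Hh. intros Hz'. assert (z = p) by (apply Hdp; assumption). subst z. contradiction.
      + intros Hz'. destruct H as [Hne Hz]. apply Hne, Hdp; assumption. }
  apply choice in Hloc. destruct Hloc as [dk Hdk].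
  set (H := fun p => snd (dk p) p).
  assert (EH : forall p z, disc p (fst (dk p)) z -> snd (dk p) z = H z).
  { intros p z Hz. destruct (classic (z = p)) as [->|Hne]; [reflexivity|].
    destruct (Hdk p) as (D1 & D2 & D3 & D4). destruct (D3 z (conj Hne Hz)) as [S1 S2].
    destruct (Hdk z) as (E1 & E2 & E3 & E4). unfold H. rewrite <- S2. apply E4, S1. }
  assert (HH : forall z, exists l, cdiff H z l).
  { intros p. destruct (Hdk p) as (D1 & D2 & D3 & D4).
    destruct (D2 p (disc_center p _ D1)) as [l Hl]. exists l.
    apply (cdiff_loc (snd (dk p)) H p l (fst (dk p)) D1); [|exact Hl].
    intros z Hz. apply EH, Hz. }
  assert (Hc : forall z, ccont H z) by (intros z; destruct (HH z) as [l Hl]; exact (cdiff_ccont _ _ _ Hl)).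
  assert (Hns : forall z, ~ sing z -> H z = h z).
  { intros z Hz. destruct (Hdk z) as (E1 & E2 & E3 & E4). symmetry. apply E4, Hz. }
  assert (Hper : forall om, (forall z, sing (z + om) <-> sing z) -> (forall z, ~ sing z -> h (z + om) = h z) ->
     forall z, H (z + om) = H z).
  { intros om Hso Ho z. destruct (Hd z) as [d [Hd0 Hdz]].
    apply (cont_unique (fun z => H (z + om)) H z d Hd0).
    - apply (ccont_shift H), Hc.
    - apply Hc.
    - intros w [Hne Hw].
      assert (Hw' : ~ sing w) by (intros Hw'; apply Hne, Hdz; assumption).
      rewrite !Hns; auto. intros Hw''. apply Hw', Hso, Hw''. }
  destruct (periodic_bounded H Hc (Hper 1 Hs1 H1) (Hper tau Hst Ht)) as [M HM].
  exists (H 0). intros z Hz. rewrite <- Hns by exact Hz.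
  apply (liouville H M); [intros w _; apply HH|exact HM].
Qed.

(** The half lattice, on which all the elliptic functions below have their poles. *)
Definition hlat z : Prop := lattice tau (2 * z).

Lemma hlat_shift_1 z : hlat (z + / 2) <-> hlat z.
Proof.
  unfold hlat. replace (2 * (z + / 2)) with (2 * z + 1) by field. split; intros H.
  - replace (2 * z) with (2 * z + 1 - 1) by ring. apply lattice_minus; [exact H|apply lattice_1].
  - apply lattice_plus; [exact H|apply lattice_1].
Qed.

Lemma hlat_shift_tau z : hlat (z + tau / 2) <-> hlat z.
Proof.
  unfold hlat. replace (2 * (z + tau / 2)) with (2 * z + tau) by field. split; intros H.
  - replace (2 * z) with (2 * z + tau - tau) by ring. apply lattice_minus; [exact H|apply lattice_tau].
  - apply lattice_plus; [exact H|apply lattice_tau].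
Qed.

Lemma hlat_opp z : hlat (- z) <-> hlat z.
Proof.
  unfold hlat. replace (2 * - z) with (- (2 * z)) by ring. split; intros H.
  - replace (2 * z) with (- - (2 * z)) by ring. apply lattice_opp, H.
  - apply lattice_opp, H.
Qed.

Lemma hlat_discrete : discrete hlat.
Proof.
  intros z. destruct (lattice_discrete (2 * z)) as [d [Hd H]].
  exists (d / 2)%R. split; [lra|]. intros w Hw Hwz.
  assert (E : 2 * w = 2 * z).
  { apply H; [exact Hw|]. replace (2 * w - 2 * z) with (2 * (w - z)) by ring.
    rewrite Cmod_mult, Cmod_R, Rabs_pos_eq; lra. }
  replace w with (/ 2 * (2 * w)) by field. rewrite E. field.
Qed.

Lemma copen_not_discrete (sing : C -> Prop) : discrete sing -> copen (fun z => ~ sing z).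
Proof.
  intros Hd z Hz. destruct (Hd z) as [d [Hd0 H]]. exists d. split; [exact Hd0|].
  intros w Hw Hs. apply Hz. rewrite <- (H w Hs Hw). exact Hs.
Qed.

Lemma copen_nhlat : copen (fun z => ~ hlat z).
Proof. apply copen_not_discrete, hlat_discrete. Qed.

(** Translation by a half lattice point multiplies [h] by a number of modulus 1,
    so the singularity at 0 decides for all. *)
Theorem half_elliptic_constant h (c1 ct : C) : c1 * c1 = 1 -> ct * ct = 1 ->
  holo (fun z => ~ hlat z) h ->
  (forall z, ~ hlat z -> h (z + / 2) = c1 * h z) -> (forall z, ~ hlat z -> h (z + tau / 2) = ct * h z) ->
  tends (fun u => u * h u) 0 0 ->
  exists c, forall z, ~ hlat z -> h z = c.
Proof.
  intros E1 Et Hh H1 Ht H0.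
  set (P := fun v => exists c, Cmod c = 1%R /\ forall z, ~ hlat z -> h (z + v / 2) = c * h z).
  assert (Hs : forall om c0, c0 * c0 = 1 -> (forall z, hlat (z + om / 2) <-> hlat z) ->
    (forall z, ~ hlat z -> h (z + om / 2) = c0 * h z) -> forall v, P v -> P (v + om) /\ P (v - om)).
  { intros om c0 Hc0 Hsh Ho v (c & Hc & H).
    assert (Hm : Cmod (c0 * c) = 1%R).
    { assert (K := f_equal Cmod Hc0). rewrite Cmod_mult, Cmod_1 in K. rewrite Cmod_mult, Hc. generalize (Cmod_ge_0 c0). nra. }
    split; exists (c0 * c); (split; [exact Hm|]); intros z Hz.
    - replace (z + (v + om) / 2) with (z + om / 2 + v / 2) by field. rewrite H, Ho by (try rewrite Hsh; exact Hz). ring.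
    - set (w := z - om / 2). assert (Ez : z = w + om / 2) by (unfold w; ring).
      assert (Hw : ~ hlat w) by (rewrite <- Hsh, <- Ez; exact Hz).
      transitivity (h (w + v / 2)); [f_equal; unfold w; field|]. rewrite H by exact Hw. rewrite Ez, Ho by exact Hw.
      transitivity (c0 * c0 * (c * h w)); [rewrite Hc0; ring|ring]. }
  assert (E2 : RtoC 1 / 2 = / 2) by field.
  assert (Hs1 := Hs 1 c1 E1). rewrite E2 in Hs1. specialize (Hs1 hlat_shift_1 H1). assert (Hst := Hs tau ct Et hlat_shift_tau Ht).
  assert (Hv : forall v, lattice tau v -> P v).
  { apply (lattice_ind P); [|intros v Hv; apply (Hs1 v Hv)|intros v Hv; apply (Hs1 v Hv)|intros v Hv; apply (Hst v Hv)|intros v Hv; apply (Hst v Hv)].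
    exists 1. split; [apply Cmod_1|]. intros z _. replace (z + 0 / 2) with z by field. ring. }
  apply (elliptic_constant hlat h).
  - apply hlat_discrete.
  - intros z. replace (z + 1) with (z + / 2 + / 2) by field. rewrite !hlat_shift_1. reflexivity.
  - intros z. replace (z + tau) with (z + tau / 2 + tau / 2) by field. rewrite !hlat_shift_tau. reflexivity.
  - exact Hh.
  - intros z Hz. replace (z + 1) with (z + / 2 + / 2) by field.
    rewrite !H1 by (try rewrite hlat_shift_1; exact Hz). rewrite Cmult_assoc, E1. ring.
  - intros z Hz. replace (z + tau) with (z + tau / 2 + tau / 2) by field.
    rewrite !Ht by (try rewrite hlat_shift_tau; exact Hz). rewrite Cmult_assoc, Et. ring.
  - intros p Hp e He. destruct (H0 e He) as [d [Hd H]].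
    destruct (hlat_discrete p) as [d2 [Hd2 H2]].
    destruct (Hv (2 * p) Hp) as (c & Hc & Hcp).
    exists (Rmin d d2). split; [apply Rmin_pos; assumption|]. intros z Hne Hz.
    set (u := z - p).
    assert (Hu0 : u - 0 = u) by ring.
    assert (Hu : u <> 0) by (intros E; apply Hne, Ceq_minus, E).
    assert (Hud : Cmod u < d) by (apply (Rmin_Rgt_l _ _ _ Hz)).
    assert (Ez : z = u + 2 * p / 2) by (unfold u; field).
    assert (Hnu : ~ hlat u).
    { intros Hlu. apply Hne. apply H2; [|apply (Rmin_Rgt_l _ _ _ Hz)].
      unfold hlat in *. replace (2 * z) with (2 * u + 2 * p) by (unfold u; ring). apply lattice_plus; assumption. }
    specialize (H u Hu). rewrite Hu0 in H. specialize (H Hud).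
    rewrite Ez, Hcp by exact Hnu.
    replace (u * (c * h u) - 0) with (c * (u * h u - 0)) by ring. rewrite Cmod_mult, Hc, Rmult_1_l. exact H.
Qed.

Lemma csum_3 (f : nat -> C) : csum f 3 = f 0%nat + f 1%nat + f 2%nat + f 3%nat.
Proof. rewrite !csum_S, csum_O. reflexivity. Qed.

Lemma C_eq_opp c : c = - c -> c = 0.
Proof.
  intros E. assert (E1 := f_equal Re E). assert (E2 := f_equal Im E).
  rewrite re_opp in E1. rewrite im_opp in E2.
  apply C_eq; [rewrite re_RtoC|rewrite im_RtoC]; lra.
Qed.

(** * The functions G_l *)

(** [Sf] and [Pf] are the zeta and [wp] functions of the half lattice up to
    constants ([S0_Sf], [Sf_diff]); [sgn1], [sgnt] are the signs by which the half
    periods [1/2] and [tau/2] multiply [Gf]. *)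
Definition zk (k : nat) z : C := wzeta tau (z - omega tau k / 2).
Definition Sf z : C := 2 * wzeta tau (2 * z).
Definition Gf (l : nat) z : C :=
  csum (fun k => eps l k * wzeta tau (z - omega tau k / 2)) 3 - eta tau (3 - l).
Definition Pf z : C := csum (fun k => wp tau (z - omega tau k / 2)) 3.
Definition dG (l : nat) : C -> C := C_derive (Gf l).
Definition sgn1 (l : nat) : C := if Nat.eqb l 1 then 1 else - (1).
Definition sgnt (l : nat) : C := if Nat.eqb l 2 then 1 else - (1).

Lemma zk_shift_1 z :
  zk 0 (z + / 2) = zk 1 z + eta tau 1 /\ zk 1 (z + / 2) = zk 0 z /\
  zk 2 (z + / 2) = zk 3 z + eta tau 1 /\ zk 3 (z + / 2) = zk 2 z.
Proof. unfold zk; simpl; repeat split; rewrite <- ?wzeta_plus_1; f_equal; field. Qed.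

Lemma zk_shift_tau z :
  zk 0 (z + tau / 2) = zk 2 z + eta tau 2 /\ zk 1 (z + tau / 2) = zk 3 z + eta tau 2 /\
  zk 2 (z + tau / 2) = zk 0 z /\ zk 3 (z + tau / 2) = zk 1 z.
Proof. unfold zk; simpl; repeat split; rewrite <- ?wzeta_plus_tau; f_equal; field. Qed.

Lemma zk_opp z :
  zk 0 (- z) = - zk 0 z /\ zk 1 (- z) = - (zk 1 z + eta tau 1) /\
  zk 2 (- z) = - (zk 2 z + eta tau 2) /\ zk 3 (- z) = - (zk 3 z + eta tau 1 + eta tau 2).
Proof.
  unfold zk; simpl; repeat split; rewrite <- ?wzeta_plus_1, <- ?wzeta_plus_tau, <- wzeta_odd; f_equal; field.
Qed.

Lemma zk_conj z :
  zk 0 (Cconj z) = Cconj (zk 0 z) /\ zk 1 (Cconj z) = Cconj (zk 1 z) /\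
  zk 2 (Cconj z) = Cconj (zk 2 z + eta tau 2) /\ zk 3 (Cconj z) = Cconj (zk 3 z + eta tau 2).
Proof.
  assert (Et := tau_conj). assert (E2 : Cconj (/ 2) = / 2) by (rewrite Cinv_conj', Cconj_R; reflexivity).
  unfold zk; simpl; repeat split; rewrite <- ?wzeta_plus_tau, <- wzeta_conj; f_equal;
    unfold Cdiv; repeat rewrite ?Cplus_conj, ?Cminus_conj, ?Cmult_conj, ?Et, ?E2, ?Cconj_R; field.
Qed.

Lemma Gf_1 z : Gf 1 z = zk 0 z + zk 1 z - zk 2 z - zk 3 z - eta tau 2.
Proof. unfold Gf. rewrite csum_3. unfold eps, zk; simpl. ring. Qed.
Lemma Gf_2 z : Gf 2 z = zk 0 z - zk 1 z + zk 2 z - zk 3 z - eta tau 1.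
Proof. unfold Gf. rewrite csum_3. unfold eps, zk; simpl. ring. Qed.
Lemma Gf_3 z : Gf 3 z = zk 0 z - zk 1 z - zk 2 z + zk 3 z.
Proof. unfold Gf. rewrite csum_3. unfold eps, zk; simpl. rewrite eta_0. ring. Qed.

Definition isl (l : nat) : Prop := l = 1%nat \/ l = 2%nat \/ l = 3%nat.

Ltac lcases Hl := destruct Hl as [-> | [-> | ->]]; rewrite ?Gf_1, ?Gf_2, ?Gf_3.

Lemma Gf_shift_1 (l : nat) z : isl l -> Gf l (z + / 2) = sgn1 l * Gf l z.
Proof.
  intros Hl. destruct (zk_shift_1 z) as (A & B & D & E).
  lcases Hl; rewrite A, B, D, E; unfold sgn1; simpl; ring.
Qed.

Lemma Gf_shift_tau (l : nat) z : isl l -> Gf l (z + tau / 2) = sgnt l * Gf l z.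
Proof.
  intros Hl. destruct (zk_shift_tau z) as (A & B & D & E).
  lcases Hl; rewrite A, B, D, E; unfold sgnt; simpl; ring.
Qed.

Lemma Gf_odd (l : nat) z : isl l -> Gf l (- z) = - Gf l z.
Proof.
  intros Hl. destruct (zk_opp z) as (A & B & D & E).
  lcases Hl; rewrite A, B, D, E; ring.
Qed.

Lemma conj_eta_1 : Cconj (eta tau 1) = eta tau 1.
Proof. apply C_eq; [apply re_conj|]. rewrite im_conj, eta_1_real. ring. Qed.

Lemma conj_eta_2 : Cconj (eta tau 2) = - eta tau 2.
Proof. apply C_eq; [|rewrite im_conj, im_opp; reflexivity]. rewrite re_conj, re_opp, eta_2_imag. ring. Qed.

Lemma Gf_conj (l : nat) z : isl l -> Gf l (Cconj z) = Cconj (Gf l z).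
Proof.
  intros Hl. destruct (zk_conj z) as (A & B & D & E).
  lcases Hl; rewrite A, B, D, E;
    repeat rewrite ?Cplus_conj, ?Cminus_conj, ?conj_eta_2, ?conj_eta_1; ring.
Qed.

Lemma sgn1_sq (l : nat) : sgn1 l * sgn1 l = 1.
Proof. unfold sgn1. destruct (Nat.eqb l 1); ring. Qed.
Lemma sgnt_sq (l : nat) : sgnt l * sgnt l = 1.
Proof. unfold sgnt. destruct (Nat.eqb l 2); ring. Qed.

Lemma lattice_omega (k : nat) : lattice tau (omega tau k).
Proof.
  destruct k as [|[|[|[|k]]]]; simpl; try apply lattice_0; try apply lattice_1; try apply lattice_tau.
  apply lattice_plus; [apply lattice_1|apply lattice_tau].
Qed.

Lemma hlat_minus_omega z (k : nat) : lattice tau (z - omega tau k / 2) -> hlat z.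
Proof.
  intros H. unfold hlat.
  replace (2 * z) with ((z - omega tau k / 2) + (z - omega tau k / 2) + omega tau k) by field.
  apply lattice_plus; [apply lattice_plus; exact H|apply lattice_omega].
Qed.

Lemma singular_hlat z : singular tau z <-> hlat z.
Proof.
  split.
  - intros (k & _ & H). exact (hlat_minus_omega z k H).
  - intros (m & n & E).
    assert (Hp : forall k m' n', (k <= 3)%nat -> RtoC (IZR m) + RtoC (IZR n) * tau = 2 * (RtoC (IZR m') + RtoC (IZR n') * tau) + omega tau k ->
      singular tau z).
    { intros k m' n' Hk E'. exists k. split; [exact Hk|]. exists m', n'.
      replace z with (/ 2 * (2 * z)) by field. rewrite E, E'. field. }
    assert (D2 : forall i : Z, exists j, (i = 2 * j \/ i = 2 * j + 1)%Z).
    { intros i. exists (i / 2)%Z. assert (H := Z.div_mod i 2 ltac:(lia)). assert (H2 := Z.mod_pos_bound i 2 ltac:(lia)). lia. }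
    destruct (D2 m) as [m' [-> | ->]]; destruct (D2 n) as [n' [-> | ->]].
    + apply (Hp 0%nat m' n'); [lia|]. rewrite !mult_IZR, !RtoC_mult. simpl. ring.
    + apply (Hp 2%nat m' n'); [lia|]. rewrite !plus_IZR, !mult_IZR, !RtoC_plus, !RtoC_mult. simpl. ring.
    + apply (Hp 1%nat m' n'); [lia|]. rewrite !plus_IZR, !mult_IZR, !RtoC_plus, !RtoC_mult. simpl. ring.
    + apply (Hp 3%nat m' n'); [lia|]. rewrite !plus_IZR, !mult_IZR, !RtoC_plus, !RtoC_mult. simpl. ring.
Qed.

Lemma half_omega_not_lattice (k : nat) : (1 <= k <= 3)%nat -> ~ lattice tau (omega tau k / 2).
Proof.
  intros Hk (m & n & E).
  assert (E1 := f_equal Re E). assert (E2 := f_equal Im E).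
  rewrite re_lin in E1. rewrite im_lin in E2.
  assert (H2 : forall i : Z, (IZR i <> / 2)%R).
  { intros i Hi. assert (2 * i = 1)%Z by (apply eq_IZR; rewrite mult_IZR; lra). lia. }
  unfold Cdiv in E1, E2. rewrite <- RtoC_inv in E1, E2 by lra.
  rewrite re_scal_r in E1. rewrite im_scal_r in E2.
  destruct k as [|[|[|[|k]]]]; try lia; cbn [omega] in E1, E2.
  - rewrite re_RtoC in E1. apply (H2 m). lra.
  - apply (H2 n). apply (Rmult_eq_reg_r (Im tau)); lra.
  - rewrite re_plus, re_RtoC, tau_re in E1. apply (H2 m). lra.
Qed.

Lemma zk_diff (k : nat) z : ~ lattice tau (z - omega tau k / 2) ->
  cdiff (zk k) z (- wp tau (z - omega tau k / 2)).
Proof. intros H. unfold zk. apply (cdiff_shift_minus (wzeta tau)). apply (wzeta_diff _ H). Qed.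

Lemma zk_diff' (k : nat) z : ~ hlat z -> cdiff (zk k) z (- wp tau (z - omega tau k / 2)).
Proof. intros H. apply zk_diff. intros H'. exact (H (hlat_minus_omega z k H')). Qed.

Lemma Gf_holo (l : nat) : holo (fun z => ~ hlat z) (Gf l).
Proof.
  intros z Hz. eexists. unfold Gf. apply cdiff_minus; [|apply cdiff_const].
  apply (cdiff_csum (fun k z => eps l k * wzeta tau (z - omega tau k / 2))).
  intros k _. apply cdiff_mult; [apply cdiff_const|apply (zk_diff' k z Hz)].
Qed.

Lemma Gf_diff (l : nat) z : ~ hlat z -> cdiff (Gf l) z (dG l z).
Proof. intros Hz. apply (cdiff_at _ _ _ copen_nhlat (Gf_holo l) Hz). Qed.

Lemma dG_holo (l : nat) : holo (fun z => ~ hlat z) (dG l).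
Proof. apply (holo_derive _ _ copen_nhlat (Gf_holo l)). Qed.

Definition S0 z : C := zk 0 z + zk 1 z + zk 2 z + zk 3 z.

Lemma S0_diff z : ~ hlat z -> cdiff S0 z (- Pf z).
Proof.
  intros Hz. unfold S0, Pf. rewrite csum_3.
  assert (A0 := zk_diff' 0 z Hz). assert (A1 := zk_diff' 1 z Hz).
  assert (A2 := zk_diff' 2 z Hz). assert (A3 := zk_diff' 3 z Hz).
  cd. ring.
Qed.

Lemma Sf_odd z : Sf (- z) = - Sf z.
Proof. unfold Sf. replace (2 * - z) with (- (2 * z)) by ring. rewrite wzeta_odd. ring. Qed.

Lemma Sf_shift_1 z : Sf (z + / 2) = Sf z + 2 * eta tau 1.
Proof. unfold Sf. replace (2 * (z + / 2)) with (2 * z + 1) by field. rewrite wzeta_plus_1. ring. Qed.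

Lemma Sf_shift_tau z : Sf (z + tau / 2) = Sf z + 2 * eta tau 2.
Proof. unfold Sf. replace (2 * (z + tau / 2)) with (2 * z + tau) by field. rewrite wzeta_plus_tau. ring. Qed.

Lemma Sf_conj z : Sf (Cconj z) = Cconj (Sf z).
Proof. unfold Sf. rewrite Cmult_conj, Cconj_R, <- wzeta_conj, Cmult_conj, Cconj_R. reflexivity. Qed.

Lemma Sf_holo : holo (fun z => ~ hlat z) Sf.
Proof.
  intros z Hz. eexists. unfold Sf. apply cdiff_mult; [apply cdiff_const|].
  apply (cdiff_scale (wzeta tau)). apply (wzeta_diff _ Hz).
Qed.

(** The pole of [wzeta] at 0 is taken out by replacing it by [Z0]. *)
Definition gl (l : nat) u : C :=
  Z0 u + (eps l 1 * zk 1 u + eps l 2 * zk 2 u + eps l 3 * zk 3 u) - eta tau (3 - l).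
Definition sl u : C := 2 * Z0 (2 * u).

Lemma Gf_gl (l : nat) u : Gf l u = 1 / u + gl l u.
Proof.
  unfold Gf, gl. rewrite csum_3. replace (eps l 0) with (RtoC 1) by reflexivity.
  replace (omega tau 0 / 2) with (0 : C) by (simpl; field). replace (u - 0) with u by ring.
  rewrite wzeta_Z0. unfold zk. ring.
Qed.

Lemma Sf_sl u : u <> 0 -> Sf u = 1 / u + sl u.
Proof. intros Hu. unfold Sf, sl. rewrite wzeta_Z0. field. exact Hu. Qed.

(** One radius for all expansions at 0, in which [gl] and [sl] are the regular
    parts of [Gf] and [Sf] ([Gf_gl], [Sf_sl]). *)
Lemma local_data : exists d, 0 < d /\ (forall u, punctured 0 d u -> ~ hlat u) /\
  (forall l, holo (disc 0 d) (gl l)) /\ holo (disc 0 d) sl.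
Proof.
  destruct (hlat_discrete 0) as [d0 [Hd0 H]]. assert (K := kap_pos). set (d := Rmin d0 (kap / 2)).
  assert (Hh : forall u, disc 0 d u -> hlat u -> u = 0).
  { intros u Hu Hl. unfold disc in Hu. apply H; [exact Hl|]. apply (Rmin_Rgt_l _ _ _ Hu). }
  assert (Hk : forall u, disc 0 d u -> Cmod u < kap / 2).
  { intros u Hu. unfold disc in Hu. replace (u - 0) with u in Hu by ring. apply (Rmin_Rgt_l _ _ _ Hu). }
  exists d. split; [apply Rmin_pos; lra|]. split; [intros u [Hu Hud] Hl; exact (Hu (Hh u Hud Hl))|]. split.
  - intros l u Hu. assert (Hr : reg0 u) by (apply reg0_small; specialize (Hk u Hu); lra).
    destruct (Z0_holo u Hr) as [m Hm].
    assert (A : forall k, (1 <= k <= 3)%nat -> ~ lattice tau (u - omega tau k / 2)).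
    { intros k Hk' Hl. assert (E := Hh u Hu (hlat_minus_omega u k Hl)). subst u.
      apply (half_omega_not_lattice k Hk').
      replace (omega tau k / 2) with (- (0 - omega tau k / 2)) by ring. apply lattice_opp, Hl. }
    assert (A1 := zk_diff 1 u (A 1%nat ltac:(lia))). assert (A2 := zk_diff 2 u (A 2%nat ltac:(lia))).
    assert (A3 := zk_diff 3 u (A 3%nat ltac:(lia))).
    eexists. unfold gl. repeat cd_step.
  - intros u Hu. destruct (Z0_holo (2 * u)) as [m Hm].
    { apply reg0_small. rewrite Cmod_mult, Cmod_R, Rabs_pos_eq by lra. specialize (Hk u Hu). lra. }
    eexists. unfold sl. apply cdiff_mult; [apply cdiff_const|]. apply (cdiff_scale Z0). exact Hm.
Qed.

Lemma gl_0 (l : nat) : isl l -> gl l 0 = 0.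
Proof.
  intros Hl. assert (E := Gf_odd l 0 Hl). rewrite !Gf_gl in E.
  replace (- (0:C)) with (0:C) in E by ring.
  assert (E0 : 1 / (0:C) = 0) by (unfold Cdiv; rewrite Cinv_0; ring). rewrite E0 in E.
  rewrite !Cplus_0_l in E. apply C_eq_opp, E.
Qed.

Lemma sl_derive_0 : C_derive sl 0 = 0.
Proof.
  assert (Hr : reg0 0) by (apply reg0_small; rewrite Cmod_0; apply kap_pos).
  assert (HZ := cdiff_at _ _ _ copen_reg0 Z0_holo Hr).
  rewrite Z0_derive_0 in HZ.
  apply C_derive_eq. unfold sl. eapply cdiff_val.
  - apply cdiff_mult; [apply cdiff_const|]. apply (cdiff_scale Z0).
    replace (2 * 0) with (0:C) by ring. exact HZ.
  - cbv beta. ring.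
Qed.

(** Duplication formula: the difference is invariant under half periods without
    poles, hence constant; it is odd, hence 0. *)
Lemma S0_Sf z : ~ hlat z -> S0 z = Sf z - (eta tau 1 + eta tau 2).
Proof.
  destruct local_data as (d & Hd & _ & _ & Hs).
  set (h := fun z => Sf z - S0 z - (eta tau 1 + eta tau 2)).
  assert (Hodd : forall z, h (- z) = - h z).
  { intros w. unfold h. rewrite Sf_odd. unfold S0. destruct (zk_opp w) as (A & B & D & E). rewrite A, B, D, E. ring. }
  destruct (half_elliptic_constant h 1 1) as [c Hc].
  - ring.
  - ring.
  - unfold h. apply holo_minus; [apply holo_minus; [apply Sf_holo|]|].
    + intros w Hw. eexists. apply S0_diff, Hw.
    + intros w Hw. eexists. apply cdiff_const.
  - intros w _. unfold h. rewrite Sf_shift_1. unfold S0. destruct (zk_shift_1 w) as (A & B & D & E). rewrite A, B, D, E. ring.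
  - intros w _. unfold h. rewrite Sf_shift_tau. unfold S0. destruct (zk_shift_tau w) as (A & B & D & E). rewrite A, B, D, E. ring.
  - set (k := fun u => u * (sl u - (Z0 u + (zk 1 u + zk 2 u + zk 3 u)) - (eta tau 1 + eta tau 2))).
    replace (RtoC 0) with (k 0) at 2 by (unfold k; ring).
    apply (tends_cont _ k 0 d Hd).
    + destruct (Hs 0 (disc_center 0 d Hd)) as [m1 Hm1].
      destruct (Z0_holo 0) as [m2 Hm2]; [apply reg0_small; auto; rewrite Cmod_0; apply kap_pos|].
      assert (A : forall k, (1 <= k <= 3)%nat -> ~ lattice tau (0 - omega tau k / 2)).
      { intros i Hi Hl. apply (half_omega_not_lattice i Hi).
        replace (omega tau i / 2) with (- (0 - omega tau i / 2)) by ring. apply lattice_opp, Hl. }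
      assert (A1 := zk_diff 1 0 (A 1%nat ltac:(lia))). assert (A2 := zk_diff 2 0 (A 2%nat ltac:(lia))).
      assert (A3 := zk_diff 3 0 (A 3%nat ltac:(lia))).
      eapply cdiff_ccont. unfold k. repeat cd_step.
    + intros u [Hu _]. unfold h, k, S0. rewrite Sf_sl by exact Hu.
      replace (zk 0 u) with (1 / u + Z0 u); [field; exact Hu|].
      unfold zk. simpl. replace (u - 0 / 2) with u by field. rewrite wzeta_Z0. reflexivity.
  - intros Hz. assert (Hc1 := Hc z Hz).
    assert (Hz' : ~ hlat (- z)) by (rewrite hlat_opp; exact Hz).
    assert (Hc2 := Hc _ Hz'). rewrite Hodd, Hc1 in Hc2.
    assert (E0 : c = 0) by (apply C_eq_opp; symmetry; exact Hc2).
    unfold h in Hc1. rewrite E0 in Hc1.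
    replace (S0 z) with (Sf z - (eta tau 1 + eta tau 2) - (Sf z - S0 z - (eta tau 1 + eta tau 2))) by ring.
    rewrite Hc1. ring.
Qed.

Lemma near_nhlat z : ~ hlat z -> exists d, 0 < d /\ forall w, Cmod (w - z) < d -> ~ hlat w.
Proof. exact (copen_nhlat z). Qed.

Lemma Sf_diff z : ~ hlat z -> cdiff Sf z (- Pf z).
Proof.
  intros Hz. destruct (near_nhlat z Hz) as [d [Hd H]].
  apply (cdiff_loc (fun z => S0 z + (eta tau 1 + eta tau 2)) Sf z _ d Hd).
  - intros w Hw. rewrite S0_Sf by (apply H, Hw). ring.
  - eapply cdiff_val; [apply cdiff_plus; [apply S0_diff, Hz|apply cdiff_const]|]. ring.
Qed.

Lemma Pf_eq z : ~ hlat z -> Pf z = - C_derive Sf z.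
Proof. intros Hz. rewrite (C_derive_eq _ _ _ (Sf_diff z Hz)). ring. Qed.

Lemma Pf_holo : holo (fun z => ~ hlat z) Pf.
Proof.
  intros z Hz. destruct (holo_derive _ _ copen_nhlat Sf_holo) as [_ H]. destruct (H z Hz) as [l Hl].
  destruct (near_nhlat z Hz) as [d [Hd Hn]]. eexists.
  apply (cdiff_loc (fun z => - C_derive Sf z) Pf z _ d Hd).
  - intros w Hw. symmetry. apply Pf_eq, Hn, Hw.
  - apply cdiff_opp, Hl.
Qed.

Lemma Pf_shift a c : (forall z, Sf (z + a) = Sf z + c) ->
  forall z, ~ hlat z -> ~ hlat (z + a) -> Pf (z + a) = Pf z.
Proof.
  intros H z Hz Hza.
  assert (E : - Pf (z + a) = - Pf z).
  { apply (cdiff_unique (fun z => Sf (z + a)) z).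
    - apply (cdiff_shift Sf), Sf_diff, Hza.
    - apply (cdiff_ext (fun z => Sf z + c)); [intros w; symmetry; apply H|].
      eapply cdiff_val; [apply cdiff_plus; [apply Sf_diff, Hz|apply cdiff_const]|]. ring. }
  replace (Pf (z + a)) with (- - Pf (z + a)) by ring. rewrite E. ring.
Qed.

Lemma Pf_shift_1 z : ~ hlat z -> Pf (z + / 2) = Pf z.
Proof. intros Hz. apply (Pf_shift (/ 2) (2 * eta tau 1) Sf_shift_1 z Hz). rewrite hlat_shift_1. exact Hz. Qed.

Lemma Pf_shift_tau z : ~ hlat z -> Pf (z + tau / 2) = Pf z.
Proof.
  intros Hz. apply (Pf_shift (tau / 2) (2 * eta tau 2) Sf_shift_tau z Hz). rewrite hlat_shift_tau. exact Hz.
Qed.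

Lemma dG_shift (l : nat) (a s : C) : (forall z, Gf l (z + a) = s * Gf l z) ->
  forall z, ~ hlat z -> ~ hlat (z + a) -> dG l (z + a) = s * dG l z.
Proof.
  intros H z Hz Hza. apply (cdiff_unique (fun z => Gf l (z + a)) z).
  - apply (cdiff_shift (Gf l)), Gf_diff, Hza.
  - apply (cdiff_ext (fun z => s * Gf l z)); [intros w; symmetry; apply H|].
    eapply cdiff_val; [apply cdiff_mult; [apply cdiff_const|apply Gf_diff, Hz]|]. cbv beta. ring.
Qed.

Lemma dG_shift_1 (l : nat) z : isl l -> ~ hlat z -> dG l (z + / 2) = sgn1 l * dG l z.
Proof.
  intros Hl Hz. apply dG_shift; auto; [intros w; apply Gf_shift_1, Hl|]. rewrite hlat_shift_1. exact Hz.
Qed.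

Lemma dG_shift_tau (l : nat) z : isl l -> ~ hlat z -> dG l (z + tau / 2) = sgnt l * dG l z.
Proof.
  intros Hl Hz. apply dG_shift; auto; [intros w; apply Gf_shift_tau, Hl|]. rewrite hlat_shift_tau. exact Hz.
Qed.

Lemma dG_even (l : nat) z : isl l -> ~ hlat z -> dG l (- z) = dG l z.
Proof.
  intros Hl Hz. assert (Hz' : ~ hlat (- z)) by (rewrite hlat_opp; exact Hz).
  assert (E : dG l (- z) * - (1) = - dG l z).
  { apply (cdiff_unique (fun z => Gf l (- z)) z).
    - apply (cdiff_comp (Gf l) (fun z => - z)); [apply Gf_diff, Hz'|].
      eapply cdiff_val; [apply cdiff_opp, cdiff_id|ring].
    - apply (cdiff_ext (fun z => - Gf l z)); [intros w; symmetry; apply Gf_odd, Hl|].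
      apply cdiff_opp, Gf_diff, Hz. }
  replace (dG l (- z)) with (- (dG l (- z) * - (1))) by ring. rewrite E. ring.
Qed.

Lemma dG_local (l : nat) (d : R) u : holo (disc 0 d) (gl l) -> punctured 0 d u -> dG l u = - (1 / (u * u)) + C_derive (gl l) u.
Proof.
  intros Hg [Hu Hud].
  apply C_derive_eq. apply (cdiff_ext (fun u => 1 / u + gl l u)); [intros w; symmetry; apply Gf_gl|].
  assert (Hgu := cdiff_at _ _ u (copen_disc 0 d) Hg Hud).
  cd; [exact Hu|]. field. exact Hu.
Qed.

Lemma Pf_local (d : R) u : holo (disc 0 d) sl -> punctured 0 d u -> ~ hlat u -> Pf u = 1 / (u * u) - C_derive sl u.
Proof.
  intros Hs [Hu Hud] Hn. rewrite Pf_eq by exact Hn.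
  rewrite (C_derive_eq Sf u (- (1 / (u * u)) + C_derive sl u)); [ring|].
  apply (cdiff_loc (fun u => 1 / u + sl u) Sf u _ (Cmod u)).
  - apply Cmod_gt_0, Hu.
  - intros w Hw. symmetry. apply Sf_sl. intros ->. replace (0 - u) with (- u) in Hw by ring. rewrite Cmod_opp in Hw. lra.
  - assert (Hsu := cdiff_at _ _ u (copen_disc 0 d) Hs Hud).
    cd; [exact Hu|]. field. exact Hu.
Qed.

(** The sign characters of [l], [m], [n] multiply to 1. *)
Definition triple (l m n : nat) : Prop :=
  isl l /\ isl m /\ isl n /\ sgn1 l = sgn1 m * sgn1 n /\ sgnt l = sgnt m * sgnt n.

Ltac conj := simpl; repeat match goal with |- _ /\ _ => split end;
  match goal with |- _ = _ => ring | |- _ \/ _ => auto | _ => congruence end.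

Lemma triples : triple 1 2 3 /\ triple 2 1 3 /\ triple 3 1 2.
Proof. unfold triple, isl, sgn1, sgnt. conj. Qed.

(** Both sides have the same double poles, and their difference is a constant
    that some half period changes into its opposite.  The second relation is the
    equality of the constant terms of the expansions at 0. *)
Lemma dG_product (l m n : nat) : triple l m n ->
  (forall z, ~ hlat z -> dG l z = - (Gf m z * Gf n z)) /\
  C_derive (gl l) 0 + C_derive (gl m) 0 + C_derive (gl n) 0 = 0.
Proof.
  intros (Hl & Hm & Hn & E1 & Et).
  destruct local_data as (d & Hd & Hpn & Hg & _). assert (D0 : disc 0 d 0) by apply disc_center, Hd.
  set (h := fun z => dG l z + Gf m z * Gf n z).
  assert (Hder : forall i, holo (disc 0 d) (C_derive (gl i))) by (intros i; apply (holo_derive _ _ (copen_disc 0 d) (Hg i))).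
  assert (Hhs1 : forall z, ~ hlat z -> h (z + / 2) = sgn1 l * h z).
  { intros z Hz. unfold h. rewrite dG_shift_1, !Gf_shift_1 by assumption. rewrite E1. ring. }
  assert (Hhst : forall z, ~ hlat z -> h (z + tau / 2) = sgnt l * h z).
  { intros z Hz. unfold h. rewrite dG_shift_tau, !Gf_shift_tau by assumption. rewrite Et. ring. }
  destruct (half_elliptic_constant h (sgn1 l) (sgnt l) (sgn1_sq l) (sgnt_sq l)) as [c Hc].
  - intros z Hz. destruct (dG_holo l z Hz) as [a Ha]. eexists. unfold h.
    apply cdiff_plus; [exact Ha|]. apply cdiff_mult; apply Gf_diff, Hz.
  - exact Hhs1.
  - exact Hhst.
  - destruct (Hder l 0 D0) as [a1 A1]. destruct (Hg m 0 D0) as [a2 A2]. destruct (Hg n 0 D0) as [a3 A3].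
    set (k := fun u => u * C_derive (gl l) u + (gl m u + gl n u) + u * (gl m u * gl n u)).
    replace (RtoC 0) with (k 0) at 2 by (unfold k; rewrite !gl_0 by assumption; ring).
    apply (tends_cont _ k 0 d Hd).
    + eapply cdiff_ccont. unfold k. repeat cd_step.
    + intros u Hu. assert (Hu0 := proj1 Hu). unfold h, k. rewrite (dG_local l d u (Hg l) Hu), !Gf_gl.
      field. exact Hu0.
  - assert (Ec : c = 0).
    { assert (Hq : ~ hlat (/ 4)).
      { unfold hlat. replace (2 * / 4) with (/ 2) by field. apply half_not_lattice. }
      assert (K1 := Hhs1 _ Hq). assert (K2 := Hhst _ Hq).
      rewrite !Hc in K1 by (try rewrite hlat_shift_1; exact Hq).
      rewrite !Hc in K2 by (try rewrite hlat_shift_tau; exact Hq).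
      assert (Hs : sgn1 l = - (1) \/ sgnt l = - (1)).
      { destruct Hl as [-> |[-> | ->]]; unfold sgn1, sgnt; simpl; auto. }
      apply C_eq_opp. replace (- c) with (- (1) * c) by ring.
      destruct Hs as [Hs|Hs]; rewrite Hs in *; assumption. }
    split.
    + intros z Hz. assert (K := Hc z Hz). unfold h in K. rewrite Ec in K.
      replace (dG l z) with (dG l z + Gf m z * Gf n z - Gf m z * Gf n z) by ring. rewrite K. ring.
    + destruct (holo_division (disc 0 d) 0 (gl m) (copen_disc 0 d) (star_disc 0 d) D0 (Hg m)) as (km & Hkm & Km0 & Ekm).
      destruct (holo_division (disc 0 d) 0 (gl n) (copen_disc 0 d) (star_disc 0 d) D0 (Hg n)) as (kn & Hkn & Kn0 & Ekn).
      rewrite <- Km0, <- Kn0.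
      destruct (Hder l 0 D0) as [a1 A1]. destruct (Hg m 0 D0) as [a2 A2]. destruct (Hg n 0 D0) as [a3 A3].
      destruct (Hkm 0 D0) as [b2 B2]. destruct (Hkn 0 D0) as [b3 B3].
      assert (K : C_derive (gl l) 0 + km 0 + kn 0 + gl m 0 * gl n 0 = 0).
      { apply (cont_unique (fun u => C_derive (gl l) u + km u + kn u + gl m u * gl n u) (fun _ => RtoC 0) 0 d Hd).
        - eapply cdiff_ccont. repeat cd_step.
        - eapply cdiff_ccont. apply cdiff_const.
        - intros u Hu. assert (Hu0 := proj1 Hu).
          assert (K := Hc u (Hpn u Hu)). unfold h in K. rewrite Ec, (dG_local l d u (Hg l) Hu), !Gf_gl in K.
          assert (Em := Ekm u (proj2 Hu)). assert (En := Ekn u (proj2 Hu)). rewrite gl_0 in Em, En by assumption.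
          rewrite <- K.
          replace (km u) with (gl m u / u) by (rewrite Em; field; exact Hu0).
          replace (kn u) with (gl n u / u) by (rewrite En; field; exact Hu0).
          field. exact Hu0. }
      rewrite !gl_0 in K by assumption. rewrite Cmult_0_l, Cplus_0_r in K. exact K.
Qed.

(** The signs square to 1 and the principal parts agree. *)
Lemma Gf_square (l : nat) z : isl l -> ~ hlat z ->
  Gf l z * Gf l z = Pf z + 2 * C_derive (gl l) 0.
Proof.
  intros Hl Hz.
  destruct local_data as (d & Hd & Hpn & Hgl & Hs). assert (Hg := Hgl l).
  assert (Hs' : holo (disc 0 d) (C_derive sl)) by apply (holo_derive _ _ (copen_disc 0 d) Hs).
  assert (D0 : disc 0 d 0) by apply disc_center, Hd.
  destruct (Hg 0 D0) as [a1 A1]. destruct (Hs' 0 D0) as [a2 A2].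
  set (h := fun z => Gf l z * Gf l z - Pf z).
  assert (Hloc : forall u, punctured 0 d u -> h u = 2 * gl l u / u + gl l u * gl l u + C_derive sl u).
  { intros u Hu. unfold h. rewrite (Pf_local d u Hs Hu (Hpn u Hu)), Gf_gl. field. apply Hu. }
  destruct (half_elliptic_constant h 1 1) as [c Hc].
  - ring.
  - ring.
  - intros w Hw. destruct (Pf_holo w Hw) as [a Ha]. eexists. unfold h.
    apply cdiff_minus; [apply cdiff_mult; apply Gf_diff, Hw|exact Ha].
  - intros w Hw. unfold h. rewrite Gf_shift_1, Pf_shift_1 by assumption.
    replace (sgn1 l * Gf l w * (sgn1 l * Gf l w)) with (sgn1 l * sgn1 l * (Gf l w * Gf l w)) by ring.
    rewrite sgn1_sq. ring.
  - intros w Hw. unfold h. rewrite Gf_shift_tau, Pf_shift_tau by assumption.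
    replace (sgnt l * Gf l w * (sgnt l * Gf l w)) with (sgnt l * sgnt l * (Gf l w * Gf l w)) by ring.
    rewrite sgnt_sq. ring.
  - set (k := fun u => 2 * gl l u + u * (gl l u * gl l u + C_derive sl u)).
    replace (RtoC 0) with (k 0) at 2 by (unfold k; rewrite !gl_0 by assumption; ring).
    apply (tends_cont _ k 0 d Hd).
    + eapply cdiff_ccont. unfold k. repeat cd_step.
    + intros u Hu. rewrite Hloc by exact Hu. unfold k. field. apply Hu.
  - destruct (holo_division (disc 0 d) 0 (gl l) (copen_disc 0 d) (star_disc 0 d) D0 Hg) as (kl & Hkl & Kl0 & Ekl).
    destruct (Hkl 0 D0) as [b1 B1].
    assert (K : 2 * kl 0 + gl l 0 * gl l 0 + C_derive sl 0 = c).
    { apply (cont_unique (fun u => 2 * kl u + gl l u * gl l u + C_derive sl u) (fun _ => c) 0 d Hd).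
      - eapply cdiff_ccont. repeat cd_step.
      - eapply cdiff_ccont. apply cdiff_const.
      - intros u Hu. assert (Hu0 := proj1 Hu).
        rewrite <- (Hc u (Hpn u Hu)), Hloc by exact Hu.
        assert (El := Ekl u (proj2 Hu)). rewrite gl_0 in El by assumption.
        replace (kl u) with (gl l u / u) by (rewrite El; field; exact Hu0). field. exact Hu0. }
    rewrite gl_0, sl_derive_0, Kl0 in K by assumption.
    assert (K2 := Hc z Hz). unfold h in K2. rewrite <- K in K2.
    replace (Gf l z * Gf l z) with (Gf l z * Gf l z - Pf z + Pf z) by ring. rewrite K2. ring.
Qed.

Lemma star_constant (U : C -> Prop) z0 g : star U z0 ->
  (forall z, U z -> cdiff g z 0) -> forall z, U z -> g z = g z0.
Proof. intros Hs Hg z Hz. apply segment_constant. intros t Ht. apply Hg, Hs; assumption. Qed.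

Lemma linear_ode_zero (U : C -> Prop) z0 (p a : C -> C) :
  copen U -> star U z0 -> holo U a -> (forall z, U z -> cdiff p z (a z * p z)) ->
  p z0 = 0 -> forall z, U z -> p z = 0.
Proof.
  intros HU Hs Ha Hp H0 z Hz.
  assert (E : p z * cexp (- segint a z0 z) = p z0 * cexp (- segint a z0 z0)).
  { apply (star_constant U z0 (fun z => p z * cexp (- segint a z0 z)) Hs); [|exact Hz].
    intros w Hw. eapply cdiff_val.
    - apply cdiff_mult; [apply Hp, Hw|].
      apply (cdiff_comp cexp (fun z => - segint a z0 z)); [apply cdiff_cexp|].
      apply cdiff_opp, (star_primitive U); assumption.
    - cbv beta. ring. }
  rewrite H0, Cmult_0_l in E. apply NNPP. intros Hn.
  exact (Cmult_neq_0 _ _ Hn (cexp_neq_0 _) E).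
Qed.

Definition rectangle (a b c d : R) z : Prop :=
  (a < Re z < b) /\ c < Im z < d.

Lemma copen_rectangle (a b c d : R) : copen (rectangle a b c d).
Proof.
  intros z [[H1 H2] [H3 H4]].
  set (e := Rmin (Rmin (Re z - a) (b - Re z)) (Rmin (Im z - c) (d - Im z))).
  exists e. split; [unfold e; repeat apply Rmin_pos; lra|].
  intros w Hw.
  assert (A := Rle_lt_trans _ _ _ (re_le (w - z)) Hw). assert (B := Rle_lt_trans _ _ _ (im_le (w - z)) Hw).
  rewrite re_minus in A. rewrite im_minus in B. apply Rabs_def2 in A. apply Rabs_def2 in B.
  assert (e <= Re z - a) by (eapply Rle_trans; [apply Rmin_l|apply Rmin_l]).
  assert (e <= b - Re z) by (eapply Rle_trans; [apply Rmin_l|apply Rmin_r]).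
  assert (e <= Im z - c) by (eapply Rle_trans; [apply Rmin_r|apply Rmin_l]).
  assert (e <= d - Im z) by (eapply Rle_trans; [apply Rmin_r|apply Rmin_r]).
  split; lra.
Qed.

Lemma re_segt z w (t : R) : Re (segt z w t) = ((1 - t) * Re z + t * Re w)%R.
Proof. unfold segt. rewrite re_plus, re_scal_l, re_minus. ring. Qed.
Lemma im_segt z w (t : R) : Im (segt z w t) = ((1 - t) * Im z + t * Im w)%R.
Proof. unfold segt. rewrite im_plus, im_scal_l, im_minus. ring. Qed.

Lemma convex_lt (a b x y t : R) : a < x < b -> a < y < b -> 0 <= t <= 1 -> a < (1 - t) * x + t * y < b.
Proof.
  intros Hx Hy Ht.
  assert (K : forall p q : R, 0 < p -> 0 < q -> 0 < (1 - t) * p + t * q).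
  { intros p q Hp Hq. destruct (Req_dec t 0) as [->|Ht0]; [lra|].
    apply Rplus_le_lt_0_compat; [apply Rmult_le_pos|apply Rmult_lt_0_compat]; lra. }
  assert (A := K (x - a)%R (y - a)%R ltac:(lra) ltac:(lra)).
  assert (B := K (b - x)%R (b - y)%R ltac:(lra) ltac:(lra)). split; lra.
Qed.

Lemma star_rectangle (a b c d : R) z0 : rectangle a b c d z0 -> star (rectangle a b c d) z0.
Proof.
  intros [H1 H2] z t [H3 H4] Ht. unfold rectangle. rewrite re_segt, im_segt.
  split; apply convex_lt; assumption.
Qed.

Lemma tends_uG (l : nat) : isl l -> tends (fun u => u * Gf l u) 0 1.
Proof.
  intros Hl. destruct local_data as (d & Hd & Hsm & Hgl & _). assert (Hg := Hgl l).
  destruct (Hg 0 (disc_center 0 d Hd)) as [a A].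
  set (k := fun u => 1 + u * gl l u).
  replace (RtoC 1) with (k 0) by (unfold k; ring).
  apply (tends_cont _ k 0 d Hd).
  - eapply cdiff_ccont. unfold k. repeat cd_step.
  - intros u [Hu _]. rewrite Gf_gl. unfold k. field. exact Hu.
Qed.

Lemma tends_plus f g p a b : tends f p a -> tends g p b -> tends (fun z => f z + g z) p (a + b).
Proof.
  intros Hf Hg e He. destruct (Hf (e / 2)%R) as [d1 [Hd1 H1]]; [lra|]. destruct (Hg (e / 2)%R) as [d2 [Hd2 H2]]; [lra|].
  exists (Rmin d1 d2). split; [apply Rmin_pos; assumption|]. intros z Hne Hz.
  specialize (H1 z Hne ltac:(apply (Rmin_Rgt_l _ _ _ Hz))).
  specialize (H2 z Hne ltac:(apply (Rmin_Rgt_l _ _ _ Hz))).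
  replace (f z + g z - (a + b)) with ((f z - a) + (g z - b)) by ring.
  eapply Rle_lt_trans; [apply Cmod_triangle|]. lra.
Qed.

(** The sum of [G_m] and [G_n] solves [p' = - G_l p]; a common zero would make it
    vanish up to the pole at 0. *)
Lemma no_common_zero (l m n : nat) om z0 (a b c d : R) : isl m -> isl n ->
  (forall z, ~ hlat z -> dG m z = - (Gf l z * Gf n z)) ->
  (forall z, ~ hlat z -> dG n z = - (Gf l z * Gf m z)) ->
  rectangle a b c d z0 -> (forall z, rectangle a b c d z -> ~ hlat z) ->
  om <> 0 -> (forall t, 0 < t <= / 4 -> rectangle a b c d (RtoC t * om)) ->
  Gf m z0 = 0 -> Gf n z0 = 0 -> False.
Proof.
  intros Hm Hn Em En Hz0 Hnl Hom Hray H1 H2.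
  set (p := fun z => Gf m z + Gf n z).
  assert (Hp : forall z, rectangle a b c d z -> p z = 0).
  { apply (linear_ode_zero (rectangle a b c d) z0 p (fun z => - Gf l z)).
    - apply copen_rectangle.
    - apply star_rectangle, Hz0.
    - intros z Hz. eexists. apply cdiff_opp, Gf_diff; auto.
    - intros z Hz. unfold p. eapply cdiff_val; [apply cdiff_plus; apply Gf_diff; auto|].
      rewrite Em, En by auto. ring.
    - unfold p. rewrite H1, H2. ring. }
  assert (T := tends_plus _ _ _ _ _ (tends_uG m Hm) (tends_uG n Hn)).
  destruct (T 1%R Rlt_0_1) as [e [He HT]].
  assert (Hmo := proj1 (Cmod_gt_0 om) Hom).
  set (t := Rmin (/ 4) (e / 2 / Cmod om)).
  assert (Ht0 : 0 < e / 2 / Cmod om) by (repeat apply Rdiv_lt_0_compat; lra).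
  assert (Ht : 0 < t <= / 4) by (split; [apply Rmin_pos; lra|apply Rmin_l]).
  set (u := RtoC t * om).
  assert (Hu : u <> 0) by (apply Cmult_neq_0; [apply RtoC_neq_0; lra|exact Hom]).
  specialize (HT u Hu).
  assert (Hue : Cmod (u - 0) < e).
  { replace (u - 0) with u by ring. unfold u. rewrite Cmod_mult, Cmod_R, Rabs_pos_eq by lra.
    apply Rle_lt_trans with (e / 2 / Cmod om * Cmod om)%R.
    - apply Rmult_le_compat_r; [lra|apply Rmin_r].
    - replace (e / 2 / Cmod om * Cmod om)%R with (e / 2)%R by (field; lra). lra. }
  specialize (HT Hue). cbv beta in HT.
  replace (u * Gf m u + u * Gf n u - (1 + 1)) with (u * p u - 2) in HT by (unfold p; ring).
  rewrite Hp in HT by (apply Hray, Ht).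
  replace (u * 0 - 2) with (- (2)) in HT by ring.
  rewrite Cmod_opp, Cmod_R, Rabs_pos_eq in HT by lra. lra.
Qed.

Lemma half_not_IZR (i : Z) (x : R) : 0 < x < 1 -> IZR i <> x.
Proof. intros Hx E. assert (0 < i < 1)%Z by (split; apply lt_IZR; lra). lia. Qed.

Lemma hlat_re z : hlat z -> exists m : Z, (2 * Re z)%R = IZR m.
Proof. intros (m & n & E). exists m. assert (E1 := f_equal Re E). rewrite re_lin, re_scal_l in E1. exact E1. Qed.

Lemma hlat_im z : hlat z -> exists n : Z, (2 * Im z)%R = (IZR n * Im tau)%R.
Proof. intros (m & n & E). exists n. assert (E1 := f_equal Im E). rewrite im_lin, im_scal_l in E1. exact E1. Qed.

Lemma re_div2 z (r : R) : r <> 0%R -> Re (z / RtoC r) = (Re z / r)%R.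
Proof. intros Hr. unfold Cdiv. rewrite <- RtoC_inv by exact Hr. rewrite re_scal_r. reflexivity. Qed.
Lemma im_div2 z (r : R) : r <> 0%R -> Im (z / RtoC r) = (Im z / r)%R.
Proof. intros Hr. unfold Cdiv. rewrite <- RtoC_inv by exact Hr. rewrite im_scal_r. reflexivity. Qed.

Definition kc (l : nat) : C := 2 * C_derive (gl l) 0.

Lemma quarter_not_hlat om : om = 1 \/ om = tau -> ~ hlat (om / 4).
Proof.
  intros [-> | ->] H.
  - destruct (hlat_re _ H) as [m E]. rewrite re_div2, re_RtoC in E by lra. apply (half_not_IZR m (/ 2)); lra.
  - destruct (hlat_im _ H) as [m E]. rewrite im_div2 in E by lra.
    apply (half_not_IZR m (/ 2)); [lra|]. apply (Rmult_eq_reg_r (Im tau)); lra.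
Qed.

Lemma no_common_zero_1 (l m n : nat) : isl m -> isl n ->
  (forall z, ~ hlat z -> dG m z = - (Gf l z * Gf n z)) ->
  (forall z, ~ hlat z -> dG n z = - (Gf l z * Gf m z)) ->
  Gf m (1 / 4) = 0 -> Gf n (1 / 4) = 0 -> False.
Proof.
  intros Hm Hn Em En.
  apply (no_common_zero l m n 1 (1 / 4) 0 (/ 2) (- Im tau) (Im tau)); auto.
  - unfold rectangle. rewrite re_div2, im_div2, re_RtoC, im_RtoC by lra. lra.
  - intros z [Hz _] H. destruct (hlat_re _ H) as [i E]. apply (half_not_IZR i (2 * Re z)); lra.
  - apply RtoC_neq_0. lra.
  - intros t Ht. unfold rectangle. rewrite re_scal_l, im_scal_l, re_RtoC, im_RtoC. lra.
Qed.

Lemma no_common_zero_tau (l m n : nat) : isl m -> isl n ->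
  (forall z, ~ hlat z -> dG m z = - (Gf l z * Gf n z)) ->
  (forall z, ~ hlat z -> dG n z = - (Gf l z * Gf m z)) ->
  Gf m (tau / 4) = 0 -> Gf n (tau / 4) = 0 -> False.
Proof.
  intros Hm Hn Em En.
  apply (no_common_zero l m n tau (tau / 4) (- (1)) 1 0 (Im tau / 2)); auto.
  - unfold rectangle. rewrite re_div2, im_div2, tau_re by lra. lra.
  - intros z [_ Hz] H. destruct (hlat_im _ H) as [i E].
    apply (half_not_IZR i (2 * Im z / Im tau)).
    + split; [apply Rdiv_lt_0_compat; lra|]. apply (Rmult_lt_reg_r (Im tau)); [lra|].
      unfold Rdiv. rewrite Rmult_assoc, Rinv_l by lra. lra.
    + rewrite E. field. lra.
  - apply tau_neq_0.
  - intros t Ht. unfold rectangle. rewrite re_scal_l, im_scal_l, tau_re. split; [lra|]. nra.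
Qed.

Lemma Gf_zero (l : nat) om : isl l -> (forall z, Gf l (z + om / 2) = Gf l z) -> Gf l (om / 4) = 0.
Proof.
  intros Hl H. apply C_eq_opp. rewrite <- Gf_odd by assumption. rewrite <- (H (- (om / 4))). f_equal. field.
Qed.

Lemma Gf_diff_square (l m : nat) z : isl l -> isl m -> ~ hlat z ->
  Gf m z * Gf m z = Gf l z * Gf l z - (kc l - kc m).
Proof. intros Hl Hm Hz. rewrite !Gf_square by assumption. unfold kc. ring. Qed.

Lemma mult_self_0 z : z * z = 0 -> z = 0.
Proof. intros H. destruct (Cmult_integral _ _ H); assumption. Qed.

(** Equal constants would make [G_l^2 = G_m^2]; but [G_1] vanishes at [1/4] and
    [G_2] at [tau/4] by their signs. *)
Lemma kc_distinct : kc 1 <> kc 2 /\ kc 1 <> kc 3 /\ kc 2 <> kc 3.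
Proof.
  destruct triples as (T1 & T2 & T3).
  assert (D1 := proj1 (dG_product _ _ _ T1)).
  assert (D2 := proj1 (dG_product _ _ _ T2)).
  assert (D3 := proj1 (dG_product _ _ _ T3)).
  assert (L1 : isl 1) by (left; reflexivity). assert (L2 : isl 2) by (right; left; reflexivity).
  assert (L3 : isl 3) by (right; right; reflexivity).
  assert (Q1 : ~ hlat (1 / 4)) by (apply quarter_not_hlat; auto).
  assert (Qt : ~ hlat (tau / 4)) by (apply quarter_not_hlat; auto).
  assert (Z1 : Gf 1 (1 / 4) = 0).
  { apply (Gf_zero 1 1 L1). intros z. replace (1 / 2) with (/ 2) by field.
    rewrite Gf_shift_1 by assumption. unfold sgn1; simpl. ring. }
  assert (Z2 : Gf 2 (tau / 4) = 0).
  { apply (Gf_zero 2 tau L2). intros z. rewrite Gf_shift_tau by assumption. unfold sgnt; simpl. ring. }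
  assert (Sq : forall l m z, isl l -> isl m -> ~ hlat z -> kc l = kc m -> Gf l z = 0 -> Gf m z = 0).
  { intros l m z Hl Hm Hz E E0. apply mult_self_0. rewrite (Gf_diff_square l m z Hl Hm Hz), E, E0. ring. }
  repeat split; intros E.
  - apply (no_common_zero_1 3 1 2 L1 L2).
    + intros z Hz. rewrite D1 by exact Hz. ring.
    + intros z Hz. rewrite D2 by exact Hz. ring.
    + exact Z1.
    + exact (Sq 1%nat 2%nat _ L1 L2 Q1 E Z1).
  - apply (no_common_zero_1 2 1 3 L1 L3).
    + exact D1.
    + intros z Hz. rewrite D3 by exact Hz. ring.
    + exact Z1.
    + exact (Sq 1%nat 3%nat _ L1 L3 Q1 E Z1).
  - exact (no_common_zero_tau 1 2 3 L2 L3 D2 D3 Z2 (Sq 2%nat 3%nat _ L2 L3 Qt E Z2)).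
Qed.

Definition cubic (l : nat) (A B : C) : Prop := forall z, ~ hlat z ->
  cdiff (dG l) z (2 * (Gf l z * Gf l z * Gf l z) - (A + B) * Gf l z) /\
  dG l z * dG l z = (Gf l z * Gf l z - A) * (Gf l z * Gf l z - B).

Definition gf_data (l : nat) (A B : C) : Prop := A <> 0 /\ B <> 0 /\ A <> B /\ cubic l A B /\
  forall z, ~ hlat z -> Pf z = Gf l z * Gf l z - (A + B) / 3.

(** The differential equation of [G_l], a Jacobi elliptic function up to scaling. *)
Theorem Gf_equation (l : nat) : isl l -> exists A B, gf_data l A B.
Proof.
  intros Hl.
  assert (H : exists m n, triple l m n /\ triple m l n /\ triple n l m /\ kc l <> kc m /\ kc l <> kc n /\ kc m <> kc n).
  { destruct kc_distinct as (K1 & K2 & K3). unfold triple, sgn1, sgnt, isl.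
    destruct Hl as [-> |[-> | ->]].
    - exists 2%nat, 3%nat. conj.
    - exists 1%nat, 3%nat. conj.
    - exists 1%nat, 2%nat. conj. }
  destruct H as (m & n & T1 & T2 & T3 & K1 & K2 & K3).
  assert (Hm : isl m) by apply T1. assert (Hn : isl n) by apply T1.
  destruct (dG_product _ _ _ T1) as [D1 Sum].
  destruct (dG_product _ _ _ T2) as [D2 _].
  destruct (dG_product _ _ _ T3) as [D3 _].
  exists (kc l - kc m), (kc l - kc n).
  split; [intros E; apply K1, Ceq_minus, E|]. split; [intros E; apply K2, Ceq_minus, E|].
  split.
  { intros E. apply K3. replace (kc m) with (kc l - (kc l - kc m)) by ring. rewrite E. ring. }
  split; [intros z Hz|intros z Hz].
  1: assert (Em := Gf_diff_square l m z Hl Hm Hz). 1: assert (En := Gf_diff_square l n z Hl Hn Hz). 1: split.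
  - destruct (near_nhlat z Hz) as [d [Hd Hnear]].
    apply (cdiff_loc (fun z => - (Gf m z * Gf n z)) (dG l) z _ d Hd).
    + intros w Hw. symmetry. apply D1, Hnear, Hw.
    + assert (Gm := Gf_diff m z Hz). assert (Gn := Gf_diff n z Hz).
      rewrite D2 in Gm by exact Hz. rewrite D3 in Gn by exact Hz.
      cd. transitivity (Gf l z * (Gf n z * Gf n z + Gf m z * Gf m z)); [ring|].
      rewrite Em, En. ring.
  - rewrite D1 by exact Hz.
    transitivity ((Gf m z * Gf m z) * (Gf n z * Gf n z)); [ring|]. rewrite Em, En. reflexivity.
  - rewrite (Gf_square l z Hl Hz). unfold kc.
    assert (Sum' : C_derive (gl m) 0 = - C_derive (gl l) 0 - C_derive (gl n) 0).
    { replace (C_derive (gl m) 0) with (C_derive (gl l) 0 + C_derive (gl m) 0 + C_derive (gl n) 0 - C_derive (gl l) 0 - C_derive (gl n) 0) by ring.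
      rewrite Sum. ring. }
    rewrite Sum'. field.
Qed.

Lemma shift_lattice (l : nat) v : isl l -> lattice tau v -> exists s c : C, s * s = 1 /\
  (forall z, Gf l (z + v / 2) = s * Gf l z) /\ (forall z, Sf (z + v / 2) = Sf z + c).
Proof.
  intros Hl. revert v.
  set (P := fun v => exists s c : C, s * s = 1 /\
    (forall z, Gf l (z + v / 2) = s * Gf l z) /\ (forall z, Sf (z + v / 2) = Sf z + c)).
  assert (B : forall om, P om -> forall v, P v -> P (v + om) /\ P (v - om)).
  { intros om (sg & c0 & Hsg & HG0 & HS0) v (s & c & Hs & HG & HS).
    assert (Hss : sg * s * (sg * s) = 1).
    { transitivity ((sg * sg) * (s * s)); [ring|]. rewrite Hsg, Hs. ring. }
    split; [exists (sg * s), (c + c0)|exists (sg * s), (c - c0)]; (split; [exact Hss|]); split; intros z.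
    - replace (z + (v + om) / 2) with (z + v / 2 + om / 2) by field. rewrite HG0, HG. ring.
    - replace (z + (v + om) / 2) with (z + v / 2 + om / 2) by field. rewrite HS0, HS. ring.
    - set (w := z - om / 2). replace z with (w + om / 2) by (unfold w; ring).
      replace (w + om / 2 + (v - om) / 2) with (w + v / 2) by field. rewrite HG, HG0.
      transitivity (sg * sg * s * Gf l w); [rewrite Hsg; ring|ring].
    - set (w := z - om / 2). replace z with (w + om / 2) by (unfold w; ring).
      replace (w + om / 2 + (v - om) / 2) with (w + v / 2) by field. rewrite HS, HS0. ring. }
  assert (P1 : P 1).
  { exists (sgn1 l), (2 * eta tau 1). split; [apply sgn1_sq|]. split; intros z; replace (1 / 2) with (/ (2 : C)) by field;
      [apply Gf_shift_1, Hl|apply Sf_shift_1]. }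
  assert (Pt : P tau).
  { exists (sgnt l), (2 * eta tau 2). split; [apply sgnt_sq|]. split; intros z; [apply Gf_shift_tau, Hl|apply Sf_shift_tau]. }
  apply (lattice_ind P); [|intros v Hv; apply (B _ P1 v Hv)|intros v Hv; apply (B _ P1 v Hv)
    |intros v Hv; apply (B _ Pt v Hv)|intros v Hv; apply (B _ Pt v Hv)].
  exists 1, 0. split; [ring|]. split; intros z; replace (z + 0 / 2) with z by field; ring.
Qed.

Lemma Gf_period (l : nat) z : isl l -> Gf l (z + 1) = Gf l z /\ Gf l (z + tau) = Gf l z.
Proof.
  intros Hl. split.
  - replace (z + 1) with (z + / 2 + / 2) by field. rewrite !Gf_shift_1, Cmult_assoc, sgn1_sq by assumption. ring.
  - replace (z + tau) with (z + tau / 2 + tau / 2) by field. rewrite !Gf_shift_tau, Cmult_assoc, sgnt_sq by assumption. ring.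
Qed.

Lemma hlat_period z : (hlat (z + 1) <-> hlat z) /\ (hlat (z + tau) <-> hlat z).
Proof.
  split.
  - replace (z + 1) with (z + / 2 + / 2) by field. rewrite !hlat_shift_1. reflexivity.
  - replace (z + tau) with (z + tau / 2 + tau / 2) by field. rewrite !hlat_shift_tau. reflexivity.
Qed.

Lemma tends_shift f p a : tends (fun u => f (p + u)) 0 a -> tends f p a.
Proof.
  intros H e He. destruct (H e He) as [d [Hd H1]]. exists d. split; [exact Hd|]. intros z Hne Hz.
  replace z with (p + (z - p)) by ring. apply H1.
  - intros E. apply Hne, Ceq_minus, E.
  - replace (z - p - 0) with (z - p) by ring. exact Hz.
Qed.

(** A value [D] that [G_l] omits would make [1/(G_l - D)] constant. *)
Theorem Gf_surjective (l : nat) (D : C) : isl l -> exists a, ~ hlat a /\ Gf l a = D.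
Proof.
  intros Hl. apply NNPP. intros Hno.
  assert (Hne : forall z, ~ hlat z -> Gf l z - D <> 0).
  { intros z Hz E. apply Hno. exists z. split; [exact Hz|apply Ceq_minus, E]. }
  set (h := fun z => / (Gf l z - D)).
  destruct local_data as (d & Hd & Hsm & Hgl & _). assert (Hg := Hgl l).
  destruct (Hg 0 (disc_center 0 d Hd)) as [a0 A0].
  assert (Hlim : forall v, lattice tau v -> tends (fun u => h (u + v / 2)) 0 0).
  { intros v Hv. destruct (shift_lattice l v Hl Hv) as (s & _ & Hs & Hsh & _).
    assert (Hs0 : s <> 0) by (intros ->; apply C1_nz; rewrite <- Hs; ring).
    set (k := fun u => u / (s * (1 + u * gl l u) - D * u)).
    replace (RtoC 0) with (k 0) at 2 by (unfold k, Cdiv; ring).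
    apply (tends_cont _ k 0 d Hd).
    - eapply cdiff_ccont. unfold k. repeat cd_step.
      replace (s * (1 + 0 * gl l 0) - D * 0) with s by ring. exact Hs0.
    - intros u [Hu Hud]. unfold h, k. rewrite Hsh, Gf_gl.
      assert (Hnu : ~ hlat (u + v / 2)).
      { intros H. apply (Hsm u); [split; assumption|].
        unfold hlat in *. replace (2 * u) with (2 * (u + v / 2) - v) by field. apply lattice_minus; assumption. }
      specialize (Hne _ Hnu). rewrite Hsh, Gf_gl in Hne.
      assert (Hden : s * (1 + u * gl l u) - D * u <> 0).
      { intros E. apply Hne. replace (s * (1 / u + gl l u) - D) with ((s * (1 + u * gl l u) - D * u) / u) by (field; exact Hu).
        rewrite E. unfold Cdiv. ring. }
      replace (s * (1 / u + gl l u) - D) with ((s * (1 + u * gl l u) - D * u) / u) by (field; exact Hu).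
      field. split; [exact Hden|exact Hu]. }
  destruct (elliptic_constant hlat h) as [c Hc].
  - apply hlat_discrete; assumption.
  - intros z. apply hlat_period.
  - intros z. apply hlat_period.
  - intros z Hz. eexists. unfold h. apply cdiff_inv; [|apply Hne, Hz].
    apply cdiff_minus; [apply Gf_diff; assumption|apply cdiff_const].
  - intros z _. unfold h. rewrite (proj1 (Gf_period l z Hl)). reflexivity.
  - intros z _. unfold h. rewrite (proj2 (Gf_period l z Hl)). reflexivity.
  - intros p Hp. apply tends_shift. intros e He.
    destruct (Hlim (2 * p) Hp 1%R Rlt_0_1) as [d1 [Hd1 H1]].
    exists (Rmin d1 e). split; [apply Rmin_pos; assumption|]. intros u Hu Hud.
    specialize (H1 u Hu ltac:(apply (Rmin_Rgt_l _ _ _ Hud))).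
    assert (Hue : Cmod (u - 0) < e) by (apply (Rmin_Rgt_l _ _ _ Hud)).
    replace (u + 2 * p / 2) with (p + u) in H1 by field.
    replace (u - 0) with u in Hue by ring. replace (h (p + u) - 0) with (h (p + u)) in H1 by ring.
    replace ((p + u - p) * h (p + u) - 0) with (u * h (p + u)) by ring.
    rewrite Cmod_mult. apply Rle_lt_trans with (Cmod u * 1)%R; [|lra].
    apply Rmult_le_compat_l; [apply Cmod_ge_0|lra].
  - assert (Q1 : ~ hlat (1 / 4)) by (apply quarter_not_hlat; auto).
    assert (Hc0 : c <> 0).
    { intros ->. specialize (Hc _ Q1). unfold h in Hc.
      apply C1_nz. rewrite <- (Cinv_r (Gf l (1 / 4) - D)) by (apply Hne, Q1). rewrite Hc. ring. }
    assert (Hcp := proj1 (Cmod_gt_0 c) Hc0).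
    destruct (Hlim 0 lattice_0 (Cmod c) Hcp) as [d1 [Hd1 H1]].
    set (u := RtoC (Rmin d d1 / 2)).
    assert (Hm : 0 < Rmin d d1) by (apply Rmin_pos; assumption).
    assert (Hu : u <> 0) by (apply RtoC_neq_0; lra).
    assert (Eu : Cmod (u - 0) = (Rmin d d1 / 2)%R).
    { replace (u - 0) with u by ring. unfold u. rewrite Cmod_R, Rabs_pos_eq; lra. }
    specialize (H1 u Hu). generalize (Rmin_l d d1), (Rmin_r d d1). intros M1 M2.
    specialize (H1 ltac:(lra)). replace (u + 0 / 2) with u in H1 by field.
    rewrite Hc in H1.
    + replace (c - 0) with c in H1 by ring. lra.
    + apply Hsm. split; [exact Hu|]. rewrite Eu. lra.
Qed.

Lemma re_recont f z : ccont f z -> recont (fun z => Re (f z)) z.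
Proof.
  intros H e He. destruct (H e He) as [r [Hr H1]]. exists r. split; [exact Hr|]. intros w Hw.
  rewrite <- re_minus. eapply Rle_lt_trans; [apply re_le|]. apply H1, Hw.
Qed.

Lemma recont_plus (V W : C -> R) z : recont V z -> recont W z -> recont (fun z => V z + W z)%R z.
Proof.
  intros HV HW e He. destruct (HV (e / 2)%R) as [r1 [Hr1 H1]]; [lra|]. destruct (HW (e / 2)%R) as [r2 [Hr2 H2]]; [lra|].
  exists (Rmin r1 r2). split; [apply Rmin_pos; assumption|]. intros w Hw.
  specialize (H1 w ltac:(apply (Rmin_Rgt_l _ _ _ Hw))).
  specialize (H2 w ltac:(apply (Rmin_Rgt_l _ _ _ Hw))).
  apply Rabs_def2 in H1. apply Rabs_def2 in H2. apply Rabs_def1; lra.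
Qed.

Lemma recont_re (g : R -> R) z : continuity_pt g (Re z) -> recont (fun z => g (Re z)) z.
Proof.
  intros Hg e He. destruct (Hg e He) as [r [Hr H]]. exists r. split; [exact Hr|]. intros w Hw.
  destruct (Req_dec (Re w) (Re z)) as [->|Hne]; [rewrite Rminus_diag, Rabs_R0; exact He|].
  apply (H (Re w)). split; [split; [exact I|auto]|]. unfold dist; simpl. unfold Rdist.
  rewrite <- re_minus. eapply Rle_lt_trans; [apply re_le|exact Hw].
Qed.

(** * Positivity in a strip *)

Definition strip4 z : Prop := (0 < Re z < / 4).

Lemma copen_strip4 : copen strip4.
Proof.
  intros z Hz. unfold strip4 in *. exists (Rmin (Re z) (/ 4 - Re z)). split; [apply Rmin_pos; lra|].
  intros w Hw. assert (A := Rle_lt_trans _ _ _ (re_le (w - z)) Hw). rewrite re_minus in A. apply Rabs_def2 in A.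
  generalize (Rmin_l (Re z) (/ 4 - Re z)), (Rmin_r (Re z) (/ 4 - Re z)). lra.
Qed.

(** In the average the linear Taylor terms cancel in pairs, the quadratic ones
    because [1 + 1 + i^2 + i^2 = 0]. *)
Lemma square_average f z (r : R) : 0 < r -> holo (disc z r) f ->
  exists M s0, 0 < s0 /\ 0 < M /\ forall s, 0 < s < s0 ->
    Rabs (Re (f (z + RtoC s)%C) + Re (f (z - RtoC s)%C) + Re (f (z + RtoC s * Ci)%C) + Re (f (z - RtoC s * Ci)%C) - 4 * Re (f z))
       <= M * (s * s * s).
Proof.
  intros Hr Hf. assert (Ho := copen_disc z r). assert (Hs := star_disc z r). assert (H0 := disc_center z r Hr).
  destruct (holo_division _ z f Ho Hs H0 Hf) as (k1 & Hk1 & _ & E1).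
  destruct (holo_division _ z k1 Ho Hs H0 Hk1) as (k2 & Hk2 & _ & E2).
  destruct (holo_division _ z k2 Ho Hs H0 Hk2) as (k3 & Hk3 & _ & E3).
  destruct (holo_ccont _ _ _ Hk3 H0 1%R Rlt_0_1) as [d [Hd H]].
  set (B := (Cmod (k3 z) + 1)%R). assert (HB : 0 < B) by (unfold B; generalize (Cmod_ge_0 (k3 z)); lra).
  exists (4 * B)%R, (Rmin d r). split; [apply Rmin_pos; assumption|]. split; [lra|].
  intros s Hs0.
  destruct (Rmin_Rgt_l _ _ _ (proj2 Hs0)) as [Hsd Hsr].
  assert (T : forall u, Cmod u = s -> f (z + u) = f z + u * k1 z + u * u * k2 z + u * u * u * k3 (z + u) /\
     Cmod (u * u * u * k3 (z + u))%C <= s * s * s * B).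
  { intros u Hu. assert (Hin : disc z r (z + u)) by (unfold disc; replace (z + u - z) with u by ring; lra).
    split.
    - rewrite (E1 _ Hin), (E2 _ Hin), (E3 _ Hin). replace (z + u - z) with u by ring. ring.
    - rewrite !Cmod_mult, Hu. apply Rmult_le_compat_l; [repeat apply Rmult_le_pos; lra|].
      specialize (H (z + u)). replace (z + u - z) with u in H by ring. specialize (H ltac:(lra)).
      generalize (Cmod_minus_ge (k3 (z + u)) (k3 z)). unfold B. lra. }
  assert (U1 : Cmod (RtoC s) = s) by (rewrite Cmod_R, Rabs_pos_eq; lra).
  assert (U2 : Cmod (- RtoC s) = s) by (rewrite Cmod_opp; exact U1).
  assert (U3 : Cmod (RtoC s * Ci) = s) by (rewrite Cmod_mult, Cmod_Ci, U1; ring).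
  assert (U4 : Cmod (- (RtoC s * Ci)) = s) by (rewrite Cmod_opp; exact U3).
  destruct (T _ U1) as [F1 G1]. destruct (T _ U2) as [F2 G2]. destruct (T _ U3) as [F3 G3]. destruct (T _ U4) as [F4 G4].
  set (X1 := RtoC s * RtoC s * RtoC s * k3 (z + RtoC s)) in *.
  set (X2 := - RtoC s * - RtoC s * - RtoC s * k3 (z + - RtoC s)) in *.
  set (X3 := RtoC s * Ci * (RtoC s * Ci) * (RtoC s * Ci) * k3 (z + RtoC s * Ci)) in *.
  set (X4 := - (RtoC s * Ci) * - (RtoC s * Ci) * - (RtoC s * Ci) * k3 (z + - (RtoC s * Ci))) in *.
  assert (E : f (z + RtoC s) + f (z - RtoC s) + f (z + RtoC s * Ci) + f (z - RtoC s * Ci) - 4 * f z = X1 + X2 + X3 + X4).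
  { change (z - RtoC s) with (z + - RtoC s). change (z - RtoC s * Ci) with (z + - (RtoC s * Ci)).
    rewrite F1, F2, F3, F4. unfold X1, X2, X3, X4.
    assert (Ei : Ci * Ci = - (1)) by (apply injective_projections; simpl; ring).
    replace (RtoC s * Ci * (RtoC s * Ci)) with (- (RtoC s * RtoC s)).
    2:{ replace (RtoC s * Ci * (RtoC s * Ci)) with (RtoC s * RtoC s * (Ci * Ci)) by ring. rewrite Ei. ring. }
    replace (- (RtoC s * Ci) * - (RtoC s * Ci)) with (- (RtoC s * RtoC s)).
    2:{ replace (- (RtoC s * Ci) * - (RtoC s * Ci)) with (RtoC s * RtoC s * (Ci * Ci)) by ring. rewrite Ei. ring. }
    ring. }
  assert (ER := f_equal Re E). rewrite re_minus, !re_plus, re_scal_l in ER. rewrite ER.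
  generalize (Rle_trans _ _ _ (re_le X1) G1), (Rle_trans _ _ _ (re_le X2) G2), (Rle_trans _ _ _ (re_le X3) G3), (Rle_trans _ _ _ (re_le X4) G4).
  intros A1 A2 A3 A4. apply Rabs_le_between in A1, A2, A3, A4. apply Rabs_le. lra.
Qed.

(** The minimum principle in the strip. The hypothesis keeps a negative infimum away
    from the boundary and from infinity; at a minimum of [Re f + e x (1/4 - x)] the
    average over a small square would have to be smaller than the value. *)
Lemma minimum_principle f : holo strip4 f ->
  (forall delta, 0 < delta -> exists alpha Y, 0 < alpha < / 8 /\ 0 < Y /\
     forall z, strip4 z -> - delta <= Re (f z) \/
       exists y, alpha <= Re z <= / 4 - alpha /\ - Y <= y <= Y /\ Re (f (ptc (Re z) y)) <= Re (f z)) ->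
  forall z, strip4 z -> 0 <= Re (f z).
Proof.
  intros Hf Hbd z1 Hz1. apply Rnot_lt_le. intros Hneg.
  set (mu := (- Re (f z1))%R). assert (Hmu : 0 < mu) by (unfold mu; lra).
  set (w := fun x : R => (x * (/ 4 - x))%R).
  set (V := fun z : C => (Re (f z) + mu * w (Re z))%R).
  assert (Hw : forall x, 0 < x < / 4 -> 0 < w x <= / 64).
  { intros x Hx. unfold w. split; [apply Rmult_lt_0_compat; lra|].
    assert (0 <= (x - / 8) * (x - / 8)) by apply Rle_0_sqr. lra. }
  destruct (Hbd (mu / 2)%R) as (alpha & Y & Ha & HY & HK); [lra|].
  assert (HV1 : V z1 <= - mu + mu / 64).
  { unfold V. destruct (Hw _ Hz1). assert (mu * w (Re z1) <= mu * / 64) by (apply Rmult_le_compat_l; lra).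
    unfold mu in *. lra. }
  assert (Hcont : forall z, strip4 z -> recont V z).
  { intros z Hz. apply recont_plus; [apply re_recont, (holo_ccont _ _ _ Hf Hz)|].
    apply (recont_re (fun x => mu * w x)%R). unfold w. reg. }
  assert (Hbox : forall x y, alpha <= x <= / 4 - alpha -> strip4 (ptc x y)).
  { intros x y Hx. unfold strip4. rewrite re_ptc. lra. }
  destruct (box_min V alpha (/ 4 - alpha) (- Y) Y) as (x0 & y0 & Hx0 & Hy0 & Hmin); [lra|lra| |].
  { intros x y Hx _. apply Hcont, Hbox, Hx. }
  set (zs := ptc x0 y0) in *. assert (Hzs : strip4 zs) by (apply Hbox, Hx0).
  assert (Hlow : forall z, strip4 z -> V z <= - mu / 2 -> V zs <= V z).
  { intros z Hz HVz. destruct (HK z Hz) as [K|(y & K1 & K2 & K3)].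
    - exfalso. unfold V in HVz. destruct (Hw _ Hz). assert (0 < mu * w (Re z)) by (apply Rmult_lt_0_compat; lra). lra.
    - eapply Rle_trans; [apply (Hmin (Re z) y K1 K2)|]. unfold V. rewrite re_ptc. lra. }
  assert (HVs : V zs <= - mu / 2).
  { eapply Rle_trans; [apply (Hlow z1 Hz1)|]; lra. }
  assert (Hglob : forall z, strip4 z -> V zs <= V z).
  { intros z Hz. destruct (Rle_dec (V z) (- mu / 2)) as [K|K]; [apply Hlow; assumption|lra]. }
  destruct (copen_strip4 zs Hzs) as [r [Hr Hin]].
  destruct (square_average f zs r Hr) as (M & s0 & Hs0 & HM & Hav).
  { intros z Hz. apply Hf, Hin, Hz. }
  set (s := (Rmin (Rmin s0 r) (mu / M) / 2)%R).
  assert (HmM : 0 < mu / M) by (apply Rdiv_lt_0_compat; lra).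
  assert (Hmin0 : 0 < Rmin (Rmin s0 r) (mu / M)) by (repeat apply Rmin_pos; lra).
  assert (Hs : 0 < s) by (unfold s; lra).
  assert (Hss0 : s < s0).
  { generalize (Rle_trans _ _ _ (Rmin_l (Rmin s0 r) (mu / M)) (Rmin_l s0 r)). unfold s; lra. }
  assert (Hsr : s < r).
  { generalize (Rle_trans _ _ _ (Rmin_l (Rmin s0 r) (mu / M)) (Rmin_r s0 r)). unfold s; lra. }
  assert (HsM : M * s < mu).
  { apply Rlt_le_trans with (M * (mu / M))%R; [|right; field; lra]. apply Rmult_lt_compat_l; [exact HM|].
    generalize (Rmin_r (Rmin s0 r) (mu / M)). unfold s in *. lra. }
  assert (Hnb : forall u, Cmod u = s -> V zs <= V (zs + u)%C).
  { intros u Hu. apply Hglob, Hin. replace (zs + u - zs) with u by ring. lra. }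
  assert (U1 : Cmod (RtoC s) = s) by (rewrite Cmod_R, Rabs_pos_eq; lra).
  assert (U2 : Cmod (- RtoC s) = s) by (rewrite Cmod_opp; exact U1).
  assert (U3 : Cmod (RtoC s * Ci) = s) by (rewrite Cmod_mult, Cmod_Ci, U1; ring).
  assert (U4 : Cmod (- (RtoC s * Ci)) = s) by (rewrite Cmod_opp; exact U3).
  assert (N1 := Hnb _ U1). assert (N2 := Hnb _ U2). assert (N3 := Hnb _ U3). assert (N4 := Hnb _ U4).
  unfold V in N1, N2, N3, N4.
  assert (R1 : Re (zs + RtoC s) = (Re zs + s)%R) by (rewrite re_plus, re_RtoC; reflexivity).
  assert (R2 : Re (zs + - RtoC s) = (Re zs - s)%R) by (rewrite re_plus, re_opp, re_RtoC; reflexivity).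
  assert (Rc : Re Ci = 0%R) by reflexivity.
  assert (R3 : Re (zs + RtoC s * Ci) = Re zs) by (rewrite re_plus, re_scal_l, Rc; ring).
  assert (R4 : Re (zs + - (RtoC s * Ci)) = Re zs) by (rewrite re_plus, re_opp, re_scal_l, Rc; ring).
  rewrite R1 in N1. rewrite R2 in N2. rewrite R3 in N3. rewrite R4 in N4. unfold w in N1, N2, N3, N4.
  specialize (Hav s (conj Hs Hss0)). apply Rabs_le_between in Hav.
  change (zs - RtoC s) with (zs + - RtoC s) in Hav. change (zs - RtoC s * Ci) with (zs + - (RtoC s * Ci)) in Hav.
  assert (F : 2 * mu * (s * s) <= M * (s * s * s)) by lra.
  assert (F2 : M * s * (s * s) < mu * (s * s)).
  { apply Rmult_lt_compat_r; [apply Rmult_lt_0_compat; lra|exact HsM]. }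
  assert (0 < mu * (s * s)) by (repeat apply Rmult_lt_0_compat; lra). lra.
Qed.

(** The barrier [2 pi cot (2 pi z)]. *)
Definition ecot z : C := cexp (4 * PI * Ci * z).
Definition cot2 z : C := 2 * PI * Ci * ((ecot z + 1) / (ecot z - 1)).

Lemma ecot_parts z : Re (ecot z) = (exp (- (4 * PI * Im z)) * cos (4 * PI * Re z))%R /\
  Im (ecot z) = (exp (- (4 * PI * Im z)) * sin (4 * PI * Re z))%R /\ Cmod (ecot z) = exp (- (4 * PI * Im z)).
Proof.
  assert (E : Re (4 * PI * Ci * z) = (- (4 * PI * Im z))%R /\ Im (4 * PI * Ci * z) = (4 * PI * Re z)%R).
  { destruct z as [x y]. unfold Re, Im; simpl. split; ring. }
  destruct E as [E1 E2]. unfold ecot. rewrite Cmod_cexp, <- E1, <- E2. repeat split.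
Qed.

Lemma ecot_diff z : cdiff ecot z (ecot z * (4 * PI * Ci)).
Proof. apply (cdiff_scale cexp), cdiff_cexp. Qed.

Lemma cot2_re z : ecot z - 1 <> 0 ->
  Re (cot2 z) = (4 * PI * Im (ecot z) / (Cmod (ecot z - 1) ^ 2))%R.
Proof.
  intros H. unfold cot2. set (E := ecot z) in *.
  assert (Hc : Cconj (E - 1) <> 0).
  { intros H'. apply H. rewrite <- (Cconj_conj (E - 1)), H', Cconj_R. reflexivity. }
  assert (Hm : (Cmod (E - 1) ^ 2)%R <> 0%R) by (apply pow_nonzero; apply Cmod_gt_0 in H; lra).
  replace ((E + 1) / (E - 1)) with ((E + 1) * Cconj (E - 1) * / RtoC (Cmod (E - 1) ^ 2)).
  2:{ rewrite Cmod2_conj. field. split; assumption. }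
  rewrite <- RtoC_inv by exact Hm. unfold Rdiv.
  replace (2 * PI * Ci * ((E + 1) * Cconj (E - 1) * (/ Cmod (E - 1) ^ 2)%R)) with
    (2 * PI * Ci * ((E + 1) * Cconj (E - 1)) * (/ Cmod (E - 1) ^ 2)%R) by ring.
  rewrite re_scal_r. f_equal. destruct E as [x y]. unfold Re, Im; simpl. ring.
Qed.

Lemma ecot_neq_1 z : ecot z <> 1 -> ecot z - 1 <> 0.
Proof. intros H E. apply H, Ceq_minus, E. Qed.

Lemma cot2_holo z : ecot z <> 1 -> exists l, cdiff cot2 z l.
Proof.
  intros H. assert (D := ecot_diff z). eexists. unfold cot2.
  repeat cd_step. apply ecot_neq_1, H.
Qed.

Lemma sin_strip (x : R) : 0 < x < / 4 -> 0 < sin (4 * PI * x).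
Proof.
  intros [H1 H2]. assert (P := PI_RGT_0). assert (0 < PI * x) by nra.
  assert (0 < PI * (/ 4 - x)) by (apply Rmult_lt_0_compat; lra). apply sin_gt_0; lra.
Qed.

Lemma ecot_strip z : strip4 z -> 0 < Im (ecot z) /\ ecot z <> 1.
Proof.
  intros Hz. destruct (ecot_parts z) as (_ & E & _).
  assert (K : 0 < Im (ecot z)).
  { rewrite E. apply Rmult_lt_0_compat; [apply exp_pos|apply sin_strip, Hz]. }
  split; [exact K|]. intros E1. rewrite E1, im_RtoC in K. lra.
Qed.

Lemma cot2_pos z : strip4 z -> 0 < Re (cot2 z).
Proof.
  intros Hz. destruct (ecot_strip z Hz) as [K1 K2]. apply ecot_neq_1 in K2.
  rewrite cot2_re by exact K2. apply Rdiv_lt_0_compat.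
  - assert (P := PI_RGT_0). apply Rmult_lt_0_compat; [lra|exact K1].
  - apply pow_lt, Cmod_gt_0, K2.
Qed.

Lemma cot2_decay (delta : R) : 0 < delta -> exists Y, 0 < Y /\
  forall z, strip4 z -> Y <= Rabs (Im z) -> Re (cot2 z) <= delta.
Proof.
  intros Hd. assert (P := PI_RGT_0).
  set (Y := (1 + 16 * PI / delta)%R). assert (HY : 1 < Y).
  { unfold Y. assert (0 < 16 * PI / delta) by (apply Rdiv_lt_0_compat; lra). lra. }
  exists Y. split; [lra|]. intros z Hz HYz.
  destruct (ecot_strip z Hz) as [_ K2]. apply ecot_neq_1 in K2. rewrite cot2_re by exact K2.
  destruct (ecot_parts z) as (_ & _ & Em).
  assert (Him := im_le (ecot z)). set (E := ecot z) in *. set (m := Cmod E) in *.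
  assert (Hm0 : 0 < m) by (rewrite Em; apply exp_pos).
  set (N := Cmod (E - 1)) in *. assert (HN : 0 < N) by (apply Cmod_gt_0, K2).
  set (e := exp (- (4 * PI * Y))). assert (He : 0 < e) by apply exp_pos.
  assert (P3 : 3 < PI) by (generalize PI2_3_2; unfold PI2; lra).
  assert (He2 : e * (1 + 4 * PI * Y) <= 1).
  { unfold e. rewrite exp_Ropp. apply (Rmult_le_reg_l (exp (4 * PI * Y))); [apply exp_pos|].
    rewrite <- Rmult_assoc, Rinv_r, Rmult_1_l, Rmult_1_r by (apply Rgt_not_eq, exp_pos).
    apply exp_ineq1_le. }
  assert (He3 : e <= / 2).
  { apply (Rmult_le_reg_r (1 + 4 * PI * Y)); [nra|]. nra. }
  assert (He4 : 16 * PI * e <= delta).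
  { assert (Hdy : (delta * Y = delta + 16 * PI)%R) by (unfold Y; field; lra).
    apply (Rmult_le_reg_r (1 + 4 * PI * Y)); [nra|].
    apply Rle_trans with (16 * PI)%R; [nra|]. nra. }
  assert (Hbound : m / N ^ 2 <= 4 * e).
  { apply (Rmult_le_reg_r (N ^ 2)); [apply pow_lt, HN|]. unfold Rdiv. rewrite Rmult_assoc, Rinv_l, Rmult_1_r by (apply pow_nonzero; lra).
    destruct (Rle_dec 0 (Im z)) as [Hy|Hy].
    - rewrite Rabs_pos_eq in HYz by exact Hy.
      assert (Hme : m <= e).
      { rewrite Em. unfold e. destruct (Req_dec (Im z) Y) as [->|Hne]; [lra|]. left. apply exp_increasing. nra. }
      assert (HNb : / 2 <= N).
      { unfold N. generalize (Cmod_minus_ge 1 E). rewrite Cmod_sym, Cmod_1. fold m. lra. }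
      assert (/ 2 * / 2 <= N * N) by (apply Rmult_le_compat; lra).
      assert (e * (/ 2 * / 2) <= e * (N * N)) by (apply Rmult_le_compat_l; lra).
      simpl. lra.
    - rewrite Rabs_left in HYz by lra.
      assert (Hme : 1 <= m * e).
      { rewrite Em. unfold e. rewrite <- exp_plus. rewrite <- exp_0.
        destruct (Req_dec (- (4 * PI * Im z) + - (4 * PI * Y)) 0) as [->|Hne]; [lra|]. left. apply exp_increasing. nra. }
      assert (Hm2 : 2 <= m) by nra.
      assert (HNb : m / 2 <= N).
      { unfold N. generalize (Cmod_minus_ge E 1). rewrite Cmod_1. fold m. lra. }
      assert (m / 2 * (m / 2) <= N * N) by (apply Rmult_le_compat; lra).
      assert (m * 1 <= m * (m * e)) by (apply Rmult_le_compat_l; lra).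
      assert (e * (m / 2 * (m / 2)) <= e * (N * N)) by (apply Rmult_le_compat_l; lra).
      simpl. lra. }
  apply Rle_trans with (4 * PI * (m / N ^ 2))%R.
  - unfold Rdiv. rewrite Rmult_assoc. apply Rmult_le_compat_l; [lra|].
    apply Rmult_le_compat_r; [left; apply Rinv_0_lt_compat, pow_lt, HN|].
    eapply Rle_trans; [apply Rle_abs|exact Him].
  - apply Rle_trans with (4 * PI * (4 * e))%R; [apply Rmult_le_compat_l; lra|lra].
Qed.

Lemma cot2_edge z : (sin (4 * PI * Re z) = 0)%R -> ecot z <> 1 -> Re (cot2 z) = 0%R.
Proof.
  intros Hs H. apply ecot_neq_1 in H. rewrite cot2_re by exact H.
  destruct (ecot_parts z) as (_ & E & _). rewrite E, Hs. unfold Rdiv. ring.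
Qed.

Lemma ecot_edge0 (y : R) : y <> 0%R -> ecot (ptc 0 y) <> 1.
Proof.
  intros Hy E. destruct (ecot_parts (ptc 0 y)) as (_ & _ & Em). rewrite E, Cmod_1, im_ptc in Em.
  assert (P := PI_RGT_0). rewrite <- exp_0 in Em. apply exp_inv in Em. apply Hy. nra.
Qed.

Lemma ecot_edge4 (y : R) : ecot (ptc (/ 4) y) <> 1.
Proof.
  intros E. destruct (ecot_parts (ptc (/ 4) y)) as (Er & _ & _). rewrite E, re_ptc, im_ptc, re_RtoC in Er.
  replace (4 * PI * / 4)%R with PI in Er by field. rewrite cos_PI in Er.
  generalize (exp_pos (- (4 * PI * y))). lra.
Qed.

Lemma ecot_0 : ecot 0 = 1.
Proof. unfold ecot. replace (4 * PI * Ci * 0) with (0:C) by ring. apply cexp_0. Qed.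

Lemma four_pi_i : 4 * PI * Ci <> 0.
Proof.
  repeat apply Cmult_neq_0; [apply RtoC_neq_0; lra|apply RtoC_neq_0; generalize PI_RGT_0; lra|apply Ci_nz].
Qed.

(** Write [E = 1 + u g] and [g = c + u g1] with [c = 4 pi i]: the regular part is
    [(c g / 2 - g1) / g], and [g1 0 = c^2 / 2] makes it vanish at 0. *)
Lemma cot2_local : exists d k, 0 < d /\ holo (disc 0 d) k /\ k 0 = 0 /\
  forall u, punctured 0 d u -> ecot u <> 1 /\ cot2 u = 1 / u + k u.
Proof.
  set (c := 4 * PI * Ci). assert (Hc := four_pi_i). fold c in Hc.
  assert (He : holo (disc 0 1) ecot) by (intros z _; eexists; apply ecot_diff).
  assert (D0 := disc_center 0 1 Rlt_0_1). assert (Ho := copen_disc 0 1). assert (De := ecot_diff 0).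
  rewrite ecot_0 in De.
  destruct (holo_division _ 0 ecot Ho (star_disc 0 1) D0 He) as (g & Hg & Hg0 & Eg).
  destruct (holo_division _ 0 g Ho (star_disc 0 1) D0 Hg) as (g1 & Hg1 & Hg10 & Eg1).
  rewrite (C_derive_eq _ _ _ De) in Hg0. replace (1 * (4 * PI * Ci)) with c in Hg0 by (unfold c; ring).
  destruct (holo_derive _ _ Ho Hg) as [Dg Hg']. destruct (Hg' 0 D0) as [m Dm]. assert (Dg0 := Dg 0 D0).
  (* the Taylor coefficients of the exponential, from [E' = c E] *)
  assert (H2 : C_derive g 0 = c * c / 2).
  { assert (E : C_derive g 0 + (C_derive g 0 + 0 * m) - c * c = 0).
    { apply (cdiff_unique (fun u => g u + u * C_derive g u - c * ecot u) 0).
      - cd. unfold c. ring.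
      - apply (cdiff_loc (fun _ => 0) _ 0 _ 1%R Rlt_0_1); [|apply cdiff_const]. intros u Hu.
        symmetry. transitivity (c * ecot u - c * ecot u); [|ring]. f_equal. apply (cdiff_unique ecot u).
        + destruct (copen_disc 0 1 u Hu) as [r [Hr H]].
          apply (cdiff_loc (fun u => 1 + u * g u) ecot u _ r Hr).
          * intros w Hw. rewrite (Eg w (H w Hw)), ecot_0. ring.
          * assert (A := Dg u Hu). cd. ring.
        + eapply cdiff_val; [apply ecot_diff|unfold c; ring]. }
    transitivity ((C_derive g 0 + (C_derive g 0 + 0 * m) - c * c + c * c) / 2); [field|]. rewrite E. field. }
  destruct (holo_ccont _ _ _ Hg D0 (Cmod (g 0))) as [d0 [Hd0 Hgd]]; [apply Cmod_gt_0; rewrite Hg0; exact Hc|].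
  set (d := Rmin 1 d0).
  assert (Hgne : forall u, disc 0 d u -> disc 0 1 u /\ g u <> 0).
  { intros u Hu. destruct (Rmin_Rgt_l _ _ _ Hu) as [U1 U2]. split; [exact U1|]. intros E. specialize (Hgd u U2).
    rewrite E in Hgd. replace (0 - g 0) with (- g 0) in Hgd by ring. rewrite Cmod_opp in Hgd. lra. }
  exists d, (fun u => (c / 2 * g u - g1 u) / g u). split; [apply Rmin_pos; lra|]. split; [|split].
  - intros u Hu. destruct (Hgne u Hu) as [U1 U2]. destruct (Hg u U1) as [m1 A1]. destruct (Hg1 u U1) as [m2 A2].
    eexists. repeat cd_step. exact U2.
  - rewrite Hg10, Hg0, H2. field. exact Hc.
  - intros u [Hu Hud]. destruct (Hgne u Hud) as [U1 U2].
    assert (E : ecot u = 1 + u * g u) by (rewrite (Eg u U1), ecot_0; ring).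
    assert (E1 : g1 u = (g u - c) / u) by (rewrite (Eg1 u U1), Hg0; field; exact Hu).
    split.
    + intros E2. apply (Cmult_neq_0 u (g u) Hu U2). transitivity (1 + u * g u - 1); [ring|]. rewrite <- E, E2. ring.
    + unfold cot2. rewrite E, E1. replace (1 + u * g u - 1) with (u * g u) by ring. unfold c. field. split; assumption.
Qed.

(** A function with the pole [1/z] at 0, whose real part is odd under reflection
    and carries the pole over to all points of [Z/2 + i q Z]. *)
Section Positivity.
Variables (h k : C -> C) (q d : R).
Hypothesis q_pos : 0 < q.
Hypothesis d_pos : 0 < d.
Definition pole z : Prop := exists m n : Z, z = ptc (IZR m / 2) (IZR n * q).
Hypothesis h_holo : forall z, ~ pole z -> exists l, cdiff h z l.
Hypothesis h_per1 : forall z, Re (h (z + / 2)) = Re (h z).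
Hypothesis h_perq : forall z, Re (h (z + RtoC q * Ci)) = Re (h z).
Hypothesis h_refl : forall z, Re (h (- Cconj z)) = (- Re (h z))%R.
Hypothesis k_holo : holo (disc 0 d) k.
Hypothesis k_0 : k 0 = 0.
Hypothesis h_local : forall u, punctured 0 d u -> h u = 1 / u + k u.

Lemma h_perqn (n : Z) z : Re (h (z + RtoC (IZR n * q) * Ci)) = Re (h z).
Proof.
  revert z. induction n using Z.peano_ind; intros z.
  - do 2 f_equal. rewrite Rmult_0_l. ring.
  - rewrite <- (IHn z), <- (h_perq (z + RtoC (IZR n * q) * Ci)). do 2 f_equal.
    rewrite succ_IZR, Rmult_plus_distr_r, RtoC_plus, Rmult_1_l. ring.
  - rewrite <- (IHn z), <- (h_perq (z + RtoC (IZR (Z.pred n) * q) * Ci)). do 2 f_equal.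
    rewrite <- Z.sub_1_r, minus_IZR, Rmult_minus_distr_r, RtoC_minus, Rmult_1_l. ring.
Qed.

Lemma strip_no_pole z : 0 < Re z < / 2 -> ~ pole z.
Proof. intros Hz (m & n & E). rewrite E, re_ptc in Hz. apply (half_not_IZR m (IZR m)); [lra|reflexivity]. Qed.

Lemma h_strip : holo strip4 h.
Proof. intros z Hz. apply h_holo, strip_no_pole. unfold strip4 in Hz. lra. Qed.

Lemma h_edge z : Re z = 0%R \/ Re z = (/ 4)%R -> Re (h z) = 0%R.
Proof.
  intros Hz. assert (E := h_refl z). assert (E2 : Re (h (- Cconj z)) = Re (h z)); [|lra].
  destruct Hz as [Hz|Hz].
  - do 2 f_equal. apply C_eq; [rewrite re_opp, re_conj|rewrite im_opp, im_conj]; lra.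
  - rewrite <- h_per1. do 2 f_equal. rewrite <- RtoC_inv by lra.
    apply C_eq; [rewrite re_plus, re_opp, re_conj, re_RtoC|rewrite im_plus, im_opp, im_conj, im_RtoC]; lra.
Qed.

(** The real part has nonnegative lower limit at each point of an edge. *)
Definition edge_ok f (x0 : R) : Prop := forall delta y0, 0 < delta ->
  exists r, 0 < r /\ forall z, strip4 z -> Cmod (z - ptc x0 y0) < r -> - delta <= Re (f z).

Lemma edge_continuous f p (delta : R) : 0 < delta -> ccont f p -> Re (f p) = 0%R ->
  exists r, 0 < r /\ forall z, Cmod (z - p) < r -> Rabs (Re (f z)) < delta.
Proof.
  intros Hd Hf H0. destruct (Hf delta Hd) as [r [Hr H]]. exists r. split; [exact Hr|]. intros z Hz.
  specialize (H z Hz). assert (A := Rle_lt_trans _ _ _ (re_le _) H). rewrite re_minus, H0 in A.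
  rewrite Rminus_0_r in A. exact A.
Qed.

Lemma re_inv_pos u : 0 < Re u -> 0 <= Re (1 / u).
Proof.
  intros Hu. destruct u as [x y]. unfold Re in *. simpl in *.
  assert (0 < x * (x * 1) + y * (y * 1)) by nra.
  replace (1 * (x / (x * (x * 1) + y * (y * 1))) - 0 * (- y / (x * (x * 1) + y * (y * 1))))%R with (x / (x * (x * 1) + y * (y * 1)))%R by (field; lra).
  apply Rmult_le_pos; [lra|]. left; apply Rinv_0_lt_compat; assumption.
Qed.

Lemma h_edge0 : edge_ok h 0.
Proof.
  intros delta y0 Hde. destruct (classic (pole (ptc 0 y0))) as [(m & n & E)|Hnp].
  - assert (Ey : y0 = (IZR n * q)%R) by (rewrite <- (im_ptc 0 y0), E, im_ptc; reflexivity).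
    destruct (edge_continuous k 0 delta Hde) as [r [Hr H]].
    { apply (holo_ccont _ _ _ k_holo), disc_center, d_pos. }
    { rewrite k_0. apply re_RtoC. }
    exists (Rmin r d). split; [apply Rmin_pos; assumption|]. intros z Hz Hzr.
    set (u := z - ptc 0 y0). assert (Eu : u - 0 = u) by ring.
    assert (Ez : z = u + RtoC (IZR n * q) * Ci) by (unfold u, ptc; rewrite Ey; ring).
    assert (Hre : Re u = Re z) by (unfold u; rewrite re_minus, re_ptc; ring).
    unfold strip4 in Hz.
    rewrite Ez, h_perqn, h_local.
    + rewrite re_plus. specialize (H u). rewrite Eu in H.
      specialize (H ltac:(apply (Rmin_Rgt_l _ _ _ Hzr))). apply Rabs_def2 in H.
      generalize (re_inv_pos u). lra.
    + split.
      * intros E0. rewrite E0, re_RtoC in Hre. lra.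
      * rewrite Eu. apply (Rmin_Rgt_l _ _ _ Hzr).
  - destruct (h_holo _ Hnp) as [l Hl].
    destruct (edge_continuous h (ptc 0 y0) delta Hde (cdiff_ccont _ _ _ Hl)) as [r [Hr H]].
    { apply h_edge. rewrite re_ptc. auto. }
    exists r. split; [exact Hr|]. intros z _ Hz. specialize (H z Hz). apply Rabs_def2 in H. lra.
Qed.

Lemma h_edge4 : edge_ok h (/ 4).
Proof.
  intros delta y0 Hde.
  destruct (h_holo (ptc (/ 4) y0)) as [l Hl]; [apply strip_no_pole; rewrite re_ptc; lra|].
  destruct (edge_continuous h (ptc (/ 4) y0) delta Hde (cdiff_ccont _ _ _ Hl)) as [r [Hr H]].
  { apply h_edge. rewrite re_ptc. auto. }
  exists r. split; [exact Hr|]. intros z _ Hz. specialize (H z Hz). apply Rabs_def2 in H. lra.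
Qed.

Lemma edge_uniform f (delta Y : R) : edge_ok f 0 -> edge_ok f (/ 4) -> 0 < delta ->
  exists alpha, 0 < alpha < / 8 /\ forall z, strip4 z -> - Y <= Im z <= Y ->
    (Re z < alpha \/ / 4 - alpha < Re z)%R -> - delta <= Re (f z).
Proof.
  intros H0 H4 Hde.
  assert (HU : forall x0, edge_ok f x0 -> exists r, 0 < r /\ forall y, - Y <= y <= Y ->
    forall z, strip4 z -> Cmod (z - ptc x0 y) < r -> - delta <= Re (f z)).
  { intros x0 He.
    destruct (compact_interval (fun y r => forall z, strip4 z -> Cmod (z - ptc x0 y) < r -> - delta <= Re (f z)) (- Y) Y) as [r [Hr H]].
    - intros s r r' Hr H z Hz Hz'. apply H; [exact Hz|lra].
    - intros y0 _. destruct (He delta y0 Hde) as [r [Hr H]]. exists (r / 2)%R. split; [lra|].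
      intros y Hy _ z Hz Hz'. apply H; [exact Hz|].
      generalize (Cmod_tri_minus z (ptc x0 y) (ptc x0 y0)), (Cmod_ptc_minus x0 y x0 y0).
      rewrite Rminus_diag, Rabs_R0. lra.
    - exists r. auto. }
  destruct (HU _ H0) as [r1 [Hr1 A1]]. destruct (HU _ H4) as [r2 [Hr2 A2]].
  exists (Rmin (/ 16) (Rmin r1 r2)). split.
  { split; [repeat apply Rmin_pos; lra|]. generalize (Rmin_l (/ 16) (Rmin r1 r2)). lra. }
  assert (M1 : Rmin (/ 16) (Rmin r1 r2) <= r1) by (eapply Rle_trans; [apply Rmin_r|apply Rmin_l]).
  assert (M2 : Rmin (/ 16) (Rmin r1 r2) <= r2) by (eapply Rle_trans; [apply Rmin_r|apply Rmin_r]).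
  intros z Hz Hy Hx. unfold strip4 in Hz.
  assert (Dist : forall x0, Cmod (z - ptc x0 (Im z)) <= Rabs (Re z - x0)).
  { intros x0. rewrite (ptc_eta z) at 1. eapply Rle_trans; [apply Cmod_ptc_minus|]. rewrite Rminus_diag, Rabs_R0. lra. }
  destruct Hx as [Hx|Hx].
  - apply (A1 (Im z) Hy z Hz). eapply Rle_lt_trans; [apply Dist|]. rewrite Rminus_0_r, Rabs_pos_eq; lra.
  - apply (A2 (Im z) Hy z Hz). eapply Rle_lt_trans; [apply Dist|]. rewrite Rabs_left; lra.
Qed.

(** The bound at infinity for the comparison with the barrier, which decays there;
    here the periodicity in [i q] takes the place of decay. *)
Lemma h_nonneg z : strip4 z -> 0 <= Re (h z).
Proof.
  apply (minimum_principle h h_strip). intros delta Hde.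
  destruct (edge_uniform h delta q h_edge0 h_edge4 Hde) as (alpha & Ha & H).
  exists alpha, q. split; [exact Ha|]. split; [exact q_pos|]. intros z' Hz'.
  set (n := Int_part (Im z' / q)). set (y := (Im z' - IZR n * q)%R).
  assert (Hy : 0 <= y <= q).
  { destruct (base_fp (Im z' / q)) as [F1 F2]. unfold frac_part in F1, F2. fold n in F1, F2.
    assert (Ey : y = ((Im z' / q - IZR n) * q)%R) by (unfold y; field; lra). rewrite Ey. split; nra. }
  assert (Ez : z' = ptc (Re z') y + RtoC (IZR n * q) * Ci).
  { rewrite (ptc_eta z') at 1. unfold ptc, y. rewrite RtoC_minus. ring. }
  assert (Eh : Re (h z') = Re (h (ptc (Re z') y))) by (rewrite Ez at 1; apply h_perqn).
  destruct (Rle_dec alpha (Re z')) as [L1|L1]; [destruct (Rle_dec (Re z') (/ 4 - alpha)) as [L2|L2]|].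
  - right. exists y. repeat split; lra.
  - left. rewrite Eh. apply H; [unfold strip4 in *; rewrite re_ptc; lra|rewrite im_ptc; lra|rewrite re_ptc; lra].
  - left. rewrite Eh. apply H; [unfold strip4 in *; rewrite re_ptc; lra|rewrite im_ptc; lra|rewrite re_ptc; lra].
Qed.

Lemma h_barrier z : strip4 z -> 0 <= Re (h z - cot2 z).
Proof.
  apply (minimum_principle (fun z => h z - cot2 z)).
  { apply holo_minus; [exact h_strip|]. intros w Hw. apply cot2_holo, ecot_strip, Hw. }
  assert (Hgen : forall x0 y0 delta, 0 < delta -> edge_ok h x0 -> ecot (ptc x0 y0) <> 1 -> sin (4 * PI * x0) = 0%R ->
    exists r, 0 < r /\ forall z, strip4 z -> Cmod (z - ptc x0 y0) < r -> - delta <= Re (h z - cot2 z)).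
  { intros x0 y0 delta Hde Hh Hne Hs.
    destruct (Hh (delta / 2)%R y0) as [r1 [Hr1 H1]]; [lra|].
    destruct (cot2_holo _ Hne) as [l Hl].
    destruct (edge_continuous cot2 (ptc x0 y0) (delta / 2) ltac:(lra) (cdiff_ccont _ _ _ Hl)) as [r2 [Hr2 H2]].
    { apply cot2_edge; [rewrite re_ptc; exact Hs|exact Hne]. }
    exists (Rmin r1 r2). split; [apply Rmin_pos; assumption|]. intros z' Hz' Hzr.
    specialize (H1 z' Hz' ltac:(apply (Rmin_Rgt_l _ _ _ Hzr))).
    specialize (H2 z' ltac:(apply (Rmin_Rgt_l _ _ _ Hzr))).
    apply Rabs_def2 in H2. rewrite re_minus. lra. }
  assert (E0 : edge_ok (fun z => h z - cot2 z) 0).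
  { intros delta y0 Hde. destruct (Req_dec y0 0) as [->|Hy].
    - destruct cot2_local as (d2 & k2 & Hd2 & Hk2 & K20 & Ek2).
      destruct (edge_continuous (fun u => k u - k2 u) 0 delta Hde) as [r [Hr H]].
      { assert (D1 := k_holo 0 (disc_center 0 d d_pos)). assert (D2 := Hk2 0 (disc_center 0 d2 Hd2)).
        destruct D1 as [l1 D1]. destruct D2 as [l2 D2]. eapply cdiff_ccont. repeat cd_step. }
      { rewrite k_0, K20, re_minus, re_RtoC. ring. }
      exists (Rmin r (Rmin d d2)). split; [repeat apply Rmin_pos; assumption|]. intros u Hu Hur.
      replace (ptc 0 0) with (0:C) in Hur by (unfold ptc; ring).
      assert (B1 : Cmod (u - 0) < r) by (apply (Rmin_Rgt_l _ _ _ Hur)).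
      assert (B2 : Cmod (u - 0) < d) by (eapply Rlt_le_trans; [apply Hur|eapply Rle_trans; [apply Rmin_r|apply Rmin_l]]).
      assert (B3 : Cmod (u - 0) < d2) by (eapply Rlt_le_trans; [apply Hur|eapply Rle_trans; [apply Rmin_r|apply Rmin_r]]).
      assert (Hu0 : u <> 0) by (intros ->; unfold strip4 in Hu; rewrite re_RtoC in Hu; lra).
      rewrite (h_local u (conj Hu0 B2)). destruct (Ek2 u (conj Hu0 B3)) as [_ ->].
      replace (1 / u + k u - (1 / u + k2 u)) with (k u - k2 u) by ring.
      specialize (H u B1). apply Rabs_def2 in H. lra.
    - apply (Hgen 0%R y0 delta Hde h_edge0 (ecot_edge0 y0 Hy)). rewrite Rmult_0_r. apply sin_0. }
  assert (E4 : edge_ok (fun z => h z - cot2 z) (/ 4)).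
  { intros delta y0 Hde. apply (Hgen (/ 4)%R y0 delta Hde h_edge4 (ecot_edge4 y0)).
    replace (4 * PI * / 4)%R with PI by field. apply sin_PI. }
  intros delta Hde. destruct (cot2_decay delta Hde) as (Y & HY & Hdec).
  destruct (edge_uniform _ delta Y E0 E4 Hde) as (alpha & Ha & H).
  exists alpha, Y. split; [exact Ha|]. split; [exact HY|]. intros z' Hz'.
  destruct (Rle_dec Y (Rabs (Im z'))) as [L|L].
  { left. rewrite re_minus. generalize (Hdec z' Hz' L), (h_nonneg z' Hz'). lra. }
  assert (L' : Rabs (Im z') < Y) by lra. apply Rabs_def2 in L'.
  destruct (Rle_dec alpha (Re z')) as [L1|L1]; [destruct (Rle_dec (Re z') (/ 4 - alpha)) as [L2|L2]|].
  - right. exists (Im z'). rewrite <- ptc_eta. repeat split; lra.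
  - left. apply H; [exact Hz'|lra|lra].
  - left. apply H; [exact Hz'|lra|lra].
Qed.

(** The pole of [h] at 0 has the residue of the barrier, so the difference is
    harmless on the edges; the barrier itself is positive. *)
Theorem strip_positivity z : strip4 z -> 0 < Re (h z).
Proof. intros Hz. generalize (h_barrier z Hz), (cot2_pos z Hz). rewrite re_minus. lra. Qed.
End Positivity.

Lemma sl_0 : sl 0 = 0.
Proof.
  apply C_eq_opp. unfold sl. transitivity (2 * Z0 (- (2 * 0))); [do 2 f_equal; ring|].
  rewrite Z0_odd. ring.
Qed.

(** The two periods with their quasi-periods; they enter below through [om / 2]. *)
Definition half_period om et : Prop := (om = 1 /\ et = eta tau 1) \/ (om = tau /\ et = eta tau 2).

(** Its real part is the logarithm of the squared modulus of a multiplier. *)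
Definition drift om et z : C := om * Sf z - 4 * et * z.

Section Period.
Variables om et : C.
Hypothesis Hom : half_period om et.

Lemma period_neq_0 : om <> 0.
Proof. destruct Hom as [[-> _]|[-> _]]; [apply RtoC_neq_0; lra|apply tau_neq_0]. Qed.

Lemma Sf_shift_period z : Sf (z + om / 2) = Sf z + 2 * et.
Proof.
  destruct Hom as [[-> ->]|[-> ->]].
  - replace (1 / 2) with (/ (2:C)) by field. apply Sf_shift_1; assumption.
  - apply Sf_shift_tau; assumption.
Qed.

(** In the variable [w = z / om] both periods have the same strip. *)
Definition hh w : C := drift om et (om * w).

Lemma hh_shift w : hh (w + / 2) = hh w.
Proof.
  unfold hh, drift. replace (om * (w + / 2)) with (om * w + om / 2) by field. rewrite Sf_shift_period. field.
Qed.

Lemma hh_refl w : hh (- Cconj w) = - Cconj (hh w).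
Proof.
  unfold hh, drift. rewrite Cminus_conj, !Cmult_conj, !Cconj_R, <- Sf_conj, Cmult_conj.
  assert (Ht := tau_conj).
  destruct Hom as [[-> ->]|[-> ->]].
  - rewrite Cconj_R, conj_eta_1.
    replace (1 * - Cconj w) with (- (1 * Cconj w)) by ring. rewrite Sf_odd. ring.
  - rewrite Ht, conj_eta_2.
    replace (- tau * Cconj w) with (tau * - Cconj w) by ring. ring.
Qed.

(** The other half period, divided by [om], is [i] times this number, up to sign. *)
Definition qq : R := (if excluded_middle_informative (om = 1) then Im tau / 2 else / (2 * Im tau))%R.

Lemma tau_not_1 : tau <> 1.
Proof. intros E. assert (K := tau_im). rewrite E, im_RtoC in K. lra. Qed.

Lemma tau_times_i : tau * Ci = - RtoC (Im tau).
Proof. rewrite tau_eq at 1. transitivity (RtoC (Im tau) * (Ci * Ci)); [ring|].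
apply injective_projections; simpl; ring. Qed.

Lemma Sf_shift_m1 z : Sf (z - / 2) = Sf z - 2 * eta tau 1.
Proof.
  replace (Sf z) with (Sf (z - / 2 + / 2)) by (f_equal; ring).
  rewrite Sf_shift_1. ring.
Qed.

Lemma hh_shift_q w : Re (hh (w + RtoC qq * Ci)) = Re (hh w).
Proof.
  assert (E1 := eta_1_real). assert (E2 := eta_2_imag).
  assert (E3 : Re (2 * eta tau 2 - 2 * (eta tau 1 * tau)) = 0%R).
  { destruct (eta tau 1) as [a b], (eta tau 2) as [c d]. destruct tau as [x y]. unfold Re, Im in *; simpl in *. rewrite E2, tau_re, E1. ring. }
  unfold hh, drift, qq. destruct excluded_middle_informative as [H|H]; destruct Hom as [[Ho ->]|[Ho ->]].
  - rewrite H. unfold Rdiv. rewrite RtoC_mult, RtoC_inv by lra.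
    replace (1 * (w + RtoC (Im tau) * / 2 * Ci)) with (1 * w + (RtoC (Im tau) * Ci) / 2) by field.
    rewrite <- tau_eq, Sf_shift_tau.
    replace (1 * (Sf (1 * w) + 2 * eta tau 2) - 4 * eta tau 1 * (1 * w + tau / 2)) with
      (1 * Sf (1 * w) - 4 * eta tau 1 * (1 * w) + (2 * eta tau 2 - 2 * (eta tau 1 * tau))) by field.
    rewrite re_plus, E3. ring.
  - exfalso. apply tau_not_1. rewrite <- Ho. exact H.
  - contradiction.
  - rewrite Ho. rewrite RtoC_inv, RtoC_mult by lra. assert (Hi : RtoC (Im tau) <> 0) by (apply RtoC_neq_0; lra).
    replace (tau * (w + / (2 * RtoC (Im tau)) * Ci)) with (tau * w + (tau * Ci) / (2 * RtoC (Im tau))) by (field; exact Hi).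
    rewrite tau_times_i. replace (tau * w + - RtoC (Im tau) / (2 * RtoC (Im tau))) with (tau * w - / 2) by (field; exact Hi).
    rewrite Sf_shift_m1.
    replace (tau * (Sf (tau * w) - 2 * eta tau 1) - 4 * eta tau 2 * (tau * w - / 2)) with
      (tau * Sf (tau * w) - 4 * eta tau 2 * (tau * w) + (2 * eta tau 2 - 2 * (eta tau 1 * tau))) by field.
    rewrite re_plus, E3. ring.
Qed.

Lemma qq_pos : 0 < qq.
Proof. unfold qq. destruct excluded_middle_informative; [lra|apply Rinv_0_lt_compat; lra]. Qed.

Lemma re_tau_mult w : Re (tau * w) = (- (Im tau * Im w))%R /\ Im (tau * w) = (Im tau * Re w)%R.
Proof. rewrite re_mult, im_mult, tau_re. split; ring. Qed.

Lemma hlat_pole w : hlat (om * w) -> pole qq w.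
Proof.
  intros H. destruct (hlat_re _ H) as [m Em]. destruct (hlat_im _ H) as [n En].
  unfold pole, qq. destruct excluded_middle_informative as [Ho|Ho]; destruct Hom as [[Ho' _]|[Ho' _]].
  - rewrite Ho, Cmult_1_l in Em, En. exists m, n. rewrite (ptc_eta w). f_equal; lra.
  - exfalso. apply tau_not_1. rewrite <- Ho'. exact Ho.
  - contradiction.
  - rewrite Ho' in Em, En. destruct (re_tau_mult w) as [E1 E2]. rewrite E1 in Em. rewrite E2 in En.
    exists n, (- m)%Z. rewrite (ptc_eta w), opp_IZR. f_equal.
    + apply (Rmult_eq_reg_l (Im tau)); lra.
    + rewrite <- Em. field. lra.
Qed.

Lemma hh_positive w : strip4 w -> 0 < Re (hh w).
Proof.
  assert (Ho := period_neq_0).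
  destruct local_data as (d & Hd & _ & _ & Hs).
  assert (Hm : 0 < Cmod om) by (apply Cmod_gt_0, Ho).
  set (k := fun u => om * sl (om * u) - 4 * et * (om * u)).
  apply (strip_positivity hh k qq (d / Cmod om)).
  - exact qq_pos.
  - apply Rdiv_lt_0_compat; assumption.
  - intros z Hz. assert (Hn : ~ hlat (om * z)) by (intros H; apply Hz, hlat_pole, H).
    destruct (Sf_holo _ Hn) as [l Hl]. eexists. unfold hh, drift.
    apply (cdiff_scale (fun z => om * Sf z - 4 * et * z)). repeat cd_step.
  - intros z. rewrite hh_shift. reflexivity.
  - exact hh_shift_q.
  - intros z. rewrite hh_refl, re_opp, re_conj. reflexivity.
  - intros u Hu. unfold disc in Hu.
    destruct (Hs (om * u)) as [l Hl].
    { unfold disc. replace (om * u - 0) with (om * (u - 0)) by ring. rewrite Cmod_mult.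
      apply (Rmult_lt_compat_l (Cmod om)) in Hu; [|exact Hm]. replace (Cmod om * (d / Cmod om))%R with d in Hu by (field; lra). exact Hu. }
    eexists. unfold k. apply (cdiff_scale (fun z => om * sl z - 4 * et * z)). repeat cd_step.
  - unfold k. replace (om * 0) with (0:C) by ring. rewrite sl_0. ring.
  - intros u [Hu _]. unfold hh, drift, k. rewrite Sf_sl by (apply Cmult_neq_0; assumption). field. split; assumption.
Qed.

(** By periodicity and reflection, the sign in the strip leaves only its edges
    and their translates as zeros of the real part. *)
Lemma drift_zero a : Re (drift om et a) = 0%R -> exists n : Z, (4 * Re (a / om))%R = IZR n.
Proof.
  intros H. assert (Ho := period_neq_0). set (w := a / om).
  replace a with (om * w) in H by (unfold w; field; exact Ho). fold (hh w) in H.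
  assert (Hper : forall (n : Z) z, Re (hh (z - RtoC (IZR n / 2))) = Re (hh z)).
  { intros n. induction n using Z.peano_ind; intros z.
    - do 2 f_equal. unfold Rdiv. rewrite Rmult_0_l. ring.
    - rewrite <- (IHn z), <- (hh_shift (z - RtoC (IZR (Z.succ n) / 2))). do 2 f_equal.
      rewrite succ_IZR. unfold Rdiv. rewrite !RtoC_mult, RtoC_plus, RtoC_inv by lra. field.
    - rewrite <- (IHn z), <- (hh_shift (z - RtoC (IZR n / 2))). do 2 f_equal.
      rewrite <- Z.sub_1_r, minus_IZR. unfold Rdiv. rewrite !RtoC_mult, RtoC_minus, RtoC_inv by lra. field. }
  set (n := Int_part (2 * Re w)). set (v := w - RtoC (IZR n / 2)).
  assert (Hv : Re (hh v) = 0%R) by (unfold v; rewrite Hper; exact H).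
  assert (Ev : Re v = (Re w - IZR n / 2)%R) by (unfold v; rewrite re_minus, re_RtoC; reflexivity).
  destruct (base_fp (2 * Re w)) as [F1 F2]. unfold frac_part in F1, F2. fold n in F1, F2.
  destruct (Req_dec (Re v) 0) as [E0|E0].
  { exists (2 * n)%Z. rewrite mult_IZR. lra. }
  destruct (Req_dec (Re v) (/ 4)) as [E4|E4].
  { exists (2 * n + 1)%Z. rewrite plus_IZR, mult_IZR. lra. }
  exfalso. destruct (Rlt_le_dec (Re v) (/ 4)) as [L|L].
  - assert (K := hh_positive v ltac:(unfold strip4; lra)). lra.
  - assert (Er : Re (- Cconj v + / 2) = (/ 2 - Re v)%R).
    { rewrite <- RtoC_inv, re_plus, re_opp, re_conj, re_RtoC by lra. ring. }
    assert (K := hh_positive (- Cconj v + / 2) ltac:(unfold strip4; rewrite Er; lra)).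
    rewrite hh_shift, hh_refl, re_opp, re_conj in K. lra.
Qed.
End Period.

Lemma drift_both_zero a :
  (forall om et, half_period om et -> Re (drift om et a) = 0%R) -> hlat (2 * a).
Proof.
  intros H.
  destruct (drift_zero 1 (eta tau 1) (or_introl (conj eq_refl eq_refl)) a) as [m Em].
  { apply H. left. auto. }
  destruct (drift_zero tau (eta tau 2) (or_intror (conj eq_refl eq_refl)) a) as [n En].
  { apply H. right. auto. }
  exists m, n. assert (Ht := tau_neq_0).
  assert (E1 : Re (a / 1) = Re a) by (f_equal; field). rewrite E1 in Em.
  assert (E2 : Im a = (Im tau * Re (a / tau))%R).
  { replace a with (tau * (a / tau)) at 1 by (field; exact Ht). apply re_tau_mult. }
  apply C_eq.
  - rewrite re_lin, <- Em. replace (2 * (2 * a)) with (a * RtoC 4) by ring. rewrite re_scal_r. ring.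
  - rewrite im_lin, <- En. replace (2 * (2 * a)) with (a * RtoC 4) by ring. rewrite im_scal_r, E2. ring.
Qed.

(** Otherwise [E = Sf - 4 eta_1 z] would be elliptic, [E^2 - Pf] constant, and
    the zeros [1/4], [tau/4] of [E] would have equal values of [Pf], against
    [kc_distinct]. *)
Lemma legendre_neq : eta tau 2 <> tau * eta tau 1.
Proof.
  intros HL. set (E := fun z => Sf z - 4 * eta tau 1 * z).
  assert (E1 : forall z, E (z + / 2) = E z).
  { intros z. unfold E. rewrite Sf_shift_1. field. }
  assert (Et : forall z, E (z + tau / 2) = E z).
  { intros z. unfold E. rewrite Sf_shift_tau, HL. field. }
  assert (Eo : forall z, E (- z) = - E z).
  { intros z. unfold E. rewrite Sf_odd. ring. }
  destruct (half_elliptic_constant (fun z => E z * E z - Pf z) 1 1) as [c Hc].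
  - ring.
  - ring.
  - apply holo_minus; [|apply Pf_holo; assumption].
    intros z Hz. destruct (Sf_holo z Hz) as [l Hl]. eexists. unfold E. repeat cd_step.
  - intros z Hz. rewrite E1, Pf_shift_1 by exact Hz. ring.
  - intros z Hz. rewrite Et, Pf_shift_tau by exact Hz. ring.
  - destruct local_data as (d & Hd & Hsm & _ & Hs).
    destruct (holo_derive _ _ (copen_disc 0 d) Hs) as [Hs1 Hs2].
    destruct (Hs 0 (disc_center 0 d Hd)) as [l1 D1]. destruct (Hs2 0 (disc_center 0 d Hd)) as [l2 D2].
    set (s := fun u => sl u - 4 * eta tau 1 * u).
    set (k := fun u => 2 * s u + u * (s u * s u) + u * C_derive sl u).
    replace (RtoC 0) with (k 0) at 2.
    2:{ unfold k, s. rewrite sl_0. ring. }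
    apply (tends_cont _ k 0 d Hd).
    + eapply cdiff_ccont. unfold k, s. repeat cd_step.
    + intros u Hu. rewrite (Pf_local d u Hs Hu (Hsm u Hu)). destruct Hu as [Hu _].
      unfold E, k, s. rewrite Sf_sl by exact Hu. field. exact Hu.
  - assert (Z : forall om : C, om = 1 \/ om = tau -> (forall z, E (z + om / 2) = E z) -> Pf (om / 4) = - c).
    { intros om Ho Hs. rewrite <- (Hc (om / 4)) by (apply quarter_not_hlat; assumption).
      assert (E0 : E (om / 4) = 0).
      { apply C_eq_opp. rewrite <- Eo, <- (Hs (- (om / 4))). f_equal. field. }
      rewrite E0. ring. }
    assert (Z1 := Z 1 (or_introl eq_refl)). assert (Zt := Z tau (or_intror eq_refl) Et).
    specialize (Z1 ltac:(intros z; replace (1 / 2) with (/ (2:C)) by field; apply E1)).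
    assert (N1 := quarter_not_hlat 1 (or_introl eq_refl)).
    assert (Nt := quarter_not_hlat tau (or_intror eq_refl)).
    assert (I1 : isl 1) by (left; reflexivity). assert (I2 : isl 2) by (right; left; reflexivity).
    assert (S1 := Gf_square 1 _ I1 N1). assert (S2 := Gf_square 2 _ I2 Nt).
    rewrite (Gf_zero 1 1 I1), Z1 in S1.
    2:{ intros z. replace (1 / 2) with (/ (2:C)) by field. rewrite Gf_shift_1 by assumption. unfold sgn1; simpl. ring. }
    rewrite (Gf_zero 2 tau I2), Zt in S2.
    2:{ intros z. rewrite Gf_shift_tau by assumption. unfold sgnt; simpl. ring. }
    apply (proj1 kc_distinct). unfold kc.
    transitivity (- c + 2 * C_derive (gl 1) 0 + c); [ring|]. rewrite <- S1.
    transitivity (- c + 2 * C_derive (gl 2) 0 + c); [|ring]. rewrite <- S2. ring.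
Qed.

(** * Reciprocals of 2T - G_l and multipliers *)

Lemma tends_local (h k : C -> C) (p l : C) (d : R) : 0 < d -> cdiff k 0 l -> k 0 = 0 ->
  (forall u, punctured 0 d u -> u * h (p + u) = k u) -> tends (fun z => (z - p) * h z) p 0.
Proof.
  intros Hd Hk K0 E. apply tends_shift.
  assert (T := tends_cont (fun u => (p + u - p) * h (p + u)) k 0 d Hd (cdiff_ccont _ _ _ Hk)). rewrite K0 in T.
  apply T. intros u Hu. rewrite <- E by exact Hu. f_equal. ring.
Qed.

Lemma discrete_or (s1 s2 : C -> Prop) : discrete s1 -> discrete s2 -> discrete (fun z => s1 z \/ s2 z).
Proof.
  intros H1 H2 z. destruct (H1 z) as [d1 [Hd1 K1]]. destruct (H2 z) as [d2 [Hd2 K2]].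
  exists (Rmin d1 d2). split; [apply Rmin_pos; assumption|]. intros w [Hw|Hw] Hz.
  - apply K1; [exact Hw|]. apply (Rmin_Rgt_l _ _ _ Hz).
  - apply K2; [exact Hw|]. apply (Rmin_Rgt_l _ _ _ Hz).
Qed.

Lemma discrete_shift (s : C -> Prop) a : discrete s -> discrete (fun z => s (z + a)).
Proof.
  intros H z. destruct (H (z + a)) as [d [Hd K]]. exists d. split; [exact Hd|]. intros w Hw Hz.
  replace w with (w + a - a) by ring. rewrite (K _ Hw); [ring|]. replace (w + a - (z + a)) with (w - z) by ring. exact Hz.
Qed.

Lemma hlat_plus z w : hlat z -> hlat w -> hlat (z + w).
Proof. unfold hlat. intros Hz Hw. replace (2 * (z + w)) with (2 * z + 2 * w) by ring. apply lattice_plus; assumption. Qed.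

Lemma hlat_shift z p : hlat p -> (hlat (z + p) <-> hlat z).
Proof.
  intros Hp. split; intros H; [|apply hlat_plus; assumption].
  replace z with (z + p + - p) by ring. apply hlat_plus; [exact H|]. apply hlat_opp, Hp.
Qed.

Lemma shift_hlat (l : nat) p : isl l -> hlat p -> exists s c : C, s * s = 1 /\
  (forall z, Gf l (z + p) = s * Gf l z) /\ (forall z, Sf (z + p) = Sf z + c).
Proof.
  intros Hl Hp. destruct (shift_lattice l _ Hl Hp) as (s & c & H). exists s, c.
  replace (2 * p / 2) with p in H by field. exact H.
Qed.

Definition sing a z : Prop := hlat z \/ hlat (z - a) \/ hlat (z + a).

Lemma sing_discrete a : discrete (sing a).
Proof.
  assert (H := hlat_discrete).
  apply discrete_or; [exact H|]. apply discrete_or; [|apply (discrete_shift hlat), H].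
  exact (discrete_shift hlat (- a) H).
Qed.

Lemma sing_period a om z : om = 1 \/ om = tau -> (sing a (z + om) <-> sing a z).
Proof.
  intros Ho. assert (H : forall w, hlat (w + om) <-> hlat w).
  { intros w. destruct (hlat_period w) as [H1 Ht]. destruct Ho as [-> | ->]; assumption. }
  unfold sing. rewrite H. replace (z + om - a) with (z - a + om) by ring. replace (z + om + a) with (z + a + om) by ring.
  rewrite !H. reflexivity.
Qed.

Lemma Sf_period om et z : half_period om et -> Sf (z + om) = Sf z + 4 * et.
Proof.
  intros H. replace (z + om) with (z + om / 2 + om / 2) by field.
  rewrite !(Sf_shift_period om et H). ring.
Qed.

Lemma Gf_period_om (l : nat) om z : isl l -> om = 1 \/ om = tau -> Gf l (z + om) = Gf l z.
Proof. intros Hl Ho. destruct (Gf_period l z Hl) as [H1 Ht]. destruct Ho as [-> | ->]; assumption. Qed.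

(** The value at [a] identifies the constant. *)
Lemma elliptic_sing_value a h (k : C -> C) (d : R) : holo (fun z => ~ sing a z) h ->
  (forall om z : C, om = 1 \/ om = tau -> ~ sing a z -> h (z + om) = h z) ->
  (forall p, sing a p -> tends (fun z => (z - p) * h z) p 0) ->
  0 < d -> ccont k 0 -> (forall u, punctured 0 d u -> h (u + a) = k u) ->
  forall z, ~ sing a z -> h z = k 0.
Proof.
  intros Hh Hp Ht Hd Hk E z Hz. destruct (elliptic_constant (sing a) h) as [c Hc]; auto.
  - apply sing_discrete.
  - intros w. apply sing_period. auto.
  - intros w. apply sing_period. auto.
  - rewrite (Hc z Hz). destruct (sing_discrete a a) as [r [Hr Hn]].
    apply (cont_unique (fun _ => c) k 0 (Rmin d r)); [apply Rmin_pos; assumption|eapply cdiff_ccont, cdiff_const|exact Hk|].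
    intros u [Hu Hud]. destruct (Rmin_Rgt_l _ _ _ Hud) as [U1 U2]. rewrite <- (Hc (u + a)); [apply E; split; assumption|].
    intros H. apply Hu. transitivity (u + a - a); [ring|]. rewrite (Hn _ H); [ring|]. replace (u + a - a) with (u - 0) by ring. exact U2.
Qed.

Section Product.
Variables (l : nat) (D a : C).
Hypothesis Hl : isl l.
Hypothesis Ha : ~ hlat a.
Hypothesis Ga : Gf l a = D.

(** Up to the factors [- G_l'(a)] and [- G_l''(a)] the partial fractions of
    [1 / (D - G_l)] for simple and for double zeros. *)
Definition Xf z : C :=
  (Sf (z - a) - Sf (z + a) + Gf l (z - a) + Gf l (z + a)) / 2 + Sf a.
Definition Yf z : C := Pf (z - a) - dG l (z - a) - Pf a.

Lemma Gf_neg_a : Gf l (- a) = - D.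
Proof. rewrite Gf_odd, Ga by assumption. reflexivity. Qed.

Lemma Pf_shift_hlat p z : hlat p -> ~ hlat z -> Pf (z + p) = Pf z.
Proof.
  intros Hp Hz. destruct (shift_hlat l p Hl Hp) as (s & c & Hs & HG & _).
  assert (E1 := Gf_square l _ Hl Hz). assert (E2 := Gf_square l (z + p) Hl ltac:(rewrite hlat_shift; assumption)).
  rewrite HG in E2. transitivity (Pf (z + p) + 2 * C_derive (gl l) 0 - 2 * C_derive (gl l) 0); [ring|]. rewrite <- E2.
  replace (s * Gf l z * (s * Gf l z)) with (s * s * (Gf l z * Gf l z)) by ring. rewrite Hs, E1. ring.
Qed.

(** Translation by [2 a] multiplies [G_l] by a sign [s], so that [D = - s D] and
    [G_l'(a) = s G_l'(a)]. *)
Lemma hlat_double : hlat (2 * a) -> D = 0 \/ dG l a = 0.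
Proof.
  intros H2. destruct (shift_hlat l _ Hl H2) as (s & c & Hs & HG & _).
  assert (Hna : ~ hlat (- a)) by (rewrite hlat_opp; exact Ha).
  assert (E1 : D = - s * D).
  { rewrite <- Ga at 1. replace a with (- a + 2 * a) at 1 by ring. rewrite HG, Gf_neg_a. ring. }
  assert (E2 : dG l a = s * dG l a).
  { rewrite <- (dG_even l a Hl Ha) at 2. rewrite <- (dG_shift l (2 * a) s HG).
    - f_equal. ring.
    - exact Hna.
    - rewrite hlat_shift; assumption. }
  destruct (square_eq s 1) as [-> | ->]; [rewrite Hs; ring| |].
  - left. apply C_eq_opp. rewrite E1 at 1. ring.
  - right. apply C_eq_opp. rewrite E2 at 1. ring.
Qed.

Lemma Sf_at c : ~ hlat c -> exists m, cdiff (fun u => Sf (u + c)) 0 m.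
Proof. intros Hc. eexists. apply (cdiff_shift Sf). rewrite Cplus_0_l. apply (Sf_diff _ Hc). Qed.
Lemma Gf_at c : ~ hlat c -> cdiff (fun u => Gf l (u + c)) 0 (dG l c).
Proof. intros Hc. apply (cdiff_shift (Gf l)). rewrite Cplus_0_l. apply (Gf_diff l _ Hc). Qed.

(** Every pole of either factor is met by a zero of the other, so that the
    product is constant; its value is the one at [a]. *)
Theorem X_product z : D <> 0 -> dG l a <> 0 -> ~ sing a z -> Xf z * (D - Gf l z) = - dG l a.
Proof.
  intros HD HdG.
  assert (H2a : ~ hlat (2 * a)) by (intros H; destruct (hlat_double H); contradiction).
  assert (Hna : ~ hlat (- a)) by (rewrite hlat_opp; exact Ha).
  assert (H2na : ~ hlat (- (2 * a))) by (rewrite hlat_opp; exact H2a).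
  assert (Gna := Gf_neg_a).
  destruct local_data as (d & Hd & Hsm & Hgl & Hs). assert (Hg := Hgl l).
  destruct (Hg 0 (disc_center 0 d Hd)) as [mg Dg]. destruct (Hs 0 (disc_center 0 d Hd)) as [ms Ds].
  destruct (Sf_at _ Ha) as [m1 S1]. destruct (Sf_at _ Hna) as [m2 S2].
  destruct (Sf_at _ H2a) as [m3 S3]. destruct (Sf_at _ H2na) as [m4 S4].
  assert (G1 := Gf_at _ Ha). assert (G2 := Gf_at _ Hna). assert (G3 := Gf_at _ H2a). assert (G4 := Gf_at _ H2na).
  destruct (near_nhlat a Ha) as [r' [Hr' Hn']].
  destruct (holo_division (disc a r') a (Gf l) (copen_disc a r') (star_disc a r') (disc_center a r' Hr')) as (k & Hk1 & Ka & Ek).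
  { apply (holo_sub (fun w => ~ hlat w)); [exact Hn'|apply Gf_holo; assumption]. }
  destruct (Hk1 a (disc_center a r' Hr')) as [mk Dk].
  assert (Dk' : cdiff (fun u => k (u + a)) 0 mk) by (apply (cdiff_shift k); rewrite Cplus_0_l; exact Dk).
  set (kk := fun u => ((1 + u * sl u + (1 + u * gl l u) + u * (Gf l (u + 2 * a) - Sf (u + 2 * a))) / 2 + u * Sf a)
      * - k (u + a)).
  intros Hz. transitivity (kk 0).
  2:{ unfold kk. rewrite !Cplus_0_l, Ka. unfold dG. field. }
  revert z Hz. apply (elliptic_sing_value a (fun z => Xf z * (D - Gf l z)) kk (Rmin d r')).
  - intros w Hw. unfold sing in Hw.
    assert (B1 := Sf_diff (w - a) ltac:(tauto)). assert (B2 := Sf_diff (w + a) ltac:(tauto)).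
    assert (B3 := Gf_diff l (w - a) ltac:(tauto)). assert (B4 := Gf_diff l (w + a) ltac:(tauto)).
    assert (B5 := Gf_diff l w ltac:(tauto)).
    apply (cdiff_shift_minus Sf) in B1. apply (cdiff_shift Sf) in B2.
    apply (cdiff_shift_minus (Gf l)) in B3. apply (cdiff_shift (Gf l)) in B4.
    eexists. unfold Xf. repeat cd_step.
  - intros om w Ho _. assert (Hh : exists et, half_period om et).
    { destruct Ho as [-> | ->]; [exists (eta tau 1); left|exists (eta tau 2); right]; auto. }
    destruct Hh as [et Het]. unfold Xf.
    replace (w + om - a) with (w - a + om) by ring. replace (w + om + a) with (w + a + om) by ring.
    rewrite !(Sf_period om et) by exact Het. rewrite !(Gf_period_om l om) by assumption. f_equal. field.
  - intros p Hp. assert (Hcase : exists p0 v, p = p0 + v /\ hlat v /\ (p0 = 0 \/ p0 = a \/ p0 = - a)).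
    { destruct Hp as [Hp|[Hp|Hp]]; [exists 0, p|exists a, (p - a)|exists (- a), (p + a)]; (split; [ring|]); auto. }
    destruct Hcase as (p0 & v & -> & Hv & Hp0). destruct (shift_hlat l v Hl Hv) as (s & cs & Hss & HG & HS).
    assert (Hform : forall u, Xf (p0 + v + u) * (D - Gf l (p0 + v + u)) =
      ((Sf (u + (p0 - a)) - Sf (u + (p0 + a)) + s * Gf l (u + (p0 - a)) + s * Gf l (u + (p0 + a))) / 2 + Sf a)
        * (D - s * Gf l (u + p0))).
    { intros u. unfold Xf. replace (p0 + v + u - a) with (u + (p0 - a) + v) by ring.
      replace (p0 + v + u + a) with (u + (p0 + a) + v) by ring. replace (p0 + v + u) with (u + p0 + v) by ring.
      rewrite !HG, !HS. f_equal. f_equal. field. }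
    destruct Hp0 as [-> | [-> | ->]].
    + eapply (tends_local _ (fun u => ((Sf (u + - a) - Sf (u + a) + s * Gf l (u + - a) + s * Gf l (u + a)) / 2 + Sf a)
        * (u * D - s * (1 + u * gl l u))) _ _ d Hd); [repeat cd_step| |].
      * rewrite !Cplus_0_l, Sf_odd, Ga, Gna. field.
      * intros u [Hu _]. rewrite Hform. rewrite Cplus_0_r, (Gf_gl l u).
        replace (0 - a) with (- a) by ring. replace (0 + a) with a by ring. field. exact Hu.
    + eapply (tends_local _ (fun u => ((1 + u * sl u + s * (1 + u * gl l u)
          + u * (s * Gf l (u + 2 * a) - Sf (u + 2 * a))) / 2 + u * Sf a)
        * (D - s * Gf l (u + a))) _ _ d Hd); [repeat cd_step| |].
      * rewrite !Cplus_0_l, Ga. transitivity ((1 - s * s) * D / 2); [field|]. rewrite Hss. field.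
      * intros u [Hu _]. rewrite Hform. replace (u + (a - a)) with u by ring. replace (a + a) with (2 * a) by ring.
        rewrite (Gf_gl l u), (Sf_sl u Hu). field. exact Hu.
    + eapply (tends_local _ (fun u => ((- (1 + u * sl u) + s * (1 + u * gl l u)
          + u * (s * Gf l (u + - (2 * a)) + Sf (u + - (2 * a)))) / 2 + u * Sf a)
        * (D - s * Gf l (u + - a))) _ _ d Hd); [repeat cd_step| |].
      * rewrite !Cplus_0_l, Gna. transitivity ((s * s - 1) * D / 2); [field|]. rewrite Hss. field.
      * intros u [Hu _]. rewrite Hform. replace (u + (- a + a)) with u by ring. replace (- a - a) with (- (2 * a)) by ring.
        rewrite (Gf_gl l u), (Sf_sl u Hu). field. exact Hu.
  - apply Rmin_pos; assumption.
  - eapply cdiff_ccont. unfold kk. repeat cd_step.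
  - intros u [Hu Hud]. unfold Xf, kk. rewrite (Ek (u + a)).
    2:{ unfold disc. replace (u + a - a) with (u - 0) by ring. apply (Rmin_Rgt_l _ _ _ Hud). }
    rewrite Ga. replace (u + a - a) with u by ring. replace (u + a + a) with (u + 2 * a) by ring.
    rewrite (Gf_gl l u), (Sf_sl u Hu). field. exact Hu.
Qed.

(** The analogue at a double zero [a] of [D - Gf], again by comparing poles. *)
Theorem Y_product (m z : C) : dG l a = 0 -> cdiff (dG l) a m -> ~ sing a z -> Yf z * (D - Gf l z) = - m.
Proof.
  intros HdG Hm.
  assert (Hna : ~ hlat (- a)) by (rewrite hlat_opp; exact Ha).
  destruct local_data as (d & Hd & Hsm & Hgl & Hs). assert (Hg := Hgl l).
  destruct (Hg 0 (disc_center 0 d Hd)) as [mg Dg].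
  destruct (proj2 (holo_derive _ _ (copen_disc 0 d) Hg) 0 (disc_center 0 d Hd)) as [mg1 Dg1].
  destruct (proj2 (holo_derive _ _ (copen_disc 0 d) Hs) 0 (disc_center 0 d Hd)) as [ms1 Ds1].
  destruct (near_nhlat a Ha) as [r' [Hr' Hn']].
  assert (Hc0 := disc_center a r' Hr').
  destruct (holo_division (disc a r') a (Gf l) (copen_disc a r') (star_disc a r') Hc0) as (k1 & Hk1 & Ka & Ek).
  { apply (holo_sub (fun w => ~ hlat w)); [exact Hn'|apply Gf_holo; assumption]. }
  destruct (holo_division (disc a r') a k1 (copen_disc a r') (star_disc a r') Hc0 Hk1) as (k2 & Hk2 & _ & Ek2).
  fold (dG l) in Ka. rewrite HdG in Ka.
  assert (EG : forall w, disc a r' w -> Gf l w = D + (w - a) * (w - a) * k2 w).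
  { intros w Hw. rewrite Ek, Ek2, Ka, Ga by exact Hw. ring. }
  destruct (holo_derive _ _ (copen_disc a r') Hk2) as [Dk2 Hk2'].
  assert (Em : m = 2 * k2 a).
  { apply (cdiff_unique (dG l) a); [exact Hm|].
    apply (cdiff_loc (fun w => 2 * (w - a) * k2 w + (w - a) * (w - a) * C_derive k2 w) _ a _ r' Hr').
    - intros w Hw. symmetry. apply C_derive_eq.
      assert (A1 := Dk2 w Hw). destruct (copen_disc a r' w Hw) as [r2 [Hr2 Hsub]].
      apply (cdiff_loc (fun w => D + (w - a) * (w - a) * k2 w) _ w _ r2 Hr2).
      + intros w' Hw'. symmetry. apply EG, Hsub, Hw'.
      + cd. ring.
    - assert (A1 := Dk2 a Hc0). destruct (Hk2' a Hc0) as [l2 A2]. cd. ring. }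
  assert (Dk : cdiff (fun u => k2 (u + a)) 0 (C_derive k2 a)).
  { apply (cdiff_shift k2). rewrite Cplus_0_l. exact (Dk2 a Hc0). }
  assert (HP : forall u, punctured 0 d u -> Pf u = 1 / (u * u) - C_derive sl u).
  { intros u Hu. exact (Pf_local d u Hs Hu (Hsm u Hu)). }
  assert (HdGu : forall u, punctured 0 d u -> dG l u = - (1 / (u * u)) + C_derive (gl l) u).
  { intros u Hu. exact (dG_local l d u Hg Hu). }
  assert (Hreg : forall w, ~ hlat w -> ~ hlat (w - a) -> exists m, cdiff (fun z => Yf z * (D - Gf l z)) w m).
  { intros w Hw Hwa. destruct (Pf_holo _ Hwa) as [n1 B1].
    destruct (dG_holo l _ Hwa) as [n2 B2]. assert (B3 := Gf_diff l w Hw).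
    apply (cdiff_shift_minus Pf) in B1. apply (cdiff_shift_minus (dG l)) in B2.
    eexists. unfold Yf. repeat cd_step. }
  set (kk := fun u => (2 + u * u * (- C_derive sl u - C_derive (gl l) u - Pf a)) * - k2 (u + a)).
  intros Hz. transitivity (kk 0).
  2:{ unfold kk. rewrite !Cplus_0_l, Em. ring. }
  revert z Hz. apply (elliptic_sing_value a (fun z => Yf z * (D - Gf l z)) kk (Rmin d r')).
  - intros w Hw. unfold sing in Hw. apply Hreg; tauto.
  - intros om w Ho Hw. unfold sing in Hw.
    assert (Hwa : ~ hlat (w - a)) by tauto.
    assert (Hom : hlat om).
    { unfold hlat. destruct Ho as [-> | ->]; [exists 2%Z, 0%Z|exists 0%Z, 2%Z]; ring. }
    unfold Yf. rewrite (Gf_period_om l om w Hl Ho). f_equal.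
    replace (w + om - a) with (w - a + om) by ring. rewrite (Pf_shift_hlat om) by assumption.
    rewrite (dG_shift l om 1); [ring| |exact Hwa|rewrite hlat_shift; assumption].
    intros w'. rewrite (Gf_period_om l om w' Hl Ho). ring.
  - intros p Hp. destruct (classic (hlat p)) as [Hv|Hv]; [|destruct (classic (hlat (p - a))) as [Hv2|Hv2]].
    + destruct (shift_hlat l p Hl Hv) as (s & cs & Hss & HG & _).
      destruct (Pf_holo _ Hna) as [n1 B1]. destruct (dG_holo l _ Hna) as [n2 B2].
      assert (B1' : cdiff (fun u => Pf (u + - a)) 0 n1) by (apply (cdiff_shift Pf); rewrite Cplus_0_l; exact B1).
      assert (B2' : cdiff (fun u => dG l (u + - a)) 0 n2) by (apply (cdiff_shift (dG l)); rewrite Cplus_0_l; exact B2).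
      destruct (near_nhlat _ Hna) as [r2 [Hr2 Hn2]].
      eapply (tends_local _ (fun u => (Pf (u + - a) - s * dG l (u + - a) - Pf a) * (u * D - s * (1 + u * gl l u)))
        _ _ (Rmin d r2)); [apply Rmin_pos; assumption|repeat cd_step| |].
      * rewrite !Cplus_0_l, dG_even, HdG by assumption.
        assert (S1 := Gf_square l _ Hl Ha). assert (S2 := Gf_square l _ Hl Hna).
        rewrite Gf_neg_a in S2. rewrite Ga in S1. set (e := 2 * C_derive (gl l) 0) in *.
        replace (Pf (- a)) with (Pf (- a) + e - e) by ring. rewrite <- S2.
        replace (Pf a) with (Pf a + e - e) by ring. rewrite <- S1. ring.
      * intros u [Hu Hud].
        assert (Hua : ~ hlat (u + - a)).
        { apply Hn2. replace (u + - a - - a) with (u - 0) by ring. apply (Rmin_Rgt_l _ _ _ Hud). }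
        unfold Yf. replace (p + u - a) with (u + - a + p) by ring. rewrite (Pf_shift_hlat p) by assumption.
        rewrite (dG_shift l p s HG) by (first [assumption|rewrite (hlat_shift _ p) by assumption; assumption]).
        replace (p + u) with (u + p) by ring. rewrite HG, (Gf_gl l u). field. exact Hu.
    + destruct (shift_hlat l (p - a) Hl Hv2) as (s & cs & Hss & HG & _).
      eapply (tends_local _ (fun u => u * (- C_derive sl u - s * C_derive (gl l) u - Pf a)
        * (D - s * D - s * (u * u * k2 (u + a))) - (1 + s) * s * (u * k2 (u + a))) _ _ (Rmin d r'));
        [apply Rmin_pos; assumption|repeat cd_step|ring|].
      intros u [Hu Hud]. assert (Pu : punctured 0 d u) by (split; [exact Hu|apply (Rmin_Rgt_l _ _ _ Hud)]).
      assert (Hul := Hsm u Pu).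
      unfold Yf. replace (p + u - a) with (u + (p - a)) by ring. rewrite (Pf_shift_hlat (p - a)) by assumption.
      rewrite (dG_shift l (p - a) s HG) by (first [assumption|rewrite (hlat_shift _ (p - a)) by assumption; assumption]).
      replace (p + u) with (u + a + (p - a)) by ring. rewrite HG, HP, HdGu by exact Pu.
      rewrite EG.
      2:{ unfold disc. replace (u + a - a) with (u - 0) by ring. apply (Rmin_Rgt_l _ _ _ Hud). }
      match goal with |- _ = ?k => transitivity (k + (1 - s * s) * D / u) end; [field; exact Hu|]. rewrite Hss. field. exact Hu.
    + destruct (Hreg p Hv Hv2) as [n Hn]. eapply (tends_local _ (fun u => u * (Yf (u + p) * (D - Gf l (u + p)))) _ _ 1%R Rlt_0_1).
      * apply cdiff_mult; [apply cdiff_id|]. apply (cdiff_shift (fun z => Yf z * (D - Gf l z))). rewrite Cplus_0_l. exact Hn.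
      * ring.
      * intros u _. rewrite (Cplus_comm p u). reflexivity.
  - apply Rmin_pos; assumption.
  - eapply cdiff_ccont. unfold kk. repeat cd_step.
  - intros u [Hu Hud]. destruct (Rmin_Rgt_l _ _ _ Hud) as [U1 U2]. unfold Yf, kk. rewrite (EG (u + a)).
    2:{ unfold disc. replace (u + a - a) with (u - 0) by ring. exact U2. }
    replace (u + a - a) with u by ring. rewrite HP, HdGu by (split; assumption). field. exact Hu.
Qed.
End Product.

Definition wstrip (y d : R) w : Prop := (Rabs (Im w - y) < d).

Lemma copen_wstrip (y d : R) : copen (wstrip y d).
Proof.
  intros z Hz. unfold wstrip in *. exists (d - Rabs (Im z - y))%R. split; [lra|]. intros w Hw.
  assert (A := Rle_lt_trans _ _ _ (im_le (w - z)) Hw). rewrite im_minus in A.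
  replace (Im w - y)%R with ((Im w - Im z) + (Im z - y))%R by ring. generalize (Rabs_triang (Im w - Im z) (Im z - y)). lra.
Qed.

Lemma star_wstrip (y d : R) w : wstrip y d w -> star (wstrip y d) w.
Proof.
  unfold wstrip. intros Hw z t Hz Ht. rewrite im_segt. apply Rabs_def2 in Hw. apply Rabs_def2 in Hz.
  assert (K := convex_lt (y - d) (y + d) (Im w) (Im z) t ltac:(lra) ltac:(lra) Ht). apply Rabs_def1; lra.
Qed.

Lemma cdiff_reflect f (z l : C) : cdiff f (- Cconj z) l -> cdiff (fun z => Cconj (f (- Cconj z))) z (- Cconj l).
Proof.
  rewrite !cdiff_eps. intros H e He. destruct (H e He) as [d [Hd H1]]. exists d. split; [exact Hd|]. intros w Hw.
  assert (E : Cmod (- Cconj w - - Cconj z) = Cmod (w - z)).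
  { replace (- Cconj w - - Cconj z) with (- Cconj (w - z)) by (rewrite Cminus_conj; ring). rewrite Cmod_opp, Cmod_conj. reflexivity. }
  specialize (H1 (- Cconj w)). rewrite E in H1. specialize (H1 Hw).
  rewrite <- Cmod_conj in H1. rewrite !Cminus_conj, Cmult_conj, Cminus_conj, !Copp_conj, !Cconj_conj in H1.
  replace (- Cconj l * (w - z)) with (Cconj l * (- w - - z)) by ring. exact H1.
Qed.

(** A function that is odd under the reflection of a strip and adds a real
    constant [e] along it: its primitive has an increment with an explicit real
    part, because the reflection makes this real part 0 from [-1/2] to [1/2]. *)
Lemma strip_increment g (e y d : R) : 0 < d -> holo (wstrip y d) g ->
  (forall w, wstrip y d w -> g (w + 1) = g w + RtoC e) -> (forall w, g (- Cconj w) = - Cconj (g w)) ->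
  exists F, (forall w, wstrip y d w -> cdiff F w (g w)) /\
    forall w, wstrip y d w -> Re (F (w + 1) - F w) = (e * (Re w + / 2))%R.
Proof.
  intros Hd Hg He Hr. set (c := ptc 0 y).
  assert (Hc : forall x, wstrip y d (ptc x y)).
  { intros x. unfold wstrip. rewrite im_ptc, Rminus_diag, Rabs_R0. exact Hd. }
  assert (Hs := star_wstrip y d c (Hc 0%R)). set (F := segint g c).
  assert (HF : forall w, wstrip y d w -> cdiff F w (g w)).
  { intros w Hw. apply (star_primitive (wstrip y d)); auto. apply copen_wstrip. }
  assert (Href : forall w, wstrip y d w -> Re (F (- Cconj w)) = Re (F w)).
  { intros w Hw.
    assert (K : Cconj (F (- Cconj w)) - F w = Cconj (F (- Cconj c)) - F c).
    { apply (star_constant (wstrip y d) c (fun w => Cconj (F (- Cconj w)) - F w)); auto.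
      intros z Hz. assert (A1 := HF z Hz).
      assert (A2 := cdiff_reflect F z _ (HF (- Cconj z) ltac:(unfold wstrip in *; rewrite im_opp, im_conj, Ropp_involutive; exact Hz))).
      cbv beta in A2. rewrite Hr, Copp_conj, Cconj_conj in A2. eapply cdiff_val; [apply (cdiff_minus (fun z => Cconj (F (- Cconj z))) F); eassumption|ring]. }
    assert (Ec : - Cconj c = c).
    { apply C_eq; [rewrite re_opp, re_conj|rewrite im_opp, im_conj]; unfold c; rewrite ?re_ptc, ?im_ptc; ring. }
    rewrite Ec in K. assert (KR := f_equal Re K). rewrite !re_minus, !re_conj in KR. lra. }
  exists F. split; [exact HF|]. intros w Hw.
  assert (Hs1 : forall z, wstrip y d z -> wstrip y d (z + 1)).
  { intros z Hz. unfold wstrip in *. rewrite im_plus, im_RtoC, Rplus_0_r. exact Hz. }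
  set (K := fun z => F (z + 1) - F z - RtoC e * z).
  assert (HK : forall z, wstrip y d z -> cdiff K z 0).
  { intros z Hz. assert (A1 := HF z Hz). assert (A2 := HF (z + 1) (Hs1 z Hz)). apply (cdiff_shift F) in A2.
    rewrite He in A2 by exact Hz. unfold K. cd. ring. }
  set (h := ptc (- / 2) y).
  assert (EK : K w = K h) by (apply (star_constant (wstrip y d) h); auto; apply star_wstrip, Hc).
  assert (Eh : h + 1 = - Cconj h).
  { unfold h. apply C_eq; [rewrite re_plus, re_opp, re_conj, re_RtoC, !re_ptc|rewrite im_plus, im_opp, im_conj, im_RtoC, !im_ptc]; lra. }
  assert (ER := f_equal Re EK). unfold K in ER. rewrite Eh, !re_minus, !re_scal_l, Href in ER by apply Hc.
  unfold h in ER. rewrite !re_ptc in ER. rewrite re_minus. lra.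
Qed.

Lemma grid_gap (c q y : R) : 0 < q -> exists r, 0 < r /\
  forall n : Z, Rabs (c + IZR n * q - y) < r -> (c + IZR n * q)%R = y.
Proof.
  intros Hq. set (x := ((y - c) / q)%R). set (m := Int_part x).
  assert (Ex : forall n : Z, (c + IZR n * q - y = (IZR n - x) * q)%R) by (intros n; unfold x; field; lra).
  destruct (base_fp x) as [F1 F2]. unfold frac_part in F1, F2. fold m in F1, F2.
  set (s := if Req_EM_T x (IZR m) then 1%R else Rmin (x - IZR m) (IZR m + 1 - x)).
  assert (Hs : 0 < s /\ forall n : Z, Rabs (IZR n - x) < s -> IZR n = x).
  { assert (Hn : forall n : Z, (n <= m - 1)%Z \/ n = m \/ (m + 1 <= n)%Z) by (intros n; lia).
    unfold s. destruct (Req_EM_T x (IZR m)) as [E|E].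
    - split; [lra|]. intros n H. apply Rabs_def2 in H.
      destruct (Hn n) as [K|[-> |K]]; [|lra|]; apply IZR_le in K; rewrite ?minus_IZR, ?plus_IZR in K; lra.
    - split; [apply Rmin_pos; lra|]. intros n H.
      destruct (Rmin_Rgt_l _ _ _ H) as [H1 H2].
      apply Rabs_def2 in H1. apply Rabs_def2 in H2.
      destruct (Hn n) as [K|[-> |K]]; [|lra|]; [apply IZR_le in K; rewrite minus_IZR in K|apply IZR_le in K; rewrite plus_IZR in K]; lra. }
  destruct Hs as [Hs1 Hs2]. exists (s * q)%R. split; [apply Rmult_lt_0_compat; assumption|]. intros n Hn.
  rewrite Ex, Rabs_mult, (Rabs_pos_eq q) in Hn by lra. apply Rmult_lt_reg_r in Hn; [|exact Hq].
  generalize (Ex n). rewrite (Hs2 n Hn). lra.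
Qed.

Definition ostrip om (y d : R) z : Prop := wstrip y d (z / om).

Section Period.
Variables om et : C.
Hypothesis Hom : half_period om et.

Let om_neq_0 : om <> 0.
Proof. exact (period_neq_0 om et Hom). Qed.

Let om_cases : om = 1 \/ om = tau.
Proof. destruct Hom as [[H _]|[H _]]; auto. Qed.

Lemma copen_ostrip (y d : R) : copen (ostrip om y d).
Proof.
  intros z Hz. destruct (copen_wstrip y d _ Hz) as [r [Hr H]]. assert (Hm : 0 < Cmod om) by (apply Cmod_gt_0, om_neq_0).
  exists (r * Cmod om)%R. split; [apply Rmult_lt_0_compat; assumption|]. intros w Hw. apply H. unfold disc in *.
  replace (w / om - z / om) with ((w - z) / om) by (field; exact om_neq_0). rewrite Cmod_div by exact om_neq_0.
  apply (Rmult_lt_reg_r (Cmod om)); [exact Hm|]. unfold Rdiv. rewrite Rmult_assoc, Rinv_l by lra. lra.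
Qed.

Lemma star_ostrip (y d : R) z : ostrip om y d z -> star (ostrip om y d) z.
Proof.
  intros Hz w t Hw Ht. unfold ostrip in *. replace (segt z w t / om) with (segt (z / om) (w / om) t).
  - apply star_wstrip; assumption.
  - unfold segt. field. exact om_neq_0.
Qed.

Lemma ostrip_shift (y d : R) z : ostrip om y d z -> ostrip om y d (z + om).
Proof.
  unfold ostrip, wstrip. replace ((z + om) / om) with (z / om + 1) by (field; exact om_neq_0).
  rewrite im_plus, im_RtoC, Rplus_0_r. auto.
Qed.

Lemma ostrip_scale (y d : R) w : ostrip om y d (om * w) <-> wstrip y d w.
Proof. unfold ostrip. replace (om * w / om) with w by (field; exact om_neq_0). reflexivity. Qed.

Lemma ostrip_center (y d : R) : 0 < d -> ostrip om y d (om * ptc 0 y).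
Proof. intros Hd. apply ostrip_scale. unfold wstrip. rewrite im_ptc, Rminus_diag, Rabs_R0. exact Hd. Qed.

(** Translates of the half lattice meet a strip in finitely many parallel lines. *)
Lemma ostrip_avoid a (y d : R) : 0 < d -> (forall z, ostrip om y d z -> ~ hlat z) ->
  exists y' d', 0 < d' /\ (forall z, ostrip om y' d' z -> ostrip om y d z /\ ~ sing a z).
Proof.
  intros Hd Hn. set (q := qq om). assert (Hq : 0 < q) by (apply (qq_pos om)).
  destruct (grid_gap (Im (a / om)) q y Hq) as [r1 [Hr1 H1]]. destruct (grid_gap (- Im (a / om)) q y Hq) as [r2 [Hr2 H2]].
  set (r := Rmin d (Rmin r1 r2)). assert (Hr : 0 < r) by (repeat apply Rmin_pos; assumption).
  assert (L1 : r <= d) by apply Rmin_l.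
  assert (L2 : r <= r1) by (eapply Rle_trans; [apply Rmin_r|apply Rmin_l]).
  assert (L3 : r <= r2) by (eapply Rle_trans; [apply Rmin_r|apply Rmin_r]).
  exists (y + r / 2)%R, (r / 4)%R. split; [lra|]. intros z Hz. unfold ostrip, wstrip in Hz. apply Rabs_def2 in Hz.
  assert (Hzy : ostrip om y d z) by (unfold ostrip, wstrip; apply Rabs_def1; lra).
  split; [exact Hzy|]. intros [H|[H|H]].
  - exact (Hn z Hzy H).
  - replace (z - a) with (om * ((z - a) / om)) in H by (field; exact om_neq_0).
    destruct (hlat_pole om et Hom _ H) as (m & n & E). apply (f_equal Im) in E. rewrite im_ptc in E. fold q in E.
    replace ((z - a) / om) with (z / om - a / om) in E by (field; exact om_neq_0). rewrite im_minus in E.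
    specialize (H1 n). rewrite <- E in H1. assert (K := H1 ltac:(apply Rabs_def1; lra)). lra.
  - replace (z + a) with (om * ((z + a) / om)) in H by (field; exact om_neq_0).
    destruct (hlat_pole om et Hom _ H) as (m & n & E). apply (f_equal Im) in E. rewrite im_ptc in E. fold q in E.
    replace ((z + a) / om) with (z / om + a / om) in E by (field; exact om_neq_0). rewrite im_plus in E.
    specialize (H2 n). rewrite <- E in H2. assert (K := H2 ltac:(apply Rabs_def1; lra)). lra.
Qed.

Lemma reflect_odd f : (forall z, f (- z) = - f z) -> (forall z, f (Cconj z) = Cconj (f z)) ->
  forall w, om * f (om * - Cconj w) = - Cconj (om * f (om * w)).
Proof.
  intros Ho Hc w. rewrite (Cmult_conj om (f (om * w))), <- Hc, Cmult_conj.
  destruct om_cases as [-> | ->].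
  - rewrite Cconj_R, !Cmult_1_l. apply Ho.
  - rewrite tau_conj. replace (tau * - Cconj w) with (- tau * Cconj w) by ring. ring.
Qed.

Lemma quasi_real : RtoC (Re (4 * om * et)) = 4 * om * et.
Proof.
  apply C_eq; [apply re_RtoC|]. rewrite im_RtoC. symmetry.
  assert (E1 := eta_1_real). assert (E2 := eta_2_imag).
  destruct Hom as [[-> ->]|[-> ->]].
  - destruct (eta tau 1) as [x y]. unfold Im, Re in *; simpl in *. rewrite E1. ring.
  - destruct (eta tau 2) as [x y]. destruct tau as [t1 t2]. unfold Im, Re in *; simpl in *. rewrite E2, tau_re. ring.
Qed.

Section Multiplier.
Variables (l : nat) (a : C) (y d : R).
Hypothesis Hl : isl l.
Hypothesis Hd : 0 < d.
Hypothesis Havoid : forall z, ostrip om y d z -> ~ sing a z.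

(** [Xf] is a combination of translates of [Sf + Gf] and [Sf - Gf], each of which
    [strip_increment] integrates over a period. *)
Lemma X_primitive : exists F, (forall w, wstrip y d w -> cdiff F w (om * Xf l a (om * w))) /\
  forall w, wstrip y d w -> Re (F (w + 1) - F w) = Re (drift om et a).
Proof.
  set (al := a / om). assert (Eal : om * al = a) by (unfold al; field; exact om_neq_0).
  assert (Hstrip : forall s : R, forall w, wstrip (y + s * Im al) d w -> wstrip y d (w - RtoC s * al)).
  { intros s w Hw. unfold wstrip in *. rewrite im_minus, im_scal_l. replace (Im w - s * Im al - y)%R with (Im w - (y + s * Im al))%R by ring. exact Hw. }
  assert (Hh : forall (s : R) w, s = 1%R \/ s = (-1)%R -> wstrip (y + s * Im al) d w -> ~ hlat (om * w)).
  { intros s w Hs Hw H. apply (Havoid (om * (w - RtoC s * al))); [apply ostrip_scale, Hstrip, Hw|].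
    unfold sing. destruct Hs as [-> | ->].
    - right. right. replace (om * (w - 1 * al) + a) with (om * w) by (rewrite <- Eal; ring). exact H.
    - right. left. replace (om * (w - (-1) * al) - a) with (om * w) by (rewrite <- Eal; ring). exact H. }
  assert (HS : forall w, ~ hlat (om * w) -> exists m, cdiff (fun w => Sf (om * w)) w m).
  { intros w Hw. eexists. apply (cdiff_scale Sf), (Sf_diff _ Hw). }
  assert (HG : forall w, ~ hlat (om * w) -> exists m, cdiff (fun w => Gf l (om * w)) w m).
  { intros w Hw. eexists. apply (cdiff_scale (Gf l)), (Gf_diff l _ Hw). }
  assert (Hall : forall s sg : R, s = 1%R \/ s = (-1)%R ->
    exists F, (forall w, wstrip (y + s * Im al) d w -> cdiff F w (om * (Sf (om * w) + RtoC sg * Gf l (om * w)))) /\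
      forall w, wstrip (y + s * Im al) d w -> Re (F (w + 1) - F w) = (Re (4 * om * et) * (Re w + / 2))%R).
  { intros s sg Hs. apply (strip_increment (fun w => om * (Sf (om * w) + RtoC sg * Gf l (om * w)))); [exact Hd| | |].
    - intros w Hw. destruct (HS w (Hh s w Hs Hw)) as [m1 A1]. destruct (HG w (Hh s w Hs Hw)) as [m2 A2].
      eexists. repeat cd_step.
    - intros w _. rewrite quasi_real. replace (om * (w + 1)) with (om * w + om) by ring.
      rewrite (Sf_period om et _ Hom), (Gf_period_om l om) by assumption. ring.
    - intros w.
      apply (reflect_odd (fun z => Sf z + RtoC sg * Gf l z)); intros z.
      + rewrite Sf_odd, (Gf_odd l z Hl). ring.
      + rewrite Sf_conj, (Gf_conj l z Hl), Cplus_conj, Cmult_conj, Cconj_R. reflexivity. }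
  destruct (Hall (-1)%R 1%R (or_intror eq_refl)) as (F1 & HF1 & IF1).
  destruct (Hall 1%R (-1)%R (or_introl eq_refl)) as (F2 & HF2 & IF2).
  exists (fun w => (F1 (w - al) - F2 (w + al)) / 2 + om * Sf a * w).
  assert (W1 : forall w, wstrip y d w -> wstrip (y + -1 * Im al) d (w - al)).
  { intros w Hw. unfold wstrip in *. rewrite im_minus. replace (Im w - Im al - (y + -1 * Im al))%R with (Im w - y)%R by ring. exact Hw. }
  assert (W2 : forall w, wstrip y d w -> wstrip (y + 1 * Im al) d (w + al)).
  { intros w Hw. unfold wstrip in *. rewrite im_plus. replace (Im w + Im al - (y + 1 * Im al))%R with (Im w - y)%R by ring. exact Hw. }
  split.
  - intros w Hw. assert (A1 := HF1 _ (W1 w Hw)). assert (A2 := HF2 _ (W2 w Hw)).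
    apply (cdiff_shift_minus F1) in A1. apply (cdiff_shift F2) in A2. cd.
    unfold Xf. replace (om * (w - al)) with (om * w - a) by (rewrite <- Eal; ring).
    replace (om * (w + al)) with (om * w + a) by (rewrite <- Eal; ring). field.
  - intros w Hw. assert (I1 := IF1 _ (W1 w Hw)). assert (I2 := IF2 _ (W2 w Hw)).
    replace (w + 1 - al) with (w - al + 1) by ring. replace (w + 1 + al) with (w + al + 1) by ring.
    rewrite !re_minus in I1. rewrite re_minus, re_plus in I2.
    match goal with |- Re ?e = _ => replace e with ((F1 (w - al + 1) - F1 (w - al) - (F2 (w + al + 1) - F2 (w + al))) * RtoC (/ 2) + om * Sf a) end.
    2:{ rewrite RtoC_inv by lra. field. }
    rewrite re_plus, re_scal_r, !re_minus. unfold drift. rewrite re_minus.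
    replace (4 * et * a) with (RtoC (Re (4 * om * et)) * al) by (rewrite quasi_real, <- Eal; ring).
    rewrite re_scal_l. lra.
Qed.
End Multiplier.
End Period.

(** * Solutions and their multipliers *)

Definition sol2 q (U : C -> Prop) (y y' : C -> C) : Prop :=
  forall z, U z -> cdiff y z (y' z) /\ cdiff y' z (q z * y z).

Definition wr (y y' u u' : C -> C) z : C := y z * u' z - y' z * u z.

Lemma sol2_lin q (U : C -> Prop) (y y' u u' : C -> C) a b : sol2 q U y y' -> sol2 q U u u' ->
  sol2 q U (fun z => a * y z + b * u z) (fun z => a * y' z + b * u' z).
Proof. intros Hy Hu z Hz. destruct (Hy z Hz) as [A1 A2]. destruct (Hu z Hz) as [B1 B2]. split; cd; ring. Qed.

Lemma sol2_sub q (U V : C -> Prop) (y y' : C -> C) : (forall z, V z -> U z) -> sol2 q U y y' -> sol2 q V y y'.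
Proof. intros H Hy z Hz. apply Hy, H, Hz. Qed.

Lemma sol2_shift q (U : C -> Prop) (y y' : C -> C) om : (forall z, U z -> U (z + om)) ->
  (forall z, U z -> q (z + om) = q z) -> sol2 q U y y' -> sol2 q U (fun z => y (z + om)) (fun z => y' (z + om)).
Proof.
  intros HU Hq Hy z Hz. destruct (Hy _ (HU z Hz)) as [A1 A2]. rewrite Hq in A2 by exact Hz.
  split; [apply (cdiff_shift y), A1|apply (cdiff_shift y'), A2].
Qed.

Section Space.
Variables (U : C -> Prop) (z0 : C) (q : C -> C).
Hypothesis HU : copen U.
Hypothesis HS : star U z0.
Hypothesis H0 : U z0.
Hypothesis Hq : holo U q.

Lemma wr_const (y y' u u' : C -> C) (z1 z2 : C) : sol2 q U y y' -> sol2 q U u u' -> U z1 -> U z2 ->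
  wr y y' u u' z1 = wr y y' u u' z2.
Proof.
  intros Hy Hu. assert (K : forall z, U z -> wr y y' u u' z = wr y y' u u' z0).
  { apply star_constant; [exact HS|]. intros z Hz. destruct (Hy z Hz) as [A1 A2]. destruct (Hu z Hz) as [B1 B2].
    unfold wr. cd. ring. }
  intros H1 H2. rewrite (K z1 H1), (K z2 H2). reflexivity.
Qed.

Lemma sol_comb (y1 y1' y2 y2' y y' : C -> C) z1 : sol2 q U y1 y1' -> sol2 q U y2 y2' -> sol2 q U y y' ->
  U z1 -> wr y1 y1' y2 y2' z1 <> 0 ->
  forall z, U z ->
    y z = wr y y' y2 y2' z1 / wr y1 y1' y2 y2' z1 * y1 z + wr y1 y1' y y' z1 / wr y1 y1' y2 y2' z1 * y2 z /\
    y' z = wr y y' y2 y2' z1 / wr y1 y1' y2 y2' z1 * y1' z + wr y1 y1' y y' z1 / wr y1 y1' y2 y2' z1 * y2' z.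
Proof.
  intros S1 S2 S Hz1 Hw z Hz. set (w := wr y1 y1' y2 y2' z1) in *.
  assert (E1 := wr_const _ _ _ _ z z1 S1 S2 Hz Hz1). fold w in E1.
  rewrite <- (wr_const _ _ _ _ z z1 S S2 Hz Hz1), <- (wr_const _ _ _ _ z z1 S1 S Hz Hz1).
  rewrite <- E1 in Hw. rewrite <- E1. unfold wr in *. split; field; exact Hw.
Qed.

Lemma sol_basis : exists u1 u1' u2 u2' : C -> C, sol2 q U u1 u1' /\ sol2 q U u2 u2' /\ forall z, U z -> wr u1 u1' u2 u2' z = 1.
Proof.
  destruct (ode_existence U q z0 1 0 HU HS H0 Hq) as (u1 & u1' & S1 & A1 & A2).
  destruct (ode_existence U q z0 0 1 HU HS H0 Hq) as (u2 & u2' & S2 & B1 & B2).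
  exists u1, u1', u2, u2'. split; [exact S1|]. split; [exact S2|]. intros z Hz.
  rewrite (wr_const u1 u1' u2 u2' z z0 S1 S2 Hz H0). unfold wr. rewrite A1, A2, B1, B2. ring.
Qed.

Lemma sol_zero (y y' : C -> C) z1 : sol2 q U y y' -> U z1 -> y z1 = 0 -> y' z1 = 0 ->
  forall z, U z -> y z = 0 /\ y' z = 0.
Proof.
  intros S Hz1 E1 E2 z Hz. destruct sol_basis as (u1 & u1' & u2 & u2' & S1 & S2 & W).
  assert (W1 := W z1 Hz1).
  destruct (sol_comb _ _ _ _ _ _ z1 S1 S2 S Hz1) with (z := z) as [K1 K2]; [rewrite W1; apply RtoC_neq_0; lra|exact Hz|].
  rewrite K1, K2, W1. unfold wr. rewrite E1, E2. split; field.
Qed.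

Lemma sol_exists (z1 c c' : C) : U z1 -> exists y y', sol2 q U y y' /\ y z1 = c /\ y' z1 = c'.
Proof.
  intros Hz1. destruct sol_basis as (u1 & u1' & u2 & u2' & S1 & S2 & W).
  assert (W1 := W z1 Hz1). unfold wr in W1.
  set (a := c * u2' z1 - c' * u2 z1). set (b := u1 z1 * c' - u1' z1 * c).
  exists (fun z => a * u1 z + b * u2 z), (fun z => a * u1' z + b * u2' z).
  split; [apply sol2_lin; assumption|]. unfold a, b. split.
  - transitivity (c * (u1 z1 * u2' z1 - u1' z1 * u2 z1)); [ring|]. rewrite W1. ring.
  - transitivity (c' * (u1 z1 * u2' z1 - u1' z1 * u2 z1)); [ring|]. rewrite W1. ring.
Qed.
End Space.

Lemma sol_independent q (V : C -> Prop) (y1 y1' y2 y2' : C -> C) z1 a b : copen V -> V z1 ->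
  sol2 q V y1 y1' -> sol2 q V y2 y2' -> wr y1 y1' y2 y2' z1 <> 0 ->
  (forall z, V z -> a * y1 z + b * y2 z = 0) -> a = 0 /\ b = 0.
Proof.
  intros HV Hz1 S1 S2 Hw H.
  assert (E1 := H z1 Hz1).
  assert (E2 : a * y1' z1 + b * y2' z1 = 0).
  { apply (cdiff_unique (fun z => a * y1 z + b * y2 z) z1).
    - apply (sol2_lin q V y1 y1' y2 y2' a b S1 S2 z1 Hz1).
    - destruct (HV z1 Hz1) as [r [Hr Hsub]]. apply (cdiff_loc (fun _ => 0) _ z1 _ r Hr); [|apply cdiff_const].
      intros z Hz. symmetry. apply H, Hsub, Hz. }
  unfold wr in Hw. split.
  - replace a with ((a * y1 z1 + b * y2 z1) * y2' z1 / (y1 z1 * y2' z1 - y1' z1 * y2 z1)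
      - (a * y1' z1 + b * y2' z1) * y2 z1 / (y1 z1 * y2' z1 - y1' z1 * y2 z1)) by (field; exact Hw).
    rewrite E1, E2. field. exact Hw.
  - replace b with ((a * y1' z1 + b * y2' z1) * y1 z1 / (y1 z1 * y2' z1 - y1' z1 * y2 z1)
      - (a * y1 z1 + b * y2 z1) * y1' z1 / (y1 z1 * y2' z1 - y1' z1 * y2 z1)) by (field; exact Hw).
    rewrite E1, E2. field. exact Hw.
Qed.

Lemma first_order_ratio (V : C -> Prop) (b f h : C -> C) z1 : copen V -> (forall z, V z -> star V z) -> holo V b ->
  (forall z, V z -> cdiff f z (b z * f z)) -> (forall z, V z -> cdiff h z (b z * h z)) -> V z1 -> f z1 <> 0 ->
  (forall z, V z -> f z <> 0) /\ exists lam, forall z, V z -> h z = lam * f z.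
Proof.
  intros HV HS Hb Hf Hh Hz1 Hf1. split.
  - intros z Hz E. apply Hf1. exact (linear_ode_zero V z f b HV (HS z Hz) Hb Hf E z1 Hz1).
  - exists (h z1 / f z1). intros z Hz. apply Ceq_minus.
    apply (linear_ode_zero V z1 (fun z => h z - h z1 / f z1 * f z) b HV (HS z1 Hz1) Hb); [| |exact Hz].
    + intros w Hw. assert (A := Hf w Hw). assert (B := Hh w Hw). cd. ring.
    + field. exact Hf1.
Qed.

(** The potential on [V_l], in terms of [Gf] (see [Gf_equation] for [A], [B]). *)
Definition qf (l : nat) (t A B z : C) : C :=
  t * t + t * Gf l z + 3 / 4 * (Gf l z * Gf l z) - (A + B) / 4.

Section Family.
Variables (l : nat) (t D A B : C).
Hypothesis Hl : isl l.
Hypothesis HD : D = 2 * t.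
Hypothesis Heq : cubic l A B.

Lemma qf_holo : holo (fun z => ~ hlat z) (qf l t A B).
Proof. intros z Hz. assert (G := Gf_diff l z Hz). eexists. unfold qf. repeat cd_step. Qed.

(** The operator [y -> F y' - F' y / 2] maps solutions to solutions and its
    square is the scalar [Q / 4]; this is an eigenvector, given by its Cauchy
    data at [z1]. *)
Lemma eigenfunction (U : C -> Prop) z0 z1 kappa : copen U -> star U z0 -> U z0 -> U z1 ->
  (forall z, U z -> ~ hlat z) -> D - Gf l z1 <> 0 -> kappa * kappa = (D * D - A) * (D * D - B) ->
  exists f f', sol2 (qf l t A B) U f f' /\ f z1 <> 0 /\
    forall z, U z -> 2 * (D - Gf l z) * f' z = (kappa - dG l z) * f z.
Proof.
  intros HU HS H0 Hz1 Hn HF Hk.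
  assert (Hq : holo U (qf l t A B)) by (apply (holo_sub (fun z => ~ hlat z)); [exact Hn|exact qf_holo]).
  destruct (sol_exists U z0 _ HU HS H0 Hq z1 (2 * (D - Gf l z1)) (kappa - dG l z1) Hz1) as (f & f' & S & E1 & E2).
  exists f, f'. split; [exact S|]. split.
  { rewrite E1. apply Cmult_neq_0; [apply RtoC_neq_0; lra|exact HF]. }
  set (h := fun z => 2 * (D - Gf l z) * f' z - (kappa - dG l z) * f z).
  set (h' := fun z => (- dG l z - kappa) * f' z
    + (2 * (D - Gf l z) * qf l t A B z + (2 * (Gf l z * Gf l z * Gf l z) - (A + B) * Gf l z)) * f z).
  assert (Sh : sol2 (qf l t A B) U h h').
  { intros z Hz. destruct (S z Hz) as [A1 A2]. destruct (Heq z (Hn z Hz)) as [A3 _].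
    assert (A4 := Gf_diff l z (Hn z Hz)). split.
    - unfold h. cd. unfold h'. ring.
    - unfold h', qf. unfold qf in A2. cd. unfold h. rewrite HD. field. }
  destruct (Heq z1 (Hn z1 Hz1)) as [_ A5].
  intros z Hz. apply Ceq_minus. change (h z = 0).
  apply (sol_zero U z0 _ HU HS H0 Hq h h' z1 Sh Hz1); [| |exact Hz].
  - unfold h. rewrite E1, E2. ring.
  - unfold h'. rewrite E1, E2.
    transitivity (dG l z1 * dG l z1 - kappa * kappa + 2 * (D - Gf l z1) *
      (2 * (D - Gf l z1) * qf l t A B z1 + (2 * (Gf l z1 * Gf l z1 * Gf l z1) - (A + B) * Gf l z1))); [ring|].
    rewrite A5, Hk. unfold qf. rewrite HD. field.
Qed.
Lemma Cinv_neq_0 z : z <> 0 -> / z <> 0.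
Proof. intros Hz E. apply (RtoC_neq_0 1); [lra|]. rewrite <- (Cinv_r z Hz), E. ring. Qed.

Section OnePeriod.
Variables (om et : C) (y0 d0 : R).
Hypothesis Hom : half_period om et.
Hypothesis Hd0 : 0 < d0.
Definition strip : C -> Prop := ostrip om y0 d0.
Hypothesis Hn : forall z, strip z -> ~ hlat z.
Local Notation sol := (sol2 (qf l t A B) strip).
Variables (y1 y1' y2 y2' : C -> C) (z0 m11 m12 m21 m22 : C).
Hypothesis Hz0 : strip z0.
Hypothesis S1 : sol y1 y1'.
Hypothesis S2 : sol y2 y2'.
Hypothesis Hw : wr y1 y1' y2 y2' z0 <> 0.
Hypothesis Hm1 : forall z, strip z -> y1 (z + om) = m11 * y1 z + m12 * y2 z.
Hypothesis Hm2 : forall z, strip z -> y2 (z + om) = m21 * y1 z + m22 * y2 z.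

Let om_cases : om = 1 \/ om = tau.
Proof. destruct Hom as [[H _]|[H _]]; auto. Qed.
Let strip_open : copen strip := copen_ostrip om et Hom y0 d0.
Let strip_star (z : C) : strip z -> star strip z := star_ostrip om et Hom y0 d0 z.
Let strip_shift (z : C) : strip z -> strip (z + om) := ostrip_shift om et Hom y0 d0 z.

Lemma G_period z : Gf l (z + om) = Gf l z.
Proof. apply Gf_period_om; assumption. Qed.

Lemma hlat_om : hlat om.
Proof. unfold hlat. destruct om_cases as [E|E]; rewrite E; [exists 2%Z, 0%Z|exists 0%Z, 2%Z]; ring. Qed.

Lemma dG_period z : ~ hlat z -> dG l (z + om) = dG l z.
Proof.
  intros Hz. rewrite (dG_shift l om 1); [ring| |exact Hz|].
  - intros w. rewrite G_period. ring.
  - rewrite (hlat_shift z om hlat_om). exact Hz.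
Qed.

Lemma sol_period f f' : sol f f' ->
  sol (fun z => f (z + om)) (fun z => f' (z + om)).
Proof. apply sol2_shift; [exact strip_shift|]. intros z _. unfold qf. rewrite G_period. reflexivity. Qed.

Lemma wr_strip f f' g g' (z1 z2 : C) : sol f f' ->
  sol g g' -> strip z1 -> strip z2 -> wr f f' g g' z1 = wr f f' g g' z2.
Proof. apply (wr_const strip z0). apply strip_star, Hz0. Qed.

Lemma wr_neq_0 z : strip z -> wr y1 y1' y2 y2' z <> 0.
Proof. intros Hz. rewrite (wr_strip _ _ _ _ z z0 S1 S2 Hz Hz0). exact Hw. Qed.

Lemma derivative_period f f' a b z : sol f f' ->
  (forall z, strip z -> f (z + om) = a * y1 z + b * y2 z) -> strip z ->
  f' (z + om) = a * y1' z + b * y2' z.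
Proof.
  intros Hsf E Hz. apply (cdiff_unique (fun z => f (z + om)) z).
  - apply (sol_period f f' Hsf z Hz).
  - destruct (strip_open z Hz) as [r [Hr Hsub]].
    apply (cdiff_loc (fun z => a * y1 z + b * y2 z) _ z _ r Hr).
    + intros w Hww. symmetry. apply E, Hsub, Hww.
    + apply (sol2_lin _ _ _ _ _ _ a b S1 S2 z Hz).
Qed.

(** The Wronskian is constant. *)
Lemma monodromy_det : m11 * m22 - m12 * m21 = 1.
Proof.
  assert (E1 := Hm1 z0 Hz0). assert (E2 := Hm2 z0 Hz0).
  assert (E3 := derivative_period y1 y1' m11 m12 z0 S1 Hm1 Hz0). assert (E4 := derivative_period y2 y2' m21 m22 z0 S2 Hm2 Hz0).
  assert (E : wr y1 y1' y2 y2' (z0 + om) = wr y1 y1' y2 y2' z0).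
  { apply wr_strip; auto. }
  unfold wr in *. rewrite E1, E2, E3, E4 in E.
  replace (m11 * m22 - m12 * m21) with (((m11 * y1 z0 + m12 * y2 z0) * (m21 * y1' z0 + m22 * y2' z0) -
    (m11 * y1' z0 + m12 * y2' z0) * (m21 * y1 z0 + m22 * y2 z0)) / (y1 z0 * y2' z0 - y1' z0 * y2 z0)) by (field; exact Hw).
  rewrite E. field. exact Hw.
Qed.

Lemma multiplier_eigen f f' (V : C -> Prop) z1 lam : sol f f' ->
  copen V -> (forall z, V z -> strip z) -> V z1 -> f z1 <> 0 -> (forall z, V z -> f (z + om) = lam * f z) ->
  exists c1 c2 : C, (c1 <> 0 \/ c2 <> 0) /\ c1 * m11 + c2 * m21 = lam * c1 /\ c1 * m12 + c2 * m22 = lam * c2 /\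
    lam * lam - (m11 + m22) * lam + 1 = 0.
Proof.
  intros Hsf HV Hsub Hz1 Hf1 Hlam.
  assert (Hc := sol_comb strip z0 _ (strip_star z0 Hz0) _ _ _ _ _ _ z0 S1 S2 Hsf Hz0 Hw).
  set (c1 := wr f f' y2 y2' z0 / wr y1 y1' y2 y2' z0) in Hc. set (c2 := wr y1 y1' f f' z0 / wr y1 y1' y2 y2' z0) in Hc.
  exists c1, c2.
  assert (Hne : c1 <> 0 \/ c2 <> 0).
  { apply NNPP. intros Hno. apply Hf1. rewrite (proj1 (Hc z1 (Hsub z1 Hz1))).
    assert (Z1 : c1 = 0) by (apply NNPP; intros K; apply Hno; auto). assert (Z2 : c2 = 0) by (apply NNPP; intros K; apply Hno; auto).
    rewrite Z1, Z2. ring. }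
  destruct (sol_independent (qf l t A B) V y1 y1' y2 y2' z1 (c1 * m11 + c2 * m21 - lam * c1) (c1 * m12 + c2 * m22 - lam * c2)) as [E1 E2].
  - exact HV.
  - exact Hz1.
  - exact (sol2_sub _ _ _ _ _ Hsub S1).
  - exact (sol2_sub _ _ _ _ _ Hsub S2).
  - apply wr_neq_0, Hsub, Hz1.
  - intros z Hz. assert (Hs := Hsub z Hz). assert (E := Hlam z Hz).
    rewrite (proj1 (Hc _ (strip_shift z Hs))), (proj1 (Hc z Hs)), Hm1, Hm2 in E by exact Hs.
    match type of E with ?L = ?R => transitivity (L - R); [ring|rewrite E; ring] end.
  - apply Ceq_minus in E1. apply Ceq_minus in E2. split; [exact Hne|]. split; [exact E1|]. split; [exact E2|].
    assert (Hdet := monodromy_det).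
    assert (K1 : c1 * (lam * lam - (m11 + m22) * lam + 1) = 0).
    { transitivity ((c1 * m11 + c2 * m21 - lam * c1) * (m22 - lam) - m21 * (c1 * m12 + c2 * m22 - lam * c2) + (1 - (m11 * m22 - m12 * m21)) * c1); [ring|].
      rewrite E1, E2, Hdet. ring. }
    assert (K2 : c2 * (lam * lam - (m11 + m22) * lam + 1) = 0).
    { transitivity ((c1 * m12 + c2 * m22 - lam * c2) * (m11 - lam) - m12 * (c1 * m11 + c2 * m21 - lam * c1) + (1 - (m11 * m22 - m12 * m21)) * c2); [ring|].
      rewrite E1, E2, Hdet. ring. }
    destruct (Cmult_integral _ _ K1); [|assumption]. destruct (Cmult_integral _ _ K2); [|assumption]. tauto.
Qed.

(** Where [F = D - Gf] does not vanish, an eigenfunction and its translate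
    satisfy the same equation of the first order. *)
Lemma eigen_multiplier kappa (y d : R) : 0 < d ->
  (forall z, ostrip om y d z -> strip z /\ D - Gf l z <> 0) -> kappa * kappa = (D * D - A) * (D * D - B) ->
  exists (f f' : C -> C) (lam c1 c2 : C), sol f f' /\ (forall z, ostrip om y d z -> f z <> 0) /\
    (forall z, strip z -> 2 * (D - Gf l z) * f' z = (kappa - dG l z) * f z) /\
    (forall z, ostrip om y d z -> f (z + om) = lam * f z) /\
    (c1 <> 0 \/ c2 <> 0) /\ c1 * m11 + c2 * m21 = lam * c1 /\ c1 * m12 + c2 * m22 = lam * c2 /\
    lam * lam - (m11 + m22) * lam + 1 = 0.
Proof.
  intros Hd HV Hk. assert (om_neq_0 := period_neq_0 om et Hom).
  set (z1 := om * ptc 0 y).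
  assert (Hz1 : ostrip om y d z1) by (apply (ostrip_center om et Hom), Hd).
  destruct (eigenfunction strip z0 z1 kappa strip_open (strip_star z0 Hz0) Hz0 (proj1 (HV z1 Hz1)) Hn (proj2 (HV z1 Hz1)) Hk)
    as (f & f' & Hsf & Hf1 & Hord).
  assert (H2 : RtoC 2 <> 0) by (apply RtoC_neq_0; lra).
  assert (Hb : forall z, ostrip om y d z -> forall h h' : C, 2 * (D - Gf l z) * h' = (kappa - dG l z) * h ->
     h' = (kappa - dG l z) / (2 * (D - Gf l z)) * h).
  { intros z Hz h h' E. destruct (HV z Hz) as [_ HF].
    replace h' with (2 * (D - Gf l z) * h' / (2 * (D - Gf l z))) by (field; exact HF). rewrite E. field. exact HF. }
  destruct (first_order_ratio (ostrip om y d) (fun z => (kappa - dG l z) / (2 * (D - Gf l z))) f (fun z => f (z + om)) z1) as [Hne [lam Hlam]].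
  - exact (copen_ostrip om et Hom y d).
  - exact (star_ostrip om et Hom y d).
  - intros z Hz. destruct (HV z Hz) as [Hs HF]. assert (A1 := Gf_diff l z (Hn z Hs)).
    destruct (dG_holo l z (Hn z Hs)) as [m A2]. eexists. repeat cd_step. apply Cmult_neq_0; assumption.
  - intros z Hz. destruct (HV z Hz) as [Hs _]. rewrite <- (Hb z Hz _ _ (Hord z Hs)). apply (Hsf z Hs).
  - intros z Hz. destruct (HV z Hz) as [Hs _].
    assert (E := Hord _ (strip_shift z Hs)). rewrite G_period, (dG_period z (Hn z Hs)) in E.
    rewrite <- (Hb z Hz _ _ E). apply (sol_period f f' Hsf z Hs).
  - exact Hz1.
  - exact Hf1.
  - destruct (multiplier_eigen f f' (ostrip om y d) z1 lam Hsf) as (c1 & c2 & K); auto.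
    + exact (copen_ostrip om et Hom y d).
    + intros z Hz. apply (HV z Hz).
    + exists f, f', lam, c1, c2. tauto.
Qed.

(** [f^2 / F] is the exponential of a primitive of [Xf], whose increment over
    the period is known from [X_primitive]. *)
Lemma generic_multiplier a : D <> 0 -> ~ hlat a -> Gf l a = D -> dG l a <> 0 ->
  exists lam c1 c2 : C, (c1 <> 0 \/ c2 <> 0) /\ c1 * m11 + c2 * m21 = lam * c1 /\ c1 * m12 + c2 * m22 = lam * c2 /\
    lam * lam - (m11 + m22) * lam + 1 = 0 /\ (Cmod lam ^ 2)%R = exp (Re (drift om et a)).
Proof.
  intros HD0 Ha Ga HdG. assert (om_neq_0 := period_neq_0 om et Hom).
  destruct (ostrip_avoid om et Hom a y0 d0 Hd0 Hn) as (y & d & Hd & HV).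
  assert (HX : forall z, ostrip om y d z -> Xf l a z * (D - Gf l z) = - dG l a).
  { intros z Hz. apply X_product; auto. apply (HV z Hz). }
  assert (HF : forall z, ostrip om y d z -> D - Gf l z <> 0).
  { intros z Hz E. apply HdG. replace (dG l a) with (- - dG l a) by ring. rewrite <- (HX z Hz), E. ring. }
  destruct (eigen_multiplier (- dG l a) y d Hd) as (f & f' & lam & c1 & c2 & Hsf & Hne & Hord & Hlam & K1 & K2 & K3 & K4).
  { intros z Hz. split; [apply (HV z Hz)|apply HF, Hz]. }
  { transitivity (dG l a * dG l a); [ring|]. rewrite (proj2 (Heq a Ha)), Ga. reflexivity. }
  exists lam, c1, c2. repeat (split; [assumption|]).
  destruct (X_primitive om et Hom l a y d Hl Hd (fun z Hz => proj2 (HV z Hz))) as (F & DF & IF).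
  set (p := fun z => f z * f z / (D - Gf l z)).
  assert (Hp : forall z, ostrip om y d z -> cdiff p z (Xf l a z * p z)).
  { intros z Hz. assert (HFz := HF z Hz). assert (Hs := proj1 (HV z Hz)).
    assert (A1 := Gf_diff l z (Hn z Hs)). assert (A2 := proj1 (Hsf z Hs)).
    unfold p. cd; [exact HFz|].
    assert (EX : Xf l a z = - dG l a / (D - Gf l z)) by (rewrite <- (HX z Hz); field; exact HFz).
    rewrite EX. assert (Ef : f' z = (- dG l a - dG l z) * f z / (2 * (D - Gf l z))).
    { rewrite <- (Hord z Hs). field. exact HFz. }
    rewrite Ef. field. exact HFz. }
  set (w := ptc 0 y).
  assert (Hwy : wstrip y d w) by (unfold wstrip, w; rewrite im_ptc, Rminus_diag, Rabs_R0; exact Hd).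
  assert (Hz : ostrip om y d (om * w)) by (apply (ostrip_scale om et Hom), Hwy).
  assert (Hw1 : wstrip y d (w + 1)) by (unfold wstrip in *; rewrite im_plus, im_RtoC, Rplus_0_r; exact Hwy).
  assert (HC : p (om * (w + 1)) * cexp (- F (w + 1)) = p (om * w) * cexp (- F w)).
  { apply (star_constant (wstrip y d) w (fun v => p (om * v) * cexp (- F v)) (star_wstrip y d w Hwy)); [|exact Hw1].
    intros v Hv. assert (B1 := Hp (om * v) ltac:(apply (ostrip_scale om et Hom), Hv)).
    assert (B2 := DF v Hv). apply (cdiff_scale p) in B1.
    assert (B3 : cdiff (fun v => cexp (- F v)) v (cexp (- F v) * - (om * Xf l a (om * v)))).
    { apply (cdiff_comp cexp (fun v => - F v)); [apply cdiff_cexp|apply cdiff_opp, B2]. }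
    cd. ring. }
  assert (Ep : p (om * (w + 1)) = lam * lam * p (om * w)).
  { replace (om * (w + 1)) with (om * w + om) by ring. unfold p. rewrite (Hlam _ Hz), G_period. field. apply HF, Hz. }
  assert (Hp0 : p (om * w) <> 0).
  { unfold p. apply Cmult_neq_0; [apply Cmult_neq_0; apply Hne, Hz|]. apply Cinv_neq_0, HF, Hz. }
  rewrite Ep in HC. apply (f_equal Cmod) in HC. rewrite !Cmod_mult, !Cmod_cexp, !re_opp in HC.
  rewrite <- (IF w Hwy), re_minus. unfold Rminus. rewrite exp_plus.
  set (m0 := Cmod (p (om * w))) in HC. assert (Hm0 : 0 < m0) by (apply Cmod_gt_0, Hp0).
  set (r := Re (F (w + 1))) in *. assert (P1 := exp_pos (- r)).
  assert (Einv : (exp r * exp (- r) = 1)%R) by (rewrite <- exp_plus, Rplus_opp_r; apply exp_0).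
  apply (Rmult_eq_reg_r (m0 * exp (- r))).
  2:{ apply Rgt_not_eq, Rmult_lt_0_compat; assumption. }
  transitivity (Cmod lam * Cmod lam * m0 * exp (- r))%R; [ring|]. rewrite HC.
  transitivity (m0 * exp (- Re (F w)) * (exp r * exp (- r)))%R; [rewrite Einv; ring|ring].
Qed.

(** Now [f^2 / F] is constant, so [lam^2 = 1], and [Yf] is up to a factor the
    derivative of the quotient [g / f] of two solutions.  If the monodromy is
    scalar, this quotient is periodic, and so is the primitive of [Yf]. *)
Lemma degenerate_multiplier (a m : C) : ~ hlat a -> Gf l a = D -> dG l a = 0 -> cdiff (dG l) a m -> m <> 0 ->
  exists lam : C, lam * lam = 1 /\ lam * lam - (m11 + m22) * lam + 1 = 0 /\
    (m11 = lam -> m12 = 0 -> m21 = 0 -> m22 = lam -> 4 * et + Pf a * om = 0).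
Proof.
  intros Ha Ga HdG Hm Hm0. assert (om_neq_0 := period_neq_0 om et Hom).
  destruct (ostrip_avoid om et Hom a y0 d0 Hd0 Hn) as (y & d & Hd & HV).
  assert (HY : forall z, ostrip om y d z -> Yf l a z * (D - Gf l z) = - m).
  { intros z Hz. apply Y_product; auto. apply (HV z Hz). }
  assert (HF : forall z, ostrip om y d z -> D - Gf l z <> 0).
  { intros z Hz E. apply Hm0. replace m with (- - m) by ring. rewrite <- (HY z Hz), E. ring. }
  destruct (eigen_multiplier 0 y d Hd) as (f & f' & lam & c1 & c2 & Hsf & Hne & Hord & Hlam & K1 & K2 & K3 & K4).
  { intros z Hz. split; [apply (HV z Hz)|apply HF, Hz]. }
  { transitivity (dG l a * dG l a); [rewrite HdG; ring|]. rewrite (proj2 (Heq a Ha)), Ga. reflexivity. }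
  set (V := ostrip om y d) in *.
  set (z1 := om * ptc 0 y). assert (Hz1 : V z1) by (apply (ostrip_center om et Hom), Hd).
  assert (HVs : forall z, V z -> V (z + om)) by exact (ostrip_shift om et Hom y d).
  assert (HVstar := star_ostrip om et Hom y d z1 Hz1). fold V in HVstar.
  set (p := fun z => f z * f z / (D - Gf l z)).
  assert (Hf' : forall z, V z -> f' z = - dG l z * f z / (2 * (D - Gf l z))).
  { intros z Hz. transitivity (2 * (D - Gf l z) * f' z / (2 * (D - Gf l z))); [field; apply HF, Hz|].
    rewrite (Hord z (proj1 (HV z Hz))). field. apply HF, Hz. }
  assert (Hp : forall z, V z -> p z = p z1).
  { apply star_constant; [exact HVstar|]. intros z Hz. assert (Hs := proj1 (HV z Hz)).
    assert (A1 := Gf_diff l z (Hn z Hs)). assert (A2 := proj1 (Hsf z Hs)).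
    unfold p. cd; [apply HF, Hz|]. rewrite (Hf' z Hz). field. apply HF, Hz. }
  assert (Hp0 : p z1 <> 0).
  { unfold p. apply Cmult_neq_0; [apply Cmult_neq_0; apply Hne, Hz1|]. apply Cinv_neq_0, HF, Hz1. }
  assert (Hl2 : lam * lam = 1).
  { assert (E := Hp _ (HVs z1 Hz1)). unfold p in E at 1. rewrite (Hlam z1 Hz1), G_period in E.
    replace (lam * lam) with (lam * f z1 * (lam * f z1) / (D - Gf l z1) / p z1).
    - rewrite E. field. exact Hp0.
    - unfold p. field. split; [apply HF, Hz1|apply Hne, Hz1]. }
  exists lam. split; [exact Hl2|]. split; [exact K4|].
  intros E11 E12 E21 E22.
  destruct (sol_exists strip z0 _ strip_open (strip_star z0 Hz0) Hz0
    (holo_sub _ _ _ Hn qf_holo) z1 0 1 (proj1 (HV z1 Hz1))) as (g & g' & Sg & G1 & G2).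
  set (w0 := wr f f' g g' z1).
  assert (Hw0 : w0 <> 0).
  { unfold w0, wr. rewrite G1, G2. replace (f z1 * 1 - f' z1 * 0) with (f z1) by ring. apply Hne, Hz1. }
  assert (Hwr : forall z, V z -> f z * g' z - f' z * g z = w0).
  { intros z Hz. apply (wr_strip f f' g g' z z1 Hsf Sg); [apply (HV z Hz)|apply (HV z1 Hz1)]. }
  assert (Hg : forall z, V z -> g (z + om) = lam * g z).
  { intros z Hz. assert (Hs := proj1 (HV z Hz)).
    assert (Hc := sol_comb strip z0 _ (strip_star z0 Hz0) _ _ _ _ _ _ z0 S1 S2 Sg Hz0 Hw).
    rewrite (proj1 (Hc _ (strip_shift z Hs))), (proj1 (Hc z Hs)), Hm1, Hm2, E11, E12, E21, E22 by exact Hs. ring. }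
  set (k := - w0 / (p z1 * m)).
  set (R := fun z => g z / f z + k * (Sf (z - a) + Gf l (z - a) + Pf a * z)).
  assert (HR : R (z1 + om) = R z1).
  { apply (star_constant V z1 R HVstar); [|apply HVs, Hz1]. intros z Hz. destruct (HV z Hz) as [Hs Hsg]. unfold sing in Hsg.
    assert (A1 := proj1 (Hsf z Hs)). assert (A2 := proj1 (Sg z Hs)).
    assert (A3 := Sf_diff (z - a) ltac:(tauto)). assert (A4 := Gf_diff l (z - a) ltac:(tauto)).
    apply (cdiff_shift_minus Sf) in A3. apply (cdiff_shift_minus (Gf l)) in A4.
    unfold R. cd; [apply Hne, Hz|].
    replace (g' z * f z - g z * f' z) with (f z * g' z - f' z * g z) by ring.
    assert (EY : Yf l a z = - m / (D - Gf l z)) by (rewrite <- (HY z Hz); field; apply HF, Hz).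
    assert (Ef2 : f z * f z = p z1 * (D - Gf l z)) by (rewrite <- (Hp z Hz); unfold p; field; apply HF, Hz).
    unfold Yf in EY.
    transitivity (w0 / (f z * f z) - k * (Pf (z - a) - dG l (z - a) - Pf a)).
    - rewrite <- (Hwr z Hz). field. apply Hne, Hz.
    - rewrite EY, Ef2. unfold k. field. repeat split; [apply HF, Hz|exact Hm0|exact Hp0]. }
  assert (Hl0 : lam <> 0) by (intros E; rewrite E in Hl2; apply (RtoC_neq_0 1); [lra|rewrite <- Hl2; ring]).
  assert (Hk0 : k <> 0).
  { unfold k. apply Cmult_neq_0; [intros E; apply Hw0; replace w0 with (- - w0) by ring; rewrite E; ring|].
    apply Cinv_neq_0, Cmult_neq_0; assumption. }
  unfold R in HR. rewrite (Hg z1 Hz1), (Hlam z1 Hz1) in HR.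
  replace (z1 + om - a) with (z1 - a + om) in HR by ring. rewrite (Sf_period om et _ Hom), G_period in HR.
  replace (4 * et + Pf a * om) with
    ((lam * g z1 / (lam * f z1) + k * (Sf (z1 - a) + 4 * et + Gf l (z1 - a) + Pf a * (z1 + om)) -
      (g z1 / f z1 + k * (Sf (z1 - a) + Gf l (z1 - a) + Pf a * z1))) / k).
  - rewrite HR. field. split; [apply Hne, Hz1|exact Hk0].
  - field. assert (Hfz := Hne z1 Hz1). auto.
Qed.

(** At [T = 0] the translate by [om / 2] exchanges the two eigenlines.  With
    [f3] the translate by [om], the identity between the three Wronskians of
    [f], [f2], [f3] reads [f3 = - f]. *)
Lemma trivial_multiplier : t = 0 -> A <> 0 -> B <> 0 -> (forall z, Gf l (z + om / 2) = - Gf l z) ->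
  m11 = - (1) /\ m12 = 0 /\ m21 = 0 /\ m22 = - (1).
Proof.
  intros Ht HA HB Hhalf. assert (om_neq_0 := period_neq_0 om et Hom).
  assert (HD0 : D = 0) by (rewrite HD, Ht; ring).
  assert (HAB : A * B <> 0) by (apply Cmult_neq_0; assumption).
  assert (Hstar0 := strip_star z0 Hz0).
  assert (Hq : holo strip (qf l t A B)) by exact (holo_sub _ _ _ Hn qf_holo).
  destruct (Gf_surjective l 0 Hl) as (a & Ha & Ga).
  set (kappa := dG l a).
  assert (Hk : kappa * kappa = A * B) by (unfold kappa; rewrite (proj2 (Heq a Ha)), Ga; ring).
  assert (Hk0 : kappa <> 0) by (intros E; apply HAB; rewrite <- Hk, E; ring).
  assert (Hz1 : exists z1, strip z1 /\ Gf l z1 <> 0).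
  { apply NNPP. intros Hno. assert (Hz : forall z, strip z -> Gf l z = 0).
    { intros z Hz. apply NNPP. intros K. apply Hno. exists z. auto. }
    apply HAB. assert (E : dG l z0 = 0).
    { apply (cdiff_unique (Gf l) z0); [apply Gf_diff; auto|]. destruct (strip_open z0 Hz0) as [r [Hr Hsub]].
      apply (cdiff_loc (fun _ => 0) _ z0 _ r Hr); [|apply cdiff_const]. intros w Hww. symmetry. apply Hz, Hsub, Hww. }
    assert (E2 := proj2 (Heq z0 (Hn z0 Hz0))). rewrite E, (Hz z0 Hz0) in E2.
    transitivity ((0 * 0 - A) * (0 * 0 - B)); [ring|]. rewrite <- E2. ring. }
  destruct Hz1 as (z1 & Hz1 & HG1).
  assert (Hs2 : forall z, strip z -> strip (z + om / 2)).
  { intros z Hz. unfold strip, ostrip, wstrip in *. replace ((z + om / 2) / om) with (z / om + / 2) by (field; exact om_neq_0).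
    rewrite <- RtoC_inv, im_plus, im_RtoC, Rplus_0_r by lra. exact Hz. }
  destruct (eigenfunction strip z0 z1 kappa strip_open Hstar0 Hz0 Hz1 Hn) as (f & f' & Hsf & Hf1 & Hord).
  { rewrite HD0. intros E. apply HG1. replace (Gf l z1) with (- (0 - Gf l z1)) by ring. rewrite E. ring. }
  { rewrite Hk, HD0. ring. }
  assert (Hshift : forall u u' : C -> C, sol u u' ->
    sol (fun z => u (z + om / 2)) (fun z => u' (z + om / 2))).
  { intros u u'. apply sol2_shift; [exact Hs2|]. intros z _. unfold qf. rewrite Hhalf, Ht. ring. }
  set (f2 := fun z => f (z + om / 2)). set (f2' := fun z => f' (z + om / 2)).
  set (f3 := fun z => f2 (z + om / 2)). set (f3' := fun z => f2' (z + om / 2)).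
  assert (Hs2f : sol f2 f2') by exact (Hshift f f' Hsf).
  assert (Hs3f : sol f3 f3') by exact (Hshift f2 f2' Hs2f).
  assert (O1 : forall z, strip z -> 2 * - Gf l z * f' z = (kappa - dG l z) * f z).
  { intros z Hz. rewrite <- (Hord z Hz), HD0. ring. }
  assert (HdG : forall z, strip z -> dG l (z + om / 2) = - dG l z).
  { intros z Hz. rewrite (dG_shift l (om / 2) (- (1))); [ring| |apply Hn, Hz|apply Hn, Hs2, Hz].
    intros w. rewrite Hhalf. ring. }
  assert (O2 : forall z, strip z -> 2 * - Gf l z * f2' z = (- kappa - dG l z) * f2 z).
  { intros z Hz. assert (E := O1 _ (Hs2 z Hz)). rewrite Hhalf, (HdG z Hz) in E. fold (f2 z) (f2' z) in E.
    transitivity (- (2 * - - Gf l z * f2' z)); [ring|]. rewrite E. ring. }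
  assert (O3 : forall z, strip z -> 2 * - Gf l z * f3' z = (kappa - dG l z) * f3 z).
  { intros z Hz. assert (E := O2 _ (Hs2 z Hz)). rewrite Hhalf, (HdG z Hz) in E. fold (f3 z) (f3' z) in E.
    transitivity (- (2 * - - Gf l z * f3' z)); [ring|]. rewrite E. ring. }
  assert (HG2 : 2 * - Gf l z1 <> 0).
  { apply Cmult_neq_0; [apply RtoC_neq_0; lra|]. intros E. apply HG1. replace (Gf l z1) with (- - Gf l z1) by ring. rewrite E. ring. }
  set (w := wr f f' f2 f2' z1).
  assert (Ew : (2 * - Gf l z1) * w = - 2 * kappa * (f z1 * f2 z1)).
  { unfold w, wr. transitivity (f z1 * (2 * - Gf l z1 * f2' z1) - 2 * - Gf l z1 * f' z1 * f2 z1); [ring|].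
    rewrite (O1 z1 Hz1), (O2 z1 Hz1). ring. }
  assert (Hw0 : w <> 0).
  { intros E. rewrite E, Cmult_0_r in Ew.
    assert (F0 : f2 z1 = 0).
    { apply NNPP. intros K. apply (Cmult_neq_0 (- 2 * kappa) (f z1 * f2 z1)).
      - apply Cmult_neq_0; [apply RtoC_neq_0; lra|exact Hk0].
      - apply Cmult_neq_0; assumption.
      - symmetry. exact Ew. }
    assert (F1 : f2' z1 = 0).
    { apply NNPP. intros K. apply (Cmult_neq_0 _ _ HG2 K). rewrite (O2 z1 Hz1), F0. ring. }
    apply Hf1. exact (proj1 (sol_zero strip z0 _ strip_open Hstar0 Hz0 Hq f f' (z1 + om / 2) Hsf (Hs2 z1 Hz1) F0 F1 z1 Hz1)). }
  assert (W13 : wr f f' f3 f3' z1 = 0).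
  { apply NNPP. intros K. apply (Cmult_neq_0 _ _ HG2 K). unfold wr.
    transitivity (f z1 * (2 * - Gf l z1 * f3' z1) - 2 * - Gf l z1 * f' z1 * f3 z1); [ring|].
    rewrite (O1 z1 Hz1), (O3 z1 Hz1). ring. }
  assert (Hf3 : forall z, strip z -> f3 z = - f z).
  { intros z Hz.
    assert (E1 : wr f f' f2 f2' z = w) by exact (wr_strip _ _ _ _ z z1 Hsf Hs2f Hz Hz1).
    assert (E2 : wr f2 f2' f3 f3' z = w) by exact (wr_strip _ _ _ _ (z + om / 2) z1 Hsf Hs2f (Hs2 z Hz) Hz1).
    assert (E3 : wr f f' f3 f3' z = 0) by (rewrite (wr_strip _ _ _ _ z z1 Hsf Hs3f Hz Hz1); exact W13).
    assert (E : f z * w - f2 z * 0 + f3 z * w = 0).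
    { transitivity (f z * wr f2 f2' f3 f3' z - f2 z * wr f f' f3 f3' z + f3 z * wr f f' f2 f2' z); [rewrite E1, E2, E3; reflexivity|unfold wr; ring]. }
    replace (f3 z) with ((f z * w - f2 z * 0 + f3 z * w) / w - f z) by (field; exact Hw0). rewrite E. field. exact Hw0. }
  assert (Hall : forall u u' : C -> C, sol u u' -> forall z, strip z -> u (z + om) = - u z).
  { intros u u' Su z Hz. assert (Hc := sol_comb strip z0 _ Hstar0 _ _ _ _ _ _ z1 Hsf Hs2f Su Hz1 Hw0).
    assert (E1 : f (z + om) = - f z).
    { rewrite <- (Hf3 z Hz). unfold f3, f2. f_equal. field. }
    assert (E2 : f2 (z + om) = - f2 z).
    { change (- f2 z) with (- f (z + om / 2)). rewrite <- (Hf3 _ (Hs2 z Hz)). unfold f3, f2. f_equal. field. }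
    rewrite (proj1 (Hc _ (strip_shift z Hz))), (proj1 (Hc z Hz)), E1, E2. ring. }
  destruct (sol_independent (qf l t A B) strip y1 y1' y2 y2' z0 (m11 + 1) m12) as [R1 R2]; auto.
  { intros z Hz. transitivity (m11 * y1 z + m12 * y2 z + y1 z); [ring|]. rewrite <- Hm1, (Hall y1 y1' S1) by exact Hz. ring. }
  destruct (sol_independent (qf l t A B) strip y1 y1' y2 y2' z0 m21 (m22 + 1)) as [R3 R4]; auto.
  { intros z Hz. transitivity (m21 * y1 z + m22 * y2 z + y2 z); [ring|]. rewrite <- Hm2, (Hall y2 y2' S2) by exact Hz. ring. }
  repeat split; [|exact R2|exact R3|].
  - replace m11 with (m11 + 1 - 1) by ring. rewrite R1. ring.
  - replace m22 with (m22 + 1 - 1) by ring. rewrite R4. ring.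
Qed.
End OnePeriod.
End Family.

(** * Monodromy matrices *)

Local Notation Mmul := (Mmult (T := C_Ring)).
Local Notation Mid := (Mone (T := C_Ring)).
Definition en (M : CM2) (i j : nat) : C := coeff_mat (0 : C) M i j.

Lemma en_mult (M N : CM2) (i j : nat) : (i < 2)%nat -> (j < 2)%nat ->
  en (Mmul M N) i j = en M i 0 * en N 0 j + en M i 1 * en N 1 j.
Proof.
  intros Hi Hj. unfold en, Mmult. rewrite coeff_mat_bij by assumption. simpl Nat.pred. rewrite sum_Sn, sum_O. reflexivity.
Qed.

Lemma en_one (i j : nat) : (i < 2)%nat -> (j < 2)%nat -> en (Mid) i j = if Nat.eqb i j then 1 else RtoC 0.
Proof.
  intros Hi Hj. unfold en, Mone. rewrite coeff_mat_bij by assumption. unfold Mone_seq.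
  destruct i as [|[|i]], j as [|[|j]]; try lia; reflexivity.
Qed.

Lemma en_ext (M N : CM2) : (forall i j, (i < 2)%nat -> (j < 2)%nat -> en M i j = en N i j) -> M = N.
Proof. intros H. apply (coeff_mat_ext_aux (0:C) (0:C)). exact H. Qed.

Lemma en_mk (u : nat -> nat -> C) (i j : nat) : (i < 2)%nat -> (j < 2)%nat -> en (mk_matrix 2 2 u) i j = u i j.
Proof. apply coeff_mat_bij. Qed.

Lemma mult_conj z : z * Cconj z = RtoC (Re z * Re z + Im z * Im z).
Proof. destruct z as [x y]. apply injective_projections; simpl; ring. Qed.

Lemma mult_conj_Cmod z : z * Cconj z = RtoC (Cmod z ^ 2).
Proof. rewrite Cmod2_conj. reflexivity. Qed.

Lemma square_one lam : lam * lam = 1 -> lam = 1 \/ lam = - (1).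
Proof. intros H. apply square_eq. rewrite H. ring. Qed.

Lemma unit_of_trace lam (x : R) : -1 <= x <= 1 -> lam * lam - 2 * RtoC x * lam + 1 = 0 -> (Cmod lam ^ 2)%R = 1%R.
Proof.
  intros Hx E. rewrite <- (re_RtoC (Cmod lam ^ 2)), <- mult_conj_Cmod, mult_conj, re_RtoC.
  destruct lam as [u v]. assert (E1 := f_equal Re E). assert (E2 := f_equal Im E). unfold Re, Im in *; simpl in *.
  assert (F2 : (2 * v * (u - x) = 0)%R) by lra.
  destruct (Rmult_integral _ _ F2) as [F|F].
  - assert (v = 0%R) by lra. subst v. assert (K : ((u - x) * (u - x) = x * x - 1)%R) by lra.
    assert (u = x) by nra. subst u. nra.
  - assert (u = x) by lra. subst u. nra.
Qed.

Lemma unitary_rows (N : CM2) : unitary N -> forall i j, (i < 2)%nat -> (j < 2)%nat ->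
  en N i 0 * Cconj (en N j 0) + en N i 1 * Cconj (en N j 1) = if Nat.eqb i j then 1 else RtoC 0.
Proof.
  intros H i j Hi Hj. rewrite <- en_one by assumption. rewrite <- H, en_mult by assumption.
  unfold adjoint. rewrite !en_mk by (assumption || lia). reflexivity.
Qed.

Lemma unitary_eigenvalue (N : CM2) (d0 d1 lam : C) : unitary N -> (d0 <> 0 \/ d1 <> 0) ->
  d0 * en N 0 0 + d1 * en N 1 0 = lam * d0 -> d0 * en N 0 1 + d1 * en N 1 1 = lam * d1 -> (Cmod lam ^ 2)%R = 1%R.
Proof.
  intros HN Hd E0 E1. assert (R := unitary_rows N HN).
  assert (R00 := R 0%nat 0%nat ltac:(lia) ltac:(lia)). assert (R01 := R 0%nat 1%nat ltac:(lia) ltac:(lia)).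
  assert (R10 := R 1%nat 0%nat ltac:(lia) ltac:(lia)). assert (R11 := R 1%nat 1%nat ltac:(lia) ltac:(lia)). simpl in R00, R01, R10, R11.
  set (n00 := en N 0 0) in *. set (n01 := en N 0 1) in *. set (n10 := en N 1 0) in *. set (n11 := en N 1 1) in *.
  assert (K : lam * Cconj lam * (d0 * Cconj d0 + d1 * Cconj d1) = d0 * Cconj d0 + d1 * Cconj d1).
  { transitivity (lam * d0 * Cconj (lam * d0) + lam * d1 * Cconj (lam * d1)); [rewrite !Cmult_conj; ring|].
    rewrite <- E0, <- E1, !Cplus_conj, !Cmult_conj.
    transitivity (d0 * Cconj d0 * (n00 * Cconj n00 + n01 * Cconj n01) + d0 * Cconj d1 * (n00 * Cconj n10 + n01 * Cconj n11)
      + d1 * Cconj d0 * (n10 * Cconj n00 + n11 * Cconj n01) + d1 * Cconj d1 * (n10 * Cconj n10 + n11 * Cconj n11)); [ring|].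
    rewrite R00, R01, R10, R11. ring. }
  rewrite !mult_conj_Cmod, <- !RtoC_plus, <- RtoC_mult in K. apply RtoC_inj in K.
  assert (0 < Cmod d0 ^ 2 + Cmod d1 ^ 2).
  { assert (P := Cmod_ge_0 d0). assert (P' := Cmod_ge_0 d1). destruct Hd as [Hd|Hd]; apply Cmod_gt_0 in Hd; nra. }
  apply (Rmult_eq_reg_r (Cmod d0 ^ 2 + Cmod d1 ^ 2)); lra.
Qed.

(** The diagonal entries have modulus at most 1 and sum [2 lam], [lam = 1] or
    [-1], so each is [lam] and fills its row. *)
Lemma unitary_scalar (N : CM2) lam : unitary N -> lam * lam = 1 -> en N 0 0 + en N 1 1 = 2 * lam ->
  en N 0 0 = lam /\ en N 0 1 = 0 /\ en N 1 0 = 0 /\ en N 1 1 = lam.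
Proof.
  intros HN Hl Ht. assert (R := unitary_rows N HN).
  assert (R00 := R 0%nat 0%nat ltac:(lia) ltac:(lia)). assert (R11 := R 1%nat 1%nat ltac:(lia) ltac:(lia)). simpl in R00, R11.
  rewrite !mult_conj, <- RtoC_plus in R00, R11. apply RtoC_inj in R00. apply RtoC_inj in R11.
  destruct (en N 0 0) as [a b], (en N 0 1) as [c d], (en N 1 0) as [e f], (en N 1 1) as [g h].
  assert (T1 := f_equal Re Ht). unfold Re, Im in *.
  destruct (square_one lam Hl) as [-> | ->]; simpl in *.
  - assert (a = 1%R) by nra. assert (g = 1%R) by nra. subst a g.
    assert (b = 0%R) by nra. assert (c = 0%R) by nra. assert (d = 0%R) by nra.
    assert (e = 0%R) by nra. assert (f = 0%R) by nra. assert (h = 0%R) by nra. subst. auto.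
  - assert (a = (-1)%R) by nra. assert (g = (-1)%R) by nra. subst a g.
    assert (b = 0%R) by nra. assert (c = 0%R) by nra. assert (d = 0%R) by nra.
    assert (e = 0%R) by nra. assert (f = 0%R) by nra. assert (h = 0%R) by nra. subst.
    repeat split; apply injective_projections; simpl; ring.
Qed.

Lemma locally_open z0 (U : C -> Prop) : copen U -> U z0 -> locally z0 U.
Proof.
  intros HU H0. destruct (HU z0 H0) as [r [Hr H]]. assert (Hr2 : 0 < r / 2) by lra.
  exists (mkposreal _ Hr2). intros z [B1 B2]. apply H. unfold disc.
  eapply Rle_lt_trans; [apply Cmod_le_re_im|]. rewrite re_minus, im_minus.
  change (Rabs (Re z - Re z0) < r / 2) in B1. change (Rabs (Im z - Im z0) < r / 2) in B2. lra.
Qed.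

Lemma locally_disc z0 (Q : C -> Prop) : locally z0 Q -> exists r, 0 < r /\ forall z, disc z0 r z -> Q z.
Proof.
  intros [e H]. exists e. split; [apply cond_pos|]. intros z Hz. apply H. unfold disc in Hz.
  assert (A := Rle_lt_trans _ _ _ (re_le (z - z0)) Hz). assert (B := Rle_lt_trans _ _ _ (im_le (z - z0)) Hz).
  rewrite re_minus in A. rewrite im_minus in B. split; assumption.
Qed.

Lemma column_mult (M : CM2) (u v a b : C -> C) z w :
  column u v w = Mmul M (column a b z) <->
  u w = en M 0 0 * a z + en M 0 1 * b z /\ v w = en M 1 0 * a z + en M 1 1 * b z.
Proof.
  assert (K : forall i, (i < 2)%nat ->
    coeff_mat (0:C) (Mmul M (column a b z)) i 0 = en M i 0 * a z + en M i 1 * b z).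
  { intros i Hi. unfold Mmult. rewrite coeff_mat_bij by lia. simpl Nat.pred. rewrite sum_Sn, sum_O. reflexivity. }
  split.
  - intros E. rewrite <- !K, <- E by lia. split; reflexivity.
  - intros [E1 E2]. apply (coeff_mat_ext_aux (0:C) (0:C)). intros i j Hi Hj.
    assert (j = 0%nat) by lia. subst j. rewrite K by exact Hi. unfold column. rewrite coeff_mat_bij by lia.
    destruct i as [|[|i]]; [exact E1|exact E2|lia].
Qed.

Lemma strip1_ostrip z0 (e : R) z : strip1 tau z0 e z <-> ostrip 1 (Im z0) (e * Im tau) z.
Proof.
  unfold strip1, ostrip, wstrip. replace (z / 1) with z by field. split.
  - intros (s & t & E & Ht). rewrite E, !im_plus, im_RtoC, im_scal_l.
    replace (Im z0 + 0 + t * Im tau - Im z0)%R with (t * Im tau)%R by ring. rewrite Rabs_mult, (Rabs_pos_eq (Im tau)) by lra.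
    apply Rmult_lt_compat_r; assumption.
  - intros H. exists (Re z - Re z0)%R, ((Im z - Im z0) / Im tau)%R. split.
    + apply C_eq; [rewrite !re_plus, re_RtoC, re_scal_l, tau_re; ring|].
      rewrite !im_plus, im_RtoC, im_scal_l. field. lra.
    + unfold Rdiv. rewrite Rabs_mult, (Rabs_pos_eq (/ Im tau)) by (left; apply Rinv_0_lt_compat; lra).
      apply (Rmult_lt_reg_r (Im tau)); [exact tau_im|]. rewrite Rmult_assoc, Rinv_l by lra. lra.
Qed.

Lemma im_div_tau z : Im (z / tau) = (- Re z / Im tau)%R.
Proof.
  assert (Ht := tau_neq_0). replace (Re z) with (Re (tau * (z / tau))) by (f_equal; field; exact Ht).
  rewrite (proj1 (re_tau_mult (z / tau))). field. lra.
Qed.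

Lemma strip2_ostrip z0 (e : R) z : strip2 tau z0 e z <-> ostrip tau (Im (z0 / tau)) (e / Im tau) z.
Proof.
  unfold strip2, ostrip, wstrip. rewrite !im_div_tau.
  replace (- Re z / Im tau - - Re z0 / Im tau)%R with (- (Re z - Re z0) * / Im tau)%R by (field; lra).
  rewrite Rabs_mult, Rabs_Ropp, (Rabs_pos_eq (/ Im tau)) by (left; apply Rinv_0_lt_compat; lra).
  assert (K : (Rabs (Re z - Re z0) * / Im tau < e / Im tau) <-> (Rabs (Re z - Re z0) < e)).
  { split; intros H.
    - apply (Rmult_lt_reg_r (/ Im tau)); [apply Rinv_0_lt_compat; lra|exact H].
    - apply Rmult_lt_compat_r; [apply Rinv_0_lt_compat; lra|exact H]. }
  rewrite K. split.
  - intros (s & t & E & Hs). rewrite E, !re_plus, re_RtoC, re_scal_l, tau_re.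
    replace (Re z0 + s + t * 0 - Re z0)%R with s by ring. exact Hs.
  - intros H. exists (Re z - Re z0)%R, ((Im z - Im z0) / Im tau)%R. split; [|exact H].
    apply C_eq; [rewrite !re_plus, re_RtoC, re_scal_l, tau_re; ring|].
    rewrite !im_plus, im_RtoC, im_scal_l. field. lra.
Qed.

(** Both strips of the cross, uniformly in the period. *)
Definition arm om z0 (e : R) z : Prop := (om = 1 /\ strip1 tau z0 e z) \/ (om = tau /\ strip2 tau z0 e z).

Lemma arm_ostrip om et z0 (e : R) : half_period om et -> 0 < e ->
  exists d, 0 < d /\ forall z, arm om z0 e z <-> ostrip om (Im (z0 / om)) d z.
Proof.
  intros [[-> _]|[-> _]] He.
  - exists (e * Im tau)%R. split; [apply Rmult_lt_0_compat; lra|]. intros z.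
    replace (z0 / 1) with z0 by field. rewrite <- strip1_ostrip. unfold arm. split; [|auto].
    intros [[_ H]|[E _]]; [exact H|]. exfalso. apply tau_not_1. auto.
  - exists (e / Im tau)%R. split; [apply Rdiv_lt_0_compat; lra|]. intros z. rewrite <- strip2_ostrip. unfold arm. split; [|auto].
    intros [[E _]|[_ H]]; [|exact H]. exfalso. apply tau_not_1. auto.
Qed.

Definition cross z0 (e : R) z : Prop := strip1 tau z0 e z \/ strip2 tau z0 e z.

Lemma cross_arm z0 (e : R) z : cross z0 e z <-> arm 1 z0 e z \/ arm tau z0 e z.
Proof. assert (N := tau_not_1). unfold cross, arm. intuition congruence. Qed.

Lemma arm_facts om et z0 (e : R) : half_period om et -> 0 < e ->
  copen (arm om z0 e) /\ star (arm om z0 e) z0 /\ arm om z0 e z0 /\ forall z, arm om z0 e z -> arm om z0 e (z + om).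
Proof.
  intros Hom He. destruct (arm_ostrip om et z0 e Hom He) as (d & Hd & Ha).
  assert (Hc : ostrip om (Im (z0 / om)) d z0) by (unfold ostrip, wstrip; rewrite Rminus_diag, Rabs_R0; exact Hd).
  repeat split.
  - intros z Hz. apply Ha in Hz. destruct (copen_ostrip om et Hom _ _ z Hz) as [r [Hr H]]. exists r.
    split; [exact Hr|]. intros w Hw. apply Ha, H, Hw.
  - intros z t Hz Ht. apply Ha. apply Ha in Hz. apply (star_ostrip om et Hom _ _ z0 Hc); assumption.
  - apply Ha, Hc.
  - intros z Hz. apply Ha, (ostrip_shift om et Hom), Ha, Hz.
Qed.

Lemma cross_facts z0 (e : R) : 0 < e -> copen (cross z0 e) /\ star (cross z0 e) z0 /\ cross z0 e z0.
Proof.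
  intros He. destruct (arm_facts 1 (eta tau 1) z0 e) as (O1 & T1 & C1 & _); [left; auto|exact He|].
  destruct (arm_facts tau (eta tau 2) z0 e) as (O2 & T2 & _); [right; auto|exact He|]. repeat split.
  - intros z Hz. apply cross_arm in Hz. destruct Hz as [Hz|Hz]; [destruct (O1 z Hz) as [r [Hr H]]|destruct (O2 z Hz) as [r [Hr H]]];
      exists r; (split; [exact Hr|]); intros w Hw; apply cross_arm; [left|right]; apply H, Hw.
  - intros z t Hz Ht. apply cross_arm in Hz. apply cross_arm. destruct Hz as [Hz|Hz]; [left; apply T1|right; apply T2]; assumption.
  - apply cross_arm. left. exact C1.
Qed.

Lemma hlat_grid (x y : R) (m n : Z) : x = (IZR m / 2)%R -> y = (IZR n * (Im tau / 2))%R -> hlat (ptc x y).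
Proof.
  intros -> ->. exists m, n. apply C_eq; rewrite ?re_lin, ?im_lin, ?re_scal_l, ?im_scal_l, ?re_ptc, ?im_ptc; field.
Qed.

Lemma admissible_cross z0 : admissible_base tau z0 ->
  exists e, 0 < e /\ forall z, cross z0 e z -> ~ hlat z.
Proof.
  intros H.
  destruct (grid_gap 0 (Im tau / 2) (Im z0)) as [r1 [Hr1 K1]]; [lra|].
  destruct (grid_gap 0 (/ 2) (Re z0)) as [r2 [Hr2 K2]]; [lra|].
  exists (Rmin (r1 / Im tau) r2). split; [apply Rmin_pos; [apply Rdiv_lt_0_compat; assumption|exact Hr2]|].
  intros z Hz Hl. destruct (hlat_re z Hl) as [m Em]. destruct (hlat_im z Hl) as [n En].
  destruct Hz as [(s & t & E & Ht)|(s & t & E & Hs)].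
  - assert (Ei := f_equal Im E). rewrite !im_plus, im_RtoC, im_scal_l in Ei.
    assert (Ht' : Rabs (t * Im tau) < r1).
    { rewrite Rabs_mult, (Rabs_pos_eq (Im tau)) by lra. assert (L := Rlt_le_trans _ _ _ Ht (Rmin_l _ _)).
      apply (Rmult_lt_compat_r (Im tau)) in L; [|exact tau_im]. unfold Rdiv in L. rewrite Rmult_assoc, Rinv_l, Rmult_1_r in L by lra. exact L. }
    assert (G : (0 + IZR n * (Im tau / 2) = Im z0)%R).
    { apply K1. replace (0 + IZR n * (Im tau / 2) - Im z0)%R with (t * Im tau)%R by lra. exact Ht'. }
    apply (proj1 (H (- Re z0)%R)). apply singular_hlat.
    replace (z0 + RtoC (- Re z0)) with (ptc 0 (Im z0)).
    + apply (hlat_grid _ _ 0 n); lra.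
    + apply C_eq; [rewrite re_plus, re_ptc, re_RtoC|rewrite im_plus, im_ptc, im_RtoC]; ring.
  - assert (Er := f_equal Re E). rewrite !re_plus, re_RtoC, re_scal_l, tau_re in Er.
    assert (G : (0 + IZR m * / 2 = Re z0)%R).
    { apply K2. assert (L := Rlt_le_trans _ _ _ Hs (Rmin_r _ _)). replace (0 + IZR m * / 2 - Re z0)%R with s by lra. exact L. }
    apply (proj2 (H (- Im z0 / Im tau)%R)). apply singular_hlat.
    replace (z0 + tau * RtoC (- Im z0 / Im tau)) with (ptc (Re z0) 0).
    + apply (hlat_grid _ _ m 0); lra.
    + apply C_eq; [rewrite re_plus, re_ptc, re_scal_r, tau_re|rewrite im_plus, im_ptc, im_scal_r]; field; lra.
Qed.

Section Potential.
Variables (q qh : C -> C) (z0 : C).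
Hypothesis Hqh : holo (fun z => ~ hlat z) qh.
Hypothesis Hper : forall om z : C, om = 1 \/ om = tau -> ~ hlat z -> qh (z + om) = qh z.
Hypothesis Hq : forall z, ~ hlat z -> q z = qh z.

Lemma solution_sol2 (U : C -> Prop) (y : C -> C) : (forall z, U z -> ~ hlat z) ->
  (solution q U y <-> exists y', sol2 qh U y y').
Proof.
  intros HU. split.
  - intros [y' H]. exists y'. intros z Hz. rewrite <- (Hq z (HU z Hz)). exact (H z Hz).
  - intros [y' H]. exists y'. intros z Hz. rewrite (Hq z (HU z Hz)). exact (H z Hz).
Qed.

(** The data of [monodromy] with derivatives as functions, independence as a
    Wronskian and the matrices by entries. *)
Definition mono_data (e : R) (y1 y1' y2 y2' : C -> C) (M1 M2 : CM2) : Prop :=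
  (0 < e) /\ (forall z, cross z0 e z -> ~ hlat z) /\
  sol2 qh (cross z0 e) y1 y1' /\ sol2 qh (cross z0 e) y2 y2' /\ wr y1 y1' y2 y2' z0 <> 0 /\
  forall (om : C) (M : CM2), (om = 1 /\ M = M1) \/ (om = tau /\ M = M2) -> forall z, arm om z0 e z ->
    y1 (z + om) = en M 0 0 * y1 z + en M 0 1 * y2 z /\ y2 (z + om) = en M 1 0 * y1 z + en M 1 1 * y2 z.

Lemma wr_of_independent (U : C -> Prop) (y1 y1' y2 y2' : C -> C) : copen U -> star U z0 -> U z0 ->
  (forall z, U z -> ~ hlat z) -> sol2 qh U y1 y1' -> sol2 qh U y2 y2' ->
  (forall a b : C, locally z0 (fun z : C => a * y1 z + b * y2 z = 0) -> a = 0 /\ b = 0) -> wr y1 y1' y2 y2' z0 <> 0.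
Proof.
  intros HU HS H0 Hn S1 S2 Hi Hw. unfold wr in Hw.
  assert (Hqu : holo U qh) by exact (holo_sub _ _ _ Hn Hqh).
  assert (K : forall a b, a * y1 z0 + b * y2 z0 = 0 -> a * y1' z0 + b * y2' z0 = 0 -> a = 0 /\ b = 0).
  { intros a b E1 E2. apply Hi. apply (filter_imp U); [|apply locally_open; assumption].
    intros z Hz. exact (proj1 (sol_zero U z0 qh HU HS H0 Hqu _ _ z0 (sol2_lin _ _ _ _ _ _ a b S1 S2) H0 E1 E2 z Hz)). }
  destruct (K (y2 z0) (- y1 z0)) as [A1 A2]; [ring|transitivity (- (y1 z0 * y2' z0 - y1' z0 * y2 z0)); [ring|rewrite Hw; ring]|].
  destruct (K (y2' z0) (- y1' z0)) as [B1 B2]; [transitivity (y1 z0 * y2' z0 - y1' z0 * y2 z0); [ring|exact Hw]|ring|].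
  destruct (K 1 0) as [C1 _].
  - transitivity (- - y1 z0); [ring|]. rewrite A2. ring.
  - transitivity (- - y1' z0); [ring|]. rewrite B2. ring.
  - revert C1. apply RtoC_neq_0. lra.
Qed.

Lemma monodromy_data (M1 M2 : CM2) : monodromy tau z0 q M1 M2 -> exists e y1 y1' y2 y2', mono_data e y1 y1' y2 y2' M1 M2.
Proof.
  intros (e & y1 & y2 & He & Hns & S1 & S2 & Hi & HM1 & HM2).
  assert (Hn : forall z, cross z0 e z -> ~ hlat z) by (intros z Hz H; apply (Hns z Hz), singular_hlat, H).
  destruct (proj1 (solution_sol2 (cross z0 e) y1 Hn) S1) as [y1' T1]. destruct (proj1 (solution_sol2 (cross z0 e) y2 Hn) S2) as [y2' T2].
  exists e, y1, y1', y2, y2'. repeat (split; [assumption|]).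
  destruct (cross_facts z0 e He) as (HU & HS & H0).
  split; [apply (wr_of_independent (cross z0 e)); assumption|].
  intros om M [[-> ->]|[-> ->]] z [[E Hz]|[E Hz]]; try (exfalso; apply tau_not_1; congruence).
  - apply column_mult, HM1, Hz.
  - apply column_mult, HM2, Hz.
Qed.

(** The conjugated pair belongs to the basis [P (y1, y2)^t]. *)
Lemma monodromy_conj (M1 M2 P P' : CM2) : Mmul P P' = Mid ->
  Mmul P' P = Mid -> monodromy tau z0 q M1 M2 ->
  monodromy tau z0 q (Mmul (Mmul P M1) P') (Mmul (Mmul P M2) P').
Proof.
  intros HP HP' (e & y1 & y2 & He & Hn & (y1' & S1) & (y2' & S2) & Hi & HM1 & HM2).
  set (u := fun i z => en P i 0 * y1 z + en P i 1 * y2 z).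
  assert (Hu : forall z, column (u 0%nat) (u 1%nat) z = Mmul P (column y1 y2 z)).
  { intros z. apply column_mult. split; reflexivity. }
  assert (HC : forall M z w, column y1 y2 w = Mmul M (column y1 y2 z) ->
    column (u 0%nat) (u 1%nat) w = Mmul (Mmul (Mmul P M) P') (column (u 0%nat) (u 1%nat) z)).
  { intros M z w E. rewrite !Hu, E, <- (Mmult_assoc _ P'), (Mmult_assoc P' P), HP', Mmult_one_l. exact (Mmult_assoc (T := C_Ring) P M _). }
  exists e, (u 0%nat), (u 1%nat). split; [exact He|]. split; [exact Hn|].
  split; [exact (ex_intro _ _ (sol2_lin _ _ _ _ _ _ _ _ S1 S2))|].
  split; [exact (ex_intro _ _ (sol2_lin _ _ _ _ _ _ _ _ S1 S2))|].
  split; [|split; intros z Hz; apply HC; auto].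
  intros a b H. assert (E : forall j, (j < 2)%nat -> a * en P 0 j + b * en P 1 j = 0).
  { destruct (Hi (a * en P 0 0 + b * en P 1 0) (a * en P 0 1 + b * en P 1 1)) as [E0 E1].
    - revert H. apply filter_imp. intros z <-. unfold u. ring.
    - intros [|[|j]] Hj; [exact E0|exact E1|lia]. }
  assert (F : forall j, (j < 2)%nat -> (if Nat.eqb 0 j then a else b) = 0).
  { intros j Hj. transitivity ((a * en P 0 0 + b * en P 1 0) * en P' 0 j + (a * en P 0 1 + b * en P 1 1) * en P' 1 j).
    - transitivity (a * en (Mmul P P') 0 j + b * en (Mmul P P') 1 j).
      + rewrite HP, !en_one by lia. destruct j as [|[|j]]; simpl; try lia; ring.
      + rewrite !en_mult by lia. ring.
    - rewrite !E by lia. ring. }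
  split; [apply (F 0%nat)|apply (F 1%nat)]; lia.
Qed.

Lemma monodromy_exists : admissible_base tau z0 -> exists M1 M2, monodromy tau z0 q M1 M2.
Proof.
  intros Hz0. destruct (admissible_cross z0 Hz0) as (e & He & Hn).
  destruct (cross_facts z0 e He) as (HU & HS & H0).
  assert (Hqu : holo (cross z0 e) qh) by exact (holo_sub _ _ _ Hn Hqh).
  destruct (sol_basis (cross z0 e) z0 qh HU HS H0 Hqu) as (y1 & y1' & y2 & y2' & S1 & S2 & W).
  assert (Hw : wr y1 y1' y2 y2' z0 <> 0) by (rewrite W by exact H0; apply RtoC_neq_0; lra).
  assert (HM : forall om et, half_period om et -> exists M, forall z, arm om z0 e z ->
    column y1 y2 (z + om) = Mmul M (column y1 y2 z)).
  { intros om et Hom. destruct (arm_facts om et z0 e Hom He) as (_ & HVS & Hc & Hsh). set (V := arm om z0 e) in *.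
    assert (Hsub : forall z, V z -> cross z0 e z).
    { intros z Hz. apply cross_arm. destruct Hom as [[E _]|[E _]]; unfold V in Hz; rewrite E in Hz; auto. }
    assert (T1 := sol2_sub _ _ V _ _ Hsub S1). assert (T2 := sol2_sub _ _ V _ _ Hsub S2).
    assert (Hp : forall z, V z -> qh (z + om) = qh z).
    { intros z Hz. apply Hper; [destruct Hom as [[E _]|[E _]]; auto|apply Hn, Hsub, Hz]. }
    assert (P1 := sol_comb V z0 qh HVS _ _ _ _ _ _ z0 T1 T2 (sol2_shift _ _ _ _ om Hsh Hp T1) Hc Hw).
    assert (P2 := sol_comb V z0 qh HVS _ _ _ _ _ _ z0 T1 T2 (sol2_shift _ _ _ _ om Hsh Hp T2) Hc Hw).
    match type of P1 with forall z, _ -> _ = ?a * _ + ?b * _ /\ _ => set (a1 := a) in P1; set (b1 := b) in P1 end.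
    match type of P2 with forall z, _ -> _ = ?a * _ + ?b * _ /\ _ => set (a2 := a) in P2; set (b2 := b) in P2 end.
    exists (mk_matrix 2 2 (fun i j => match i, j with O, O => a1 | O, _ => b1 | _, O => a2 | _, _ => b2 end)).
    intros z Hz. apply column_mult. rewrite !en_mk by lia. split; [apply (P1 z Hz)|apply (P2 z Hz)]. }
  destruct (HM 1 (eta tau 1)) as [M1 HM1]; [left; auto|]. destruct (HM tau (eta tau 2)) as [M2 HM2]; [right; auto|].
  exists M1, M2, e, y1, y2. split; [exact He|].
  split; [intros z Hz H; apply (Hn z Hz), singular_hlat, H|].
  split; [apply (solution_sol2 (cross z0 e)); [exact Hn|exists y1'; exact S1]|].
  split; [apply (solution_sol2 (cross z0 e)); [exact Hn|exists y2'; exact S2]|].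
  split.
  - intros a b Hab. destruct (locally_disc _ _ Hab) as [r [Hr Hd]]. destruct (HU z0 H0) as [r' [Hr' Hd']].
    assert (L : forall z, disc z0 (Rmin r r') z -> disc z0 r z /\ cross z0 e z).
    { intros z Hz. split; [|apply Hd']; (eapply Rlt_le_trans; [exact Hz|]); [apply Rmin_l|apply Rmin_r]. }
    apply (sol_independent qh (disc z0 (Rmin r r')) y1 y1' y2 y2' z0 a b).
    + apply copen_disc.
    + apply disc_center, Rmin_pos; assumption.
    + exact (sol2_sub _ _ _ _ _ (fun z Hz => proj2 (L z Hz)) S1).
    + exact (sol2_sub _ _ _ _ _ (fun z Hz => proj2 (L z Hz)) S2).
    + exact Hw.
    + intros z Hz. apply Hd, L, Hz.
  - split; intros z Hz; [apply HM1|apply HM2]; [left|right]; auto.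
Qed.

(** On a common smaller cross two bases differ by an invertible matrix [a], so
    that the monodromy matrices are conjugate. *)
Lemma trace_unique (e f : R) (y1 y1' y2 y2' u1 u1' u2 u2' : C -> C) (M1 M2 N1 N2 : CM2) :
  mono_data e y1 y1' y2 y2' M1 M2 -> mono_data f u1 u1' u2 u2' N1 N2 -> trace M1 = trace N1 /\ trace M2 = trace N2.
Proof.
  intros (He & Hn & S1 & S2 & Hw & HM) (Hf & _ & T1 & T2 & Hv & HN).
  assert (K : forall (om : C) (M N : CM2) (et : C), half_period om et -> (om = 1 /\ M = M1) \/ (om = tau /\ M = M2) ->
    (om = 1 /\ N = N1) \/ (om = tau /\ N = N2) -> trace M = trace N).
  2:{ split; [apply (K 1 M1 N1 (eta tau 1))|apply (K tau M2 N2 (eta tau 2))]; unfold half_period; auto. }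
  intros om M N et Hom HMo HNo. set (g := Rmin e f). assert (Hg : 0 < g) by (apply Rmin_pos; assumption).
  destruct (arm_facts om et z0 g Hom Hg) as (HVo & HVS & Hc & Hsh). set (V := arm om z0 g) in *.
  assert (Hmono : forall h : R, g <= h -> forall z, V z -> arm om z0 h z /\ cross z0 h z).
  { intros h Hh z [[E (s & t & Ez & L)]|[E (s & t & Ez & L)]]; (split; [|apply cross_arm]); unfold arm.
    - left. split; [exact E|]. exists s, t. split; [exact Ez|lra].
    - left. left. split; [reflexivity|]. exists s, t. split; [exact Ez|lra].
    - right. split; [exact E|]. exists s, t. split; [exact Ez|lra].
    - right. right. split; [reflexivity|]. exists s, t. split; [exact Ez|lra]. }
  assert (Ve := Hmono e (Rmin_l _ _)). assert (Vf := Hmono f (Rmin_r _ _)).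
  assert (S1' := sol2_sub _ _ V _ _ (fun z Hz => proj2 (Ve z Hz)) S1). assert (S2' := sol2_sub _ _ V _ _ (fun z Hz => proj2 (Ve z Hz)) S2).
  assert (T1' := sol2_sub _ _ V _ _ (fun z Hz => proj2 (Vf z Hz)) T1). assert (T2' := sol2_sub _ _ V _ _ (fun z Hz => proj2 (Vf z Hz)) T2).
  assert (A1 := sol_comb V z0 qh HVS _ _ _ _ _ _ z0 S1' S2' T1' Hc Hw).
  assert (A2 := sol_comb V z0 qh HVS _ _ _ _ _ _ z0 S1' S2' T2' Hc Hw).
  match type of A1 with forall z, _ -> _ = ?a * _ + ?b * _ /\ _ => set (a11 := a) in A1; set (a12 := b) in A1 end.
  match type of A2 with forall z, _ -> _ = ?a * _ + ?b * _ /\ _ => set (a21 := a) in A2; set (a22 := b) in A2 end.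
  set (w := wr y1 y1' y2 y2' z0) in *.
  assert (Hdet : a11 * a22 - a12 * a21 <> 0).
  { intros E. apply Hv. destruct (A1 z0 Hc) as [B1 B2]. destruct (A2 z0 Hc) as [B3 B4]. unfold wr. rewrite B1, B2, B3, B4.
    transitivity ((a11 * a22 - a12 * a21) * wr y1 y1' y2 y2' z0); [unfold wr; ring|rewrite E; ring]. }
  assert (L : forall (v : C -> C) n0 n1 b1 b2, (forall z, V z -> v z = b1 * y1 z + b2 * y2 z) ->
    (forall z, V z -> v (z + om) = n0 * u1 z + n1 * u2 z) ->
    n0 * a11 + n1 * a21 - (b1 * en M 0 0 + b2 * en M 1 0) = 0 /\ n0 * a12 + n1 * a22 - (b1 * en M 0 1 + b2 * en M 1 1) = 0).
  { intros v n0 n1 b1 b2 E Es. apply (sol_independent qh V y1 y1' y2 y2' z0 _ _ HVo Hc S1' S2' Hw). intros z Hz.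
    destruct (HM om M HMo z (proj1 (Ve z Hz))) as [X1 X2]. assert (Y := Es z Hz).
    rewrite (E _ (Hsh z Hz)), (proj1 (A1 z Hz)), (proj1 (A2 z Hz)), X1, X2 in Y.
    match type of Y with ?L = ?R => transitivity (R - L); [ring|rewrite Y; ring] end. }
  assert (E := fun z Hz => HN om N HNo z (proj1 (Vf z Hz))).
  destruct (L u1 _ _ _ _ (fun z Hz => proj1 (A1 z Hz)) (fun z Hz => proj1 (E z Hz))) as [L11 L12].
  destruct (L u2 _ _ _ _ (fun z Hz => proj1 (A2 z Hz)) (fun z Hz => proj2 (E z Hz))) as [L21 L22].
  change (en M 0 0 + en M 1 1 = en N 0 0 + en N 1 1).
  symmetry. apply Ceq_minus.
  destruct (Cmult_integral (en N 0 0 + en N 1 1 - (en M 0 0 + en M 1 1)) (a11 * a22 - a12 * a21)); [|assumption|contradiction].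
  match type of L11 with ?P = _ => match type of L12 with ?Q = _ => match type of L21 with ?R = _ => match type of L22 with ?S = _ =>
    transitivity (P * a22 - Q * a21 - R * a12 + S * a11); [ring|rewrite L11, L12, L21, L22; ring] end end end end.
Qed.
End Potential.

(** * Freedom from logarithms *)

Lemma slit_disc_real p (r x : R) : 0 < x < r -> slit_disc p r (p + RtoC x).
Proof.
  intros Hx. unfold slit_disc. replace (p + RtoC x - p) with (RtoC x) by ring.
  rewrite Cmod_R, Rabs_pos_eq, im_RtoC, re_RtoC by lra. split; [lra|]. intros [_ H]. lra.
Qed.

Lemma copen_slit_disc p (r : R) : copen (slit_disc p r).
Proof.
  intros z [H1 H2].
  assert (Hs : exists d, 0 < d /\ forall w, Cmod (w - z) < d -> ~ (Im (w - p) = 0%R /\ Re (w - p) <= 0)).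
  { destruct (Req_dec (Im (z - p)) 0) as [E|E].
    - assert (P : 0 < Re (z - p)) by (apply Rnot_le_lt; intros K; apply H2; auto).
      exists (Re (z - p)). split; [exact P|]. intros w Hw [_ K].
      assert (A := Rle_lt_trans _ _ _ (re_le (w - z)) Hw). rewrite !re_minus in *. apply Rabs_def2 in A. lra.
    - exists (Rabs (Im (z - p))). split; [apply Rabs_pos_lt, E|]. intros w Hw [K _].
      assert (A := Rle_lt_trans _ _ _ (im_le (w - z)) Hw). rewrite !im_minus in *.
      replace (Im w - Im z)%R with (- (Im z - Im p))%R in A by lra. rewrite Rabs_Ropp in A. lra. }
  destruct Hs as [d [Hd H]]. destruct (copen_disc p r z H1) as [d' [Hd' H']].
  exists (Rmin d d'). split; [apply Rmin_pos; assumption|]. intros w Hw. split.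
  - apply H'. apply (Rmin_Rgt_l _ _ _ Hw).
  - apply H. apply (Rmin_Rgt_l _ _ _ Hw).
Qed.

Lemma star_slit_disc p (r : R) : 0 < r -> star (slit_disc p r) (p + RtoC (r / 2)).
Proof.
  intros Hr z t [H1 H2] Ht. set (c := p + RtoC (r / 2)).
  assert (E : segt c z t - p = RtoC ((1 - t) * (r / 2)) + RtoC t * (z - p)).
  { unfold segt, c. rewrite RtoC_mult, RtoC_minus. ring. }
  split.
  - rewrite E. eapply Rle_lt_trans; [apply Cmod_triangle|]. rewrite Cmod_mult, !Cmod_R, !Rabs_pos_eq by nra.
    destruct (Req_dec t 1) as [-> |Ht1]; [lra|]. assert (P := Cmod_ge_0 (z - p)). nra.
  - rewrite E, im_plus, im_RtoC, im_scal_l, re_plus, re_RtoC, re_scal_l. intros [K1 K2].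
    destruct (Req_dec t 0) as [-> |Ht0]; [lra|].
    assert (E1 : Im (z - p) = 0%R) by (apply (Rmult_eq_reg_l t); lra).
    apply H2. split; [exact E1|]. nra.
Qed.

Lemma sqrt_branch_diff (s : C -> C) p z (d : R) : 0 < d -> ccont s z -> z <> p ->
  (forall w, Cmod (w - z) < d -> s w * s w = w - p) -> cdiff s z (1 / (2 * s z)).
Proof.
  intros Hd Hs Hz Hsq.
  assert (E0 : s z * s z = z - p) by (apply Hsq; rewrite Cmod_self; exact Hd).
  assert (Hs0 : s z <> 0) by (intros E; apply Hz, Ceq_minus; rewrite <- E0, E; ring).
  assert (Hm : 0 < Cmod (s z)) by (apply Cmod_gt_0, Hs0). set (m := Cmod (s z)) in *.
  apply cdiff_eps. intros e He.
  destruct (Hs (Rmin m (2 * e * (m * m)))) as [d1 [Hd1 H1]].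
  { apply Rmin_pos; [exact Hm|]. repeat apply Rmult_lt_0_compat; lra. }
  exists (Rmin d d1). split; [apply Rmin_pos; assumption|]. intros w Hw.
  assert (Ew := Hsq w (Rlt_le_trans _ _ _ Hw (Rmin_l _ _))).
  assert (K := H1 w (Rlt_le_trans _ _ _ Hw (Rmin_r _ _))).
  destruct (Rmin_Rgt_l _ _ _ K) as [K1 K2].
  assert (Ewz : w - z = (s w - s z) * (s w + s z)).
  { transitivity (s w * s w - s z * s z); [rewrite Ew, E0; ring|ring]. }
  assert (Hsum : m <= Cmod (s w + s z)).
  { replace (s w + s z) with (2 * s z - (s z - s w)) by ring. eapply Rle_trans; [|apply Cmod_minus_ge].
    rewrite (Cmod_sym (s z)), Cmod_mult, Cmod_R, Rabs_pos_eq by lra. fold m. lra. }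
  replace (s w - s z - 1 / (2 * s z) * (w - z)) with (- ((s w - s z) * (s w - s z)) / (2 * s z)).
  2:{ rewrite Ewz. field. exact Hs0. }
  rewrite Cmod_div by (apply Cmult_neq_0; [apply RtoC_neq_0; lra|exact Hs0]).
  rewrite Cmod_opp, Ewz, !Cmod_mult, Cmod_R, (Rabs_pos_eq 2) by lra. fold m.
  set (x := Cmod (s w - s z)) in *. assert (Hx : 0 <= x) by apply Cmod_ge_0.
  apply (Rmult_le_reg_r (2 * m)); [lra|]. unfold Rdiv. rewrite Rmult_assoc, Rinv_l, Rmult_1_r by lra.
  assert (e * (x * m) <= e * (x * Cmod (s w + s z))).
  { apply Rmult_le_compat_l; [lra|]. apply Rmult_le_compat_l; assumption. }
  assert (x * x <= x * (2 * e * (m * m))) by (apply Rmult_le_compat_l; lra). nra.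
Qed.

Lemma continuous_ccont (s : C -> C) z : continuous s z -> ccont s z.
Proof.
  intros H e He. apply (locally_disc z (fun w => disc (s z) e (s w))).
  apply (H (disc (s z) e)). apply locally_open; [apply copen_disc|apply disc_center, He].
Qed.

Lemma slit_limit (R0 : C -> C) p (r : R) : 0 < r -> ccont R0 p -> (forall z, slit_disc p r z -> R0 z = 0) -> R0 p = 0.
Proof.
  intros Hr Hc H. apply NNPP. intros Hne. assert (Hm : 0 < Cmod (R0 p)) by (apply Cmod_gt_0, Hne).
  destruct (Hc _ Hm) as [d [Hd K]]. set (x := (Rmin d r / 2)%R). assert (Hx : 0 < x /\ x < d /\ x < r).
  { assert (P := Rmin_pos d r Hd Hr). generalize (Rmin_l d r), (Rmin_r d r). unfold x. lra. }
  specialize (K (p + RtoC x)). replace (p + RtoC x - p) with (RtoC x) in K by ring.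
  rewrite Cmod_R, Rabs_pos_eq in K by lra. rewrite H in K by (apply slit_disc_real; lra).
  replace (0 - R0 p) with (- R0 p) in K by ring. rewrite Cmod_opp in K. specialize (K ltac:(lra)). lra.
Qed.

Lemma slit_punctured p (r : R) z : slit_disc p r z -> punctured p r z.
Proof.
  intros [H1 H2]. split; [|exact H1]. intros ->. apply H2. replace (p - p) with (0:C) by ring. rewrite im_RtoC, re_RtoC. lra.
Qed.

Section Frobenius.
Variables (q Cf : C -> C) (p T : C) (r : R).
Hypothesis Hr : 0 < r.
Hypothesis HCf : holo (disc p r) Cf.
Hypothesis Hq : forall z, punctured p r z -> q z = 3 / 4 / ((z - p) * (z - p)) + T / (z - p) + Cf z.

(** [h] is the regular factor of the solution; the last equation is [y'' = q y]
    rewritten for [h]. *)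
Lemma regular_factor (y y' : C -> C) : log_free q p -> sol2 q (slit_disc p r) y y' ->
  exists rho s h, 0 < rho <= r /\ holo (disc p rho) h /\
    forall z, slit_disc p rho z -> s z * s z = z - p /\ s z * y z = h z /\
      s z * y' z = C_derive h z - h z / (2 * (z - p)) /\
      (z - p) * C_derive (C_derive h) z - C_derive h z - T * h z - (z - p) * Cf z * h z = 0.
Proof.
  intros Hlf Hy. destruct (Hlf r y Hr) as (rho & s & h & Hrho & Hs & Hh & Hsy).
  { exists y'. exact Hy. }
  assert (Hhol : holo (disc p rho) h) by exact Hh.
  exists rho, s, h. split; [exact Hrho|]. split; [exact Hhol|].
  destruct (holo_derive _ _ (copen_disc p rho) Hhol) as [Dh Dh'].
  assert (Hsub : forall z, slit_disc p rho z -> slit_disc p r z) by (intros z [H1 H2]; split; [lra|exact H2]).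
  assert (Hds : forall z, slit_disc p rho z -> z - p <> 0 /\ s z <> 0 /\ cdiff s z (1 / (2 * s z))).
  { intros z Hz. destruct (Hs z Hz) as [Hc Hsq]. destruct (slit_punctured _ _ _ Hz) as [Hne _].
    assert (Hne' : z - p <> 0) by (intros E; apply Hne, Ceq_minus, E).
    split; [exact Hne'|]. split; [intros E; apply Hne'; rewrite <- Hsq, E; ring|].
    destruct (copen_slit_disc p rho z Hz) as [d [Hd H]].
    apply (sqrt_branch_diff s p z d Hd (continuous_ccont s z Hc) Hne). intros w Hw. apply Hs, H, Hw. }
  assert (E1 : forall z, slit_disc p rho z -> s z * y' z = C_derive h z - h z / (2 * (z - p))).
  { intros z Hz. destruct (Hds z Hz) as (Hne & Hs0 & D1). destruct (Hs z Hz) as [_ Hsq].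
    destruct (Hy z (Hsub z Hz)) as [D2 _].
    assert (E : C_derive h z = 1 / (2 * s z) * y z + s z * y' z).
    { apply (cdiff_unique h z); [apply Dh, (proj1 Hz)|].
      destruct (copen_slit_disc p rho z Hz) as [d [Hd H]].
      apply (cdiff_loc (fun w => s w * y w) h z _ d Hd); [intros w Hw; apply Hsy, H, Hw|]. cd. ring. }
    rewrite E, <- (Hsy z Hz), <- Hsq. field. exact Hs0. }
  intros z Hz. destruct (Hds z Hz) as (Hne & Hs0 & D1). destruct (Hs z Hz) as [_ Hsq].
  split; [exact Hsq|]. split; [apply Hsy, Hz|]. split; [apply E1, Hz|].
  destruct (Hy z (Hsub z Hz)) as [_ D3].
  assert (A1 := Dh z (proj1 Hz)). assert (A2 := proj1 (holo_derive _ _ (copen_disc p rho) Dh') z (proj1 Hz)).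
  assert (E : 1 / (2 * s z) * y' z + s z * (q z * y z) =
    C_derive (C_derive h) z - C_derive h z / (2 * (z - p)) + h z / (2 * ((z - p) * (z - p)))).
  { apply (cdiff_unique (fun w => s w * y' w) z).
    - cd. ring.
    - destruct (copen_slit_disc p rho z Hz) as [d [Hd H]].
      apply (cdiff_loc (fun w => C_derive h w - h w / (2 * (w - p))) _ z _ d Hd); [intros w Hw; symmetry; apply E1, H, Hw|].
      cd; [apply Cmult_neq_0; [apply RtoC_neq_0; lra|exact Hne]|]. field. exact Hne. }
  rewrite (Hq z (slit_punctured _ _ _ (Hsub z Hz))) in E.
  replace (1 / (2 * s z) * y' z) with (s z * y' z / (2 * (s z * s z))) in E by (field; exact Hs0).
  rewrite (E1 z Hz), Hsq in E.
  replace (s z * ((3 / 4 / ((z - p) * (z - p)) + T / (z - p) + Cf z) * y z)) with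
    ((3 / 4 / ((z - p) * (z - p)) + T / (z - p) + Cf z) * (s z * y z)) in E by ring.
  rewrite (Hsy z Hz) in E.
  match type of E with ?L = ?Q => transitivity ((z - p) * (Q - L)); [field; exact Hne|rewrite E; ring] end.
Qed.

(** If the regular factor of some solution does not vanish at [p], its equation
    and the derivative of the equation at [p] give [T^2 = Cf p].  Otherwise two
    independent solutions are too small at [p] for their Wronskian 1. *)
Theorem frobenius : log_free q p -> T * T = Cf p.
Proof.
  intros Hlf. set (c := p + RtoC (r / 2)).
  assert (Hqh : holo (slit_disc p r) q).
  { intros z Hz. destruct (slit_punctured _ _ _ Hz) as [Hne Hd]. assert (Hne' : z - p <> 0) by (intros E; apply Hne, Ceq_minus, E).
    destruct (HCf z Hd) as [l Hl]. destruct (copen_slit_disc p r z Hz) as [d [Hdp H]]. eexists.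
    apply (cdiff_loc (fun z => 3 / 4 / ((z - p) * (z - p)) + T / (z - p) + Cf z) q z _ d Hdp).
    - intros w Hw. symmetry. apply Hq, slit_punctured, H, Hw.
    - repeat cd_step; try exact Hne'. apply Cmult_neq_0; assumption. }
  destruct (sol_basis (slit_disc p r) c q (copen_slit_disc p r) (star_slit_disc p r Hr)
    ltac:(apply slit_disc_real; lra) Hqh) as (y1 & y1' & y2 & y2' & S1 & S2 & W).
  destruct (regular_factor y1 y1' Hlf S1) as (r1 & s1 & h1 & Hr1 & Hh1 & E1).
  destruct (regular_factor y2 y2' Hlf S2) as (r2 & s2 & h2 & Hr2 & Hh2 & E2).
  assert (Hcase : forall rho h, 0 < rho <= r -> holo (disc p rho) h ->
    (forall z, slit_disc p rho z -> (z - p) * C_derive (C_derive h) z - C_derive h z - T * h z - (z - p) * Cf z * h z = 0) ->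
    h p <> 0 -> T * T = Cf p).
  { intros rho h Hrho Hh E Hp.
    assert (Hc := disc_center p rho ltac:(lra)).
    destruct (holo_derive _ _ (copen_disc p rho) Hh) as [D1 Hh']. destruct (holo_derive _ _ (copen_disc p rho) Hh') as [D2 Hh''].
    destruct (holo_derive _ _ (copen_disc p rho) Hh'') as [D3 Hh'''].
    assert (HC' : holo (disc p rho) Cf) by (apply (holo_sub (disc p r)); [intros z Hz; unfold disc in *; lra|exact HCf]).
    destruct (holo_derive _ _ (copen_disc p rho) HC') as [D4 HC''].
    assert (A1 := D1 p Hc). assert (A2 := D2 p Hc). assert (A3 := D3 p Hc). assert (A4 := D4 p Hc).
    destruct (Hh''' p Hc) as [m5 A5]. destruct (HC'' p Hc) as [m6 A6].
    assert (F1 : (p - p) * C_derive (C_derive h) p - C_derive h p - T * h p - (p - p) * Cf p * h p = 0).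
    { apply (slit_limit (fun z => (z - p) * C_derive (C_derive h) z - C_derive h z - T * h z - (z - p) * Cf z * h z) p rho); [lra| |exact E].
      eapply cdiff_ccont. repeat cd_step. }
    set (R1 := fun z => (z - p) * C_derive (C_derive (C_derive h)) z - T * C_derive h z - Cf z * h z
      - (z - p) * (C_derive Cf z * h z + Cf z * C_derive h z)).
    assert (F2 : R1 p = 0).
    { apply (slit_limit R1 p rho); [lra|eapply cdiff_ccont; unfold R1; repeat cd_step|].
      intros z Hz. assert (Hzd := proj1 Hz).
      assert (B1 := D1 z Hzd). assert (B2 := D2 z Hzd). assert (B3 := D3 z Hzd). assert (B4 := D4 z Hzd).
      apply (cdiff_unique (fun z => (z - p) * C_derive (C_derive h) z - C_derive h z - T * h z - (z - p) * Cf z * h z) z).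
      - cd. unfold R1. ring.
      - destruct (copen_slit_disc p rho z Hz) as [d [Hd H]].
        apply (cdiff_loc (fun _ => 0) _ z _ d Hd); [intros w Hw; symmetry; apply E, H, Hw|apply cdiff_const]. }
    assert (Hd1 : C_derive h p = - T * h p).
    { transitivity (- ((p - p) * C_derive (C_derive h) p - C_derive h p - T * h p - (p - p) * Cf p * h p) - T * h p); [ring|]. rewrite F1. ring. }
    unfold R1 in F2. rewrite Hd1 in F2.
    apply Ceq_minus. apply NNPP. intros Hne. apply (Cmult_neq_0 _ _ Hne Hp).
    match type of F2 with ?L = _ => transitivity L; [ring|exact F2] end. }
  destruct (classic (h1 p = 0)) as [Z1|Z1]; [|apply (Hcase r1 h1 Hr1 Hh1); [intros z Hz; apply (E1 z Hz)|exact Z1]].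
  destruct (classic (h2 p = 0)) as [Z2|Z2]; [|apply (Hcase r2 h2 Hr2 Hh2); [intros z Hz; apply (E2 z Hz)|exact Z2]].
  exfalso. set (rho := Rmin r1 r2). assert (Hrho : 0 < rho) by (apply Rmin_pos; lra).
  assert (L1 : rho <= r1) by apply Rmin_l. assert (L2 : rho <= r2) by apply Rmin_r.
  assert (Hc := disc_center p rho Hrho).
  assert (Hk : forall r' h, rho <= r' -> holo (disc p r') h -> h p = 0 -> exists k, holo (disc p rho) k /\
    forall z, disc p rho z -> h z = (z - p) * k z /\ C_derive h z = k z + (z - p) * C_derive k z).
  { intros r' h Hle Hh Hz. assert (Hh' : holo (disc p rho) h) by (apply (holo_sub (disc p r')); [intros z Hd; unfold disc in *; lra|exact Hh]).
    destruct (holo_division (disc p rho) p h (copen_disc p rho) (star_disc p rho) Hc Hh') as (k & Hk & _ & Ek).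
    assert (Ek' : forall z, disc p rho z -> h z = (z - p) * k z) by (intros z Hd; rewrite (Ek z Hd), Hz; ring).
    exists k. split; [exact Hk|]. intros z Hd. split; [apply Ek', Hd|]. apply C_derive_eq.
    destruct (copen_disc p rho z Hd) as [d [Hd0 H]]. apply (cdiff_loc (fun z => (z - p) * k z) h z _ d Hd0).
    - intros w Hw. symmetry. apply Ek', H, Hw.
    - assert (A := cdiff_at _ _ _ (copen_disc p rho) Hk Hd). cd. ring. }
  destruct (Hk r1 h1 L1 Hh1 Z1) as (k1 & Hk1 & F1). destruct (Hk r2 h2 L2 Hh2 Z2) as (k2 & Hk2 & F2).
  set (K := fun z => k1 z * C_derive k2 z - C_derive k1 z * k2 z).
  (* the Wronskian gives [s1 s2 = (z - p)^2 K], although [(s1 s2)^2 = (z - p)^2] *)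
  apply (RtoC_neq_0 1); [lra|].
  replace (RtoC 1) with (1 - (p - p) * (p - p) * (K p * K p)) by ring.
  apply (slit_limit (fun z => 1 - (z - p) * (z - p) * (K z * K z)) p rho Hrho).
  - destruct (holo_derive _ _ (copen_disc p rho) Hk1) as [D1 D1']. destruct (holo_derive _ _ (copen_disc p rho) Hk2) as [D2 D2'].
    assert (A1 := D1 p Hc). assert (A2 := D2 p Hc). destruct (D1' p Hc) as [m1 A3]. destruct (D2' p Hc) as [m2 A4].
    eapply cdiff_ccont. unfold K. repeat cd_step.
  - intros z Hz. assert (Hd := proj1 Hz). destruct (slit_punctured _ _ _ Hz) as [Hne _].
    assert (Hne' : z - p <> 0) by (intros E; apply Hne, Ceq_minus, E).
    destruct (E1 z) as (Q1 & P1 & P1' & _); [destruct Hz; split; [lra|assumption]|].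
    destruct (E2 z) as (Q2 & P2 & P2' & _); [destruct Hz; split; [lra|assumption]|].
    assert (Wz := W z ltac:(destruct Hz; split; [lra|assumption])).
    destruct (F1 z Hd) as [X1 X1']. destruct (F2 z Hd) as [X2 X2'].
    assert (EW : s1 z * s2 z = (z - p) * (z - p) * K z).
    { transitivity (s1 z * s2 z * wr y1 y1' y2 y2' z); [rewrite Wz; ring|]. unfold wr.
      transitivity ((s1 z * y1 z) * (s2 z * y2' z) - (s1 z * y1' z) * (s2 z * y2 z)); [ring|].
      rewrite P1, P1', P2, P2', X1, X2, X1', X2'. unfold K. field. exact Hne'. }
    assert (ES : (z - p) * (z - p) = (s1 z * s2 z) * (s1 z * s2 z)).
    { transitivity ((s1 z * s1 z) * (s2 z * s2 z)); [rewrite Q1, Q2; reflexivity|ring]. }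
    rewrite EW in ES.
    transitivity (((z - p) * (z - p) - (z - p) * (z - p) * K z * ((z - p) * (z - p) * K z)) / ((z - p) * (z - p))); [field; exact Hne'|].
    rewrite <- ES. field. exact Hne'.
Qed.
End Frobenius.

Lemma potential_Gf (T : nat -> C) (B z : C) : csum T 3 = 0 ->
  potential tau T B z = 3 / 4 * Pf z + ((T 0%nat + T 1%nat) / 2 * (Gf 1 z + eta tau 2)
    + (T 0%nat + T 2%nat) / 2 * (Gf 2 z + eta tau 1) + (T 0%nat + T 3%nat) / 2 * Gf 3 z) + B.
Proof.
  intros Hs. rewrite csum_3 in Hs. unfold potential. rewrite (csum_3 (fun k => T k * _)).
  fold (Pf z) (zk 0 z) (zk 1 z) (zk 2 z) (zk 3 z).
  rewrite !Gf_1, !Gf_2, !Gf_3 by assumption.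
  assert (E3 : T 3%nat = - T 0%nat - T 1%nat - T 2%nat).
  { transitivity (T 0%nat + T 1%nat + T 2%nat + T 3%nat - T 0%nat - T 1%nat - T 2%nat); [ring|rewrite Hs; ring]. }
  rewrite E3. field.
Qed.

Lemma hlat_omega (k : nat) : hlat (omega tau k / 2).
Proof. unfold hlat. replace (2 * (omega tau k / 2)) with (omega tau k) by field. apply lattice_omega. Qed.

Lemma Gf_shift_omega (l k : nat) u : isl l -> (k <= 3)%nat -> Gf l (u + omega tau k / 2) = eps l k * Gf l u.
Proof.
  intros Hl Hk. assert (A := fun z => Gf_shift_1 l z Hl). assert (A' := fun z => Gf_shift_tau l z Hl).
  destruct k as [|[|[|[|k]]]]; [| | | |lia]; simpl omega.
  - replace (u + 0 / 2) with u by field. unfold eps. simpl. ring.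
  - replace (u + 1 / 2) with (u + / 2) by field. rewrite A. destruct Hl as [-> |[-> | ->]]; unfold sgn1, eps; simpl; ring.
  - rewrite A'. destruct Hl as [-> |[-> | ->]]; unfold sgnt, eps; simpl; ring.
  - replace (u + (1 + tau) / 2) with (u + / 2 + tau / 2) by field. rewrite A', A.
    destruct Hl as [-> |[-> | ->]]; unfold sgn1, sgnt, eps; simpl; ring.
Qed.

(** The constant term of the potential is the same at its four poles. *)
Lemma log_free_square (T : nat -> C) (B : C) (k : nat) : csum T 3 = 0 -> (k <= 3)%nat ->
  log_free (potential tau T B) (omega tau k / 2) ->
  T k * T k = (T 0%nat + T 1%nat) / 2 * eta tau 2 + (T 0%nat + T 2%nat) / 2 * eta tau 1 + B.
Proof.
  intros Hs Hk Hlf. set (p := omega tau k / 2).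
  destruct local_data as (d & Hd & Hsm & Hg & Hsl).
  assert (I1 : isl 1) by (unfold isl; auto). assert (I2 : isl 2) by (unfold isl; auto). assert (I3 : isl 3) by (unfold isl; auto).
  destruct (holo_derive _ _ (copen_disc 0 d) Hsl) as [_ Hsl'].
  set (t1 := (T 0%nat + T 1%nat) / 2). set (t2 := (T 0%nat + T 2%nat) / 2). set (t3 := (T 0%nat + T 3%nat) / 2).
  set (B' := t1 * eta tau 2 + t2 * eta tau 1 + B).
  set (cf := fun z => - (3 / 4) * C_derive sl (z - p) + t1 * eps 1 k * gl 1 (z - p) + t2 * eps 2 k * gl 2 (z - p)
    + t3 * eps 3 k * gl 3 (z - p) + B').
  transitivity (cf p).
  - apply (frobenius (potential tau T B) cf p (T k) d Hd); [| |exact Hlf].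
    + intros z Hz. assert (Hz0 : disc 0 d (z - p)) by (unfold disc in *; replace (z - p - 0) with (z - p) by ring; exact Hz).
      destruct (Hsl' _ Hz0) as [m1 A1]. destruct (Hg 1%nat _ Hz0) as [m2 A2].
      destruct (Hg 2%nat _ Hz0) as [m3 A3]. destruct (Hg 3%nat _ Hz0) as [m4 A4].
      apply cdiff_shift_minus in A1. apply (cdiff_shift_minus (gl 1)) in A2. apply (cdiff_shift_minus (gl 2)) in A3. apply (cdiff_shift_minus (gl 3)) in A4.
      eexists. unfold cf. repeat cd_step.
    + intros z [Hz Hzd]. set (u := z - p). assert (Hu : u <> 0) by (intros E; apply Hz, Ceq_minus, E).
      assert (Pu : punctured 0 d u) by (split; [exact Hu|replace (u - 0) with (z - p) by (unfold u; ring); exact Hzd]).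
      assert (Hun := Hsm u Pu).
      rewrite (potential_Gf T B z Hs). fold t1 t2 t3.
      replace z with (u + p) by (unfold u; ring).
      rewrite (Pf_shift_hlat 1 I1 p u (hlat_omega k) Hun).
      unfold p. rewrite !Gf_shift_omega by assumption. fold p.
      rewrite (Pf_local d u Hsl Pu Hun), !Gf_gl.
      assert (ET : T k = t1 * eps 1 k + t2 * eps 2 k + t3 * eps 3 k).
      { rewrite csum_3 in Hs. assert (E3 : T 3%nat = - T 0%nat - T 1%nat - T 2%nat).
        { transitivity (T 0%nat + T 1%nat + T 2%nat + T 3%nat - T 0%nat - T 1%nat - T 2%nat); [ring|rewrite Hs; ring]. }
        unfold t1, t2, t3. rewrite E3. destruct k as [|[|[|[|k]]]]; [| | | |lia]; unfold eps; simpl; rewrite ?E3; field. }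
      rewrite ET. unfold cf, B'. replace (u + p - p) with u by ring. field. exact Hu.
  - unfold cf. replace (p - p) with (0:C) by ring. rewrite sl_derive_0, !gl_0 by assumption.
    unfold B'. ring.
Qed.

Lemma AP_family (T : nat -> C) (B : C) : AP tau T B ->
  exists l t, isl l /\ (forall k, (k <= 3)%nat -> T k = V_res l t k) /\ B = V_acc tau l t.
Proof.
  intros [Hs Hlf]. assert (Hsq := fun k Hk => log_free_square T B k Hs Hk (Hlf k Hk)).
  rewrite csum_3 in Hs.
  assert (E0 := Hsq 0%nat ltac:(lia)).
  assert (K : forall k, (k <= 3)%nat -> T k = T 0%nat \/ T k = - T 0%nat).
  { intros k Hk. apply square_eq. rewrite E0. apply Hsq, Hk. }
  assert (Hzero : forall c : C, c + c = 0 -> c = 0).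
  { intros c Hc. replace c with ((c + c) / 2) by field. rewrite Hc. field. }
  assert (Hfour : forall c : C, c + c + c + c = 0 -> c = 0).
  { intros c Hc. apply Hzero, Hzero. rewrite <- Hc. ring. }
  set (t := T 0%nat) in *. assert (He0 := eta_0).
  assert (HB : B = t * t - (t + T 1%nat) / 2 * eta tau 2 - (t + T 2%nat) / 2 * eta tau 1).
  { rewrite E0. ring. }
  destruct (K 1%nat ltac:(lia)) as [K1|K1], (K 2%nat ltac:(lia)) as [K2|K2], (K 3%nat ltac:(lia)) as [K3|K3]; rewrite K1, K2, K3 in Hs.
  all: try (assert (Z : t = 0) by (apply Hfour; rewrite <- Hs; ring)).
  all: try (assert (Z : t = 0) by (apply Hzero; rewrite <- Hs; ring)).
  all: try (assert (Z : t = 0) by (apply Hzero; transitivity (- (t + - t + - t + - t)); [ring|rewrite Hs; ring])).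
  all: try (exists 1%nat, t; split; [unfold isl; auto|]; split;
    [intros [|[|[|[|k]]]] Hk; try lia; unfold V_res, eps; simpl; fold t; rewrite ?K1, ?K2, ?K3, ?Z; ring
    |rewrite HB, K1, K2; unfold V_acc; simpl; rewrite ?Z; field]; fail).
  all: try (exists 2%nat, t; split; [unfold isl; auto|]; split;
    [intros [|[|[|[|k]]]] Hk; try lia; unfold V_res, eps; simpl; fold t; rewrite ?K1, ?K2, ?K3, ?Z; ring
    |rewrite HB, K1, K2; unfold V_acc; simpl; rewrite ?Z; field]; fail).
  all: exists 3%nat, t; split; [unfold isl; auto|]; split;
    [intros [|[|[|[|k]]]] Hk; try lia; unfold V_res, eps; simpl; fold t; rewrite ?K1, ?K2, ?K3, ?Z; ring
    |rewrite HB, K1, K2; unfold V_acc; simpl; rewrite ?He0, ?Z; field].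
Qed.

(** * Stability and unitarizability *)

Section Data.
Variables (l : nat) (A B : C).
Hypothesis Hl : isl l.
Hypothesis HG : gf_data l A B.

Lemma gf_equation : cubic l A B.
Proof. apply HG. Qed.

Lemma potential_qf (T : nat -> C) (b t z : C) : (forall k, (k <= 3)%nat -> T k = V_res l t k) -> b = V_acc tau l t ->
  ~ hlat z -> potential tau T b z = qf l t A B z.
Proof.
  intros HT Hb Hz. assert (HP := proj2 (proj2 (proj2 (proj2 HG))) z Hz). unfold Pf in HP.
  unfold potential, qf. rewrite HP, Hb. unfold V_acc, Gf. rewrite !csum_3, !HT by lia. unfold V_res. field.
Qed.

Lemma F_Gf (T z : C) : F_ tau l T z = 2 * T - Gf l z.
Proof. unfold F_, Gf. ring. Qed.

Lemma Q_value (T : C) : Q_ tau l T = (2 * T * (2 * T) - A) * (2 * T * (2 * T) - B).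
Proof.
  set (D := 2 * T).
  assert (D1 : forall z, ~ hlat z -> C_derive (F_ tau l T) z = - dG l z).
  { intros z Hz. apply C_derive_eq. apply (cdiff_ext (fun z => 2 * T - Gf l z)).
    - intros w. symmetry. apply F_Gf.
    - assert (E := Gf_diff l z Hz). cd. ring. }
  assert (D2 : forall z, ~ hlat z -> C_derive (C_derive (F_ tau l T)) z = - (2 * (Gf l z * Gf l z * Gf l z) - (A + B) * Gf l z)).
  { intros z Hz. apply C_derive_eq. destruct (near_nhlat z Hz) as [d [Hd Hn]].
    apply (cdiff_loc (fun z => - dG l z) _ z _ d Hd).
    - intros w Hw. symmetry. apply D1, Hn, Hw.
    - assert (E := proj1 (gf_equation z Hz)). cd. ring. }
  assert (K : forall z, ~ singular tau z -> C_derive (F_ tau l T) z * C_derive (F_ tau l T) z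
    - 2 * C_derive (C_derive (F_ tau l T)) z * F_ tau l T z + 4 * q_ tau l T z * (F_ tau l T z * F_ tau l T z) = (D * D - A) * (D * D - B)).
  { intros z Hz. assert (Hn : ~ hlat z) by (intros H; apply Hz, singular_hlat, H).
    rewrite D1, D2, F_Gf by exact Hn. unfold q_. rewrite (potential_qf _ _ T z (fun k _ => eq_refl) eq_refl Hn).
    transitivity (dG l z * dG l z + 2 * (2 * (Gf l z * Gf l z * Gf l z) - (A + B) * Gf l z) * (2 * T - Gf l z)
      + 4 * qf l T A B z * ((2 * T - Gf l z) * (2 * T - Gf l z))); [ring|].
    rewrite (proj2 (gf_equation z Hn)). unfold qf, D. field. }
  unfold Q_. apply the_unique; [exact K|]. intros v Hv.
  assert (Hq : ~ singular tau (1 / 4)).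
  { intros H. apply (quarter_not_hlat 1 (or_introl eq_refl)), singular_hlat, H. }
  rewrite <- (Hv _ Hq). apply K, Hq.
Qed.

Lemma qf_shift_period (t om z : C) : om = 1 \/ om = tau -> ~ hlat z -> qf l t A B (z + om) = qf l t A B z.
Proof. intros Ho _. unfold qf. rewrite (Gf_period_om l om z Hl Ho). reflexivity. Qed.

Section Member.
Variables (t a : C) (T : nat -> C) (b z0 : C).
Hypothesis HT : forall k, (k <= 3)%nat -> T k = V_res l t k.
Hypothesis Hb : b = V_acc tau l t.
Hypothesis Ha : ~ hlat a.
Hypothesis Ga : Gf l a = 2 * t.

Let Hq (z : C) (Hz : ~ hlat z) : potential tau T b z = qf l t A B z := potential_qf T b t z HT Hb Hz.
Let Hqf : holo (fun z => ~ hlat z) (qf l t A B) := qf_holo l t A B.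
Let Hper (om z : C) : om = 1 \/ om = tau -> ~ hlat z -> qf l t A B (z + om) = qf l t A B z := qf_shift_period t om z.

Lemma arm_data (e : R) (y1 y1' y2 y2' : C -> C) (M1 M2 M : CM2) om et :
  mono_data (qf l t A B) z0 e y1 y1' y2 y2' M1 M2 -> half_period om et ->
  (om = 1 /\ M = M1) \/ (om = tau /\ M = M2) ->
  exists y d, 0 < d /\ (forall z, strip om y d z -> ~ hlat z) /\ strip om y d z0 /\
    sol2 (qf l t A B) (strip om y d) y1 y1' /\ sol2 (qf l t A B) (strip om y d) y2 y2' /\
    wr y1 y1' y2 y2' z0 <> 0 /\
    (forall z, strip om y d z -> y1 (z + om) = en M 0 0 * y1 z + en M 0 1 * y2 z) /\
    (forall z, strip om y d z -> y2 (z + om) = en M 1 0 * y1 z + en M 1 1 * y2 z).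
Proof.
  intros (He & Hn & S1 & S2 & Hw & HM) Hom HMo. destruct (arm_ostrip om et z0 e Hom He) as (d & Hd & Hs).
  assert (Hc : forall z, strip om (Im (z0 / om)) d z -> cross z0 e z).
  { intros z Hz. apply cross_arm. apply Hs in Hz. destruct Hom as [[E _]|[E _]]; rewrite E in Hz; auto. }
  exists (Im (z0 / om)), d. split; [exact Hd|]. split; [intros z Hz; apply Hn, Hc, Hz|].
  split; [unfold strip, ostrip, wstrip; rewrite Rminus_diag, Rabs_R0; exact Hd|].
  split; [exact (sol2_sub _ _ _ _ _ Hc S1)|]. split; [exact (sol2_sub _ _ _ _ _ Hc S2)|]. split; [exact Hw|].
  split; intros z Hz; apply (HM om M HMo z), Hs, Hz.
Qed.

Definition is_eigenvalue (M : CM2) lam : Prop := exists c0 c1 : C, (c0 <> 0 \/ c1 <> 0) /\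
  c0 * en M 0 0 + c1 * en M 1 0 = lam * c0 /\ c0 * en M 0 1 + c1 * en M 1 1 = lam * c1.

(** Both exponents of [generic_multiplier] would vanish, so that [4 a] is a
    lattice point and [hlat_double] applies. *)
Lemma unimodular_degenerate (M1 M2 : CM2) : monodromy tau z0 (potential tau T b) M1 M2 -> t <> 0 ->
  (forall M lam, M = M1 \/ M = M2 -> is_eigenvalue M lam -> lam * lam - (en M 0 0 + en M 1 1) * lam + 1 = 0 -> (Cmod lam ^ 2)%R = 1%R) ->
  dG l a = 0.
Proof.
  intros HM Ht Hu. apply NNPP. intros HdG.
  destruct (monodromy_data _ _ z0 Hqf Hq M1 M2 HM) as (e & y1 & y1' & y2 & y2' & Hdata).
  assert (HD0 : 2 * t <> 0) by (apply Cmult_neq_0; [apply RtoC_neq_0; lra|exact Ht]).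
  assert (H2a : hlat (2 * a)).
  { apply drift_both_zero. intros om et Hom.
    assert (HMo : exists M, (om = 1 /\ M = M1) \/ (om = tau /\ M = M2)) by (destruct Hom as [[-> _]|[-> _]]; eauto).
    destruct HMo as [M HMo].
    destruct (arm_data e y1 y1' y2 y2' M1 M2 M om et Hdata Hom HMo) as (y & d & Hd & Hn & Hz & S1 & S2 & Hw & E1 & E2).
    destruct (generic_multiplier l t (2 * t) A B Hl eq_refl gf_equation om et y d Hom Hd Hn
      y1 y1' y2 y2' z0 _ _ _ _ Hz S1 S2 Hw E1 E2 a HD0 Ha Ga HdG) as (lam & c1 & c2 & K1 & K2 & K3 & K4 & K5).
    assert (K : exp (Re (drift om et a)) = 1%R).
    { rewrite <- K5. apply (Hu M lam); [destruct HMo as [[_ ->]|[_ ->]]; auto|exists c1, c2; auto|exact K4]. }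
    rewrite <- exp_0 in K. apply exp_inv in K. exact K. }
  destruct (hlat_double l (2 * t) a Hl Ha Ga H2a); contradiction.
Qed.

(** [G_l'(a) = 0] means [D^2 = A] or [D^2 = B], and there the second derivative is
    [D (2 D^2 - A - B)]. *)
Lemma degenerate_root : dG l a = 0 -> exists m, cdiff (dG l) a m /\ m <> 0.
Proof.
  intros H. destruct HG as (HA & HB & HAB & _). destruct (gf_equation a Ha) as [E1 E2]. rewrite H, Ga in E2.
  eexists. split; [exact E1|]. rewrite Ga. set (D := 2 * t) in *.
  assert (HD : D <> 0).
  { intros E. apply (Cmult_neq_0 A B HA HB). transitivity ((0 * 0 - A) * (0 * 0 - B)); [ring|].
    rewrite E in E2. rewrite <- E2. ring. }
  intros E. apply (Cmult_neq_0 D (2 * (D * D) - A - B) HD); [|rewrite <- E; ring].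
  intros E3. apply HAB. destruct (classic (D * D - A = 0)) as [E4|E4].
  - apply Ceq_minus. transitivity (2 * (D * D) - A - B - 2 * (D * D - A)); [ring|]. rewrite E3, E4. ring.
  - assert (E5 : D * D - B = 0) by (apply NNPP; intros E5; apply (Cmult_neq_0 _ _ E4 E5); rewrite <- E2; ring).
    apply Ceq_minus. transitivity (2 * (D * D - B) - (2 * (D * D) - A - B)); [ring|]. rewrite E3, E5. ring.
Qed.

Lemma degenerate_monodromy (M1 M2 : CM2) : monodromy tau z0 (potential tau T b) M1 M2 -> dG l a = 0 ->
  forall om et M, half_period om et -> (om = 1 /\ M = M1) \/ (om = tau /\ M = M2) ->
  exists lam, lam * lam = 1 /\ en M 0 0 + en M 1 1 = 2 * lam /\
    (en M 0 0 = lam -> en M 0 1 = 0 -> en M 1 0 = 0 -> en M 1 1 = lam -> 4 * et + Pf a * om = 0).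
Proof.
  intros HM HdG om et M Hom HMo.
  destruct (monodromy_data _ _ z0 Hqf Hq M1 M2 HM) as (e & y1 & y1' & y2 & y2' & Hdata).
  destruct (arm_data e y1 y1' y2 y2' M1 M2 M om et Hdata Hom HMo) as (y & d & Hd & Hn & Hz & S1 & S2 & Hw & E1 & E2).
  destruct (degenerate_root HdG) as (m & Hm & Hm0).
  destruct (degenerate_multiplier l t (2 * t) A B Hl eq_refl gf_equation om et y d Hom Hd Hn
      y1 y1' y2 y2' z0 _ _ _ _ Hz S1 S2 Hw E1 E2 a m Ha Ga HdG Hm Hm0) as (lam & K1 & K2 & K3).
  exists lam. split; [exact K1|]. split; [|exact K3].
  transitivity ((lam * lam - (lam * lam - (en M 0 0 + en M 1 1) * lam + 1) + 1) * lam + (en M 0 0 + en M 1 1) * (1 - lam * lam)); [ring|].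
  rewrite K2, K1. ring.
Qed.

Lemma unitary_trivial (M1 M2 : CM2) : monodromy tau z0 (potential tau T b) M1 M2 -> unitary M1 -> unitary M2 -> t = 0.
Proof.
  intros HM U1 U2. apply NNPP. intros Ht.
  assert (HdG : dG l a = 0).
  { apply (unimodular_degenerate _ _ HM Ht). intros M lam HMo (c0 & c1 & Hc & E1 & E2) _.
    destruct HMo as [-> | ->]; [exact (unitary_eigenvalue _ c0 c1 lam U1 Hc E1 E2)|exact (unitary_eigenvalue _ c0 c1 lam U2 Hc E1 E2)]. }
  assert (K : forall om et M, half_period om et -> unitary M -> (om = 1 /\ M = M1) \/ (om = tau /\ M = M2) -> 4 * et + Pf a * om = 0).
  { intros om et M Hom HU HMo. destruct (degenerate_monodromy _ _ HM HdG om et M Hom HMo) as (lam & K1 & K2 & K3).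
    destruct (unitary_scalar M lam HU K1 K2) as (L1 & L2 & L3 & L4). auto. }
  assert (K1 := K 1 (eta tau 1) _ (or_introl (conj eq_refl eq_refl)) U1 (or_introl (conj eq_refl eq_refl))).
  assert (K2 := K tau (eta tau 2) _ (or_intror (conj eq_refl eq_refl)) U2 (or_intror (conj eq_refl eq_refl))).
  apply legendre_neq. apply Ceq_minus.
  transitivity ((4 * eta tau 2 + Pf a * tau - tau * (4 * eta tau 1 + Pf a * 1)) / 4); [field|].
  rewrite K1, K2. field.
Qed.

Lemma unitarizable_trivial : unitarizable tau z0 (potential tau T b) -> t = 0.
Proof.
  intros (M1 & M2 & P & P' & HM & HP & HP' & U1 & U2).
  exact (unitary_trivial _ _ (monodromy_conj _ z0 _ _ _ _ HP HP' HM) U1 U2).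
Qed.
End Member.
End Data.

(** The zero parameter belongs to all three families, and for [l = 3] the function
    [Gf] changes sign under both half periods. *)
Lemma trivial_monodromy (T : nat -> C) b z0 (M1 M2 : CM2) : (forall k, (k <= 3)%nat -> T k = 0) -> b = 0 ->
  monodromy tau z0 (potential tau T b) M1 M2 -> forall M, M = M1 \/ M = M2 ->
  en M 0 0 = - (1) /\ en M 0 1 = 0 /\ en M 1 0 = 0 /\ en M 1 1 = - (1).
Proof.
  intros HT Hb HM M HMo. assert (I3 : isl 3) by (unfold isl; auto).
  destruct (Gf_equation 3 I3) as (A & B & HG).
  assert (HT' : forall k, (k <= 3)%nat -> T k = V_res 3 0 k) by (intros k Hk; unfold V_res; rewrite HT by exact Hk; ring).
  assert (Hb' : b = V_acc tau 3 0) by (unfold V_acc; rewrite Hb; ring).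
  destruct (monodromy_data (potential tau T b) _ z0 (qf_holo 3 0 A B)
    (fun z Hz => potential_qf 3 A B HG T b 0 z HT' Hb' Hz) M1 M2 HM) as (e & y1 & y1' & y2 & y2' & Hdata).
  assert (Hom : exists om et, half_period om et /\ ((om = 1 /\ M = M1) \/ (om = tau /\ M = M2))).
  { destruct HMo as [-> | ->]; [exists 1, (eta tau 1)|exists tau, (eta tau 2)]; unfold half_period; auto. }
  destruct Hom as (om & et & Hom & HMo').
  destruct (arm_data 3 A B 0 z0 e y1 y1' y2 y2' M1 M2 M om et Hdata Hom HMo') as (y & d & Hd & Hn & Hz & S1 & S2 & Hw & E1 & E2).
  apply (trivial_multiplier 3 0 0 A B I3 ltac:(ring) (gf_equation 3 A B HG) om et y d Hom Hn
    y1 y1' y2 y2' z0 _ _ _ _ Hz S1 S2 Hw E1 E2); [reflexivity|apply HG|apply HG|].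
  intros z. destruct Hom as [[-> _]|[-> _]].
  - replace (z + 1 / 2) with (z + / 2) by field. rewrite Gf_shift_1 by assumption. unfold sgn1; simpl. ring.
  - rewrite Gf_shift_tau by assumption. unfold sgnt; simpl. ring.
Qed.

(** The trace of the monodromy does not depend on the basis, so it is the unique
    value that defines [Delta]. *)
Lemma Delta_trace z0 (l : nat) (T : C) : isl l -> admissible_base tau z0 -> exists M1 M2, monodromy tau z0 (q_ tau l T) M1 M2 /\
  Delta tau z0 l 1 T = trace M1 / 2 /\ Delta tau z0 l 2 T = trace M2 / 2.
Proof.
  intros Hl Hz0. destruct (Gf_equation l Hl) as (A & B & HG).
  assert (Hq : forall z, ~ hlat z -> q_ tau l T z = qf l T A B z).
  { intros z Hz. apply (potential_qf l A B HG); auto. }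
  assert (Hqf := qf_holo l T A B).
  destruct (monodromy_exists (q_ tau l T) (qf l T A B) z0 Hqf (fun om z => qf_shift_period l A B Hl T om z) Hq Hz0) as (M1 & M2 & HM).
  exists M1, M2. split; [exact HM|].
  destruct (monodromy_data _ _ z0 Hqf Hq M1 M2 HM) as (e & y1 & y1' & y2 & y2' & D).
  assert (K : forall N1 N2, monodromy tau z0 (q_ tau l T) N1 N2 -> trace N1 = trace M1 /\ trace N2 = trace M2).
  { intros N1 N2 HN. destruct (monodromy_data _ _ z0 Hqf Hq N1 N2 HN) as (f & u1 & u1' & u2 & u2' & D').
    exact (trace_unique _ z0 _ _ _ _ _ _ _ _ _ _ _ _ _ _ D' D). }
  split; (apply the_unique; [exists M1, M2; auto|]); intros w (N1 & N2 & HN & ->); destruct (K N1 N2 HN) as [E1 E2]; congruence.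
Qed.

Lemma stability_iff z0 (l : nat) (T : C) : isl l -> admissible_base tau z0 ->
  ((stability tau z0 l 1 T /\ stability tau z0 l 2 T) <-> (T = 0 \/ Q_ tau l T = 0)).
Proof.
  intros Hl Hz0.
  destruct (Gf_equation l Hl) as (A & B & HG).
  destruct (Gf_surjective l (2 * T) Hl) as (a & Ha & Ga).
  assert (HQ : Q_ tau l T = dG l a * dG l a).
  { rewrite (Q_value l A B HG), (proj2 (gf_equation l A B HG a Ha)), Ga. reflexivity. }
  assert (HT : forall k, (k <= 3)%nat -> V_res l T k = V_res l T k) by reflexivity.
  destruct (Delta_trace z0 l T Hl Hz0) as (M1 & M2 & HM & E1 & E2).
  assert (Et : forall M, trace M = en M 0 0 + en M 1 1) by reflexivity.
  unfold stability. rewrite E1, E2, !Et. split.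
  + intros [(x1 & Hx1 & X1) (x2 & Hx2 & X2)]. destruct (classic (T = 0)) as [->|HT0]; [left; reflexivity|right].
    rewrite HQ, (unimodular_degenerate l A B Hl HG T a (V_res l T) (V_acc tau l T) z0 HT eq_refl Ha Ga M1 M2 HM HT0); [ring|].
    assert (K : forall M x lam, (-1 <= x <= 1)%R -> (en M 0 0 + en M 1 1) / 2 = RtoC x ->
      lam * lam - (en M 0 0 + en M 1 1) * lam + 1 = 0 -> (Cmod lam ^ 2)%R = 1%R).
    { intros M x lam Hx X E. apply (unit_of_trace lam x Hx). rewrite <- X, <- E. field. }
    intros M lam [-> | ->] _; [apply (K M1 x1)|apply (K M2 x2)]; assumption.
  + assert (K : forall M lam, lam * lam = 1 -> en M 0 0 + en M 1 1 = 2 * lam ->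
      exists x, (-1 <= x <= 1)%R /\ (en M 0 0 + en M 1 1) / 2 = RtoC x).
    { intros M lam Hl1 E. rewrite E. destruct (square_one lam Hl1) as [-> | ->].
      - exists 1%R. split; [lra|field].
      - exists (-1)%R. split; [lra|]. replace (-1)%R with (- (1))%R by ring. rewrite RtoC_opp. field. }
    intros [HT0|HQ0].
    * assert (K0 := trivial_monodromy (V_res l T) (V_acc tau l T) z0 M1 M2
        ltac:(intros k _; unfold V_res; rewrite HT0; ring) ltac:(unfold V_acc; rewrite HT0; ring) HM).
      destruct (K0 M1 (or_introl eq_refl)) as (A1 & _ & _ & A2). destruct (K0 M2 (or_intror eq_refl)) as (B1 & _ & _ & B2).
      split; apply (K _ (- (1))); try ring; [rewrite A1, A2|rewrite B1, B2]; ring.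
    * assert (HdG : dG l a = 0) by (apply mult_self_0; rewrite <- HQ; exact HQ0).
      assert (K0 := degenerate_monodromy l A B Hl HG T a (V_res l T) (V_acc tau l T) z0 HT eq_refl Ha Ga M1 M2 HM HdG).
      destruct (K0 1 (eta tau 1) M1) as (lam1 & A1 & A2 & _); [left; auto|left; auto|].
      destruct (K0 tau (eta tau 2) M2) as (lam2 & B1 & B2 & _); [right; auto|right; auto|].
      split; [apply (K M1 lam1)|apply (K M2 lam2)]; assumption.
Qed.

Lemma unitarizable_iff z0 (T : nat -> C) (B : C) : admissible_base tau z0 -> AP tau T B ->
  (unitarizable tau z0 (potential tau T B) <-> (forall k, (k <= 3)%nat -> T k = 0) /\ B = 0).
Proof.
  intros Hz0 HAP. destruct (AP_family T B HAP) as (l & t & Hl & HT & HB).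
  destruct (Gf_equation l Hl) as (A & B' & HG). split.
  + destruct (Gf_surjective l (2 * t) Hl) as (a & Ha & Ga). intros HU.
    assert (Ht := unitarizable_trivial l A B' Hl HG t a T B z0 HT HB Ha Ga HU).
    split; [intros k Hk; rewrite HT, Ht by exact Hk; unfold V_res; ring|rewrite HB, Ht; unfold V_acc; ring].
  + intros [HT0 HB0].
    destruct (monodromy_exists (potential tau T B) _ z0 (qf_holo l t A B')
      (fun om z => qf_shift_period l A B' Hl t om z)
      (fun z Hz => potential_qf l A B' HG T B t z HT HB Hz) Hz0) as (M1 & M2 & HM).
    assert (K := trivial_monodromy T B z0 M1 M2 HT0 HB0 HM).
    exists M1, M2, (Mid), (Mid). split; [exact HM|].
    rewrite !Mmult_one_l, !Mmult_one_r.
    assert (HU : forall M, M = M1 \/ M = M2 -> unitary M).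
    { intros M HMo. destruct (K M HMo) as (A1 & A2 & A3 & A4). unfold unitary. apply en_ext. intros i j Hi Hj.
      rewrite en_mult, en_one by assumption. unfold adjoint. rewrite !en_mk by (assumption || lia). fold (en M).
      destruct i as [|[|i]], j as [|[|j]]; try lia; simpl;
        change (coeff_mat (0:C) M) with (en M); rewrite ?A1, ?A2, ?A3, ?A4, ?Copp_conj, ?Cconj_R; ring. }
    split; [reflexivity|]. split; [reflexivity|]. split; apply HU; auto.
Qed.

End Tau.

Theorem theorem1p6 :
  forall (tau z0 : C),
    Re tau = 0%R -> (0 < Im tau)%R -> admissible_base tau z0 ->
    (forall l : nat, (1 <= l <= 3)%nat ->
       forall T : C,
         (stability tau z0 l 1 T /\ stability tau z0 l 2 T) <->
         (T = 0 \/ Q_ tau l T = 0)) /\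
    (forall (T : nat -> C) (B : C), AP tau T B ->
       (unitarizable tau z0 (potential tau T B) <->
        (forall k : nat, (k <= 3)%nat -> T k = 0) /\ B = 0)).
Proof.
  intros tau z0 Hre Him Hz0. split.
  - intros l Hl T. apply stability_iff; try assumption. unfold isl. lia.
  - intros T B. apply unitarizable_iff; assumption.
Qed.
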